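(* Let $1\le m\le n-1$, let $N_{m,n}(B)=\#\{\Lambda\in\mathrm{Gr}(m,n)(\mathbb{Q}):H(\Lambda)\le B\}$, and let $\nu_B=\frac{1}{N_{m,n}(B)}\sum_{H(\Lambda)\le B}\delta_{u(T_\Lambda)}$, a probability measure on $\mathcal{UG}_{m,n}$. Then $\nu_B$ converges weakly to $\nu$ as $B\to\infty$; that is: (i) $\lim_{B\to\infty}\int f\,d\nu_B=\int f\,d\nu$ for all bounded continuous $f:\mathcal{UG}_{m,n}\to\mathbb{R}$; (ii) $\lim_{B\to\infty}\nu_B(E)=\nu(E)$ for every Borel set $E\subset\mathcal{UG}_{m,n}$ with $\nu(\partial E)=0$; (iii) $\limsup_{B\to\infty}\nu_B(E)\le\nu(E)$ for every closed $E\subset\mathcal{UG}_{m,n}$. Moreover (iv): if $f:\mathcal{UG}_{m,n}\to\mathbb{R}_{\ge0}$ is bounded and continuous and $N_{m,n}(f;B)=\#\{\Lambda\in\mathrm{Gr}(m,n)(\mathbb{Q}):H(\Lambda)\le f(u(T_\Lambda))B\}$, then $N_{m,n}(f;B)/N_{m,n}(B)\to\int f\,d\nu$ as $B\to\infty$.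
   Context: For integers $1\le m\le n-1$, rational points of $\mathrm{Gr}(m,n)(\mathbb{Q})$ are identified with primitive sublattices $\Lambda\subset\mathbb{Z}^n$ of rank $m$ (primitive meaning $\Lambda_{\mathbb{R}}\cap\mathbb{Z}^n=\Lambda$, $\Lambda_{\mathbb{R}}$ the real span). $\mathrm{covol}(L)=\sqrt{\det(\langle b_i,b_j\rangle)}$ for a basis $(b_i)$ of a lattice $L$. Height $H(\Lambda)=\mathrm{covol}(\Lambda)^n$. Dual lattice $\Lambda^*=\{y\in\Lambda_{\mathbb{R}}:\langle y,z\rangle\in\mathbb{Z}\ \forall z\in\Lambda\}$; factor lattice $\Lambda^\pi$ = orthogonal projection of $\mathbb{Z}^n$ to $\Lambda_{\mathbb{R}}^\perp$. Tangent lattice $T_\Lambda=\Lambda^*\otimes_{\mathbb{Z}}\Lambda^\pi\subset\mathbb{R}^n\otimes\mathbb{R}^n$ (inner product $\langle a\otimes b,c\otimes d\rangle=\langle a,c\rangle\langle b,d\rangle$); $\mathrm{covol}(T_\Lambda)=H(\Lambda)^{-1}$. Spaces: $\mathcal{G}_{m,n}$ is the set of lattices in $\mathbb{R}^n\otimes\mathbb{R}^n$ of the form $L_1\otimes_{\mathbb{Z}}L_2$ with $L_1\subset\mathbb{R}^n$ of rank $m$ and $L_2\subset(L_1)_{\mathbb{R}}^\perp$ of rank $n-m$; equivalently $\mathcal{G}_{m,n}=Y/\mathrm{GL}_{m(n-m)}(\mathbb{Z})$ where $Y=\{A\otimes B: A\in\mathrm{Mat}_{n\times m}(\mathbb{R}),B\in\mathrm{Mat}_{n\times(n-m)}(\mathbb{R})$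 of full rank with orthogonal column spaces$\}$, which gives its manifold structure. $\mathcal{UG}_{m,n}$ is the submanifold of covolume-one lattices, and $u(L)=\mathrm{covol}(L)^{-1/(m(n-m))}L$. $\mathcal{P}_{m,n}$ is the set of pairs $(\Lambda,\Lambda^{\pi_\Gamma})$ where $\Gamma\subset\mathbb{R}^n$ is a full lattice of covolume 1, $\Lambda$ is a rank $m$ sublattice primitive in $\Gamma$, and $\Lambda^{\pi_\Gamma}$ is the orthogonal projection of $\Gamma$ onto $\Lambda_{\mathbb{R}}^\perp$; it is identified with $\mathrm{SL}_n(\mathbb{R})/H$, $H=\{\left[\begin{smallmatrix}\gamma_1&*\\0&\gamma_2\end{smallmatrix}\right]\in\mathrm{SL}_n(\mathbb{R}):\gamma_1\in\mathrm{GL}_m(\mathbb{Z}),\gamma_2\in\mathrm{GL}_{n-m}(\mathbb{Z})\}$. $\mathcal{UP}_{m,n}$ is the subset with $\mathrm{covol}(\Lambda)=1$, and $(\Lambda,\Lambda')\mapsto(\mathrm{covol}(\Lambda)^{-1/m}\Lambda,\mathrm{covol}(\Lambda)^{1/(n-m)}\Lambda',\mathrm{covol}(\Lambda))$ is a bijection $\mathcal{P}_{m,n}\to\mathcal{UP}_{m,n}\times\mathbb{R}_{>0}$, under which an $\mathrm{SL}_n(\mathbb{R})$-invariant measure on $\mathcal{P}_{m,n}$ corresponds to $\mathrm{vol}_{\mathcal{UP}}\otimes x^{n-1}dx$ with $\mathrm{vol}_{\mathcal{UP}}$ a finite measure, normalised to a probability measure. $\nu$ is the pushforward of $\mathrm{vol}_{\mathcal{UP}}$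 to $\mathcal{UG}_{m,n}$ under $(L,L')\mapsto L^*\otimes_{\mathbb{Z}}L'$. *)

(* Defs.v *)
(* Conventions: n = m + k (so 1 <= m <= n-1 <=> 0 < m, 0 < k).  Vectors of   *)
(* R^N are row vectors 'rV[R]_N, a lattice is a set of vectors, a basis of a *)
(* rank r lattice in R^N is a row-free matrix 'M_(r,N) (rows = basis).       *)
(* R^n (x) R^n is identified with R^(n*n) via  a (x) b := mxvec (a^T *m b),  *)
(* whose standard dot product is <a,c><b,d>.                                 *)
From HB Require Import structures.
From mathcomp Require Import all_boot all_order all_algebra.
From mathcomp Require Import all_classical all_reals all_analysis.

Set Implicit Arguments.
Unset Strict Implicit.
Unset Printing Implicit Defensive.

Import Order.TTheory GRing.Theory Num.Theory.
Import numFieldNormedType.Exports.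

Local Open Scope ring_scope.
Local Open Scope classical_set_scope.

Section Lattices.
Variable R : realType.

Definition dotv (N : nat) (u v : 'rV[R]_N) : R := (u *m v^T) 0 0.

Definition zspan (r N : nat) (A : 'M[R]_(r, N)) : set 'rV[R]_N :=
  [set v | exists z : 'rV[int]_r, v = map_mx (fun x : int => x%:~R) z *m A].

Definition is_lattice (r N : nat) (L : set 'rV[R]_N) : Prop :=
  exists A : 'M[R]_(r, N), row_free A /\ L = zspan A.

Definition realspan (N : nat) (L : set 'rV[R]_N) : set 'rV[R]_N :=
  [set v | exists (p : nat) (c : 'I_p -> R) (w : 'I_p -> 'rV[R]_N),
      (forall i, L (w i)) /\ v = \sum_(i < p) c i *: w i].

Definition covol (r N : nat) (L : set 'rV[R]_N) : R :=
  let B := xget (0 : 'M[R]_(r, N)) [set A | row_free A /\ L = zspan A] in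
  Num.sqrt (\det (B *m B^T)).

Definition Zlat (n : nat) : set 'rV[R]_n := zspan (1%:M : 'M[R]_n).

(* Gr(m,n)(Q): primitive sublattices of Z^n of rank m *)
Arguments Zlat : clear implicits.

Definition GrQ (m n : nat) : set (set 'rV[R]_n) :=
  [set L | L `<=` Zlat n /\ is_lattice m L /\ realspan L `&` Zlat n = L].

Arguments GrQ : clear implicits.

Definition height (m n : nat) (L : set 'rV[R]_n) : R := covol m L ^+ n.

Definition dual (N : nat) (L : set 'rV[R]_N) : set 'rV[R]_N :=
  [set y | realspan L y /\
           forall z, L z -> exists q : int, dotv y z = q%:~R].

Definition projperp (N : nat) (L Gam : set 'rV[R]_N) : set 'rV[R]_N :=
  [set w | exists z, Gam z /\ realspan L (z - w) /\
           forall u, realspan L u -> dotv w u = 0].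

Definition factor_lattice (n : nat) (L : set 'rV[R]_n) : set 'rV[R]_n :=
  projperp L (Zlat n).
Arguments factor_lattice {n}.

Definition tens (N : nat) (a b : 'rV[R]_N) : 'rV[R]_(N * N) :=
  mxvec (a^T *m b).

Definition tensorL (N : nat) (L1 L2 : set 'rV[R]_N) : set 'rV[R]_(N * N) :=
  [set v | exists (p : nat) (a b : 'I_p -> 'rV[R]_N),
      (forall i, L1 (a i) /\ L2 (b i)) /\ v = \sum_(i < p) tens (a i) (b i)].

Definition tangent (n : nat) (L : set 'rV[R]_n) : set 'rV[R]_(n * n) :=
  tensorL (dual L) (factor_lattice L).

Definition scaleset (N : nat) (c : R) (L : set 'rV[R]_N) : set 'rV[R]_N :=
  (fun v => c *: v) @` L.

Section UG.
Variables m k : nat.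
Local Notation n := (m + k)%N.
Local Notation Mat := 'M[R]_(m * k, n * n).

Definition unimod (L : set 'rV[R]_(n * n)) : set 'rV[R]_(n * n) :=
  scaleset (powR (covol (m * k) L) (- ((m * k)%:R)^-1)) L.

Definition Ymat (M : Mat) : Prop :=
  exists (A : 'M[R]_(m, n)) (B : 'M[R]_(k, n)),
    [/\ row_free A, row_free B, A *m B^T = 0 &
        forall i j, row (mxvec_index i j) M = tens (row i A) (row j B)].

Definition UY : set Mat := [set M | Ymat M /\ \det (M *m M^T) = 1].

Definition UG : set (set 'rV[R]_(n * n)) := (@zspan (m * k) (n * n)) @` UY.

Definition UG_open (E : set (set 'rV[R]_(n * n))) : Prop :=
  E `<=` UG /\ exists O : set Mat, open O /\
    (@zspan (m * k) (n * n)) @^-1` E `&` UY = O `&` UY.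

Definition UG_closed (E : set (set 'rV[R]_(n * n))) : Prop :=
  E `<=` UG /\ exists C : set Mat, closed C /\
    (@zspan (m * k) (n * n)) @^-1` E `&` UY = C `&` UY.

Definition UG_closure (E : set (set 'rV[R]_(n * n))) :=
  [set x | forall C, UG_closed C -> E `<=` C -> C x].

Definition UG_interior (E : set (set 'rV[R]_(n * n))) :=
  [set x | exists O, UG_open O /\ O `<=` E /\ O x].

Definition UG_boundary (E : set (set 'rV[R]_(n * n))) :=
  UG_closure E `\` UG_interior E.

Definition UG_borel : set (set (set 'rV[R]_(n * n))) := <<s UG, UG_open >>.

Definition UG_bcont (f : set 'rV[R]_(n * n) -> R) : Prop :=
  (exists C : R, forall L, UG L -> `|f L| <= C) /\
  {within UY, continuous (f \o (@zspan (m * k) (n * n)))}.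

(* ---------------- the space P_{m,n} = SL_n(R)/H ---------------- *)
Definition SL : set 'M[R]_n := [set g | \det g = 1].

Definition Ppt := (set 'rV[R]_n * set 'rV[R]_n)%type.

(* gH |-> (Lambda, Lambda^{pi_Gamma}), with Gamma spanned by the rows of g
   and Lambda by its first m rows *)
Definition pt (g : 'M[R]_n) : Ppt :=
  (zspan (usubmx g), projperp (zspan (usubmx g)) (zspan g)).

Definition Pset : set Ppt := pt @` SL.

Definition P_open (A : set Ppt) : Prop :=
  A `<=` Pset /\ exists O : set 'M[R]_n, open O /\
    [set g | SL g /\ A (pt g)] = O `&` SL.

Definition Pmeas := g_sigma_algebraType P_open.

Definition P_act (h : 'M[R]_n) (A : set Ppt) : set Ppt :=
  [set pt (g *m h) | g in [set g | SL g /\ A (pt g)]].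

Definition P_invariant (mu : {measure set Pmeas -> \bar R}) : Prop :=
  forall h, SL h -> forall A : set Pmeas, measurable A -> A `<=` Pset ->
    mu (P_act h A) = mu A.

Definition Pball : set Pmeas := [set p | Pset p /\ covol m p.1 <= 1].

Definition Pnorm (p : Ppt) : Ppt :=
  let c := covol m p.1 in
  (scaleset (powR c (- (m%:R)^-1)) p.1, scaleset (powR c ((k%:R)^-1)) p.2).

Definition Phi (p : Ppt) : set 'rV[R]_(n * n) := tensorL (dual p.1) p.2.

(* nu(E) and int f dnu, where nu = Phi_* vol_UP and vol_UP is the normalised
   measure with  mu <-> vol_UP (x) x^(n-1) dx :
   vol_UP(A) = mu {p : covol <= 1, Pnorm p in A} / mu {p : covol <= 1} *)
Definition nu (mu : {measure set Pmeas -> \bar R})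
    (E : set (set 'rV[R]_(n * n))) : R :=
  fine (mu [set p | Pball p /\ E (Phi (Pnorm p))]) / fine (mu Pball).

Definition nu_int (mu : {measure set Pmeas -> \bar R})
    (f : set 'rV[R]_(n * n) -> R) : R :=
  fine (\int[mu]_(p in Pball) (f (Phi (Pnorm p)))%:E) / fine (mu Pball).

Definition GrB (B : R) : set (set 'rV[R]_n) :=
  [set L | GrQ m n L /\ height m L <= B].

Definition Ncount (B : R) : R := \sum_(L \in GrB B) (1 : R).

Definition uT (L : set 'rV[R]_n) : set 'rV[R]_(n * n) := unimod (tangent L).

Definition nuB_int (f : set 'rV[R]_(n * n) -> R) (B : R) : R :=
  (\sum_(L \in GrB B) f (uT L)) / Ncount B.

Definition nuB (E : set (set 'rV[R]_(n * n))) (B : R) : R :=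
  (\sum_(L \in GrB B `&` [set L | E (uT L)]) (1 : R)) / Ncount B.

Definition Nf (f : set 'rV[R]_(n * n) -> R) (B : R) : R :=
  \sum_(L \in [set L | GrQ m n L /\ height m L <= f (uT L) * B]) (1 : R).

End UG.
End Lattices.

(* Main.v *)
Require Import Defs.
From HB Require Import structures.
From mathcomp Require Import all_boot all_order all_algebra.
From mathcomp Require Import all_classical all_reals all_analysis.
From mathcomp Require Import measurable_realfun.
From mathcomp Require Import ring lra zify finmap.
Set Implicit Arguments.
Unset Strict Implicit.
Unset Printing Implicit Defensive.
Import Order.TTheory GRing.Theory Num.Theory.
Import numFieldNormedType.Exports.
Local Open Scope ring_scope.
Local Open Scope classical_set_scope.

(** Write G = SL_n(R), Gam = SL_n(Z) and D_t = diag(t^(1/m), .., t^(-1/k), ..).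
    The rational points are the cosets of Gam by its block triangular subgroup, a point of
    P = H\G determines u(T) through a map which is invariant under left translation by D_t,
    and L has height at most t^n exactly when D_t^-1 gam_L lies in {covol <= 1}.  So everything
    reduces to the asymptotics of DS_t(F) = t^-n sum_L F(D_t^-1 gam_L) for F on H\G.

    For F = Hw, the average of a compactly supported w over H, the sum unfolds to an average
    of a Gam-periodic function over the translated horosphere (U_Z\U) D_t.  Decay of the
    correlations (u, R_{D_t} v) - (u, R_{D_t h} v), which is the Mautner phenomenon applied to
    almost maximisers of the limsup, and thickening of the horosphere show that this average
    forgets everything about w but its Haar integral: DS_t(F) = a_t int F dmu + o(1), with a_t
    bounded and independent of F.  Averaging over a neighbourhood of the identity excludes
    escape of mass, and the scaling of mu under D_t makes the spheres {covol = c} negligible,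
    so that F may be replaced by its product with the indicator of a ball.  An explicit family
    of lattices gives N(B) >= c B, hence the unknown a_t cancels in the quotients.  Closed sets
    are approximated from above by continuous functions; (ii) follows by applying (iii) to the
    closures of E and of its complement, and (iv) by splitting according to the value of f. *)

(** * Positive functionals *)

(** All integration on groups goes through positive linear functionals on uniformly continuous
    functions of bounded support, so that G, U and the torus U_Z\U share one calculus. The Haar
    functional of G is manufactured from mu, by integrating over H and then over H\G; uniqueness of
    invariant functionals gives it the left invariance from which mu inherits its scaling under D_t.
    Correlations on Gam\G are compared with one another and never with a limit. This yields
    equidistribution up to a factor common to all test functions, which is enough because every
    assertion is about a quotient by N(B). Weak limits are replaced by the limsup of a correlation
    over the unit ball of a semi-definite form: uniform convexity makes an almost maximiser almost
    invariant. The main obstacle is that {covol <= 1} is not compact in H\G, since shapes of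
    lattices degenerate. Smoothing by a neighbourhood of 1 in G bounds orbit sums by mu-measures of
    slightly larger sets, with a constant independent of how far the support reaches into the cusp;
    finiteness of the counts is a by-product. *)

Section ProperSpaces.
Variable R : realType.

Lemma eq_eps (a b : R) : (forall e : R, 0 < e -> `|a - b| <= e) -> a = b.
Proof.
move=> h; apply/eqP; rewrite -subr_eq0 -normr_le0; apply/ler_addgt0Pr => e e0.
by rewrite add0r h.
Qed.

(* [nm] plays the role of the distance to a base point. *)
Record pspace := PSpace {
  psort :> Type;
  dst : psort -> psort -> R;
  nm : psort -> R;
  dst_sym : forall x y, dst x y = dst y x;
  dst_tri : forall y x z, dst x z <= dst x y + dst y z;
  dst_xx : forall x, dst x x = 0;
  nm_lip : forall x y, nm x <= nm y + dst x y;
  nm_net : forall r d : R, 0 < d ->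
    exists (I : finType) (a : I -> psort),
      forall x, nm x <= r -> exists i, dst x (a i) < d }.

Lemma dst_ge0 (T : pspace) (x y : T) : 0 <= dst x y.
Proof. by have := dst_tri y x x; rewrite dst_xx (dst_sym y x); lra. Qed.

(** Boundedness and uniform continuity on every ball. Balls are only totally bounded here, so
    uniformity is built into the notion of continuity. *)
Definition lc (T1 T2 : pspace) (f : T1 -> T2) : Prop :=
  forall r, (exists r', forall x, nm x <= r -> nm (f x) <= r') /\
    forall e : R, 0 < e -> exists2 d : R, 0 < d &
      forall x y, nm x <= r -> nm y <= r -> dst x y < d -> dst (f x) (f y) < e.

(** A finite net reduces boundedness on a ball to finitely many values. The radius grows by 1
    because the centres of the net may lie outside the ball. *)
Lemma lcI (T1 T2 : pspace) (f : T1 -> T2) :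
  (forall r e : R, 0 < e -> exists2 d : R, 0 < d &
    forall x y, nm x <= r -> nm y <= r -> dst x y < d -> dst (f x) (f y) < e) ->
  lc f.
Proof.
move=> H r; split; last exact: H.
have [d d0 Hd] := H (r + 1) 1 ltr01.
have dd : 0 < Num.min d 1 by rewrite lt_min d0 ltr01.
have [I [a Ha]] := nm_net T1 r dd.
exists (\sum_i `|nm (f (a i))| + 1) => x xr.
have [i] := Ha x xr; rewrite lt_min => /andP[xy xy1].
have nx := nm_lip (a i) x; rewrite dst_sym in nx.
have h : dst (f x) (f (a i)) < 1 by apply: Hd => //; lra.
have := nm_lip (f x) (f (a i)).
have : `|nm (f (a i))| <= \sum_i `|nm (f (a i))|.
  by rewrite (bigD1 i)//= lerDl sumr_ge0.
by have := ler_norm (nm (f (a i))); lra.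
Qed.

Lemma lc_id (T : pspace) : lc (@id T).
Proof. by move=> r; split; [exists r|move=> e e0; exists e]. Qed.

Lemma lc_cst (T1 T2 : pspace) (c : T2) : lc (fun _ : T1 => c).
Proof.
by move=> r; split; [exists (nm c)|move=> e e0; exists 1 => // *; rewrite dst_xx].
Qed.

Lemma lc_comp (T1 T2 T3 : pspace) (g : T2 -> T3) (f : T1 -> T2) :
  lc g -> lc f -> lc (fun x => g (f x)).
Proof.
move=> hg hf r; have [[r1 h1] H1] := hf r; have [[r2 h2] H2] := hg r1; split.
  by exists r2 => x /h1 /h2.
move=> e /H2[d d0 hd]; have [d' d'0 hd'] := H1 _ d0; exists d' => // x y xr yr xy.
by apply: hd; [exact: h1|exact: h1|exact: hd'].
Qed.

Lemma lc_ext (T1 T2 : pspace) (f g : T1 -> T2) : (forall x, f x = g x) -> lc f -> lc g.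
Proof. by move=> /funext ->. Qed.

Definition rspace : pspace.
Proof.
refine (@PSpace R (fun x y => `|x - y|) (fun x => `|x|) _ _ _ _ _).
- by move=> x y; rewrite distrC.
- by move=> y x z; apply: le_trans (ler_normD _ _); rewrite addrA subrK.
- by move=> x; rewrite subrr normr0.
- by move=> x y; rewrite addrC -lerBlDr; exact: lerB_dist.
- move=> r d d0.
  have [N hN] : exists N : nat, r / d + 1 < N%:R.
    by exists (Num.trunc (r / d + 1)).+1; exact: truncnS_gt.
  exists (bool * 'I_N)%type, (fun i : bool * 'I_N => if i.1 then d * i.2%:R else - (d * i.2%:R)) => x xr.
  set j := Num.trunc (`|x| / d).
  have xd : 0 <= `|x| / d by rewrite divr_ge0// ltW.
  have /andP[j1 j2] := truncn_itv xd; rewrite -/j in j1 j2.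
  have jN : (j < N)%N.
    rewrite -(ltr_nat R) (le_lt_trans j1)//; apply: le_lt_trans hN.
    by rewrite (le_trans (_ : _ <= r / d))// ?ler_pM2r ?invr_gt0// lerDl.
  move: j1 j2; rewrite ler_pdivlMr// ltr_pdivrMr// -natr1 => j1 j2.
  have [x0|x0] := leP 0 x.
    exists (true, Ordinal jN) => /=.
    by move: j1 j2; rewrite ger0_norm// => j1 j2; rewrite ltr_norml; nra.
  exists (false, Ordinal jN) => /=.
  by move: j1 j2; rewrite ltr0_norm// => j1 j2; rewrite ltr_norml; nra.
Defined.
Canonical rspace.

Definition prodspace (T1 T2 : pspace) : pspace.
Proof.
refine (@PSpace (T1 * T2)%type (fun x y => dst x.1 y.1 + dst x.2 y.2)
  (fun x => Num.max (nm x.1) (nm x.2)) _ _ _ _ _).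
- by move=> x y; rewrite (dst_sym x.1) (dst_sym x.2).
- by move=> y x z; have := dst_tri y.1 x.1 z.1; have := dst_tri y.2 x.2 z.2; lra.
- by move=> x; rewrite !dst_xx addr0.
- move=> x y; rewrite ge_max.
  have := nm_lip x.1 y.1; have := nm_lip x.2 y.2.
  have := dst_ge0 x.1 y.1; have := dst_ge0 x.2 y.2.
  have : nm y.1 <= Num.max (nm y.1) (nm y.2) by rewrite le_max lexx.
  have : nm y.2 <= Num.max (nm y.1) (nm y.2) by rewrite le_max lexx orbT.
  by lra.
- move=> r d d0; have d2 : 0 < d / 2 by rewrite divr_gt0.
  have [I1 [a1 h1]] := nm_net T1 r d2; have [I2 [a2 h2]] := nm_net T2 r d2.
  exists (I1 * I2)%type, (fun i : I1 * I2 => (a1 i.1, a2 i.2)) => -[x y] /=.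
  rewrite ge_max => /andP[xr yr].
  by have [i hi] := h1 x xr; have [j hj] := h2 y yr; exists (i, j) => /=; lra.
Defined.
Canonical prodspace.

Lemma lc_fst (T1 T2 : pspace) : lc (fun x : prodspace T1 T2 => x.1).
Proof.
move=> r; split; first by exists r => x /=; rewrite ge_max => /andP[].
by move=> e e0; exists e => // x y _ _ /=; have := dst_ge0 x.2 y.2; lra.
Qed.

Lemma lc_snd (T1 T2 : pspace) : lc (fun x : prodspace T1 T2 => x.2).
Proof.
move=> r; split; first by exists r => x /=; rewrite ge_max => /andP[].
by move=> e e0; exists e => // x y _ _ /=; have := dst_ge0 x.1 y.1; lra.
Qed.

Lemma lc_pair (T T1 T2 : pspace) (f : T -> T1) (g : T -> T2) :
  lc f -> lc g -> lc (fun x => (f x, g x) : prodspace T1 T2).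
Proof.
move=> hf hg r; have [[a ha] Ha] := hf r; have [[b hb] Hb] := hg r; split.
  exists (Num.max a b) => x xr /=.
  by rewrite ge_max !le_max ha// hb// orbT.
move=> e e0; have e2 : 0 < e / 2 by rewrite divr_gt0.
have [c c0 hc] := Ha _ e2; have [d d0 hd] := Hb _ e2.
exists (Num.min c d) => [|x y xr yr]; first by rewrite lt_min c0.
by rewrite lt_min => /andP[/(hc _ _ xr yr) + /(hd _ _ xr yr)] /=; lra.
Qed.

Lemma lc_dst (T : pspace) (y : T) : lc (fun x : T => dst x y : rspace).
Proof.
apply: lcI => r e e0; exists e => // a b _ _ ab /=.
rewrite ltr_norml; have := dst_tri b a y; have := dst_tri a b y.
by rewrite (dst_sym b a); lra.
Qed.

Lemma lc_nm (T : pspace) : lc (fun x : T => nm x : rspace).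
Proof.
apply: lcI => r e e0; exists e => // a b _ _ ab /=.
rewrite ltr_norml; have := nm_lip a b; have := nm_lip b a.
by rewrite (dst_sym b a); lra.
Qed.

(** * Real-valued functions and positive functionals *)

Section RealValued.
Variable T : pspace.
Implicit Types f g w : T -> R.

Lemma lcD f g : lc (f : T -> rspace) -> lc (g : T -> rspace) ->
  lc (fun x => f x + g x : rspace).
Proof.
move=> hf hg; apply: lcI => r e e0; have e2 : 0 < e / 2 by rewrite divr_gt0.
have [_ /(_ _ e2)[c c0 hc]] := hf r; have [_ /(_ _ e2)[d d0 hd]] := hg r.
exists (Num.min c d) => [|x y xr yr]; first by rewrite lt_min c0.
rewrite lt_min => /andP[/(hc _ _ xr yr) + /(hd _ _ xr yr)] /=.
by rewrite !ltr_norml; lra.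
Qed.

Lemma lcM f g : lc (f : T -> rspace) -> lc (g : T -> rspace) ->
  lc (fun x => f x * g x : rspace).
Proof.
move=> hf hg; apply: lcI => r e e0.
have [[a ha] Ha] := hf r; have [[b hb] Hb] := hg r.
pose c := 2 * (`|a| + `|b| + 1).
have c0 : 0 < c by rewrite mulr_gt0// ltr_wpDl// addr_ge0.
have ec : 0 < e / c by rewrite divr_gt0.
have [d1 d10 h1] := Ha _ ec; have [d2 d20 h2] := Hb _ ec.
exists (Num.min d1 d2) => [|x y xr yr]; first by rewrite lt_min d10.
rewrite lt_min => /andP[/(h1 _ _ xr yr) + /(h2 _ _ xr yr)] /=.
have := ha x xr; have := hb y yr => /= gy fx A B.
have -> : f x * g x - f y * g y = f x * (g x - g y) + (f x - f y) * g y by ring.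
apply: le_lt_trans (ler_normD _ _) _; rewrite !normrM.
have : `|f x| * `|g x - g y| <= `|a| * (e / c).
  by apply: ler_pM => //; [apply: le_trans fx (ler_norm _)|exact: ltW].
have : `|f x - f y| * `|g y| <= (e / c) * `|b|.
  by apply: ler_pM => //; [exact: ltW|apply: le_trans gy (ler_norm _)].
have : e = c * (e / c) by rewrite mulrC divfK// gt_eqF.
by move: ec; set q := e / c; rewrite /c; clearbody q; lra.
Qed.

Lemma lcZ (c : R) f : lc (f : T -> rspace) -> lc (fun x => c * f x : rspace).
Proof. by move=> hf; apply: lcM => //; exact: lc_cst. Qed.

Lemma lcN f : lc (f : T -> rspace) -> lc (fun x => - f x : rspace).
Proof. by move=> hf; apply: lc_ext (lcZ (-1) hf) => x; rewrite mulN1r. Qed.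

Lemma lcB f g : lc (f : T -> rspace) -> lc (g : T -> rspace) ->
  lc (fun x => f x - g x : rspace).
Proof. by move=> hf hg; apply: lcD => //; apply: lcN. Qed.

Lemma lc_sum (I : Type) (s : seq I) (F : I -> T -> R) :
  (forall i, lc (F i : T -> rspace)) -> lc (fun x => \sum_(i <- s) F i x : rspace).
Proof.
move=> H; elim: s => [|i s IH].
  by apply: lc_ext (lc_cst _ (0 : rspace)) => x; rewrite big_nil.
by apply: lc_ext (lcD (H i) IH) => x; rewrite big_cons.
Qed.

Lemma lc_abs f : lc (f : T -> rspace) -> lc (fun x => `|f x| : rspace).
Proof.
move=> hf; apply: lcI => r e e0; have [_ /(_ _ e0)[d d0 hd]] := hf r.
exists d => // x y xr yr /(hd _ _ xr yr) /=; exact/le_lt_trans/ler_dist_dist.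
Qed.

Lemma lc_max f g : lc (f : T -> rspace) -> lc (g : T -> rspace) ->
  lc (fun x => Num.max (f x) (g x) : rspace).
Proof.
move=> hf hg.
apply: lc_ext (lcZ (2^-1) (lcD (lcD hf hg) (lc_abs (lcB hf hg)))) => x.
by rewrite maxr_absE mulrC.
Qed.

Lemma lc_min f g : lc (f : T -> rspace) -> lc (g : T -> rspace) ->
  lc (fun x => Num.min (f x) (g x) : rspace).
Proof.
move=> hf hg; apply: lc_ext (lcN (lc_max (lcN hf) (lcN hg))) => x.
by rewrite oppr_max !opprK.
Qed.

Lemma lcV (c : R) f : 0 < c -> (forall x, c <= f x) -> lc (f : T -> rspace) ->
  lc (fun x => (f x)^-1 : rspace).
Proof.
move=> c0 cf hf; apply: lcI => r e e0.
have ec : 0 < e * c ^+ 2 by rewrite mulr_gt0// exprn_gt0.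
have [_ /(_ _ ec)[d d0 hd]] := hf r; exists d => // x y xr yr /(hd _ _ xr yr) /= h.
have fx := cf x; have fy := cf y.
have fx0 : 0 < f x by exact: lt_le_trans fx.
have fy0 : 0 < f y by exact: lt_le_trans fy.
have -> : (f x)^-1 - (f y)^-1 = (f y - f x) / (f x * f y).
  by field; rewrite !gt_eqF.
rewrite normrM normfV (gtr0_norm (mulr_gt0 fx0 fy0)) ltr_pdivrMr ?mulr_gt0// distrC.
by apply: lt_le_trans h _; rewrite ler_pM2l// expr2 ler_pM// ltW.
Qed.

Definition Cc w : Prop :=
  lc (w : T -> rspace) /\ exists r, forall x, r < nm x -> w x = 0.

Lemma Cc_lc w : Cc w -> lc (w : T -> rspace). Proof. by case. Qed.

Lemma Cc_uc w : Cc w -> forall e : R, 0 < e -> exists2 d : R, 0 < d &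
  forall x y, dst x y < d -> `|w x - w y| < e.
Proof.
move=> [hw [r hr]] e e0; have [_ /(_ _ e0)[d d0 hd]] := hw (r + 1).
exists (Num.min d 1) => [|x y]; first by rewrite lt_min d0 ltr01.
rewrite lt_min => /andP[xy xy1].
have := nm_lip x y; have := nm_lip y x; rewrite (dst_sym y x) => h1 h2.
have [xr|xr] := leP (nm x) (r + 1); have [yr|yr] := leP (nm y) (r + 1).
- exact: hd.
- by rewrite !hr ?subrr ?normr0//; lra.
- by rewrite !hr ?subrr ?normr0//; lra.
- by rewrite !hr ?subrr ?normr0//; lra.
Qed.

Lemma Cc_bd w : Cc w -> exists2 b, 0 <= b & forall x, `|w x| <= b.
Proof.
move=> [hw [r hr]]; have [[b hb] _] := hw r; exists `|b| => // x.
have [xr|xr] := leP (nm x) r; first exact: le_trans (hb x xr) (ler_norm _).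
by rewrite hr// normr0.
Qed.

Lemma CcM f w : lc (f : T -> rspace) -> Cc w -> Cc (fun x => f x * w x).
Proof.
move=> hf [hw [r hr]]; split; first exact: lcM.
by exists r => x xr; rewrite hr// mulr0.
Qed.

Lemma CcD f w : Cc f -> Cc w -> Cc (fun x => f x + w x).
Proof.
move=> [hf [a ha]] [hw [r hr]]; split; first exact: lcD.
exists (Num.max a r) => x; rewrite gt_max => /andP[xa xr].
by rewrite ha// hr// addr0.
Qed.

Lemma CcZ c w : Cc w -> Cc (fun x => c * w x).
Proof. by apply: CcM; exact: lc_cst. Qed.

Lemma CcN w : Cc w -> Cc (fun x => - w x).
Proof. by move=> /(CcZ (-1)); congr Cc; apply/funext => x; rewrite mulN1r. Qed.

Lemma CcB f w : Cc f -> Cc w -> Cc (fun x => f x - w x).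
Proof. by move=> hf hw; apply: CcD => //; exact: CcN. Qed.

Lemma Cc_abs w : Cc w -> Cc (fun x => `|w x|).
Proof.
by move=> [hw [r hr]]; split; [exact: lc_abs|exists r => x /hr ->; rewrite normr0].
Qed.

Lemma Cc0 : Cc (fun _ => 0).
Proof. by split; [exact: lc_cst|exists 0]. Qed.

Lemma Cc_sum (I : Type) (s : seq I) (F : I -> T -> R) :
  (forall i, Cc (F i)) -> Cc (fun x => \sum_(i <- s) F i x).
Proof.
move=> H; elim: s => [|i s IH].
  by congr Cc: Cc0; apply/funext => x; rewrite big_nil.
by congr Cc: (CcD (H i) IH); apply/funext => x; rewrite big_cons.
Qed.

Definition cutoff (r : R) (x : T) : R := Num.max 0 (Num.min 1 (r + 1 - nm x)).

Lemma cutoff_ge0 r x : 0 <= cutoff r x.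
Proof. by rewrite le_max lexx. Qed.

Lemma cutoff_le1 r x : cutoff r x <= 1.
Proof. by rewrite ge_max ler01 ge_min lexx. Qed.

Lemma cutoff1 r x : nm x <= r -> cutoff r x = 1.
Proof.
move=> xr; rewrite /cutoff min_l ?max_r//; lra.
Qed.

Lemma cutoff0 r x : r + 1 <= nm x -> cutoff r x = 0.
Proof.
move=> xr; rewrite /cutoff max_l// ge_min; apply/orP; right; lra.
Qed.

Lemma Cc_cutoff r : Cc (cutoff r).
Proof.
split; last by exists (r + 1) => x /ltW; exact: cutoff0.
apply: lc_max; first exact: lc_cst.
apply: lc_min; first exact: lc_cst.
apply: lcB; [exact: lc_cst|exact: lc_nm].
Qed.

Lemma Cc_le_cutoff w r b : (forall x, r < nm x -> w x = 0) -> (forall x, `|w x| <= b) ->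
  forall x, `|w x| <= b * cutoff r x.
Proof.
move=> hr hb x; have [xr|xr] := leP (nm x) r; first by rewrite cutoff1// mulr1.
by rewrite hr// normr0 mulr_ge0 ?cutoff_ge0// (le_trans _ (hb x)).
Qed.

(** A Radon measure, encoded as a functional on all functions; linearity and positivity are demanded
    on [Cc] only. *)
Definition PF (L : (T -> R) -> R) : Prop :=
  (forall c f g, Cc f -> Cc g -> L (fun x => c * f x + g x) = c * L f + L g) /\
  (forall f, Cc f -> (forall x, 0 <= f x) -> 0 <= L f).

Section PFtheory.
Variables (L : (T -> R) -> R) (hL : PF L).

Lemma PFD f g : Cc f -> Cc g -> L (fun x => f x + g x) = L f + L g.
Proof.
move=> hf hg; rewrite -[L f]mul1r -hL.1//; congr L; apply/funext => x.
by rewrite mul1r.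
Qed.

Lemma PF0 : L (fun _ => 0) = 0.
Proof.
have := PFD Cc0 Cc0; rewrite (_ : (fun _ => 0 + 0) = (fun _ => 0) :> (T -> R)).
  by move=> /eqP; rewrite -subr_eq0 opprD addrA subrr sub0r oppr_eq0 => /eqP.
by apply/funext => x; rewrite addr0.
Qed.

Lemma PFZ c f : Cc f -> L (fun x => c * f x) = c * L f.
Proof.
move=> hf; rewrite -[RHS]addr0 -PF0 -hL.1//; last exact: Cc0.
by congr L; apply/funext => x; rewrite addr0.
Qed.

Lemma PFN f : Cc f -> L (fun x => - f x) = - L f.
Proof.
by move=> hf; rewrite -mulN1r -PFZ//; congr L; apply/funext => x; rewrite mulN1r.
Qed.

Lemma PFB f g : Cc f -> Cc g -> L (fun x => f x - g x) = L f - L g.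
Proof. by move=> hf hg; rewrite PFD ?PFN//; exact: CcN. Qed.

Lemma PFle f g : Cc f -> Cc g -> (forall x, f x <= g x) -> L f <= L g.
Proof.
move=> hf hg fg; rewrite -subr_ge0 -PFB//; apply: hL.2; first exact: CcB.
by move=> x; rewrite subr_ge0.
Qed.

Lemma PFabs f g : Cc f -> Cc g -> (forall x, `|f x| <= g x) -> `|L f| <= L g.
Proof.
move=> hf hg fg; rewrite ler_norml -PFN//; apply/andP; split; apply: PFle => //.
- exact: CcN.
- by move=> x; have := fg x; rewrite ler_norml => /andP[].
- by move=> x; have := fg x; rewrite ler_norml => /andP[].
Qed.

Lemma PFsum (I : Type) (s : seq I) (F : I -> T -> R) :
  (forall i, Cc (F i)) -> L (fun x => \sum_(i <- s) F i x) = \sum_(i <- s) L (F i).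
Proof.
move=> H; elim: s => [|i s IH].
  by rewrite big_nil -[RHS]PF0; congr L; apply/funext => x; rewrite big_nil.
rewrite big_cons -IH -PFD//; last exact: Cc_sum.
by congr L; apply/funext => x; rewrite big_cons.
Qed.

Lemma PF_cutoff_ge0 r : 0 <= L (cutoff r).
Proof. by apply: hL.2; [exact: Cc_cutoff|move=> x; exact: cutoff_ge0]. Qed.

Lemma PF_bound w r b : Cc w -> (forall x, r < nm x -> w x = 0) ->
  (forall x, `|w x| <= b) -> `|L w| <= b * L (cutoff r).
Proof.
move=> hw hr hb; rewrite -PFZ; last exact: Cc_cutoff.
by apply: PFabs => //; [apply: CcZ; exact: Cc_cutoff|exact: Cc_le_cutoff].
Qed.

End PFtheory.
End RealValued.

Lemma Cc_comp (T1 T2 : pspace) (f : T1 -> T2) (w : T2 -> R) : lc f ->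
  (forall r, exists r', forall x, nm (f x) <= r -> nm x <= r') ->
  Cc w -> Cc (fun x => w (f x)).
Proof.
move=> hf pf [hw [r hr]]; split; first exact: lc_comp hf.
have [r' h] := pf r; exists r' => x xr; apply: hr; rewrite ltNge.
by apply: contraTN xr => /h; rewrite leNgt.
Qed.

Lemma lc_local (T : pspace) (F : T -> R) :
  (forall r, lc (fun x => cutoff r x * F x : rspace)) -> lc (F : T -> rspace).
Proof.
move=> H; apply: lcI => r e e0; have [_ /(_ _ e0)[d d0 hd]] := H r r.
by exists d => // x y xr yr /(hd _ _ xr yr); rewrite /= !cutoff1// !mul1r.
Qed.

(** * Partitions of unity and Fubini *)

Section Fubini.
Variables T1 T2 : pspace.
Variable (K : T1 -> T2 -> R).
Hypothesis hK : Cc (fun z : prodspace T1 T2 => K z.1 z.2).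

Lemma Cc2_l x : Cc (K x).
Proof.
case: hK => h [r hr]; split.
  apply: (@lc_comp _ _ _ (fun z : prodspace T1 T2 => K z.1 z.2) (fun y => (x, y))) => //.
  by apply: lc_pair; [exact: lc_cst|exact: lc_id].
by exists r => y yr; apply: (hr (x, y)); rewrite /= lt_max yr orbT.
Qed.

Lemma Cc2_r y : Cc (K ^~ y).
Proof.
case: hK => h [r hr]; split.
  apply: (@lc_comp _ _ _ (fun z : prodspace T1 T2 => K z.1 z.2) (fun x => (x, y))) => //.
  by apply: lc_pair; [exact: lc_id|exact: lc_cst].
by exists r => x xr; apply: (hr (x, y)); rewrite /= lt_max xr.
Qed.

(** The modulus of continuity of [K] in the first variable is uniform in the second, and all
    sections are supported in one ball, so a single cutoff controls the difference. *)
Lemma Cc2_int_r L2 : @PF T2 L2 -> Cc (fun x => L2 (K x)).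
Proof.
move=> h2; have [h [r hr]] := hK; split; last first.
  exists r => x xr; rewrite -(PF0 h2); congr L2; apply/funext => y.
  by apply: (hr (x, y)); rewrite /= lt_max xr.
apply: lcI => r' e e0.
have c0 : 0 < L2 (cutoff r) + 1 by rewrite ltr_wpDl// PF_cutoff_ge0.
have [d d0 hd] := Cc_uc hK (divr_gt0 e0 c0).
exists d => // x y _ _ xy /=; rewrite -PFB//; try exact: Cc2_l.
apply: (@le_lt_trans _ _ (e / (L2 (cutoff r) + 1) * L2 (cutoff r))).
  apply: PF_bound => //; first by apply: CcB; exact: Cc2_l.
    move=> z zr; rewrite (hr (x, z)) ?(hr (y, z)) ?subrr//= lt_max zr orbT//.
  by move=> z; apply/ltW/(hd (x, z) (y, z)); rewrite /= dst_xx addr0.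
by rewrite mulrAC ltr_pdivrMr// ltr_pM2l// ltrDl.
Qed.

(** Tent functions of width d around a d/2-net, normalised by their sum. *)
Lemma partition_unity (r d : R) : 0 < d -> exists (I : finType) (a : I -> T1) (p : I -> T1 -> R),
  [/\ forall i, Cc (p i), forall i x, 0 <= p i x,
      forall i x, p i x != 0 -> dst x (a i) < d,
      forall x, \sum_i p i x <= 1 & forall x, nm x <= r -> \sum_i p i x = 1].
Proof.
move=> d0; have d2 : 0 < d / 2 by rewrite divr_gt0.
have [I [a hs]] := nm_net T1 r d2.
pose th i x := Num.max 0 (d - dst x (a i)).
pose S x := \sum_i th i x.
have th0 i x : 0 <= th i x by rewrite le_max lexx.
have lth i : lc (th i : T1 -> rspace).
  apply: lc_max; first exact: lc_cst.
  by apply: lcB; [exact: lc_cst|exact: lc_dst].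
have lS : lc (S : T1 -> rspace) by exact: lc_sum.
have lV : lc (fun x => (Num.max (d / 2) (S x))^-1 : rspace).
  by apply: (@lcV _ (d / 2)) => // [x|]; [rewrite le_max lexx|apply: lc_max => //; exact: lc_cst].
have M0 x : 0 < Num.max (d / 2) (S x) by rewrite lt_max d2.
(* The maximum keeps the denominator away from 0 off the ball. On the ball some tent exceeds
   [d / 2], so there the denominator is the sum itself. *)
exists I, a, (fun i x => (Num.max (d / 2) (S x))^-1 * th i x).
split.
- move=> i; apply: CcM => //; split => //.
  exists (nm (a i) + d) => x xr; rewrite /th max_l//.
  by have := nm_lip x (a i); lra.
- by move=> i x; rewrite mulr_ge0// invr_ge0 ltW.
- move=> i x; apply: contraNlt => h; have -> : th i x = 0 by rewrite /th max_l// subr_le0.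
  by rewrite mulr0.
- by move=> x; rewrite -mulr_sumr mulrC ler_pdivrMr// mul1r le_max lexx orbT.
- move=> x /hs[i hi]; rewrite -mulr_sumr -/(S x).
  have -> : Num.max (d / 2) (S x) = S x.
    apply/max_idPr; rewrite /S (bigD1 i)//=.
    apply: (@le_trans _ _ (th i x)); last by rewrite lerDl sumr_ge0.
    by rewrite /th le_max; apply/orP; right; lra.
  rewrite mulVf// gt_eqF// /S (bigD1 i)//= ltr_wpDr ?sumr_ge0//.
  by rewrite /th lt_max; apply/orP; right; lra.
Qed.

End Fubini.

Lemma Cc2_swap (T1 T2 : pspace) (K : T1 -> T2 -> R) :
  Cc (fun z : prodspace T1 T2 => K z.1 z.2) -> Cc (fun z : prodspace T2 T1 => K z.2 z.1).
Proof.
move=> h; apply: (@Cc_comp (prodspace T2 T1) (prodspace T1 T2) (fun z => (z.2, z.1))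
  (fun z => K z.1 z.2)) => //.
  by apply: lc_pair; [exact: lc_snd|exact: lc_fst].
by move=> r; exists r => x /=; rewrite maxC.
Qed.

(** A partition of unity in the first variable replaces [K] by a finite sum of products, for which
    the exchange is linearity; the error is uniformly small and lives in a fixed box. *)
Lemma PF_fubini (T1 T2 : pspace) (K : T1 -> T2 -> R) L1 L2 :
  Cc (fun z : prodspace T1 T2 => K z.1 z.2) -> @PF T1 L1 -> @PF T2 L2 ->
  L1 (fun x => L2 (K x)) = L2 (fun y => L1 (K ^~ y)).
Proof.
move=> hK h1 h2; have [h [r hr]] := hK.
have hK' := Cc2_swap hK.
have C1 := Cc2_int_r hK h2; have C2 := @Cc2_int_r T2 T1 (fun y x => K x y) hK' _ h1.
have c0 : 0 <= L1 (cutoff (r + 1)) * L2 (cutoff r) by rewrite mulr_ge0// PF_cutoff_ge0.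
set c := L1 (cutoff (r + 1)) * L2 (cutoff r) in c0.
apply: eq_eps => e e0.
pose e1 := e / (2 * c + 1).
have c1 : 0 < 2 * c + 1 by lra.
have e10 : 0 < e1 by rewrite divr_gt0.
have [d' d'0 hd'] := Cc_uc hK e10.
pose d := Num.min d' 1.
have d0 : 0 < d by rewrite lt_min d'0 ltr01.
have hd x y z : dst x y < d -> `|K x z - K y z| <= e1.
  rewrite lt_min => /andP[xy _]; apply/ltW/(hd' (x, z) (y, z)).
  by rewrite /= dst_xx addr0.
have [I [a [p [Cp p0 pd p1 pr]]]] := @partition_unity T1 r d d0.
pose Q x y := \sum_i p i x * K (a i) y.
(* The radius is [r + 1] in x because the pieces of the partition reach at most d <= 1 beyond the
   support of [K]. *)
have err x y : `|K x y - Q x y| <= e1 * cutoff (r + 1) x * cutoff r y.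
  have [yr|yr] := leP (nm y) r; last first.
    rewrite /Q (hr (x, y)) ?lt_max ?yr ?orbT//= big1 ?subrr ?normr0; last first.
      by move=> i _; rewrite (hr (a i, y)) ?mulr0//= lt_max yr orbT.
    by apply: mulr_ge0; [apply: mulr_ge0; [exact: ltW|exact: cutoff_ge0]|exact: cutoff_ge0].
  rewrite (cutoff1 yr) mulr1.
  have [xr|xr] := leP (nm x) (r + 1); last first.
    rewrite /Q (hr (x, y)) ?big1 ?subrr ?normr0//=; last first.
    - by rewrite lt_max; apply/orP; left; lra.
    - move=> i _; have [->|/pd pi] := eqVneq (p i x) 0; first by rewrite mul0r.
      rewrite (hr (a i, y)) ?mulr0//= lt_max; apply/orP; left.
      have := nm_lip x (a i); have : d <= 1 by rewrite ge_min lexx orbT.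
      by lra.
    - by rewrite mulr_ge0 ?cutoff_ge0// ltW.
  rewrite (cutoff1 xr) mulr1.
  have t i : p i x * `|K x y - K (a i) y| <= p i x * e1.
    have [->|/pd pi] := eqVneq (p i x) 0; first by rewrite !mul0r.
    by rewrite ler_wpM2l// hd.
  have [xr'|xr'] := leP (nm x) r.
    rewrite -[K x y]mul1r -(pr _ xr') mulr_suml /Q -sumrB.
    apply: le_trans (ler_norm_sum _ _ _) _.
    apply: (@le_trans _ _ (\sum_i p i x * e1)).
      by apply: ler_sum => i _; rewrite -mulrBr normrM ger0_norm.
    by rewrite -mulr_suml (pr _ xr') mul1r.
  have Kx0 : K x y = 0 by apply: (hr (x, y)); rewrite /= lt_max xr'.
  rewrite Kx0 sub0r normrN /Q; apply: le_trans (ler_norm_sum _ _ _) _.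
  apply: (@le_trans _ _ (\sum_i p i x * e1)).
    apply: ler_sum => i _; rewrite normrM ger0_norm//.
    by have := t i; rewrite Kx0 sub0r normrN.
  by rewrite -mulr_suml ler_piMl// ltW.
have CQ1 y : Cc (Q ^~ y).
  apply: Cc_sum => i; have := CcZ (K (a i) y) (Cp i).
  by congr Cc; apply/funext => x; rewrite mulrC.
have CQ2 x : Cc (Q x) by apply: Cc_sum => i; apply: CcZ; exact: Cc2_l.
have CB1 := Cc_cutoff T1 (r + 1); have CB2 := Cc_cutoff T2 r.
have L2Q x : L2 (Q x) = \sum_i L2 (K (a i)) * p i x.
  rewrite PFsum//; last by move=> i; apply: CcZ; exact: Cc2_l.
  by apply: eq_bigr => i _; rewrite PFZ 1?mulrC//; exact: Cc2_l.
have L1Q y : L1 (Q ^~ y) = \sum_i L1 (p i) * K (a i) y.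
  rewrite PFsum//; last first.
    by move=> i; have := CcZ (K (a i) y) (Cp i); congr Cc; apply/funext => x; rewrite mulrC.
  apply: eq_bigr => i _; rewrite mulrC -PFZ//; congr L1.
  by apply/funext => x; rewrite mulrC.
have CL2Q : Cc (fun x => L2 (Q x)).
  by rewrite (_ : (fun x => L2 (Q x)) = fun x => \sum_i L2 (K (a i)) * p i x);
    [apply: Cc_sum => i; exact: CcZ|apply/funext].
have CL1Q : Cc (fun y => L1 (Q ^~ y)).
  rewrite (_ : (fun y => L1 (Q ^~ y)) = fun y => \sum_i L1 (p i) * K (a i) y);
    [apply: Cc_sum => i; apply: CcZ; exact: Cc2_l|exact/funext].
have e1A : `|L1 (fun x => L2 (K x)) - L1 (fun x => L2 (Q x))| <= e1 * c.
  rewrite -PFB// (_ : e1 * c = e1 * L2 (cutoff r) * L1 (cutoff (r + 1))); last by rewrite /c; ring.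
  rewrite -PFZ//; apply: PFabs => //; [exact: CcB|exact: CcZ|] => x.
  rewrite -PFB//; last exact: Cc2_l.
  rewrite (_ : e1 * _ * _ = e1 * cutoff (r + 1) x * L2 (cutoff r)); last by ring.
  rewrite -PFZ//; apply: PFabs => //; [|exact: CcZ].
  by apply: CcB => //; exact: Cc2_l.
have e1B : `|L2 (fun y => L1 (K ^~ y)) - L2 (fun y => L1 (Q ^~ y))| <= e1 * c.
  rewrite -PFB// (_ : e1 * c = e1 * L1 (cutoff (r + 1)) * L2 (cutoff r)); last by rewrite /c; ring.
  rewrite -PFZ//; apply: PFabs => //; [exact: CcB|exact: CcZ|] => y.
  rewrite -PFB//; last exact: Cc2_r.
  rewrite (_ : e1 * _ * _ = e1 * cutoff r y * L1 (cutoff (r + 1))); last by ring.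
  rewrite -PFZ//; apply: PFabs => //; [|exact: CcZ|].
    by apply: CcB => //; exact: Cc2_r.
  by move=> x; rewrite -mulrA [cutoff r y * _]mulrC mulrA.
have QQ : L1 (fun x => L2 (Q x)) = L2 (fun y => L1 (Q ^~ y)).
  have -> : (fun x => L2 (Q x)) = fun x => \sum_i L2 (K (a i)) * p i x by exact/funext.
  have -> : (fun y => L1 (Q ^~ y)) = fun y => \sum_i L1 (p i) * K (a i) y by exact/funext.
  rewrite !PFsum//; try by move=> i; apply: CcZ => //; exact: Cc2_l.
  by apply: eq_bigr => i _; rewrite !PFZ//; [rewrite mulrC|exact: Cc2_l].
have := ler_distD (L1 (fun x => L2 (Q x))) (L1 (fun x => L2 (K x))) (L2 (fun y => L1 (K ^~ y))).
rewrite -QQ distrC in e1B.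
have : e1 * c + e1 * c <= e.
  rewrite /e1 -mulrDr mulrAC ler_pdivrMr// ler_pM2l//; lra.
by lra.
Qed.

End ProperSpaces.

(** * Matrix spaces and the special linear group *)

Section MatrixSpaces.
Variable R : realType.
Local Notation rspace := (rspace R).

(** The entrywise l^1 norm; it is submultiplicative for rectangular matrices. *)
Definition nrm p q (A : 'M[R]_(p, q)) : R := \sum_i \sum_j `|A i j|.

Lemma nrm_ge0 p q (A : 'M[R]_(p, q)) : 0 <= nrm A.
Proof. by rewrite sumr_ge0// => i _; rewrite sumr_ge0. Qed.

Lemma nrm_entry p q (A : 'M[R]_(p, q)) i j : `|A i j| <= nrm A.
Proof.
rewrite /nrm (bigD1 i)//= (bigD1 j)//= -addrA lerDl addr_ge0//.
  by rewrite sumr_ge0.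
by rewrite sumr_ge0// => i' _; rewrite sumr_ge0.
Qed.

Lemma nrm_le p q (A : 'M[R]_(p, q)) e : (forall i j, `|A i j| <= e) ->
  nrm A <= (p * q)%:R * e.
Proof.
move=> h; apply: (@le_trans _ _ (\sum_(i < p) \sum_(j < q) e)).
  by apply: ler_sum => i _; apply: ler_sum => j _.
by rewrite !sumr_const !card_ord -mulrnA mulr_natl mulnC.
Qed.

Lemma nrm0 p q : nrm (0 : 'M[R]_(p, q)) = 0.
Proof. by rewrite /nrm big1// => i _; rewrite big1// => j _; rewrite mxE normr0. Qed.

Lemma nrmD p q (A B : 'M[R]_(p, q)) : nrm (A + B) <= nrm A + nrm B.
Proof.
rewrite /nrm -big_split/=; apply: ler_sum => i _; rewrite -big_split/=.
by apply: ler_sum => j _; rewrite mxE ler_normD.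
Qed.

Lemma nrmN p q (A : 'M[R]_(p, q)) : nrm (- A) = nrm A.
Proof. by apply: eq_bigr => i _; apply: eq_bigr => j _; rewrite mxE normrN. Qed.

Lemma nrmZ p q c (A : 'M[R]_(p, q)) : nrm (c *: A) = `|c| * nrm A.
Proof.
rewrite /nrm mulr_sumr; apply: eq_bigr => i _; rewrite mulr_sumr.
by apply: eq_bigr => j _; rewrite mxE normrM.
Qed.

Lemma nrmM p q s (A : 'M[R]_(p, q)) (B : 'M[R]_(q, s)) :
  nrm (A *m B) <= nrm A * nrm B.
Proof.
rewrite /nrm mulr_suml; apply: ler_sum => i _.
apply: (@le_trans _ _ (\sum_l \sum_j `|A i l| * `|B l j|)).
  rewrite exchange_big/=; apply: ler_sum => j _; rewrite mxE.
  by apply: le_trans (ler_norm_sum _ _ _) _; apply: ler_sum => l _; rewrite normrM.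
rewrite mulr_suml; apply: ler_sum => l _; rewrite -mulr_sumr ler_wpM2l//.
by rewrite [leRHS](bigD1 l)//= lerDl sumr_ge0// => i' _; rewrite sumr_ge0.
Qed.

Definition matspace (p q : nat) : pspace R.
Proof.
refine (@PSpace R 'M[R]_(p, q) (fun A B => nrm (A - B)) (@nrm p q) _ _ _ _ _).
- by move=> x y; rewrite -nrmN opprB.
- by move=> y x z; apply: le_trans (nrmD _ _); rewrite addrA subrK.
- by move=> x; rewrite subrr nrm0.
- by move=> x y; apply: le_trans (nrmD _ _); rewrite addrCA subrr addr0.
- move=> r d d0; have pq : 0 < (p * q)%:R + 1 :> R by rewrite ltr_wpDl.
  have [I [a h]] := nm_net rspace r (divr_gt0 d0 pq).
  exists {ffun 'I_p * 'I_q -> I}, (fun f : {ffun 'I_p * 'I_q -> I} => \matrix_(i, j) a (f (i, j))).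
  move=> A Ar.
  have /choice[f hf] : forall ij : 'I_p * 'I_q, exists i, `|A ij.1 ij.2 - a i| < d / ((p * q)%:R + 1).
    by move=> ij; apply: h; apply: le_trans Ar; exact: nrm_entry.
  exists [ffun ij => f ij].
  apply: (@le_lt_trans _ _ ((p * q)%:R * (d / ((p * q)%:R + 1)))).
    by apply: nrm_le => i j; rewrite !mxE ffunE ltW// (hf (i, j)).
  by rewrite mulrCA gtr_pMr// ltr_pdivrMr// mul1r ltrDl.
Defined.
Canonical matspace.

Lemma lc_entry p q i j : lc (fun A : matspace p q => A i j : rspace).
Proof.
apply: lcI => r e e0; exists e => // A B _ _ h /=; apply: le_lt_trans h.
by have := nrm_entry (A - B) i j; rewrite !mxE.
Qed.

Lemma lc_mx (T : pspace R) p q (f : T -> matspace p q) :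
  (forall i j, lc (fun x => f x i j : rspace)) -> lc f.
Proof.
move=> h; apply: lcI => r e e0.
have pq : 0 < (p * q)%:R + 1 :> R by rewrite ltr_wpDl.
have /choice[d hd] : forall ij : 'I_p * 'I_q, exists d, 0 < d /\ forall x y, nm x <= r -> nm y <= r ->
    dst x y < d -> `|f x ij.1 ij.2 - f y ij.1 ij.2| < e / ((p * q)%:R + 1).
  move=> ij; have [_ /(_ _ (divr_gt0 e0 pq))[d d0 H]] := h ij.1 ij.2 r.
  by exists d.
exists (\big[Num.min/1]_ij d ij) => [|x y xr yr xy].
  by elim/big_ind : _ => [|a b a0 b0|ij _] //; [rewrite lt_min a0|case: (hd ij)].
apply: (@le_lt_trans _ _ ((p * q)%:R * (e / ((p * q)%:R + 1)))).
  apply: nrm_le => i j; rewrite !mxE ltW//.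
  by have [_ /(_ x y xr yr)] := hd (i, j); apply; apply: lt_le_trans xy _; exact: bigmin_le_cond.
by rewrite mulrCA gtr_pMr// ltr_pdivrMr// mul1r ltrDl.
Qed.

Lemma lc_mxE (T : pspace R) p q (f : T -> matspace p q) i j :
  lc f -> lc (fun x => f x i j : rspace).
Proof. by move=> hf; exact: (lc_comp (@lc_entry p q i j) hf). Qed.

Lemma lc_prod (T : pspace R) (I : Type) (s : seq I) (F : I -> T -> R) :
  (forall i, lc (F i : T -> rspace)) -> lc (fun x => \prod_(i <- s) F i x : rspace).
Proof.
move=> H; elim: s => [|i s IH].
  by apply: lc_ext (lc_cst _ (1 : rspace)) => x; rewrite big_nil.
by apply: lc_ext (lcM (H i) IH) => x; rewrite big_cons.
Qed.

Lemma lc_det (T : pspace R) p (f : T -> matspace p p) : lc f ->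
  lc (fun x => \det (f x) : rspace).
Proof.
move=> h; apply: lc_sum => s; apply: lcZ; apply: lc_prod => i; exact: lc_mxE.
Qed.

Lemma lc_mulmx (T : pspace R) p q s (f : T -> matspace p q) (g : T -> matspace q s) :
  lc f -> lc g -> lc (fun x => f x *m g x : matspace p s).
Proof.
move=> hf hg; apply: lc_mx => i j.
apply: (@lc_ext _ _ _ (fun x => \sum_l f x i l * g x l j)).
  by move=> x; rewrite mxE.
by apply: lc_sum => l; apply: lcM; exact: lc_mxE.
Qed.

Lemma lc_addmx (T : pspace R) p q (f g : T -> matspace p q) :
  lc f -> lc g -> lc (fun x => f x + g x : matspace p q).
Proof.
move=> hf hg; apply: lc_mx => i j.
apply: (@lc_ext _ _ _ (fun x => f x i j + g x i j)); first by move=> x; rewrite mxE.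
by apply: lcD; exact: lc_mxE.
Qed.

Lemma lc_scalemx (T : pspace R) p q (c : T -> R) (g : T -> matspace p q) :
  lc (c : T -> rspace) -> lc g -> lc (fun x => c x *: g x : matspace p q).
Proof.
move=> hf hg; apply: lc_mx => i j.
apply: (@lc_ext _ _ _ (fun x => c x * g x i j)); first by move=> x; rewrite mxE.
by apply: lcM => //; exact: lc_mxE.
Qed.

Lemma lc_trmx (T : pspace R) p q (f : T -> matspace p q) :
  lc f -> lc (fun x => (f x)^T : matspace q p).
Proof.
move=> hf; apply: lc_mx => i j.
by apply: (@lc_ext _ _ _ (fun x => f x j i)); [move=> x; rewrite mxE|exact: lc_mxE].
Qed.

Lemma lc_adj (T : pspace R) p (f : T -> matspace p p) :
  lc f -> lc (fun x => \adj (f x) : matspace p p).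
Proof.
move=> hf; apply: lc_mx => i j.
apply: (@lc_ext _ _ _ (fun x => cofactor (f x) j i)); first by move=> x; rewrite mxE.
apply: lcZ; apply: lc_det; apply: lc_mx => i' j'.
by apply: (@lc_ext _ _ _ (fun x => f x (lift j i') (lift i j'))); [move=> x; rewrite !mxE|exact: lc_mxE].
Qed.

End MatrixSpaces.

(** * SL_n(R) with the matrix distance *)

Section SpecialLinear.
Variables (R : realType) (n : nat).
Local Notation rspace := (rspace R).

Definition slT := {g : 'M[R]_n | \det g == 1}.

HB.instance Definition _ := SubType.copy slT {g : 'M[R]_n | \det g == 1}.
HB.instance Definition _ := Choice.copy slT {g : 'M[R]_n | \det g == 1}.

Lemma sl_det (g : slT) : \det (val g) = 1. Proof. by apply/eqP/(valP g). Qed.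

Lemma sl_unit (g : slT) : val g \in unitmx.
Proof. by rewrite unitmxE sl_det unitr1. Qed.

Fact sl_one_subproof : \det (1%:M : 'M[R]_n) == 1. Proof. by rewrite det1. Qed.
Fact sl_mul_subproof (g h : slT) : \det (val g *m val h) == 1.
Proof. by rewrite det_mulmx !sl_det mulr1. Qed.
Fact sl_inv_subproof (g : slT) : \det (invmx (val g)) == 1.
Proof. by rewrite det_inv sl_det invr1. Qed.

Definition sl_one : slT := @exist _ (fun g : 'M[R]_n => \det g == 1) _ sl_one_subproof.
Definition sl_mul (g h : slT) : slT := @exist _ (fun g : 'M[R]_n => \det g == 1) _ (sl_mul_subproof g h).
Definition sl_inv (g : slT) : slT := @exist _ (fun g : 'M[R]_n => \det g == 1) _ (sl_inv_subproof g).

Fact sl_mulA : associative sl_mul.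
Proof. by move=> a b c; apply: val_inj; rewrite /= mulmxA. Qed.
Fact sl_mul1 : left_id sl_one sl_mul.
Proof. by move=> a; apply: val_inj; rewrite /= mul1mx. Qed.
Fact sl_mulr1 : right_id sl_one sl_mul.
Proof. by move=> a; apply: val_inj; rewrite /= mulmx1. Qed.
Fact sl_mulV : left_inverse sl_one sl_inv sl_mul.
Proof. by move=> a; apply: val_inj; rewrite /= mulVmx// sl_unit. Qed.
Fact sl_mulrV : right_inverse sl_one sl_inv sl_mul.
Proof. by move=> a; apply: val_inj; rewrite /= mulmxV// sl_unit. Qed.

HB.instance Definition _ := isGroup.Build slT sl_mulA sl_mul1 sl_mulr1 sl_mulV sl_mulrV.

Lemma sl_valM (g h : slT) : val (g * h)%g = val g *m val h. Proof. by []. Qed.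
Lemma sl_val1 : val (1%g : slT) = 1%:M. Proof. by []. Qed.
Lemma sl_valV (g : slT) : val (g^-1)%g = invmx (val g). Proof. by []. Qed.
Lemma sl_valVadj (g : slT) : val (g^-1)%g = \adj (val g).
Proof. by rewrite sl_valV /invmx sl_unit sl_det invr1 scale1r. Qed.

Definition slspace : pspace R.
Proof.
refine (@PSpace R slT (fun g h => nrm (val g - val h)) (fun g => nrm (val g)) _ _ _ _ _).
- by move=> x y; exact: (@dst_sym R (matspace R n n)).
- by move=> y x z; exact: (@dst_tri R (matspace R n n)).
- by move=> x; exact: (@dst_xx R (matspace R n n)).
- by move=> x y; exact: (@nm_lip R (matspace R n n)).
- move=> r d d0; have d2 : 0 < d / 2 by rewrite divr_gt0.
  have [I [a h]] := nm_net (matspace R n n) r d2.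
  (* A net of the space of matrices need not meet SL_n: each centre is replaced by a group element
     within d/2 of it, when there is one. *)
  have /choice[b hb] : forall i, exists g : slT,
      (exists g' : slT, nrm (val g' - a i) < d / 2) -> nrm (val g - a i) < d / 2.
    move=> i; have [[g hg]|ng] := pselect (exists g : slT, nrm (val g - a i) < d / 2).
      by exists g.
    by exists 1%g => hg; exfalso; exact: ng.
  exists I, b => x xr; have [i hi] := h (val x) xr; exists i.
  have := hb i (ex_intro _ x hi).
  have := @dst_tri R (matspace R n n) (a i) (val x) (val (b i)).
  rewrite (@dst_sym R (matspace R n n) (a i)) /=.
  by move: hi => /=; lra.
Defined.
Canonical slspace.

Lemma lc_val (T : pspace R) (f : T -> slspace) :
  lc f -> lc (fun x => val (f x) : matspace R n n).
Proof. by []. Qed.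

Lemma lc_slI (T : pspace R) (f : T -> slspace) :
  lc (fun x => val (f x) : matspace R n n) -> lc f.
Proof. by []. Qed.

Lemma lc_mulg (T : pspace R) (f g : T -> slspace) :
  lc f -> lc g -> lc (fun x => (f x * g x)%g : slspace).
Proof. by move=> hf hg; apply/lc_slI/lc_mulmx; exact: lc_val. Qed.

(** In SL_n the inverse is the adjugate, whose entries are polynomials. *)
Lemma lc_invg (T : pspace R) (f : T -> slspace) :
  lc f -> lc (fun x => (f x)^-1%g : slspace).
Proof.
move=> hf; apply: lc_slI.
by apply: (@lc_ext _ _ _ (fun x => \adj (val (f x)) : matspace R n n)) => [x|];
  [rewrite sl_valVadj|exact/lc_adj/lc_val].
Qed.

Lemma nmM (g h : slT) : nm (g * h)%g <= nm g * nm h.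
Proof. exact: nrmM. Qed.

Lemma nm_ge0 (g : slT) : 0 <= nm g. Proof. exact: nrm_ge0. Qed.

Lemma nmV_bound r : exists2 r', 0 < r' & forall g : slT, nm g <= r -> nm (g^-1)%g <= r'.
Proof.
have [[r' h] _] := lc_invg (@lc_id _ slspace) r.
exists (`|r'| + 1) => [|g /h]; first by rewrite ltr_wpDl.
by move=> hg; apply: le_trans hg _; rewrite (le_trans (ler_norm _))// lerDl.
Qed.

Lemma dstMl (a g h : slT) : dst (a * g)%g (a * h)%g <= nm a * dst g h.
Proof. by rewrite /dst/= -mulmxBr; exact: nrmM. Qed.

Lemma dstMr (a g h : slT) : dst (g * a)%g (h * a)%g <= dst g h * nm a.
Proof. by rewrite /dst/= -mulmxBl; exact: nrmM. Qed.

Definition tl (a : slT) (w : slT -> R) : slT -> R := fun x => w (a * x)%g.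
Definition tr (a : slT) (w : slT -> R) : slT -> R := fun x => w (x * a)%g.

Lemma Cc_tl a w : Cc (w : slspace -> R) -> Cc (tl a w : slspace -> R).
Proof.
apply: Cc_comp; first by apply: lc_mulg; [exact: lc_cst|exact: lc_id].
move=> r; exists (nm (a^-1)%g * `|r|) => x xr.
rewrite -[x](mulKg a); apply: le_trans (nmM _ _) _; rewrite ler_wpM2l ?nm_ge0//.
exact: le_trans xr (ler_norm _).
Qed.

Lemma Cc_tr a w : Cc (w : slspace -> R) -> Cc (tr a w : slspace -> R).
Proof.
apply: Cc_comp; first by apply: lc_mulg; [exact: lc_id|exact: lc_cst].
move=> r; exists (`|r| * nm (a^-1)%g) => x xr.
rewrite -[x](mulgK a); apply: le_trans (nmM _ _) _; rewrite ler_wpM2r ?nm_ge0//.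
exact: le_trans xr (ler_norm _).
Qed.

Lemma Cc_inv (w : slT -> R) : Cc (w : slspace -> R) ->
  Cc ((fun x => w (x^-1)%g) : slspace -> R).
Proof.
apply: Cc_comp; first exact/lc_invg/lc_id.
move=> r; have [r' _ h] := nmV_bound r; exists r' => x /h.
by rewrite invgK.
Qed.

(** Made total by [insubd]: for i = j the value is the identity. *)
Definition elt (i j : 'I_n) (x : R) : slT := insubd (1%g : slT) (1%:M + x *: delta_mx i j).

Lemma det_elt i j x : i != j -> \det (1%:M + x *: delta_mx i j : 'M[R]_n) = 1.
Proof.
wlog ij : i j / (j < i)%N => [H|_].
  move=> ij; have [ji|ji] := ltnP j i; first exact: H.
  rewrite -det_tr linearD/= trmx1 linearZ/= trmx_delta H// 1?eq_sym//.
  by rewrite ltn_neqAle ij.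
rewrite det_trig; last first.
  apply/is_trig_mxP => a b ab; rewrite !mxE.
  rewrite (_ : (a == b) = false) ?add0r; last by rewrite -val_eqE/= ltn_eqF.
  have [ai|_] := eqVneq a i; last by rewrite mulr0.
  have [bj|_] := eqVneq b j; last by rewrite mulr0.
  by move: ab ij; rewrite ai bj => ab ij; have := ltn_trans ab ij; rewrite ltnn.
rewrite big1// => a _; rewrite !mxE eqxx.
have [ai|_] := eqVneq a i; last by rewrite mulr0 addr0.
have [aj|_] := eqVneq a j; last by rewrite mulr0 addr0.
by move: ij; rewrite -ai -aj ltnn.
Qed.

Lemma val_elt i j x : i != j -> val (elt i j x) = 1%:M + x *: delta_mx i j.
Proof. by move=> ij; rewrite /elt val_insubd det_elt// eqxx. Qed.

End SpecialLinear.

(** * Generation of SL_n(R) by elementary matrices *)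

Section Generation.
Variable R : realType.

Definition gen_closed n (S : 'M[R]_n -> Prop) :=
  [/\ S 1%:M, forall A B, S A -> S B -> S (A *m B) &
      forall i j x, i != j -> S (1%:M + x *: delta_mx i j)].

Lemma elt_inv n (i j : 'I_n) (x : R) : i != j ->
  (1%:M - x *: delta_mx i j) *m (1%:M + x *: delta_mx i j) = 1%:M :> 'M[R]_n.
Proof.
move=> ij; rewrite mulmxDl mul1mx mulmxDr mulmx1 mulNmx -scalemxAl -scalemxAr.
by rewrite mul_delta_mx_0 1?eq_sym// !scaler0 oppr0 addr0 addrK.
Qed.

(** The inverse of an elementary matrix is elementary, so a row operation can be undone within
    [S]. *)
Lemma gen_op n (S : 'M[R]_n -> Prop) i j x A : gen_closed S -> i != j ->
  S ((1%:M + x *: delta_mx i j) *m A) -> S A.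
Proof.
move=> [_ SM Se] ij SA.
by rewrite -[A]mul1mx -(elt_inv x ij) -mulmxA -scaleNr; apply: SM => //; exact: Se.
Qed.

Lemma block_eltdl n1 n2 (i : 'I_n2) (j : 'I_n1) (x : R) :
  block_mx 1%:M 0 (x *: delta_mx i j) 1%:M =
  1%:M + x *: delta_mx (rshift n1 i) (lshift n2 j) :> 'M[R]_(n1 + n2).
Proof.
rewrite delta_mx_dshift delta_mx_lshift (scalar_mx_block n1 n2) -[X in col_mx X _]row_mx0.
by rewrite -/(block_mx _ _ _ _) scale_block_mx add_block_mx !scaler0 !addr0 add0r.
Qed.

Lemma block_eltur n1 n2 (i : 'I_n1) (j : 'I_n2) (x : R) :
  block_mx 1%:M (x *: delta_mx i j) 0 1%:M =
  1%:M + x *: delta_mx (lshift n2 i) (rshift n1 j) :> 'M[R]_(n1 + n2).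
Proof.
rewrite delta_mx_ushift delta_mx_rshift (scalar_mx_block n1 n2) -[X in col_mx _ X]row_mx0.
by rewrite -/(block_mx _ _ _ _) scale_block_mx add_block_mx !scaler0 !addr0 add0r.
Qed.

Lemma block_eltdr n1 n2 (i j : 'I_n2) (x : R) :
  block_mx 1%:M 0 0 (1%:M + x *: delta_mx i j) =
  1%:M + x *: delta_mx (rshift n1 i) (rshift n1 j) :> 'M[R]_(n1 + n2).
Proof.
rewrite delta_mx_dshift delta_mx_rshift (scalar_mx_block n1 n2) -[X in col_mx X _]row_mx0.
by rewrite -/(block_mx _ _ _ _) scale_block_mx add_block_mx !scaler0 !addr0.
Qed.

Lemma gen_dl n1 n2 (S : 'M[R]_(n1 + n2) -> Prop) (c : 'M[R]_(n2, n1)) : gen_closed S ->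
  S (block_mx 1%:M 0 c 1%:M).
Proof.
move=> [S1 SM Se]; rewrite [c]matrix_sum_delta pair_big/=.
elim/big_ind: _ => [|c1 c2 h1 h2|ij _].
- by rewrite -scalar_mx_block.
- have := SM _ _ h1 h2; rewrite mulmx_block !mul0mx !mulmx0 !mul1mx !mulmx1 !addr0 add0r.
  by [].
- by rewrite block_eltdl; apply: Se; rewrite eq_sym eq_lrshift.
Qed.

Lemma gen_ur n1 n2 (S : 'M[R]_(n1 + n2) -> Prop) (c : 'M[R]_(n1, n2)) : gen_closed S ->
  S (block_mx 1%:M c 0 1%:M).
Proof.
move=> [S1 SM Se]; rewrite [c]matrix_sum_delta pair_big/=.
elim/big_ind: _ => [|c1 c2 h1 h2|ij _].
- by rewrite -scalar_mx_block.
- have := SM _ _ h1 h2; rewrite mulmx_block !mul0mx !mulmx0 !mul1mx !mulmx1 !addr0 add0r.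
  by rewrite addrC.
- by rewrite block_eltur; apply: Se; rewrite eq_lrshift.
Qed.

Lemma elt_mulE n (i j : 'I_n) (x : R) (A : 'M[R]_n) a b :
  ((1%:M + x *: delta_mx i j) *m A) a b = A a b + x * (a == i)%:R * A j b.
Proof.
rewrite mulmxDl mul1mx mxE -scalemxAl mxE -mulrA; congr (_ + _ * _).
rewrite mxE (bigD1 j)//= big1 ?addr0 => [|l lj]; first by rewrite mxE eqxx andbT.
by rewrite mxE (negbTE lj) andbF mul0r.
Qed.

Lemma sl_gen_mx n (S : 'M[R]_n -> Prop) (A : 'M[R]_n) : gen_closed S -> \det A = 1 -> S A.
Proof.
elim: n => [|n IH] in S A *; first by move=> [S1 _ _] _; rewrite (_ : A = 1%:M)//; apply/matrixP => -[].
move=> hS; have [S1 SM Se] := hS; rewrite -[n.+1]/(1 + n)%N in S A hS S1 SM Se *.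
(* normalise the top left entry to 1, then clear its row and column *)
have main (B : 'M[R]_(1 + n)) : B 0 0 = 1 -> \det B = 1 -> S B.
  move=> B00 dB; rewrite -[B]submxK in dB *.
  have ulE : ulsubmx B = 1%:M.
    by apply/matrixP => i j; rewrite !ord1 !mxE -B00; congr (B _ _); exact: val_inj.
  rewrite ulE in dB *.
  set r := ursubmx B in dB *; set c := dlsubmx B in dB *; set D := drsubmx B in dB *.
  have E : block_mx 1%:M r c D =
      block_mx 1%:M 0 c 1%:M *m block_mx 1%:M 0 0 (D - c *m r) *m block_mx 1%:M r 0 1%:M :> 'M[R]_(1 + n).
    rewrite !mulmx_block !mul0mx !mulmx0 !mul1mx !mulmx1 !addr0 !add0r.
    by rewrite mul1mx addrC subrK.
  rewrite E; apply: (SM _ _); [apply: (SM _ _); [exact: gen_dl|]|exact: gen_ur].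
  apply: (IH (fun X => S (block_mx 1%:M 0 0 X))).
    split; first by rewrite -scalar_mx_block.
      move=> X Y hX hY; have := SM _ _ hX hY.
      by rewrite mulmx_block !mul0mx !mulmx0 !mul1mx !addr0 !add0r.
    by move=> i j x ij; rewrite block_eltdr; apply: Se; rewrite eq_rshift.
  move: dB; rewrite E !det_mulmx det_lblock det_ublock det_ublock !det1 !mul1r !mulr1.
  by [].
(* A nonzero entry below the corner lets a multiple of its row be added to the top row so that the
   corner becomes 1. *)
have main2 (B : 'M[R]_(1 + n)) i : i != 0 -> B i 0 != 0 -> \det B = 1 -> S B.
  move=> i0 Bi dB; have i0' : 0 != i by rewrite eq_sym.
  apply: (@gen_op _ S 0 i ((1 - B 0 0) / B i 0)) => //; apply: main.
    by rewrite elt_mulE eqxx mulr1 divfK// addrC subrK.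
  by rewrite det_mulmx det_elt// mul1r.
move=> dA.
have [[i /andP[i0 Ai]]|nA] := pselect (exists i, (i != 0) && (A i 0 != 0)); first exact: main2 Ai dA.
have A0 i : i != 0 -> A i 0 = 0.
  by move=> i0; apply/eqP/negP => /negP Ai; apply: nA; exists i; rewrite i0.
have A00 : A 0 0 != 0.
  apply/negP => /eqP A00; move: dA; rewrite (expand_det_col A 0) big1 => [|i _].
    by move=> /eqP; rewrite eq_sym oner_eq0.
  by have [->|/A0->] := eqVneq i 0; rewrite ?A00 mul0r.
case: n => [|n] in IH S A hS S1 SM Se main main2 dA nA A0 A00 *.
  by apply: main => //; rewrite -dA [RHS]det_mx11.
have i0 : (lift ord0 ord0 : 'I_n.+2) != 0 by [].
(* The first column is concentrated in its top entry; adding row 0 to row 1 restores a nonzero entry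
   below it. *)
apply: (@gen_op _ S (lift ord0 ord0) 0 1) => //; apply: (main2 _ (lift ord0 ord0)) => //.
  by rewrite elt_mulE eqxx !mul1r A0// add0r.
by rewrite det_mulmx det_elt// mul1r.
Qed.

Lemma sl_gen n (P : slT R n -> Prop) : P 1%g -> (forall a b, P a -> P b -> P (a * b)%g) ->
  (forall i j x, i != j -> P (elt i j x)) -> forall g, P g.
Proof.
move=> P1 PM Pe g.
suff [h Ph hg] : exists2 h, P h & val h = val g by rewrite -(val_inj hg).
apply: (@sl_gen_mx n (fun A => exists2 h, P h & val h = A)); last exact: sl_det.
split; first by exists 1%g.
  by move=> _ _ [a Pa <-] [b Pb <-]; exists (a * b)%g => //; exact: PM.
by move=> i j x ij; exists (elt i j x); [exact: Pe|exact: val_elt].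
Qed.

End Generation.

(** * Finitely supported sums and the Riemann integral *)

Section FiniteSums.
Variables (R : realType) (I : choiceType).
Implicit Types (A X : set I) (f g : I -> R).

Lemma fsumE A X f : finite_set X -> X `<=` A -> (forall x, A x -> f x != 0 -> X x) ->
  \sum_(x \in A) f x = \sum_(x <- fset_set X) f x.
Proof.
move=> finX XA h; rewrite -fsbig_finite//; apply/esym/fsbig_widen => // x [Ax nX] /=.
by apply/eqP/negP => /negP /(h _ Ax).
Qed.

(** A sum with infinite support is 0 by convention, so additivity and comparison of sums are stated
    under finite support. *)
Definition fsupp A f := finite_set [set x | A x /\ f x != 0].

Lemma fsum_supp A f : fsupp A f ->
  \sum_(x \in A) f x = \sum_(x <- fset_set [set x | A x /\ f x != 0]) f x.
Proof. by move=> h; apply: fsumE => // x []. Qed.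

Lemma fsum_supp2 A f g : fsupp A f -> fsupp A g -> exists X, [/\ finite_set X, X `<=` A,
  forall x, A x -> f x != 0 -> X x & forall x, A x -> g x != 0 -> X x].
Proof.
move=> hf hg; exists ([set x | A x /\ f x != 0] `|` [set x | A x /\ g x != 0]); split.
- by rewrite finite_setU.
- by move=> x [[]|[]].
- by move=> x Ax fx; left.
- by move=> x Ax gx; right.
Qed.

Lemma fsumD A f g : fsupp A f -> fsupp A g ->
  \sum_(x \in A) (f x + g x) = \sum_(x \in A) f x + \sum_(x \in A) g x.
Proof.
move=> hf hg; have [X [fX XA Xf Xg]] := fsum_supp2 hf hg.
rewrite !(fsumE fX)// ?big_split// => x Ax h; apply: contrapT => nX; move: h.
have /eqP -> : f x == 0 by apply/negP => /negP /(Xf _ Ax).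
have /eqP -> : g x == 0 by apply/negP => /negP /(Xg _ Ax).
by rewrite addr0 eqxx.
Qed.

Lemma fsum_le A f g : fsupp A f -> fsupp A g -> (forall x, A x -> f x <= g x) ->
  \sum_(x \in A) f x <= \sum_(x \in A) g x.
Proof.
move=> hf hg fg; have [X [fX XA Xf Xg]] := fsum_supp2 hf hg.
rewrite !(fsumE fX)// big_seq [leRHS]big_seq; apply: ler_sum => x.
by rewrite in_fset_set// in_setE => /XA /fg.
Qed.

Lemma fsum_ge0 A f : (forall x, A x -> 0 <= f x) -> 0 <= \sum_(x \in A) f x.
Proof. exact: fsumr_ge0. Qed.

Lemma fsum_ge_term A f x : fsupp A f -> (forall y, A y -> 0 <= f y) -> A x ->
  f x <= \sum_(y \in A) f y.
Proof.
move=> hf f0 Ax; have fin : finite_set ([set y | A y /\ f y != 0] `|` [set x]).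
  by rewrite finite_setU.
rewrite (fsumE fin); last 2 first.
- by move=> y [[]//|->].
- by move=> y Ay fy; left.
rewrite (bigD1_seq x)/=; last 2 first.
- by rewrite in_fset_set// mem_set//; right.
- exact: fset_uniq.
rewrite lerDl big_seq_cond sumr_ge0// => y; rewrite in_fset_set// => /andP[/set_mem[[Ay _]|->] _];
  exact: f0.
Qed.

Lemma fsupp_le A f g : (forall x, A x -> g x = 0 -> f x = 0) -> fsupp A g -> fsupp A f.
Proof.
move=> h; apply: sub_finite_set => x [Ax fx]; split => //.
by apply: contra fx => /eqP /(h _ Ax) ->.
Qed.

Lemma fsum_abs A f g : fsupp A f -> fsupp A g -> (forall x, A x -> `|f x| <= g x) ->
  `|\sum_(x \in A) f x| <= \sum_(x \in A) g x.
Proof.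
move=> hf hg fg; have [X [fX XA Xf Xg]] := fsum_supp2 hf hg.
rewrite !(fsumE fX)//; apply: le_trans (ler_norm_sum _ _ _) _.
rewrite big_seq [leRHS]big_seq; apply: ler_sum => x.
by rewrite in_fset_set// in_setE => /XA /fg.
Qed.

Lemma fsum_fiber (J : choiceType) (A : set I) (B : set J) (p : I -> J) f :
  fsupp A f -> (forall x, A x -> B (p x)) ->
  \sum_(x \in A) f x = \sum_(j \in B) \sum_(x \in A `&` [set x | p x = j]) f x.
Proof.
move=> hf AB; set X := [set x | A x /\ f x != 0] in hf *.
rewrite (fsum_supp hf) -/X (partition_big_imfset _ p).
have inner j : \sum_(x \in A `&` [set x | p x = j]) f x =
    \sum_(x <- fset_set X | p x == j) f x.
  rewrite (@fsumE _ (X `&` [set x | p x = j])); last 3 first.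
  - exact: finite_setIl.
  - by move=> x [[? _] ?]; split.
  - by move=> x [? ?] ?; split.
  rewrite -[RHS]big_filter; apply: perm_big.
  apply: uniq_perm; [exact: fset_uniq|by rewrite filter_uniq// fset_uniq|] => x.
  rewrite mem_filter !in_fset_set//; last exact: finite_setIl.
  apply/idP/andP => [|[/eqP h]]; rewrite !in_setE; first by move=> [? ->].
  by move=> Xx; split.
rewrite [RHS](eq_fsbigr (fun j => \sum_(x <- fset_set X | p x == j) f x)); last by move=> j _; exact: inner.
rewrite -[RHS](@fsbig_widen _ _ _ _ (p @` X))//; last 2 first.
- by move=> _ [x [Ax _] <-]; exact: AB.
- move=> j [_ nj] /=; rewrite big_seq_cond big1// => x; rewrite in_fset_set// => /andP[/set_mem Xx /eqP xj].
  by exfalso; apply: nj; exists x.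
rewrite fsbig_finite//; last exact: finite_image.
apply: perm_big; apply: uniq_perm; [exact: fset_uniq|exact: fset_uniq|] => j.
rewrite in_fset_set; last exact: finite_image.
apply/imfsetP/idP => [[x /= + ->]|]; rewrite in_setE.
  by rewrite in_fset_set// in_setE => Xx; exists x.
by move=> [x Xx <-]; exists x => //=; rewrite in_fset_set// in_setE.
Qed.

End FiniteSums.

(** * The Lebesgue integral on matrices as a limit of lattice sums *)

Section RiemannFunctional.
Variables (R : realType) (p q : nat).
Local Notation V := (matspace R p q).
Local Notation N := (p * q)%N.

Definition zr (z : 'M[int]_(p, q)) : 'M[R]_(p, q) := map_mx intr z.

Lemma zrD a b : zr (a + b) = zr a + zr b. Proof. exact: map_mxD. Qed.

Definition zbox (K : nat) (f : {ffun 'I_p * 'I_q -> 'I_(K + K).+1}) : 'M[int]_(p, q) :=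
  \matrix_(i, j) ((f (i, j) : nat)%:Z - K%:Z).

Lemma zboxP K z : nrm (zr z) < K.+1%:R -> exists f, z = @zbox K f.
Proof.
move=> zK.
have b i j : (absz (z i j) <= K)%N.
  have := le_lt_trans (nrm_entry (zr z) i j) zK.
  by rewrite mxE -intr_norm -abszE -[_%:~R]/(_%:R) ltr_nat.
have b' i j : (absz (z i j + K%:Z)%R < (K + K).+1)%N by have := b i j; lia.
exists [ffun ij => Ordinal (b' ij.1 ij.2)]; apply/matrixP => i j.
by rewrite !mxE ffunE/=; have := b i j; lia.
Qed.

Lemma finite_zr (r : R) : finite_set [set z | nrm (zr z) <= r].
Proof.
pose K := Num.trunc r.
apply: (@sub_finite_set _ _ (@zbox K @` setT)); last exact/finite_image/finite_finset.
move=> z /= zr'; have [|f ->] := @zboxP K z; last by exists f.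
exact: le_lt_trans zr' (truncnS_gt _).
Qed.

Lemma count_zr (r : R) : 0 <= r ->
  \sum_(z <- fset_set [set z | nrm (zr z) <= r]) (1 : R) <= (2 * r + 1) ^+ N.
Proof.
move=> r0; rewrite big_const_seq count_predT iter_addr_0.
set s := fset_set _.
pose K := Num.trunc r.
have : (size s <= (K + K).+1 ^ N)%N.
  rewrite (_ : _ ^ _ = size [seq @zbox K f | f <- enum {: {ffun 'I_p * 'I_q -> 'I_(K + K).+1}}])%N; last first.
    by rewrite size_map -cardE card_ffun card_ord card_prod !card_ord.
  apply: uniq_leq_size; first exact: fset_uniq.
  move=> z; rewrite in_fset_set; last exact: finite_zr.
  move=> /set_mem/= zr'; have [|f ->] := @zboxP K z.
    exact: le_lt_trans zr' (truncnS_gt _).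
  by apply/mapP; exists f => //; rewrite mem_enum.
rewrite -(ler_nat R) => /le_trans; apply; rewrite natrX lerXn2r ?nnegrE ?addr_ge0 ?mulr_ge0//.
by have /andP[h _] := truncn_itv r0; rewrite -natr1 natrD -/K; move: h; rewrite -/K; lra.
Qed.

Definition Riem (j : nat) (f : V -> R) : R :=
  (j.+1%:R^-1) ^+ N * \sum_(z \in [set: 'M[int]_(p, q)]) f (j.+1%:R^-1 *: zr z).

Lemma fsupp_zr (c : R) f : c != 0 -> Cc f ->
  fsupp [set: 'M[int]_(p, q)] (fun z => f (c *: zr z)).
Proof.
move=> c0 [_ [r hr]]; apply: sub_finite_set (finite_zr (r / `|c|)) => z [_ fz] /=.
rewrite ler_pdivlMr ?normr_gt0// mulrC -nrmZ leNgt; apply/negP => h.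
by move: fz; rewrite hr ?eqxx.
Qed.

Lemma jn0 (j : nat) : (j.+1%:R^-1 : R) != 0. Proof. by rewrite invr_eq0 pnatr_eq0. Qed.

Lemma Riem_PF j : PF (Riem j).
Proof.
split=> [c f g hf hg|f hf f0].
  rewrite /Riem fsumD; [|exact: (@fsupp_zr _ (fun x => c * f x) (jn0 j) (CcZ c hf))|exact: fsupp_zr (jn0 j) _].
  by rewrite mulrDr -mulr_fsumr mulrCA.
by rewrite mulr_ge0 ?exprn_ge0 ?invr_ge0// fsum_ge0.
Qed.

(** The bound does not involve the mesh, which makes all error estimates on Riemann sums uniform in
    [j]. *)
Lemma Riem_cutoff j (r : R) : 0 <= r -> Riem j (cutoff r) <= (2 * r + 3) ^+ N.
Proof.
move=> r0; have j0 : 0 < j.+1%:R :> R by rewrite ltr0n.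
apply: (@le_trans _ _ (j.+1%:R^-1 ^+ N * (2 * ((r + 1) * j.+1%:R) + 1) ^+ N)); last first.
  rewrite -exprMn; apply: lerXn2r; rewrite ?nnegrE.
  - by rewrite mulr_ge0 ?invr_ge0// addr_ge0// mulr_ge0// mulr_ge0// addr_ge0.
  - by rewrite addr_ge0// mulr_ge0.
  rewrite mulrC ler_pdivrMr//.
  have : (1 : R) <= j.+1%:R by rewrite ler1n.
  nra.
rewrite ler_wpM2l ?exprn_ge0 ?invr_ge0//; apply: le_trans (count_zr _); last first.
  by rewrite mulr_ge0 ?addr_ge0.
rewrite (@fsumE _ _ _ [set z | nrm (zr z) <= (r + 1) * j.+1%:R])//; last 2 first.
- exact: finite_zr.
- move=> z _; apply: contraNT; rewrite -ltNge => h /=.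
  apply/eqP/cutoff0; rewrite /= nrmZ ger0_norm ?invr_ge0// ler_pdivlMl// mulrC.
  exact: ltW.
by apply: ler_sum => z _; exact: cutoff_le1.
Qed.

Definition zres l (z : 'M[int]_(p, q)) : {ffun 'I_p * 'I_q -> 'I_l.+1} :=
  [ffun ij => inord (absz (z ij.1 ij.2 %% l.+1)%Z)].

Definition zof l (a : {ffun 'I_p * 'I_q -> 'I_l.+1}) : 'M[int]_(p, q) :=
  \matrix_(i, j) (a (i, j) : nat)%:Z.

Lemma fsum_refine l (F : 'M[int]_(p, q) -> R) : fsupp setT F ->
  \sum_(z \in setT) F z =
  \sum_a \sum_(z \in setT) F ((l.+1%:Z) *: z + @zof l a).
Proof.
move=> hF; rewrite (@fsum_fiber _ _ _ _ setT (@zres l))//.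
rewrite (fsbigE (index_enum {ffun 'I_p * 'I_q -> 'I_l.+1})); last 3 first.
- exact: index_enum_uniq.
- by [].
- by move=> a _; rewrite mem_index_enum.
rewrite (eq_bigl xpredT); last by move=> a; rewrite mem_set.
apply: eq_bigr => a _.
apply: reindex_fsbig; split.
- move=> z _ /=; split => //; apply/ffunP => -[i j]; rewrite ffunE/= !mxE.
  rewrite mulrC modzMDl; apply: val_inj; rewrite /= modz_small; last first.
    by rewrite lez_nat/= ltz_nat.
  by rewrite absz_nat inordK.
- move=> z1 z2 _ _ /addIr h; apply/matrixP => i j.
  by have /matrixP/(_ i j) := h; rewrite !mxE => /mulfI; apply.
- move=> z /= [_ /ffunP h]; exists (\matrix_(i, j) (z i j %/ l.+1)%Z) => //.
  apply/matrixP => i j; rewrite !mxE [RHS](divz_eq _ l.+1%:Z) mulrC; congr (_ + _).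
  have := h (i, j); rewrite ffunE/= => <-; rewrite inordK.
    by rewrite gez0_abs// modz_ge0.
  by rewrite -ltz_nat gez0_abs ?modz_ge0// ltz_pmod.
Qed.

(** The grid of mesh 1/((j+1)(l+1)) is the union of (l+1)^N translates of the grid of mesh 1/(j+1),
    by vectors of norm at most N/(j+1). The fine sum is thus an average of shifted coarse sums. *)
Lemma Riem_refine j l f (e r : R) : 0 <= r -> Cc f -> (forall x, r < nm x -> f x = 0) ->
  (forall x y : V, dst x y <= N%:R / j.+1%:R -> `|f x - f y| <= e) ->
  `|Riem (j.+1 * l.+1).-1 f - Riem j f| <= e * (2 * (r + N%:R) + 3) ^+ N.
Proof.
move=> r0 hf hr he.
have j0 : 0 < j.+1%:R :> R by rewrite ltr0n.
have l0 : 0 < l.+1%:R :> R by rewrite ltr0n.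
have jlE : (j.+1 * l.+1).-1.+1 = (j.+1 * l.+1)%N by rewrite prednK// muln_gt0.
have e0 : 0 <= e.
  by have := he 0 0; rewrite dst_xx subrr normr0; apply; rewrite divr_ge0.
pose sh (a : {ffun 'I_p * 'I_q -> 'I_l.+1}) : 'M[R]_(p, q) := (j.+1%:R * l.+1%:R)^-1 *: zr (zof a).
have nsh a : nrm (sh a) <= N%:R / j.+1%:R.
  apply: nrm_le => i i'; rewrite !mxE ger0_norm ?mulr_ge0 ?invr_ge0 ?mulr_ge0//.
  rewrite invfM -mulrA ler_piMr ?invr_ge0// mulrC ler_pdivrMr// mul1r.
  by rewrite -[_%:~R]/(_%:R) ler_nat ltnW.
have Csh a : Cc (fun x : V => f (x + sh a)).
  apply: Cc_comp hf; first by apply: lc_addmx; [exact: lc_id|exact: lc_cst].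
  move=> r'; exists (r' + nrm (sh a)) => x /= xr.
  by rewrite -[x](addrK (sh a)); apply: le_trans (nrmD _ _) _; rewrite nrmN lerD2r.
have E : Riem (j.+1 * l.+1).-1 f =
    (l.+1%:R^-1) ^+ N * \sum_a Riem j (fun x => f (x + sh a)).
  rewrite /Riem jlE natrM invfM exprMn -mulr_sumr [_ ^+ N * _ ^+ N]mulrC -mulrA.
  congr (_ * (_ * _)); rewrite (@fsum_refine l); last first.
    by apply: (@fsupp_zr (j.+1%:R^-1 * l.+1%:R^-1)) => //; rewrite mulf_neq0// jn0.
  apply: eq_bigr => a _; apply: eq_fsbigr => z _; congr f.
  rewrite zrD scalerDr /sh invfM; congr (_ + _).
  rewrite /zr map_mxZ/= scalerA -mulrA mulVf ?mulr1// gt_eqF//.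
have cN : #|{ffun 'I_p * 'I_q -> 'I_l.+1}| = (l.+1 ^ N)%N.
  by rewrite card_ffun card_ord card_prod !card_ord.
have E2 : Riem j f = (l.+1%:R^-1) ^+ N * \sum_(a : {ffun 'I_p * 'I_q -> 'I_l.+1}) Riem j f.
  rewrite sumr_const cN -[Riem j f *+ _]mulr_natl natrX mulrA -exprMn mulVf ?expr1n ?mul1r//.
rewrite E [in X in _ - X]E2 -mulrBr -sumrB normrM ger0_norm ?exprn_ge0 ?invr_ge0//.
rewrite -ler_pdivlMl ?exprn_gt0 ?invr_gt0//.
apply: le_trans (ler_norm_sum _ _ _) _.
apply: (@le_trans _ _ (\sum_(a : {ffun 'I_p * 'I_q -> 'I_l.+1}) e * (2 * (r + N%:R) + 3) ^+ N)).
  apply: ler_sum => a _; rewrite -(PFB (Riem_PF j))//.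
  have rN : 0 <= r + N%:R by rewrite addr_ge0.
  apply: le_trans (_ : e * Riem j (cutoff (r + N%:R)) <= _); last first.
    by rewrite ler_wpM2l// Riem_cutoff.
  apply: (PF_bound (Riem_PF j)); first exact: CcB.
  - move=> x xr; rewrite !hr ?subrr//; first by rewrite (le_lt_trans _ xr)// lerDl.
    have := nm_lip (x : V) (x + sh a); rewrite /dst/= opprD addNKr nrmN.
    have jle : N%:R / j.+1%:R <= N%:R :> R by rewrite ler_pdivrMr// ler_peMr// ler1n.
    have xr' : r + N%:R < nrm x := xr.
    by move: xr' (le_trans (nsh a) jle); clear; move: (N%:R : R) => nN; lra.
  - by move=> x; apply: he; rewrite /dst/= addrAC subrr add0r.
by rewrite sumr_const cN -[X in X <= _]mulr_natl natrX exprVn invrK.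
Qed.

(** Two meshes are compared through their common refinement. *)
Lemma Riem_cauchy f : Cc f -> forall e : R, 0 < e -> exists J, forall i j,
  (J <= i)%N -> (J <= j)%N -> `|Riem i f - Riem j f| <= e.
Proof.
move=> hf e e0; have [_ [r0 hr0]] := hf.
pose r := Num.max 0 r0.
have r_ge0 : 0 <= r by rewrite le_max lexx.
have hr x : r < nm x -> f x = 0 by rewrite gt_max => /andP[_ /hr0].
have c0 : 0 < (2 * (r + N%:R) + 3) ^+ N :> R.
  by rewrite exprn_gt0// ltr_wpDl// mulr_ge0// addr_ge0.
set c := (_ ^+ N) in c0; pose e1 := e / (2 * c).
have e10 : 0 < e1 by rewrite divr_gt0// mulr_gt0.
have [d d0 hd] := Cc_uc hf e10.
exists (Num.trunc (N%:R / d)).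
have key j : (Num.trunc (N%:R / d) <= j)%N -> forall l, `|Riem (j.+1 * l.+1).-1 f - Riem j f| <= e / 2.
  move=> Jj l; rewrite (_ : e / 2 = e1 * c); last first.
    by rewrite /e1 invfM !mulrA mulfVK// gt_eqF.
  apply: Riem_refine => // x y xy; apply/ltW/hd; apply: le_lt_trans xy _.
  rewrite ltr_pdivrMr ?ltr0n// mulrC -ltr_pdivrMr//.
  by apply: lt_le_trans (truncnS_gt _) _; rewrite ler_nat ltnS.
move=> i j Ji Jj.
have := key i Ji j; have := key j Jj i; rewrite mulnC.
set a := Riem _ f => h1 h2.
by have := ler_distD a (Riem i f) (Riem j f); rewrite (distrC (Riem i f) a); lra.
Qed.

(** The Lebesgue integral on p by q matrices. Riemann sums are exactly invariant under grid
    translations and compatible with integral dilations; general translations and dilations follow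
    by approximation. *)
Definition Iv (f : V -> R) : R := lim (Riem ^~ f @ \oo).

Lemma Iv_lim f : Cc f -> forall e : R, 0 < e -> exists J, forall j, (J <= j)%N ->
  `|Riem j f - Iv f| <= e.
Proof.
move=> hf.
have : cvg (Riem ^~ f @ \oo).
  apply/cauchy_cvgP; apply: cauchy_exP => e e0.
  have e2 : 0 < e / 2 by rewrite divr_gt0.
  have [J hJ] := Riem_cauchy hf e2.
  exists (Riem J f); exists J => // j /= Jj; rewrite /ball/=.
  by apply: le_lt_trans (hJ J j (leqnn _) Jj) _; lra.
move=> /cvgrPdist_le h e e0; have [J _ hJ] := h e e0.
by exists J => j Jj; rewrite distrC; apply: hJ.
Qed.

Lemma Iv_uniq f l : Cc f ->
  (forall e : R, 0 < e -> forall J, exists2 j, (J <= j)%N & `|Riem j f - l| <= e) -> Iv f = l.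
Proof.
move=> hf hl; apply: eq_eps => e e0; have e2 : 0 < e / 2 by rewrite divr_gt0.
have [J hJ] := Iv_lim hf e2; have [j Jj h] := hl _ e2 J.
have := ler_distD (Riem j f) (Iv f) l; rewrite (distrC (Iv f) (Riem j f)).
by have := hJ j Jj; lra.
Qed.

Lemma Iv_PF : PF Iv.
Proof.
split=> [c f g hf hg|f hf f0]; last first.
  apply/ler_addgt0Pr => e e0; have [J /(_ _ (leqnn J))] := Iv_lim hf e0.
  by have := (Riem_PF J).2 f hf f0; rewrite ler_norml; lra.
apply: Iv_uniq; first by apply: CcD => //; exact: CcZ.
move=> e e0 J; have c0 : 0 < 2 * (`|c| + 1) by rewrite mulr_gt0// ltr_wpDl.
have e1 : 0 < e / (2 * (`|c| + 1)) by rewrite divr_gt0.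
have [J1 h1] := Iv_lim hf e1; have [J2 h2] := Iv_lim hg e1.
exists (maxn J (maxn J1 J2)); first exact: leq_maxl.
set j := maxn _ _.
rewrite (Riem_PF j).1// opprD addrACA -mulrBr; apply: le_trans (ler_normD _ _) _.
rewrite normrM.
have := h1 j _; rewrite /j !leq_max leqnn orbT/= -/j => /(_ isT) A.
have := h2 j _; rewrite /j !leq_max leqnn !orbT/= -/j => /(_ isT) B.
have : `|c| * `|Riem j f - Iv f| <= `|c| * (e / (2 * (`|c| + 1))) by rewrite ler_wpM2l.
have E : e = 2 * (`|c| + 1) * (e / (2 * (`|c| + 1))) by rewrite mulrC divfK// gt_eqF.
move: A B e1 E; set t := e / _ => A B e1 E.
by have := normr_ge0 c; nra.
Qed.

Lemma Cc_shift f (a : V) : Cc f -> Cc (fun x : V => f (x + a)).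
Proof.
apply: Cc_comp; first by apply: lc_addmx; [exact: lc_id|exact: lc_cst].
move=> r'; exists (r' + nrm a) => x /= xr.
by rewrite -[x](addrK a); apply: le_trans (nrmD _ _) _; rewrite nrmN lerD2r.
Qed.

Lemma Cc_dil f (s : R) : s != 0 -> Cc f -> Cc (fun x : V => f (s *: x)).
Proof.
move=> s0; apply: Cc_comp; first by apply: lc_scalemx; [exact: lc_cst|exact: lc_id].
move=> r; exists (r / `|s|) => x /=.
by rewrite nrmZ mulrC -ler_pdivlMr// normr_gt0.
Qed.

Lemma Riem_shift j f (a : 'M[int]_(p, q)) :
  Riem j (fun x => f (x + j.+1%:R^-1 *: zr a)) = Riem j f.
Proof.
rewrite /Riem; congr (_ * _).
rewrite [RHS](reindex_fsbigT (fun z => z + a)); last first.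
  by exists (fun z => z - a) => z; rewrite ?addrK ?subrK.
by apply: eq_fsbigr => z _; rewrite zrD scalerDr.
Qed.

Lemma Iv_shift f a : Cc f -> Iv (fun x => f (x + a)) = Iv f.
Proof.
move=> hf; have hfa := Cc_shift a hf.
have [_ [r0 hr0]] := hf; pose r := Num.max 0 r0 + nrm a + N%:R.
have r_ge0 : 0 <= r by rewrite !addr_ge0 ?nrm_ge0// le_max lexx.
apply: Iv_uniq => // e e0 J; have e2 : 0 < e / 2 by rewrite divr_gt0.
have [J1 h1] := Iv_lim hf e2.
have c0 : 0 < (2 * r + 3) ^+ N by rewrite exprn_gt0// ltr_wpDl// mulr_ge0.
have [d d0 hd] := Cc_uc hf (divr_gt0 e2 c0).
pose j := maxn J (maxn J1 (Num.trunc (N%:R / d))).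
have j0 : 0 < j.+1%:R :> R by rewrite ltr0n.
exists j; first exact: leq_maxl.
(* The translation is rounded down to the grid, where the Riemann sum is exactly invariant. *)
pose z : 'M[int]_(p, q) := \matrix_(i, i') Num.floor (j.+1%:R * a i i').
have za : nrm (a - j.+1%:R^-1 *: zr z) <= N%:R / j.+1%:R.
  apply: nrm_le => i i'; rewrite !mxE.
  have := ge_floor (j.+1%:R * a i i'); have := lt_succ_floor (j.+1%:R * a i i').
  set fl := Num.floor _; rewrite intrD => A B.
  have -> : a i i' - j.+1%:R^-1 * fl%:~R = (j.+1%:R * a i i' - fl%:~R) / j.+1%:R.
    by field; rewrite gt_eqF.
  rewrite normf_div (gtr0_norm j0) ler_pdivrMr// mulVf ?gt_eqF//.
  by rewrite ger0_norm ?subr_ge0//; lra.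
have N1 : N%:R / j.+1%:R <= N%:R :> R by rewrite ler_pdivrMr// ler_peMr// ler1n.
have zd : N%:R / j.+1%:R < d.
  rewrite ltr_pdivrMr// mulrC -ltr_pdivrMr//.
  by apply: lt_le_trans (truncnS_gt _) _; rewrite ler_nat ltnS !leq_max leqnn !orbT.
have hz := Cc_shift (j.+1%:R^-1 *: zr z) hf.
have D : `|Riem j (fun x => f (x + a)) - Riem j f| <= e / 2.
  rewrite -(Riem_shift j f z) -(PFB (Riem_PF j))//.
  apply: (@le_trans _ _ (e / 2 / (2 * r + 3) ^+ N * Riem j (cutoff r))); last first.
    by rewrite mulrAC ler_pdivrMr// ler_pM2l// Riem_cutoff.
  apply: (PF_bound (Riem_PF j)); first exact: CcB.
    move=> x xr; rewrite !hr0 ?subrr//.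
      have := nm_lip (x : V) (x + j.+1%:R^-1 *: zr z).
      rewrite /dst/= opprD addNKr nrmN.
      have := nrmD (a - j.+1%:R^-1 *: zr z) (- a); rewrite addrAC subrr add0r !nrmN.
      have : r0 <= Num.max 0 r0 by rewrite le_max lexx orbT.
      have xr' : Num.max 0 r0 + nrm a + N%:R < nrm x := xr.
      by move: xr' (le_trans za N1); clear; move: (N%:R : R) => nN; lra.
    have := nm_lip (x : V) (x + a); rewrite /dst/= opprD addNKr nrmN.
    have : r0 <= Num.max 0 r0 by rewrite le_max lexx orbT.
    have : 0 <= N%:R :> R by [].
    have xr' : Num.max 0 r0 + nrm a + N%:R < nrm x := xr.
    by move: xr'; clear; rewrite /=; lra.
  move=> x; apply/ltW/hd; rewrite /dst/= opprD addrACA subrr add0r.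
  exact: le_lt_trans za zd.
have := ler_distD (Riem j f) (Riem j (fun x => f (x + a))) (Iv f).
have := h1 j _; rewrite /j !leq_max leqnn orbT/= -/j => /(_ isT).
by lra.
Qed.

Lemma Iv_dil_nat f l : Cc f -> Iv (fun x => f (l.+1%:R^-1 *: x)) = l.+1%:R ^+ N * Iv f.
Proof.
move=> hf; have hfl := Cc_dil (jn0 l) hf.
apply: Iv_uniq => // e e0 J.
have c0 : 0 < l.+1%:R ^+ N :> R by rewrite exprn_gt0// ltr0n.
have [J1 h1] := Iv_lim hf (divr_gt0 e0 c0).
exists (maxn J J1); first exact: leq_maxl.
set j := maxn J J1.
have -> : Riem j (fun x => f (l.+1%:R^-1 *: x)) = l.+1%:R ^+ N * Riem (j.+1 * l.+1).-1 f.
  rewrite /Riem prednK ?muln_gt0// natrM invfM exprMn.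
  rewrite (eq_fsbigr (fun z => f ((j.+1%:R^-1 / l.+1%:R) *: zr z))); last first.
    by move=> z _; rewrite scalerA mulrC.
  have L : l.+1%:R ^+ N * l.+1%:R^-1 ^+ N = 1 :> R by rewrite -exprMn mulfV ?expr1n// pnatr_eq0.
  by rewrite mulrA (mulrCA (l.+1%:R ^+ N)) L mulr1.
rewrite -mulrBr normrM gtr0_norm// -ler_pdivlMl// mulrC; apply: h1.
rewrite -ltnS prednK ?muln_gt0// (leq_trans (n := j.+1))//; first by rewrite ltnS leq_maxr.
by rewrite leq_pmulr.
Qed.

(** Natural dilations give rational ratios exactly; a real ratio is approximated by rationals from
    above. *)
Lemma Iv_dil f (s : R) : 0 < s -> Cc f -> Iv (fun x => f (s *: x)) = s^-1 ^+ N * Iv f.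
Proof.
move=> s0 hf.
have rat a b : Iv (fun x => f ((a.+1%:R / b.+1%:R) *: x)) = (a.+1%:R / b.+1%:R)^-1 ^+ N * Iv f.
  have a0 : a.+1%:R != 0 :> R by rewrite pnatr_eq0.
  have ha := Cc_dil a0 hf.
  have := Iv_dil_nat b ha; have := Iv_dil_nat a ha.
  under [X in Iv X]eq_fun do rewrite scalerA mulfV// scale1r.
  move=> E1; under [X in Iv X]eq_fun do rewrite scalerA.
  move=> ->; rewrite E1 invf_div mulrA -exprMn divfK//.
have [_ [r0 hr0]] := hf.
pose r := `|r0| / s.
have r_ge0 : 0 <= r by rewrite divr_ge0// ltW.
apply: eq_eps => e e0.
have c0 : 0 < Iv (cutoff r) + 1 by rewrite ltr_wpDl// (PF_cutoff_ge0 Iv_PF).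
have e2 : 0 < e / 2 by rewrite divr_gt0.
have [d d0 hd] := Cc_uc hf (divr_gt0 e2 c0).
(* The truncation at [s] makes x^-N uniformly continuous on balls of the whole line; it is harmless
   since the approximating ratios are at least [s]. *)
pose F (x : rspace R) : rspace R := \prod_(i <- iota 0 N) (Num.max s x)^-1.
have lF : lc F.
  apply: lc_prod => i; apply: (@lcV _ _ s) => // [x|]; first by rewrite le_max lexx.
  by apply: lc_max; [exact: lc_cst|exact: lc_id].
have FE x : s <= x -> F x = x^-1 ^+ N.
  move=> sx; rewrite /F big_const_seq count_predT size_iota iter_mulr_1.
  by rewrite max_r.
have i0 : 0 < `|Iv f| + 1 by rewrite ltr_wpDl.
have [_ /(_ _ (divr_gt0 e2 i0))[d1 d10 hd1]] := lF (s + 1).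
pose del := Num.min 1 (Num.min d1 (d / (r + 1))).
have r1 : 0 < r + 1 by rewrite ltr_wpDl.
have del0 : 0 < del by rewrite !lt_min ltr01 d10 divr_gt0.
pose b := Num.trunc del^-1.
have b0 : 0 < b.+1%:R :> R by rewrite ltr0n.
have bd : b.+1%:R^-1 < del.
  by rewrite -[ltRHS]invrK ltf_pV2 ?posrE ?invr_gt0//; exact: truncnS_gt.
pose a := Num.trunc (s * b.+1%:R).
have sb : 0 <= s * b.+1%:R by rewrite mulr_ge0 ?ltW.
have /andP[a1 a2] := truncn_itv sb; rewrite -/a in a1 a2.
pose s' : R := a.+1%:R / b.+1%:R.
have ss' : s <= s' by rewrite ler_pdivlMr// ltW.
have s'd : s' - s < del.
  apply: le_lt_trans bd; rewrite lerBlDr ler_pdivrMr// mulrDl mulVf ?gt_eqF// -natr1.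
  by rewrite addrC lerD2l.
have s'0 : 0 < s' by exact: lt_le_trans ss'.
have A : `|Iv (fun x => f (s *: x)) - Iv (fun x => f (s' *: x))| <= e / 2.
  have Cs : Cc (fun x : V => f (s *: x)) by apply: Cc_dil; rewrite ?gt_eqF.
  have Cs' : Cc (fun x : V => f (s' *: x)) by apply: Cc_dil; rewrite ?gt_eqF.
  rewrite -(PFB Iv_PF)//.
  apply: (@le_trans _ _ (e / 2 / (Iv (cutoff r) + 1) * Iv (cutoff r))); last first.
    by rewrite mulrAC ler_pdivrMr// ler_pM2l// lerDl.
  have big x : r < nm (x : V) -> forall t, s <= t -> f (t *: x) = 0.
    move=> xr t st; apply: hr0; rewrite /= nrmZ (ger0_norm (le_trans (ltW s0) st)).
    apply: le_lt_trans (ler_norm _) _; move: xr; rewrite /r ltr_pdivrMr//= => xr.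
    by apply: lt_le_trans xr _; rewrite mulrC ler_wpM2r// nrm_ge0.
  apply: (PF_bound Iv_PF); first exact: CcB.
    by move=> x xr; rewrite !big// subrr.
  move=> x; have [xr|xr] := leP (nm (x : V)) r; last first.
    by rewrite !big// subrr normr0 divr_ge0// ltW.
  apply/ltW/hd; rewrite /dst/= -scalerBl nrmZ distrC ger0_norm ?subr_ge0//.
  apply: (@le_lt_trans _ _ ((s' - s) * r)).
    by rewrite ler_wpM2l// subr_ge0.
  apply: (@le_lt_trans _ _ (del * r)); first by rewrite ler_wpM2r// ltW.
  apply: (@lt_le_trans _ _ (del * (r + 1))); first by rewrite ltr_pM2l// ltrDl.
  by rewrite -ler_pdivlMr// !ge_min lexx !orbT.
have B : `|Iv (fun x => f (s' *: x)) - s^-1 ^+ N * Iv f| <= e / 2.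
  rewrite /s' rat -/s' -mulrBl normrM.
  apply: (@le_trans _ _ (e / 2 / (`|Iv f| + 1) * `|Iv f|)); last first.
    by rewrite mulrAC ler_pdivrMr// ler_pM2l// lerDl.
  rewrite ler_wpM2r// -!FE//; apply/ltW/hd1.
  - rewrite /= ger0_norm; last exact: ltW.
    by move: s'd; rewrite !lt_min => /andP[]; lra.
  - by rewrite /= ger0_norm ?lerDl// ltW.
  - rewrite /dst/= ger0_norm ?subr_ge0//.
    by move: s'd; rewrite !lt_min => /andP[_ /andP[]].
by have := ler_distD (Iv (fun x => f (s' *: x))) (Iv (fun x => f (s *: x))) (s^-1 ^+ N * Iv f); lra.
Qed.

(* N is the l^1-norm of the all-one matrix: the unit cube lies in the ball of radius N. *)
Lemma Iv_cutoff_ge1 : 1 <= Iv (cutoff N%:R).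
Proof.
apply/ler_addgt0Pr => e e0; have [J /(_ _ (leqnn J))] := Iv_lim (Cc_cutoff V N%:R) e0.
suff : 1 <= Riem J (cutoff N%:R) by rewrite ler_norml; lra.
have J0 : 0 < J.+1%:R :> R by rewrite ltr0n.
rewrite /Riem exprVn ler_pdivlMl ?exprn_gt0// mulr1.
have hfin := fsupp_zr (jn0 J) (Cc_cutoff V N%:R).
rewrite (@fsum_refine J)//.
apply: (@le_trans _ _ (\sum_(a : {ffun 'I_p * 'I_q -> 'I_J.+1}) 1)).
  by rewrite sumr_const card_ffun card_ord card_prod !card_ord natrX.
apply: ler_sum => a _.
pose sh : 'M[R]_(p, q) := J.+1%:R^-1 *: zr (zof a).
have E z : J.+1%:R^-1 *: zr (J.+1%:Z *: z + zof a) = 1 *: zr z + sh.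
  rewrite zrD scalerDr /zr map_mxZ/= scalerA -[(_%:~R)]/(J.+1%:R) mulVf ?gt_eqF//.
have hs := fsupp_zr (oner_neq0 R) (Cc_shift sh (Cc_cutoff V N%:R)).
rewrite (eq_fsbigr (fun z => cutoff N%:R (1 *: zr z + sh))); last by move=> z _; rewrite E.
apply: (@le_trans _ _ (cutoff N%:R (1 *: zr 0 + sh))); last first.
  by apply: (@fsum_ge_term _ _ _ (fun z => cutoff N%:R (1 *: zr z + sh))) => // z _; exact: cutoff_ge0.
rewrite cutoff1//= /zr map_mx0 scaler0 add0r.
have -> : N%:R = N%:R * 1 :> R by rewrite mulr1.
apply: nrm_le => i j; rewrite !mxE ger0_norm ?mulr_ge0 ?invr_ge0//.
by rewrite mulrC ler_pdivrMr// mul1r -[_%:~R]/(_%:R) ler_nat ltnW.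
Qed.

End RiemannFunctional.

(** * Uniqueness of invariant functionals *)

Section Haar.
Variables (R : realType) (n : nat).
Local Notation G := (slT R n).
Local Notation gs := (slspace R n).

Lemma dst1_nm (d : R) : exists2 b : R, 0 < b & forall g : gs, dst g 1%g < d -> nm (g^-1)%g <= b.
Proof.
have [b b0 hb] := @nmV_bound R n (nm (1%g : gs) + d); exists b => // g gd.
by apply: hb; have := nm_lip g (1%g : gs); lra.
Qed.

(** Besides uniform continuity this bounds the support of the difference: for g near 1, both w h and
    w (g h) vanish once nm h exceeds r, and r is chosen before e. *)
Lemma uc_left (w : gs -> R) : Cc w -> exists r : R, forall e : R, 0 < e ->
  exists2 d : R, 0 < d & forall g h : gs, dst g 1%g < d -> `|w (g * h)%g - w h| <= e * cutoff r h.
Proof.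
move=> hw; have [_ [r0 hr0]] := hw; have [b b0 hb] := dst1_nm 1.
pose r := b * `|r0| + `|r0| + 1.
have br0 : 0 <= b * `|r0| by rewrite mulr_ge0// ltW.
have r00 := normr_ge0 r0; have rr0 := ler_norm r0.
have rp : 0 < r by rewrite /r; lra.
exists r => e e0; have [d0 d00 hd] := Cc_uc hw e0.
exists (Num.min 1 (d0 / r)); first by rewrite lt_min ltr01 divr_gt0.
move=> g h; rewrite lt_min => /andP[g1 gd].
have [hr|hr] := leP (nm h) r.
  rewrite cutoff1// mulr1; apply/ltW/hd.
  have := dstMr h g 1%g; rewrite mul1g => /le_lt_trans; apply.
  move: gd; rewrite ltr_pdivlMr// => gd; apply: le_lt_trans gd.
  by rewrite ler_wpM2l// dst_ge0.
have -> : w h = 0 by apply: hr0; move: hr; rewrite /r; lra.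
have -> : w (g * h)%g = 0.
  apply: hr0; rewrite ltNge; apply/negP => h1.
  have := nmM (g^-1)%g (g * h)%g; rewrite mulKg => h2.
  have h3 : nm (g^-1)%g * nm (g * h)%g <= b * `|r0|.
    apply: ler_pM; rewrite ?nm_ge0//; first exact: hb.
    exact: le_trans h1 (ler_norm _).
  by move: hr; rewrite /r; lra.
by rewrite subrr normr0 mulr_ge0 ?cutoff_ge0// ltW.
Qed.

Lemma uc_right (w : gs -> R) : Cc w -> exists r : R, forall e : R, 0 < e ->
  exists2 d : R, 0 < d & forall g h : gs, dst g 1%g < d -> `|w (h * g)%g - w h| <= e * cutoff r h.
Proof.
move=> hw; have [_ [r0 hr0]] := hw; have [b b0 hb] := dst1_nm 1.
pose r := b * `|r0| + `|r0| + 1.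
have br0 : 0 <= b * `|r0| by rewrite mulr_ge0// ltW.
have r00 := normr_ge0 r0; have rr0 := ler_norm r0.
have rp : 0 < r by rewrite /r; lra.
exists r => e e0; have [d0 d00 hd] := Cc_uc hw e0.
exists (Num.min 1 (d0 / r)); first by rewrite lt_min ltr01 divr_gt0.
move=> g h; rewrite lt_min => /andP[g1 gd].
have [hr|hr] := leP (nm h) r.
  rewrite cutoff1// mulr1; apply/ltW/hd.
  have := dstMl h g 1%g; rewrite mulg1 => /le_lt_trans; apply.
  move: gd; rewrite ltr_pdivlMr// => gd; apply: le_lt_trans gd.
  by rewrite mulrC ler_wpM2l// dst_ge0.
have -> : w h = 0 by apply: hr0; move: hr; rewrite /r; lra.
have -> : w (h * g)%g = 0.
  apply: hr0; rewrite ltNge; apply/negP => h1.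
  have := nmM (h * g)%g (g^-1)%g; rewrite mulgK => h2.
  have h3 : nm (h * g)%g * nm (g^-1)%g <= b * `|r0|.
    rewrite mulrC; apply: ler_pM; rewrite ?nm_ge0//; first exact: hb.
    exact: le_trans h1 (ler_norm _).
  by move: hr; rewrite /r; lra.
by rewrite subrr normr0 mulr_ge0 ?cutoff_ge0// ltW.
Qed.

Definition rinv (L : (gs -> R) -> R) := forall a w, Cc w -> L (tr a w) = L w.

Variable J : (gs -> R) -> R.
Hypotheses (hJ : PF J) (Jr : rinv J).
Hypothesis Jnz : exists2 w, Cc w & J w != 0.

(** The support of any f in [Cc] is covered by finitely many right translates of {w > w g0 / 2}, so
    J w = 0 would force J f = 0 for every f. *)
Lemma J_gt0 (w : gs -> R) g0 : Cc w -> (forall g, 0 <= w g) -> 0 < w g0 -> 0 < J w.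
Proof.
move=> hw w0 wg0; rewrite lt_neqAle hJ.2// andbT eq_sym; apply/negP => /eqP Jw0.
have [f hf /eqP] := Jnz; apply; apply/eqP; rewrite -normr_le0.
have [_ [r hr]] := hf; have [b b0 hb] := Cc_bd hf.
have w2 : 0 < w g0 / 2 by rewrite divr_gt0.
have [d d0 hd] := Cc_uc hw w2.
have [B B0 hB] := @nmV_bound R n (r + 1).
pose c := B * nm g0 + 1.
have c0 : 0 < c by rewrite ltr_wpDl// mulr_ge0 ?nm_ge0// ltW.
have d'0 : 0 < Num.min 1 (d / c) by rewrite lt_min ltr01 divr_gt0.
have [I [a ha]] := nm_net gs r d'0.
have Ct i : Cc (tr ((a i)^-1 * g0)%g w) by exact: Cc_tr.
apply: (@le_trans _ _ (J (fun x => b / (w g0 / 2) * \sum_i tr ((a i)^-1 * g0)%g w x))); last first.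
  rewrite PFZ//; last exact: Cc_sum.
  by rewrite PFsum// big1 ?mulr0// => i _; rewrite Jr.
apply: (PFabs hJ) => //; first by apply: CcZ; exact: Cc_sum.
move=> x; have S0 : 0 <= \sum_i tr ((a i)^-1 * g0)%g w x by apply: sumr_ge0 => i _; exact: w0.
have [xr|xr] := leP (nm x) r; last first.
  by rewrite hr// normr0 mulr_ge0// divr_ge0// ltW.
have [i] := ha x xr; rewrite lt_min => /andP[x1 xd].
apply: le_trans (hb x) _; rewrite -mulrA ler_peMr// mulrC ler_pdivlMr// mul1r.
apply: (@le_trans _ _ (tr ((a i)^-1 * g0)%g w x)); last first.
  by rewrite (bigD1 i)//= lerDl sumr_ge0// => i' _; exact: w0.
have : `|w (x * ((a i)^-1 * g0))%g - w g0| < w g0 / 2.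
  apply: hd; rewrite -[X in dst _ X](mulVKg (a i)).
  apply: le_lt_trans (dstMr _ _ _) _.
  have nai : nm ((a i)^-1 * g0)%g <= B * nm g0.
    apply: le_trans (nmM _ _) _; rewrite ler_wpM2r ?nm_ge0//; apply: hB.
    by have := nm_lip (a i) x; rewrite dst_sym; lra.
  apply: (@le_lt_trans _ _ (dst x (a i) * (B * nm g0))).
    by rewrite ler_wpM2l// dst_ge0.
  move: xd; rewrite ltr_pdivlMr// => xd; apply: le_lt_trans xd.
  by rewrite ler_wpM2l ?dst_ge0// lerDl.
by rewrite /tr ltr_norml => /andP[]; lra.
Qed.

Definition kap (d : R) (g : gs) : R := Num.max 0 (d - dst g 1%g).

Lemma Cc_kap d : Cc (kap d).
Proof.
split; first by apply: lc_max; [exact: lc_cst|apply: lcB; [exact: lc_cst|exact: lc_dst]].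
exists (nm (1%g : gs) + d) => g gd; rewrite /kap max_l//.
by have := nm_lip g (1%g : gs); lra.
Qed.

Lemma kap_ge0 d g : 0 <= kap d g. Proof. by rewrite le_max lexx. Qed.

Lemma kap_dst d g : kap d g != 0 -> dst g 1%g < d.
Proof. by apply: contraNlt => h; rewrite /kap max_l// subr_le0. Qed.

(** The double integral of psi(g) kap(g h^-1) in two orders: over h first it splits exactly; after
    the substitution of g h for g it is L(kap) J(psi) up to the oscillation of psi near each h. *)
Lemma haar_kernel (L : (gs -> R) -> R) (psi : gs -> R) (e : R) : PF L -> rinv L -> Cc psi -> 0 < e ->
  exists2 d0 : R, 0 < d0 & forall d, 0 < d -> d <= d0 ->
  `|J (fun h => kap d (h^-1)%g) * L psi - L (kap d) * J psi| <= e * L (kap d).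
Proof.
move=> hL Lr hpsi e0.
have [rr hrr] := uc_left hpsi.
have [_ [r0 hr0]] := hpsi.
have J10 : 0 < J (cutoff rr) + 1 by rewrite ltr_wpDl// PF_cutoff_ge0.
set J1 := J (cutoff rr) + 1 in J10.
have [d2 d20 h2] := hrr _ (divr_gt0 e0 J10).
exists d2 => //.
move=> d d0 dle2.
have Ck := Cc_kap d.
have Lk0 : 0 <= L (kap d) by apply: hL.2 => // g; exact: kap_ge0.
pose K (g h : gs) := psi g * kap d (g * h^-1)%g.
have CK : Cc (fun z : prodspace gs gs => K z.1 z.2).
  have [lk [rk hrk]] := Ck; have [lp _] := hpsi; split.
    apply: lcM; first exact: (lc_comp lp (@lc_fst _ _ _)).
    apply: (lc_comp lk); apply: lc_mulg; first exact: lc_fst.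
    exact/lc_invg/lc_snd.
  have [B B0 hB] := @nmV_bound R n rk.
  exists (Num.max `|r0| (B * `|r0|)) => -[g h] /=; rewrite lt_max => gh.
  have [gr|gr] := leP (nm g) r0; last by rewrite /K hr0// mul0r.
  rewrite /K; have [hk|hk] := leP (nm (g * h^-1)%g) rk; last by rewrite hrk// mulr0.
  exfalso; have := nmM ((g * h^-1)^-1)%g g.
  rewrite invgM invgK mulgVK => h3.
  have gr' := le_trans gr (ler_norm r0).
  have h4 : nm ((g * h^-1)^-1)%g * nm g <= B * `|r0|.
    by apply: ler_pM; rewrite ?nm_ge0//; exact: hB.
  rewrite invgM invgK in h4.
  have M1 : `|r0| <= Num.max `|r0| (B * `|r0|) by rewrite le_max lexx.
  have M2 : B * `|r0| <= Num.max `|r0| (B * `|r0|) by rewrite le_max lexx orbT.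
  by move: gh => /orP[]; rewrite ?/nm/= in h3 h4 gr' *; move=> gh; lra.
have E1 : J (fun h => kap d (h^-1)%g) * L psi = L (fun g => J (K g)).
  rewrite -(PFZ hL)//; congr L; apply/funext => g.
  rewrite /K (PFZ hJ); last first.
    apply: (@Cc_inv _ _ (fun x => kap d (g * x)%g)); exact: (Cc_tl g Ck).
  rewrite mulrC; congr (_ * _).
  rewrite -[LHS](Jr (g^-1)%g); last exact: Cc_inv.
  by congr J; apply/funext => h; rewrite /tr invgM invgK.
have E2 : L (fun g => J (K g)) = J (fun h => L (fun g => psi (g * h)%g * kap d g)).
  rewrite (PF_fubini CK hL hJ); congr J; apply/funext => h.
  rewrite -[RHS](Lr (h^-1)%g); last by apply: CcM => //; apply: Cc_lc; exact: Cc_tr.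
  by congr L; apply/funext => g; rewrite /tr /K mulgVK.
have CL : Cc (fun h => L (fun g => psi (g * h)%g * kap d g)).
  have -> : (fun h => L (fun g => psi (g * h)%g * kap d g)) = (fun h => L (K ^~ h)).
    apply/funext => h; rewrite -[LHS](Lr (h^-1)%g); last by apply: CcM => //; apply: Cc_lc; exact: Cc_tr.
    by congr L; apply/funext => g; rewrite /tr /K mulgVK.
  exact: (@Cc2_int_r _ gs gs (fun h g => K g h) (Cc2_swap CK) _ hL).
rewrite E1 E2 -(PFZ hJ)// -(PFB hJ)//; last exact: CcZ.
have bnd g h : kap d g != 0 -> `|psi (g * h)%g - psi h| <= e / J1 * cutoff rr h.
  by move=> /kap_dst gd; apply: h2; exact: lt_le_trans gd dle2.
apply: (@le_trans _ _ (J (fun h => e / J1 * L (kap d) * cutoff rr h))); last first.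
  rewrite (PFZ hJ); last exact: Cc_cutoff.
  have E : e = e / J1 * J1 by rewrite divfK// gt_eqF.
  have t0 : 0 <= e / J1 by rewrite divr_ge0// ltW.
  have := mulr_ge0 t0 Lk0; rewrite [in X in _ -> _ <= X]E; set t := e / J1.
  by rewrite /J1; lra.
apply: (PFabs hJ).
- by apply: CcB => //; exact: CcZ.
- by apply: CcZ; exact: Cc_cutoff.
move=> h; rewrite [_ * psi h]mulrC -(PFZ hL (psi h))// -(PFB hL); last 2 first.
- by apply: CcM => //; apply: Cc_lc; exact: Cc_tr.
- exact: CcZ.
rewrite mulrAC -(PFZ hL (e / J1 * _))//; apply: (PFabs hL).
- by apply: CcB; [apply: CcM => //; apply: Cc_lc; exact: Cc_tr|exact: CcZ].
- exact: CcZ.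
move=> g; rewrite -mulrBl normrM (ger0_norm (kap_ge0 _ _)).
have [->|k0] := eqVneq (kap d g) 0; first by rewrite !mulr0.
by rewrite ler_wpM2r ?kap_ge0// bnd.
Qed.

(** The kernel estimates for psi and th share the factors L(kap) and J(kap of the inverse);
    shrinking the bump eliminates both. *)
Lemma haar_unique (L : (gs -> R) -> R) (psi th : gs -> R) : PF L -> rinv L ->
  Cc psi -> Cc th -> L psi * J th = L th * J psi.
Proof.
move=> hL Lr hp ht.
pose ref : gs -> R := cutoff (nm (1%g : gs)).
have Cr : Cc ref by exact: Cc_cutoff.
have Jref : 0 < J ref.
  by apply: (@J_gt0 _ 1%g) => // [g|]; [exact: cutoff_ge0|rewrite /ref cutoff1// ltr01].
(* [C] bounds L(kap) by a multiple of J(kap of the inverse): this is the kernel estimate for [ref]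
   with error J ref / 2. *)
pose C := 2 * L ref / J ref.
have Lref : 0 <= L ref by apply: hL.2 => // g; exact: cutoff_ge0.
have C0 : 0 <= C by rewrite divr_ge0 ?mulr_ge0// ltW.
pose D := C * (`|J th| + `|J psi|) + 1.
have D0 : 0 < D by rewrite ltr_wpDl// mulr_ge0// addr_ge0.
apply: eq_eps => e e0; have e1 : 0 < e / D by rewrite divr_gt0.
have J2 : 0 < J ref / 2 by rewrite divr_gt0.
have [d1 d10 h1] := haar_kernel hL Lr hp e1.
have [d2 d20 h2] := haar_kernel hL Lr ht e1.
have [d3 d30 h3] := haar_kernel hL Lr Cr J2.
pose d := Num.min d1 (Num.min d2 d3).
have d0 : 0 < d by rewrite !lt_min d10 d20.
have := h1 d d0; rewrite ge_min lexx => /(_ isT).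
have := h2 d d0; rewrite !ge_min lexx !orbT => /(_ isT).
have := h3 d d0; rewrite !ge_min lexx !orbT => /(_ isT).
have Lk0 : 0 <= L (kap d) by apply: hL.2 => [|g]; [exact: Cc_kap|exact: kap_ge0].
have : 0 < J (fun h => kap d (h^-1)%g).
  apply: (@J_gt0 _ 1%g); [exact/Cc_inv/Cc_kap|by move=> g; exact: kap_ge0|].
  by rewrite invg1 /kap dst_xx subr0 lt_max d0 orbT.
move: (J (fun h => _)) (L (kap d)) Lk0 => kJ lk lk0 kJ0 A3 A2 A1.
have lkC : lk <= C * kJ.
  rewrite /C mulrAC ler_pdivlMr//; move: A3; rewrite ler_norml => /andP[]; nra.
rewrite -(ler_pM2l kJ0) -{1}(gtr0_norm kJ0) -normrM.
have -> : kJ * (L psi * J th - L th * J psi) =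
  (kJ * L psi - lk * J psi) * J th - (kJ * L th - lk * J th) * J psi by ring.
apply: le_trans (ler_normB _ _) _; rewrite !normrM.
have B1 : `|kJ * L psi - lk * J psi| * `|J th| <= e / D * lk * `|J th| by rewrite ler_wpM2r.
have B2 : `|kJ * L th - lk * J th| * `|J psi| <= e / D * lk * `|J psi| by rewrite ler_wpM2r.
apply: le_trans (lerD B1 B2) _; rewrite -mulrDr -[_ * lk * _]mulrA.
apply: (@le_trans _ _ (e / D * (C * kJ * (`|J th| + `|J psi|)))).
  by apply: ler_wpM2l; [exact: ltW|apply: ler_wpM2r => //; exact: addr_ge0].
have E : e = e / D * D by rewrite divfK// gt_eqF.
have := mulr_ge0 (ltW e1) (ltW kJ0); rewrite [in X in _ -> _ <= X]E; set t := e / D.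
by rewrite /D; lra.
Qed.

Lemma tl_PF a : PF (fun w => J (tl a w)).
Proof.
split=> [c f g hf hg|f hf f0]; last by apply: hJ.2; [exact: Cc_tl|move=> x; exact: f0].
by rewrite -hJ.1//; exact: Cc_tl.
Qed.

Lemma tl_rinv a : rinv (fun w => J (tl a w)).
Proof.
move=> b w hw; rewrite -[RHS](Jr b); last exact: Cc_tl.
by congr J; apply/funext => x; rewrite /tl /tr mulgA.
Qed.

Lemma tlM a b (w : gs -> R) : tl a (tl b w) = tl (b * a)%g w.
Proof. by apply/funext => x; rewrite /tl mulgA. Qed.

Definition dgmx (v : 'rV[R]_n) : G := insubd (1%g : G) (diag_mx v).

Lemma val_dgmx (v : 'rV[R]_n) : \prod_i v 0 i = 1 -> val (dgmx v) = diag_mx v.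
Proof. by move=> h; rewrite /dgmx val_insubd det_diag h eqxx. Qed.

Lemma elt0 i j : i != j -> elt i j 0 = 1%g :> G.
Proof. by move=> ij; apply: val_inj; rewrite val_elt// scale0r addr0. Qed.

Lemma eltD i j x y : i != j -> elt i j (x + y) = (elt i j x * elt i j y)%g :> G.
Proof.
move=> ij; apply: val_inj; rewrite sl_valM !val_elt// mulmxDl mul1mx mulmxDr mulmx1.
rewrite -scalemxAl -scalemxAr mul_delta_mx_0 1?eq_sym// !scaler0 addr0 -addrA scalerDl.
by rewrite [y *: _ + _]addrC.
Qed.

Lemma eltN i j x : i != j -> ((elt i j x)^-1)%g = elt i j (- x) :> G.
Proof. by move=> ij; apply: mulg1_eq; rewrite -eltD// subrr elt0. Qed.

Lemma dgmx_elt (v : 'rV[R]_n) i j x : i != j -> \prod_l v 0 l = 1 -> v 0 j != 0 ->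
  (dgmx v * elt i j x)%g = (elt i j (v 0 i / v 0 j * x) * dgmx v)%g.
Proof.
move=> ij hv vj; apply: val_inj; rewrite !sl_valM val_dgmx// !val_elt//.
rewrite mulmxDr mulmx1 mulmxDl mul1mx -scalemxAr -scalemxAl; congr (_ + _).
apply/matrixP => a b; rewrite !mxE.
rewrite (bigD1 a)//= big1 ?addr0 => [|l la]; last by rewrite !mxE eq_sym (negbTE la) mulr0n mul0r.
rewrite [in RHS](bigD1 b)//= [in RHS]big1 ?addr0 => [|l lb]; last by rewrite !mxE (negbTE lb) mulr0n mulr0.
rewrite !mxE !eqxx !mulr1n.
have [->|_] := eqVneq a i; last by rewrite !(mulr0, mul0r).
have [->|_] := eqVneq b j; last by rewrite !(mulr0, mul0r).
by rewrite !mulr1 mul1r mulrAC divfK// mulrC.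
Qed.

(** Unimodularity. Left translates of J are again right-invariant, hence multiples c(a) J by
    uniqueness, and c is multiplicative; only its values on elementary matrices remain. *)
Lemma J_left a w : Cc w -> J (tl a w) = J w.
Proof.
move: a w; apply: sl_gen => [w _|a b ha hb w hw|i j x ij w hw].
- by congr J; apply/funext => g; rewrite /tl mul1g.
- by rewrite -tlM hb; [exact: ha|exact: Cc_tl].
pose ref : gs -> R := cutoff (nm (1%g : gs)).
have Cr : Cc ref by exact: Cc_cutoff.
have Jref : 0 < J ref.
  by apply: (@J_gt0 _ 1%g) => // [g|]; [exact: cutoff_ge0|rewrite /ref cutoff1// ltr01].
pose c a := J (tl a ref) / J ref.
have Jc a f : Cc f -> J (tl a f) = c a * J f.
  move=> hf; rewrite /c mulrAC.
  have := haar_unique (@tl_PF a) (@tl_rinv a) hf Cr.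
  by move=> /= <-; rewrite mulfK// gt_eqF.
have cM a b : c (a * b)%g = c a * c b.
  rewrite {1}/c -tlM Jc; last exact: Cc_tl.
  by rewrite Jc// mulrA mulfK ?gt_eqF// mulrC.
have c1 : c 1%g = 1.
  rewrite /c (_ : tl 1%g ref = ref) ?divff ?gt_eqF//.
  by apply/funext => g; rewrite /tl mul1g.
have c0 a : c a != 0.
  by apply/negP => /eqP h; have := cM a (a^-1)%g; rewrite h mul0r mulgV c1 => /eqP; rewrite oner_eq0.
rewrite Jc//; suff -> : c (elt i j x) = 1 by rewrite mul1r.
(* conjugation by a diagonal matrix doubles x, so c(x) = c(2x) = c(x)^2 *)
pose s : R := Num.sqrt 2.
have s0 : s != 0 by rewrite gt_eqF// sqrtr_gt0.
pose v : 'rV[R]_n := \row_l (if l == i then s else if l == j then s^-1 else 1).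
have vi : v 0 i = s by rewrite mxE eqxx.
have vj : v 0 j = s^-1 by rewrite mxE eq_sym (negbTE ij) eqxx.
have pv : \prod_l v 0 l = 1.
  rewrite (bigD1 i)//= (bigD1 j) 1?eq_sym//= vi vj mulrA mulfV// mul1r big1// => l /andP[li lj].
  by rewrite mxE (negbTE li) (negbTE lj).
have E := @dgmx_elt v i j x ij pv; rewrite vi vj invrK in E.
have ss : s * s = 2 by rewrite -expr2 sqr_sqrtr.
have := congr1 c (E _); rewrite invr_eq0 => /(_ s0); rewrite !cM ss mulrC => /(mulIf (c0 _)).
rewrite mulr_natl mulr2n eltD// cM -{1}[c (elt i j x)]mulr1 => /(mulfI (c0 _)).
by move=> <-.
Qed.

End Haar.

(** * Periodisation and mixing *)

Section LocallyFiniteSums.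
Variables (R : realType) (T : pspace R) (I : choiceType) (A : set I) (F : I -> T -> R).

Definition locfin := forall r : R, finite_set [set i | A i /\ exists2 x : T, nm x <= r & F i x != 0].

Hypotheses (lf : locfin) (lF : forall i, lc (F i : T -> rspace R)).

Lemma lfs_fsupp x : fsupp A (F ^~ x).
Proof. by apply: sub_finite_set (lf (nm x)) => i [Ai Fi]; split => //; exists x. Qed.

Lemma lfs_sum (r : R) x : nm x <= r -> \sum_(i \in A) F i x =
  \sum_(i <- fset_set [set i | A i /\ exists2 x : T, nm x <= r & F i x != 0]) F i x.
Proof.
by move=> xr; apply: fsumE => [|i []//|i Ai Fi]; [exact: lf|split => //; exists x].
Qed.

Lemma lfs_lc : lc (fun x => \sum_(i \in A) F i x : rspace R).
Proof.
apply: lcI => r e e0.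
have [_ /(_ _ e0)[d d0 hd]] := lc_sum (fset_set [set i | A i /\ exists2 x : T, nm x <= r & F i x != 0]) lF r.
by exists d => // x y xr yr xy; rewrite (lfs_sum xr) (lfs_sum yr); exact: hd.
Qed.

(** Only finitely many terms are nonzero on the support of w, so the exchange is finite
    additivity. *)
Lemma lfs_PF L w : PF L -> Cc w -> fsupp A (fun i => L (fun x => w x * F i x)) /\
  L (fun x => w x * \sum_(i \in A) F i x) = \sum_(i \in A) L (fun x => w x * F i x).
Proof.
move=> hL hw; have [_ [r hr]] := hw.
set X := [set i | A i /\ exists2 x : T, nm x <= r & F i x != 0].
have finX : finite_set X by exact: lf.
have z i : A i -> ~ X i -> L (fun x => w x * F i x) = 0.
  move=> Ai nX; rewrite -(PF0 hL); congr L; apply/funext => x.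
  have [xr|xr] := leP (nm x) r; last by rewrite hr// mul0r.
  have [->|Fx] := eqVneq (F i x) 0; first by rewrite mulr0.
  by exfalso; apply: nX; split => //; exists x.
split.
  apply: sub_finite_set finX => i [Ai h]; apply: contrapT => nX.
  by move: h; rewrite z// eqxx.
rewrite (@fsumE _ _ _ X)//; last 2 first.
- by move=> i [].
- by move=> i Ai h; apply: contrapT => nX; move: h; rewrite z// eqxx.
rewrite -PFsum//; last first.
  by move=> i; have := CcM (lF i) hw; congr Cc; apply/funext => x; rewrite mulrC.
congr L; apply/funext => x; rewrite -mulr_sumr.
have [xr|xr] := leP (nm x) r; last by rewrite hr// !mul0r.
by rewrite (lfs_sum xr).
Qed.

End LocallyFiniteSums.

(** * The periodised inner product and comparison of correlations *)

Section Mixing.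
Variables (R : realType) (n : nat).
Local Notation G := (slT R n).
Local Notation gs := (slspace R n).

Definition Gam : set G := [set g | exists z : 'M[int]_n, val g = map_mx intr z].

Lemma Gam1 : Gam 1%g. Proof. by exists 1%:M; rewrite map_mx1. Qed.

Lemma GamM a b : Gam a -> Gam b -> Gam (a * b)%g.
Proof. by move=> [x ax] [y by']; exists (x *m y); rewrite sl_valM ax by' map_mxM. Qed.

Lemma GamV a : Gam a -> Gam (a^-1)%g.
Proof. by move=> [x ax]; exists (\adj x); rewrite sl_valVadj ax map_mx_adj. Qed.

Lemma finite_Gam (r : R) : finite_set [set g | Gam g /\ nm g <= r].
Proof.
apply: sub_finite_set (finite_image (fun z => insubd (1%g : G) (map_mx intr z)) (@finite_zr R n n r)).
move=> g [[z gz] gr]; exists z; first by move: gr; rewrite /nm/= gz.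
by rewrite -gz valKd.
Qed.

Definition per (w : G -> R) (g : G) : R := \sum_(c \in Gam) tl c w g.

Lemma per_locfin (w : gs -> R) : Cc w -> locfin Gam (fun c => tl c w : gs -> R).
Proof.
move=> [_ [r0 hr0]] r; have [B B0 hB] := @nmV_bound R n r.
apply: sub_finite_set (finite_Gam (`|r0| * B)) => c [Gc [x xr cx]]; split => //.
rewrite -[c](mulgK x); apply: le_trans (nmM _ _) _; apply: ler_pM; rewrite ?nm_ge0//; last exact: hB.
apply: le_trans (ler_norm r0); rewrite leNgt; apply/negP => h.
by move: cx; rewrite /tl hr0 ?eqxx.
Qed.

Lemma per_lcF (w : gs -> R) : Cc w -> forall c, lc (tl c w : gs -> rspace R).
Proof. by move=> hw c; apply: Cc_lc; exact: Cc_tl. Qed.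

Lemma per_lc (w : gs -> R) : Cc w -> lc (per w : gs -> rspace R).
Proof. by move=> hw; exact: lfs_lc (per_locfin hw) (per_lcF hw). Qed.

Lemma per_fsupp (w : gs -> R) g : Cc w -> fsupp Gam (fun c => tl c w g).
Proof. by move=> hw; exact: (lfs_fsupp (per_locfin hw)). Qed.

Lemma perD (u w : gs -> R) : Cc u -> Cc w -> per (fun x => u x + w x) = (fun g => per u g + per w g).
Proof. by move=> hu hw; apply/funext => g; rewrite /per -fsumD//; exact: per_fsupp. Qed.

Lemma perZ c (w : gs -> R) : per (fun x => c * w x) = (fun g => c * per w g).
Proof. by apply/funext => g; rewrite /per mulr_fsumr. Qed.

Lemma per_inv (w : gs -> R) c g : Gam c -> per w (c * g)%g = per w g.
Proof.
move=> Gc; rewrite /per [RHS](reindex_fsbig (fun a => a * c)%g Gam); last first.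
  split=> [a Ga|a b _ _ /mulIg//|a Ga]; first exact: GamM.
  by exists (a * c^-1)%g; [exact/GamM/GamV|rewrite mulgVK].
by apply: eq_fsbigr => a _; rewrite /tl mulgA.
Qed.

Lemma per_tr a (w : gs -> R) : per (tr a w) = tr a (per w).
Proof. by apply/funext => g; apply: eq_fsbigr => c _; rewrite /tl /tr mulgA. Qed.

(** By Gam-invariance g can be moved into the ball of radius r, unless no term contributes; then
    only a fixed finite set of c matters. Hence a bound uniform in g and in w. *)
Lemma per_bnd (r : R) : exists2 C : R, 0 <= C & forall (w : gs -> R) (b : R), Cc w ->
  (forall x, r < nm x -> w x = 0) -> (forall x, `|w x| <= b) -> forall g, `|per w g| <= b * C.
Proof.
have [B B0 hB] := @nmV_bound R n r.
set X := [set c | Gam c /\ nm c <= `|r| * B].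
have finX : finite_set X by exact: finite_Gam.
exists (\sum_(c <- fset_set X) 1); first by rewrite sumr_ge0.
move=> w b hw hr hb g.
have b0 : 0 <= b by apply: le_trans (hb g).
have [[c0 [Gc0 hc0]]|nc] := pselect (exists c, Gam c /\ nm (c * g)%g <= r); last first.
  rewrite /per fsbig1 ?normr0 ?mulr_ge0 ?sumr_ge0// => c Gc; rewrite /tl hr// ltNge.
  by apply/negP => h; apply: nc; exists c.
rewrite -(per_inv w g Gc0) /per (@fsumE _ _ _ X)//; last 2 first.
- by move=> c [].
- move=> c Gc h; split => //.
  have hc : nm (c * (c0 * g))%g <= r.
    by rewrite leNgt; apply: contra h => h; rewrite /tl hr.
  rewrite -[c](mulgK (c0 * g)%g); apply: le_trans (nmM _ _) _.
  by apply: ler_pM; rewrite ?nm_ge0//; [exact: le_trans hc (ler_norm _)|exact: hB].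
rewrite mulr_sumr; apply: le_trans (ler_norm_sum _ _ _) _.
by apply: ler_sum => c _; rewrite mulr1; exact: hb.
Qed.

Variable J : (gs -> R) -> R.
Hypotheses (hJ : PF J) (Jr : rinv J).
Hypothesis Jnz : exists2 w, Cc w & J w != 0.
Let Jl := J_left hJ Jr Jnz.

(** Left translation by c^-1 in the term of index c exchanges the roles of u and w; this is where
    left invariance of J enters. *)
Lemma unfold_per (u w f : gs -> R) : Cc u -> Cc w -> lc (f : gs -> rspace R) ->
  (forall c g, Gam c -> f (c * g)%g = f g) ->
  J (fun g => u g * f g * per w g) = J (fun g => w g * f g * per u g).
Proof.
move=> hu hw lf fi.
have Cuf : Cc (fun g : gs => u g * f g).
  by have := CcM lf hu; congr Cc; apply/funext => g; rewrite mulrC.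
have Cwf : Cc (fun g : gs => w g * f g).
  by have := CcM lf hw; congr Cc; apply/funext => g; rewrite mulrC.
have [_ ->] := lfs_PF (per_locfin hw) (per_lcF hw) hJ Cuf.
have [_ ->] := lfs_PF (per_locfin hu) (per_lcF hu) hJ Cwf.
rewrite [RHS](reindex_fsbig (fun a => a^-1)%g Gam); last first.
  split=> [a|a b _ _ /invg_inj//|a Ga]; first exact: GamV.
  by exists (a^-1)%g; [exact: GamV|rewrite invgK].
apply: eq_fsbigr => c /set_mem Gc; rewrite -[LHS](Jl (c^-1)%g).
  congr J; apply/funext => g; rewrite /tl mulVKg fi; last exact: GamV.
  by rewrite mulrAC [RHS]mulrC mulrA.
by have := CcM (per_lcF hw c) Cuf; congr Cc; apply/funext => g; rewrite mulrC.
Qed.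

(** By unfolding, the inner product in L^2(Gam\G) of the periodisations of u and w, written as an
    integral over G. *)
Definition ip (u w : gs -> R) : R := J (fun g => u g * per w g).

Lemma ipC u w : Cc u -> Cc w -> ip u w = ip w u.
Proof.
move=> hu hw; have := @unfold_per u w (fun=> 1) hu hw (lc_cst _ (1 : rspace R)) (fun _ _ _ => erefl).
have E (a b : gs -> R) : (fun g => a g * 1 * b g) = (fun g => a g * b g).
  by apply/funext => g; rewrite mulr1.
by rewrite !E.
Qed.

Lemma Cc_ip u w : Cc u -> Cc w -> Cc (fun g : gs => u g * per w g).
Proof.
by move=> hu /per_lc hw; have := CcM hw hu; congr Cc; apply/funext => g; rewrite mulrC.
Qed.

Lemma ipDl u v w : Cc u -> Cc v -> Cc w -> ip (fun x => u x + v x) w = ip u w + ip v w.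
Proof.
move=> hu hv hw; rewrite /ip -(PFD hJ); try exact: Cc_ip.
by congr J; apply/funext => g; rewrite mulrDl.
Qed.

Lemma ipZl c u w : Cc u -> Cc w -> ip (fun x => c * u x) w = c * ip u w.
Proof.
move=> hu hw; rewrite /ip -(PFZ hJ); last exact: Cc_ip.
by congr J; apply/funext => g; rewrite mulrA.
Qed.

Lemma ipDr u v w : Cc u -> Cc v -> Cc w -> ip w (fun x => u x + v x) = ip w u + ip w v.
Proof. by move=> hu hv hw; rewrite ipC ?ipDl ?(ipC _ hw)//; exact: CcD. Qed.

Lemma ipZr c u w : Cc u -> Cc w -> ip w (fun x => c * u x) = c * ip w u.
Proof. by move=> hu hw; rewrite ipC ?ipZl ?(ipC hu)//; exact: CcZ. Qed.

Lemma ip_tr a u w : Cc u -> Cc w -> ip (tr a u) (tr a w) = ip u w.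
Proof. by move=> hu hw; rewrite /ip per_tr -[RHS](Jr a)//; exact: Cc_ip. Qed.

(* With sg_Gam = 1 on the support of u, unfolding gives (u, u) = J(sg (u_Gam)^2). *)
Lemma ip_ge0 u : Cc u -> 0 <= ip u u.
Proof.
move=> hu; have [_ [r hr]] := hu.
pose ta : gs -> R := cutoff r.
have Cta : Cc ta by exact: Cc_cutoff.
pose V g := (Num.max 1 (per ta g))^-1.
have lV : lc (V : gs -> rspace R).
  apply: (@lcV _ _ 1) => // [x|]; first by rewrite le_max lexx.
  by apply: lc_max; [exact: lc_cst|exact: per_lc].
have lf : lc (fun g => V g * per u g : rspace R) by apply: lcM => //; exact: per_lc.
have := @unfold_per u ta (fun g => V g * per u g) hu Cta lf.
rewrite (_ : (fun g => u g * (V g * per u g) * per ta g) = (fun g => u g * per u g)); last first.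
  apply/funext => g; have [gr|gr] := leP (nm g) r; last by rewrite hr// !mul0r.
  have p1 : 1 <= per ta g.
    have := @fsum_ge_term _ _ Gam (fun c => tl c ta g) 1%g (per_fsupp g Cta).
    have -> : tl 1%g ta g = 1 by rewrite /tl mul1g /ta cutoff1.
    by apply; [move=> c _; exact: cutoff_ge0|exact: Gam1].
  rewrite /V max_r// -mulrA; congr (_ * _); rewrite mulrAC mulVf ?mul1r//.
  by rewrite gt_eqF// (lt_le_trans ltr01).
rewrite -/(ip u u) => ->; last first.
  by move=> c g Gc; rewrite /V !per_inv.
apply: hJ.2.
  have := CcM (lcM lf (per_lc hu)) Cta; congr Cc; apply/funext => g; ring.
move=> g; have -> : ta g * (V g * per u g) * per u g = ta g * V g * (per u g) ^+ 2 by ring.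
have V0 : 0 <= V g by rewrite /V invr_ge0 le_max ler01.
by apply: mulr_ge0; [apply: mulr_ge0 => //; exact: cutoff_ge0|exact: sqr_ge0].
Qed.

Definition nr u := Num.sqrt (ip u u).

Lemma nr_ge0 u : 0 <= nr u. Proof. exact: sqrtr_ge0. Qed.

Lemma nr_sqr u : Cc u -> nr u ^+ 2 = ip u u.
Proof. by move=> hu; rewrite sqr_sqrtr// ip_ge0. Qed.

Lemma ip_quad u w t : Cc u -> Cc w ->
  ip (fun x => u x + t * w x) (fun x => u x + t * w x) = ip u u + 2 * t * ip u w + t ^+ 2 * ip w w.
Proof.
move=> hu hw; have ht := CcZ t hw; have hs := CcD hu ht.
rewrite ipDl// !ipDr// ipZl// !ipZr// ipZl// (ipC hw hu); ring.
Qed.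

Lemma ip_CS u w : Cc u -> Cc w -> `|ip u w| <= nr u * nr w.
Proof.
move=> hu hw; rewrite -sqrtr_sqr -sqrtrM ?ip_ge0// ler_wsqrtr//.
have a0 := ip_ge0 hu; have c0 := ip_ge0 hw.
have q t : 0 <= ip u u + 2 * t * ip u w + t ^+ 2 * ip w w.
  by rewrite -ip_quad//; apply: ip_ge0; apply: CcD => //; exact: CcZ.
move: (ip u u) (ip u w) (ip w w) a0 c0 q => a b c a0 c0 q.
(* The form may be degenerate: if (w, w) = 0 and b is nonzero, the choice t = -(a + 1)/(2b) would
   give the quadratic form the value -1. *)
have [c00|cn0] := eqVneq c 0.
  rewrite c00 mulr0; have := q (- (a + 1) / (2 * b)).
  have [->|b0] := eqVneq b 0; first by rewrite expr0n.
  rewrite c00 mulr0 addr0.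
  have -> : 2 * (- (a + 1) / (2 * b)) * b = - (a + 1) by field.
  lra.
have c1 : 0 < c by rewrite lt_neqAle eq_sym cn0.
have := q (- b / c).
have -> : a + 2 * (- b / c) * b + (- b / c) ^+ 2 * c = (a * c - b ^+ 2) / c by field.
by rewrite pmulr_lge0 ?invr_gt0// subr_ge0.
Qed.

Lemma nrD u w : Cc u -> Cc w -> nr (fun x => u x + w x) <= nr u + nr w.
Proof.
move=> hu hw; rewrite -[leRHS]ger0_norm ?addr_ge0 ?nr_ge0// -sqrtr_sqr ler_wsqrtr//.
have := ip_quad 1 hu hw.
have -> : (fun x => u x + 1 * w x) = (fun x => u x + w x) by apply/funext => x; rewrite mul1r.
move=> ->; rewrite sqrrD !nr_sqr//.
by have := ip_CS hu hw; rewrite ler_norml => /andP[_]; lra.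
Qed.

Lemma nr_tr a u : Cc u -> nr (tr a u) = nr u.
Proof. by move=> hu; rewrite /nr ip_tr. Qed.

Definition mv a u := nr (fun x => tr a u x - u x).

Lemma Cc_mv a u : Cc u -> Cc (fun x : gs => tr a u x - u x).
Proof. by move=> hu; apply: CcB => //; exact: Cc_tr. Qed.

(** The triangle inequality, since R_a is an isometry. *)
Lemma mvM a b u : Cc u -> mv (a * b)%g u <= mv a u + mv b u.
Proof.
move=> hu; rewrite /mv -(nr_tr a (Cc_mv b hu)) addrC.
apply: le_trans (nrD _ _); [|exact/Cc_tr/Cc_mv|exact: Cc_mv].
rewrite le_eqVlt; apply/orP; left; apply/eqP; congr nr; apply/funext => x.
by rewrite /tr mulgA subrKA.
Qed.

(** For g near 1 the difference is small in sup norm and supported in a fixed ball; [per_bnd] then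
    bounds its periodisation, and so its norm. *)
Lemma mv_cont u (e : R) : Cc u -> 0 < e -> exists2 d : R, 0 < d &
  forall g : gs, dst g 1%g < d -> mv g u <= e.
Proof.
move=> hu e0; have [r hr] := uc_right hu.
have [C C0 hC] := per_bnd (r + 1).
have J0 := PF_cutoff_ge0 hJ (r + 1).
pose c := C * J (cutoff (r + 1)) + 1.
have c0 : 0 < c by rewrite ltr_wpDl// mulr_ge0.
pose e1 := Num.min 1 (e ^+ 2 / c).
have e10 : 0 < e1 by rewrite lt_min ltr01 divr_gt0// exprn_gt0.
have [d d0 hd] := hr _ e10; exists d => // g gd.
set a := fun x => tr g u x - u x.
have Ca : Cc a by exact: Cc_mv.
have ab x : `|a x| <= e1.
  by apply: le_trans (hd g x gd) _; rewrite ler_piMr ?cutoff_le1// ltW.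
have as' x : r + 1 < nm x -> a x = 0.
  move=> xr; apply/eqP; rewrite -normr_le0; apply: le_trans (hd g x gd) _.
  by rewrite cutoff0 ?mulr0// ltW.
have pb x := hC a e1 Ca as' ab x.
rewrite (_ : e = Num.sqrt (e ^+ 2)); last by rewrite sqrtr_sqr gtr0_norm.
rewrite /mv -/a /nr ler_wsqrtr//.
apply: le_trans (ler_norm _) _.
apply: (@le_trans _ _ (e1 * (e1 * C) * J (cutoff (r + 1)))).
  apply: (PF_bound hJ); first exact: Cc_ip.
    by move=> x xr; rewrite as'// mul0r.
  by move=> x; rewrite normrM; apply: ler_pM.
have e11 : e1 <= 1 by rewrite ge_min lexx.
have e12 : e1 * c <= e ^+ 2 by rewrite -ler_pdivlMr// ge_min lexx orbT.
have cc : 0 <= C * J (cutoff (r + 1)) by rewrite mulr_ge0.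
apply: le_trans e12; rewrite /c -!mulrA ler_pM2l//.
apply: (@le_trans _ _ (1 * (C * J (cutoff (r + 1))))); first by rewrite ler_wpM2r.
by rewrite mul1r lerDl.
Qed.

Lemma mv_ge0 a u : 0 <= mv a u. Proof. exact: nr_ge0. Qed.

(** The parallelogram identity: two vectors of the unit ball whose sum is almost as long as possible
    are close. *)
Lemma nr_gap (c beta : R) u w : Cc u -> Cc w -> nr u <= 1 -> nr w <= 1 -> 0 < beta -> 0 <= c ->
  2 * c <= beta * nr (fun x => u x + w x) ->
  nr (fun x => w x - u x) ^+ 2 <= 4 - 4 * (c / beta) ^+ 2.
Proof.
move=> hu hw u1 w1 b0 c0 h.
have E1 := ip_quad 1 hw hu; have E2 := ip_quad (-1) hw hu.
have F1 : (fun x => w x + 1 * u x) = (fun x => u x + w x) by apply/funext => x; rewrite mul1r addrC.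
have F2 : (fun x => w x + -1 * u x) = (fun x => w x - u x) by apply/funext => x; rewrite mulN1r.
rewrite F1 in E1; rewrite F2 in E2.
have hs : Cc (fun x => u x + w x) by exact: CcD.
have hd : Cc (fun x => w x - u x) by exact: CcB.
rewrite nr_sqr// E2.
have iu : ip u u <= 1 by rewrite -nr_sqr// expr_le1// nr_ge0.
have iw : ip w w <= 1 by rewrite -nr_sqr// expr_le1// nr_ge0.
have cb : 2 * (c / beta) <= nr (fun x => u x + w x) by rewrite mulrA ler_pdivrMr// [leRHS]mulrC.
have : (2 * (c / beta)) ^+ 2 <= ip (fun x => u x + w x) (fun x => u x + w x).
  by rewrite -nr_sqr// lerXn2r ?nnegrE ?nr_ge0// mulr_ge0// divr_ge0// ltW.
rewrite E1; lra.
Qed.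

(** An abstract diagonal family of determinant 1: [Lb] marks the block with the larger entries, and
    conjugation by D_t^-1 multiplies an entry (i, j) with i in [Lb] and j outside by s t, which
    tends to 0. *)
Variables (v : R -> 'rV[R]_n) (Lb : pred 'I_n) (s : R -> R) (i0 j0 : 'I_n).
Hypotheses (v_prod : forall t, 0 < t -> \prod_l v t 0 l = 1)
  (v_gt0 : forall t, 0 < t -> forall l, 0 < v t 0 l)
  (v_s : forall t, 0 < t -> forall i j, Lb i -> ~~ Lb j -> v t 0 j / v t 0 i = s t)
  (s_cvg : forall e : R, 0 < e -> exists2 T : R, 0 < T & forall t, T <= t -> `|s t| < e)
  (Lb0 : Lb i0) (Lb1 : ~~ Lb j0).

Definition Dt t : G := dgmx (v t).

Lemma Dt_elt t i j x : 0 < t -> i != j ->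
  (elt i j x * Dt t)%g = (Dt t * elt i j (v t 0 j / v t 0 i * x))%g.
Proof.
move=> t0 ij; rewrite /Dt dgmx_elt//; [|exact: v_prod|by rewrite gt_eqF ?v_gt0].
have -> // : v t 0 i / v t 0 j * (v t 0 j / v t 0 i * x) = x.
by field; rewrite !gt_eqF ?v_gt0.
Qed.

Lemma elt_valE (i j : 'I_n) (x : R) (g : G) a b : i != j ->
  val (elt i j x * g)%g a b = val g a b + x * (a == i)%:R * val g j b.
Proof. by move=> ij; rewrite sl_valM val_elt// elt_mulE. Qed.

Lemma mautner_id (i j : 'I_n) (d l : R) : i != j -> d != 0 -> l != 0 ->
  elt j i (2 * d / l) =
  (elt i j ((l - 1) / d) * elt j i d * elt i j (- ((l - 1) / (d * l))) *
   (elt i j ((l^-1 - 1) / d) * elt j i d * elt i j (- ((l^-1 - 1) / (d * l^-1)))))%g :> G.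
Proof.
move=> ij d0 l0; have ji : j != i by rewrite eq_sym.
apply: val_inj; apply/matrixP => a b.
rewrite -[elt j i (2 * d / l)]mulg1.
rewrite -[elt i j (- ((l^-1 - 1) / (d * l^-1)))]mulg1 -!mulgA.
have [->|ai] := eqVneq a i; [|have [->|aj] := eqVneq a j];
  rewrite !elt_valE// ?eqxx ?(negbTE ij) ?(negbTE ji) ?(negbTE ai) ?(negbTE aj) /= ?mulr1n ?mulr0n;
  by field; rewrite ?d0 ?l0.
Qed.

Lemma commutator_id (p q l : 'I_n) (x : R) : p != q -> p != l -> l != q ->
  elt p q x = (elt p l x * elt l q 1 * (elt p l (- x) * elt l q (- 1)))%g :> G.
Proof.
move=> pq pl lq; have lp : l != p by rewrite eq_sym.
have qp : q != p by rewrite eq_sym. have ql : q != l by rewrite eq_sym.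
apply: val_inj; apply/matrixP => a b.
rewrite -[elt p q x]mulg1 -[elt l q (- 1)]mulg1 -!mulgA.
have [->|ap] := eqVneq a p; [|have [->|al] := eqVneq a l];
  rewrite !elt_valE// ?eqxx ?(negbTE pq) ?(negbTE pl) ?(negbTE lq) ?(negbTE lp) ?(negbTE qp)
   ?(negbTE ql) ?(negbTE ap) ?(negbTE al) /= ?mulr1n ?mulr0n; by ring.
Qed.

(* Mautner phenomenon: almost invariance under the expanded directions propagates. *)
Lemma mautner (f : gs -> R) (eta : R) : Cc f -> 0 < eta ->
  (forall i j x, Lb i -> ~~ Lb j -> mv (elt i j x) f <= eta) ->
  forall p q x, p != q -> mv (elt p q x) f <= 24 * eta.
Proof.
move=> hf e0 H.
have up i j x : Lb i -> ~~ Lb j -> mv (elt i j x) f <= 6 * eta.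
  by move=> Li Lj; apply: le_trans (H i j x Li Lj) _; lra.
have ne i j : Lb i -> ~~ Lb j -> i != j.
  by move=> Li Lj; apply: contraNneq Lj => <-.
have lo i j x : Lb i -> ~~ Lb j -> mv (elt j i x) f <= 6 * eta.
  move=> Li Lj; have ij := ne _ _ Li Lj; have ji : j != i by rewrite eq_sym.
  have [d d0 hd] := mv_cont hf e0.
  pose c := nrm (delta_mx j i : 'M[R]_n) + 1.
  have c0 : 0 < c by rewrite ltr_wpDl// nrm_ge0.
  (* Fixed once and for all and so small that [elt j i d'] moves f by at most eta; the free
     parameter l = 2 d' / x of [mautner_id] then produces every nonzero x at the cost of 6
     factors. *)
  pose d' := d / (2 * c).
  have d'0 : 0 < d' by rewrite divr_gt0// mulr_gt0.
  have sm : mv (elt j i d') f <= eta.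
    apply: hd; rewrite /dst/= val_elt// addrAC subrr add0r nrmZ gtr0_norm//.
    apply: (@le_lt_trans _ _ (d' * c)); first by rewrite ler_wpM2l ?lerDl// ltW.
    by rewrite /d' invfM mulrA mulfVK ?gt_eqF//; lra.
  have [->|x0] := eqVneq x 0.
    rewrite elt0// /mv (_ : (fun _ => _) = (fun=> 0)).
      rewrite /nr /ip (_ : (fun _ => _) = (fun=> 0)) ?(PF0 hJ) ?sqrtr0 ?mulr_ge0 ?ltW//.
      by apply/funext => g; rewrite mul0r.
    by apply/funext => g; rewrite /tr mulg1 subrr.
  clearbody d' => {hd c0 c}.
  have l0 : 2 * d' / x != 0 by rewrite mulf_neq0 ?invr_eq0// mulf_neq0// gt_eqF.
  have E : x = 2 * d' / (2 * d' / x) by field; rewrite x0 gt_eqF.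
  rewrite E (mautner_id ij (lt0r_neq0 d'0) l0).
  move: (2 * d' / x) => l.
  have M r1 r2 : mv (elt i j r1 * elt j i d' * elt i j r2)%g f <= 3 * eta.
    apply: le_trans (mvM _ _ hf) _; rewrite (_ : 3 * eta = eta + eta + eta); last by ring.
    apply: lerD; last exact: H.
    by apply: le_trans (mvM _ _ hf) _; apply: lerD => //; exact: H.
  apply: le_trans (mvM _ _ hf) _.
  by rewrite (_ : 6 * eta = 3 * eta + 3 * eta); [apply: lerD; exact: M|ring].
have all p q x : Lb p != Lb q -> mv (elt p q x) f <= 6 * eta.
  case Lp : (Lb p); case Lq : (Lb q) => // _; first by apply: up; rewrite ?Lp ?Lq.
  by apply: lo; rewrite ?Lp ?Lq.
move=> p q x pq.
have [E|nE] := eqVneq (Lb p) (Lb q); last by apply: le_trans (all _ _ _ nE) _; lra.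
(* An index of the other block: elt p q x is a commutator of four factors that change block, each
   costing 6 eta. *)
pose l := if Lb p then j0 else i0.
have pl : Lb p != Lb l by rewrite /l; case: (Lb p); rewrite ?(negbTE Lb1) ?Lb0.
have lq : Lb l != Lb q by rewrite -E eq_sym.
rewrite (@commutator_id p q l x)//; last 2 first.
- by apply: contraNneq pl => ->.
- by apply: contraNneq lq => ->.
have M y z : mv (elt p l y * elt l q z)%g f <= 12 * eta.
  apply: le_trans (mvM _ _ hf) _; rewrite (_ : 12 * eta = 6 * eta + 6 * eta); last by ring.
  by apply: lerD; exact: all.
apply: le_trans (mvM _ _ hf) _; rewrite (_ : 24 * eta = 12 * eta + 12 * eta); last by ring.
by apply: lerD; exact: M.
Qed.

Lemma ip_mv a (u w : gs -> R) : Cc u -> Cc w -> `|ip u (tr a w) - ip u w| <= nr u * mv a w.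
Proof.
move=> hu hw; have ha := Cc_tr a hw.
have -> : ip u (tr a w) - ip u w = ip u (fun x => tr a w x - w x).
  have := ipDr ha (CcN hw) hu => ->; congr (_ + _).
  by have := ipZr (-1) hw hu; rewrite mulN1r => <-; congr ip; apply/funext => x; rewrite mulN1r.
by apply: ip_CS => //; exact: Cc_mv.
Qed.

Lemma ip_trl a (u w : gs -> R) : Cc u -> Cc w -> ip (tr a u) w = ip u (tr (a^-1)%g w).
Proof.
move=> hu hw; rewrite -[RHS](ip_tr a)//; last exact: Cc_tr.
by congr ip; apply/funext => x; rewrite /tr mulgK.
Qed.

Lemma trM a b (w : gs -> R) : tr (a * b)%g w = tr a (tr b w).
Proof. by apply/funext => x; rewrite /tr mulgA. Qed.

(** The translation is moved to the other side and across D_t, where it tends to 1 and is absorbed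
    by the continuity of psi. *)
Lemma mixing_contract i j x (chi psi : gs -> R) (e : R) : Lb i -> ~~ Lb j -> Cc chi -> Cc psi -> 0 < e ->
  exists T : R, forall t, T <= t ->
  `|ip (tr (elt i j x) chi) (tr (Dt t) psi) - ip chi (tr (Dt t) psi)| <= e.
Proof.
move=> Li Lj hc hp e0; have ij : i != j by apply: contraNneq Lj => <-.
have c0 : 0 < nr chi + 1 by rewrite ltr_wpDl// nr_ge0.
have [d d0 hd] := mv_cont hp (divr_gt0 e0 c0).
pose c := `|x| * nrm (delta_mx i j : 'M[R]_n) + 1.
have c1 : 0 < c by rewrite ltr_wpDl// mulr_ge0 ?nrm_ge0.
have [T T0 hT] := s_cvg (divr_gt0 d0 c1).
exists T => t Tt; have t0 : 0 < t by exact: lt_le_trans Tt.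
have ht : Cc (tr (Dt t) psi) by exact: Cc_tr.
rewrite ip_trl// eltN// -trM Dt_elt// trM.
have := @ip_mv (elt i j (v t 0 j / v t 0 i * - x)) (tr ((Dt t)^-1)%g chi) psi (Cc_tr _ hc) hp.
rewrite !ip_trl ?invgK//; last exact: Cc_tr.
move=> /le_trans; apply; rewrite nr_tr//.
apply: (@le_trans _ _ (nr chi * (e / (nr chi + 1)))); last first.
  by rewrite mulrCA ler_piMr ?ltW// ltr_pdivrMr// mul1r ltrDl.
rewrite ler_wpM2l ?nr_ge0//; apply: hd.
rewrite /dst/= val_elt// addrAC subrr add0r nrmZ v_s// normrM normrN -mulrA.
have := hT t Tt; rewrite ltr_pdivlMr// => h; apply: le_lt_trans h.
by rewrite ler_wpM2l// lerDl.
Qed.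

(** Contradiction with the norm beta of the limsup of ell over the unit ball. An almost maximiser f
    is almost fixed by the contracted directions, as f and its translate share their large values
    and the ball is uniformly convex. By [mautner] it is almost fixed by all elementary matrices;
    moving elt p q x across D_t onto f makes ell t f small. *)
Lemma mixing_elt p q x (chi psi : gs -> R) (e : R) : p != q -> Cc chi -> Cc psi -> 0 < e ->
  exists T : R, forall t, T <= t ->
  `|ip chi (tr (Dt t * elt p q x)%g psi) - ip chi (tr (Dt t) psi)| <= e.
Proof.
move=> pq hc hp e0.
pose psi' := (fun y => tr (elt p q x) psi y - psi y).
have hp' : Cc psi' by exact: Cc_mv.
pose ell t u := ip u (tr (Dt t) psi').
have ellE t u : Cc u -> ell t u = ip u (tr (Dt t * elt p q x)%g psi) - ip u (tr (Dt t) psi).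
  move=> hu; rewrite /ell trM.
  have h1 : Cc (tr (Dt t) (tr (elt p q x) psi)) by apply: Cc_tr; exact: Cc_tr.
  have h2 : Cc (tr (Dt t) psi) by exact: Cc_tr.
  rewrite (_ : tr (Dt t) psi' = (fun y => tr (Dt t) (tr (elt p q x) psi) y + -1 * tr (Dt t) psi y)).
    by rewrite ipDr ?ipZr ?mulN1r//; exact: CcZ.
  by apply/funext => y; rewrite mulN1r.
have ell_bd t u : Cc u -> ell t u <= nr u * nr psi'.
  move=> hu; apply: le_trans (ler_norm _) _; rewrite -(nr_tr (Dt t) hp').
  by apply: ip_CS => //; exact: Cc_tr.
(* Values exceeded for arbitrarily large t by some u in the unit ball; the supremum plays the part
   of an operator norm. *)
pose S := [set c : R | exists2 u, Cc u /\ nr u <= 1 & forall T, exists2 t, T <= t & c <= ell t u].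
have S0 : S 0.
  exists (fun=> 0); first by split; [exact: Cc0|rewrite /nr /ip (_ : (fun _ => _) = (fun=> 0)) ?(PF0 hJ) ?sqrtr0//;
    apply/funext => g; rewrite mul0r].
  move=> T; exists T => //; rewrite /ell /ip (_ : (fun _ => _) = (fun=> 0)) ?(PF0 hJ)//.
  by apply/funext => g; rewrite mul0r.
have ubS : ubound S (nr psi').
  move=> c [u [hu u1] /(_ 0)[t _ ct]]; apply: le_trans ct _; apply: le_trans (ell_bd t u hu) _.
  by rewrite ler_piMl ?nr_ge0.
have supS : has_sup S by split; [exists 0|exists (nr psi')].
set beta := sup S.
have beta0 : 0 <= beta by apply: ub_le_sup => //; exact: supS.2.
suff b0 : beta = 0.
  have half u (e' : R) : Cc u -> 0 < e' -> exists T, forall t, T <= t -> ell t u <= e'.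
    move=> hu e'0; apply: contrapT => nT.
    have nu0 : 0 < nr u + 1 by rewrite ltr_wpDl// nr_ge0.
    have : S (e' / (nr u + 1)).
      exists (fun y => (nr u + 1)^-1 * u y).
        split; first exact: CcZ.
        rewrite /nr ipZl ?ipZr//; last exact: CcZ.
        rewrite mulrA -expr2 sqrtrM ?sqr_ge0// sqrtr_sqr ger0_norm ?invr_ge0 ?ltW//.
        by rewrite ltr_pdivrMl// mulr1 -/(nr u) ltrDl.
      move=> T; apply: contrapT => h; apply: nT; exists T => t Tt; rewrite leNgt; apply/negP => h'.
      apply: h; exists t => //; rewrite /ell ipZl//; last exact: Cc_tr.
      by rewrite mulrC ler_pM2l ?invr_gt0// ltW.
    by move=> /(ub_le_sup supS.2); rewrite -/beta b0 leNgt divr_gt0.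
  have [T1 h1] := half chi e hc e0.
  have [T2 h2] := half _ e (CcN hc) e0.
  exists (Num.max T1 T2) => t; rewrite ge_max => /andP[t1 t2]; rewrite -ellE// ler_norml h1// andbT.
  have := h2 t t2; rewrite (_ : ell t (fun _ => - _) = - ell t chi) 1?lerNl//.
  have := ipZl (-1) hc (Cc_tr (Dt t) hp'); rewrite mulN1r => <-; congr ip.
  by apply/funext => y; rewrite mulN1r.
apply/eqP; rewrite eq_le beta0 andbT leNgt; apply/negP => bp.
(* With 1 - ep <= c / beta, [nr_gap] gives mv^2 <= 8 ep <= eta^2; the factor 24 is that of
   [mautner], and K eta = beta / 4 will contradict c >= beta / 2. *)
pose K := 24 * (nr psi + 1).
have K0 : 0 < K by rewrite mulr_gt0// ltr_wpDl// nr_ge0.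
pose eta := beta / (4 * K).
have eta0 : 0 < eta by rewrite divr_gt0// mulr_gt0.
pose ep := Num.min (2^-1) (eta ^+ 2 / 8).
have ep0 : 0 < ep by rewrite lt_min invr_gt0 ltr0n divr_gt0// exprn_gt0.
have [c [f [hf f1] hc'] cb] := sup_adherent (mulr_gt0 bp ep0) supS.
rewrite -/beta in cb.
have ep1 : ep <= 2^-1 by rewrite ge_min lexx.
have ep2 : 8 * ep <= eta ^+ 2 by rewrite mulrC -ler_pdivlMr// ge_min lexx orbT.
have cp : beta / 2 <= c by nra.
have c0 : 0 < c by lra.
have key i j y : Lb i -> ~~ Lb j -> mv (elt i j y) f <= eta.
  move=> Li Lj; have hu := Cc_tr (elt i j y) hf.
  set w := tr (elt i j y) f in hu.
  have hs : Cc (fun z => f z + w z) by exact: CcD.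
  (* By [mixing_contract] the translate w has the same large values as f, so f + w reaches almost 2c
     at arbitrarily large times; dividing by its norm compares this with beta. *)
  have G1 : 2 * c <= beta * nr (fun z => f z + w z).
    apply/ler_addgt0Pr => e1 e10.
    have [T hT] := mixing_contract y Li Lj hf hp' e10.
    have big T' : exists2 t, T' <= t & 2 * c - e1 <= ell t (fun z => f z + w z).
      have [t] := hc' (Num.max T T'); rewrite ge_max => /andP[Tt T't] ct; exists t => //.
      rewrite /ell ipDl//; last exact: Cc_tr.
      by have := hT t Tt; rewrite -/w ler_norml -/(ell t f); move: ct => /=; rewrite -/(ell t w); lra.
    have [n0|n0] := eqVneq (nr (fun z => f z + w z)) 0.
      have [t _ ht] := big 0; have := ell_bd t _ hs; rewrite n0 mul0r mulr0; lra.
    have np : 0 < nr (fun z => f z + w z) by rewrite lt_neqAle eq_sym n0 nr_ge0.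
    rewrite -lerBlDr -ler_pdivrMr//; apply: (ub_le_sup supS.2).
    exists (fun z => (nr (fun z => f z + w z))^-1 * (f z + w z)).
      split; first exact: CcZ.
      rewrite /nr ipZl ?ipZr//; last exact: CcZ.
      rewrite mulrA -expr2 sqrtrM ?sqr_ge0// sqrtr_sqr ger0_norm ?invr_ge0 ?nr_ge0//.
      by rewrite mulVf.
    move=> T'; have [t T't ht] := big T'; exists t => //.
    rewrite /ell ipZl//; last exact: Cc_tr.
    by rewrite mulrC ler_pM2l ?invr_gt0.
  have w1 : nr w <= 1 by rewrite nr_tr.
  have := nr_gap hf hu f1 w1 bp (ltW c0) G1.
  rewrite -/(mv (elt i j y) f).
  have cbeta : 1 - ep <= c / beta by rewrite ler_pdivlMr//; lra.
  have h4 : (1 - ep) ^+ 2 <= (c / beta) ^+ 2.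
    by rewrite lerXn2r ?nnegrE//; [lra|rewrite divr_ge0// ltW].
  move=> h5; rewrite -(ler_pXn2r (n := 2))// ?nnegrE ?mv_ge0 ?ltW//; nra.
have [t t1 ct] := hc' 1; have t0 : 0 < t by exact: lt_le_trans t1.
have hphi : Cc (tr (Dt t) psi) by exact: Cc_tr.
have M := mautner hf eta0 key.
move: ct; rewrite ellE// /Dt dgmx_elt//; [|exact: v_prod|by rewrite gt_eqF ?v_gt0].
(* The entry x' depends on t, so the bound of [mautner] must be uniform in x. *)
set x' := _ * x; rewrite -/(Dt t) trM.
have := @ip_trl ((elt p q x')^-1)%g f (tr (Dt t) psi) hf hphi; rewrite invgK => <-.
rewrite eltN// -/(Dt t) => ct.
have h := @ip_mv (elt p q (- x')) (tr (Dt t) psi) f hphi hf.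
rewrite [ip _ f]ipC// [ip _ (tr _ f)]ipC// in h; last exact: Cc_tr.
have h2 : c <= nr psi * (24 * eta).
  apply: le_trans ct _; apply: le_trans (ler_norm _) _; apply: le_trans h _.
  by rewrite nr_tr// ler_wpM2l ?nr_ge0// M.
have h3 : nr psi * (24 * eta) <= K * eta by rewrite /K; have := nr_ge0 psi; nra.
have h4 : K * eta = beta / 4 by rewrite /eta; field; rewrite gt_eqF.
lra.
Qed.

End Mixing.

(** * Asymptotic uniqueness *)

Section SupportForm.
Variables (R : realType) (T : pspace R).

Lemma Cc_supp (w : T -> R) : Cc w -> exists2 r : R, 0 <= r & forall x, w x != 0 -> nm x <= r.
Proof.
move=> [_ [r hr]]; exists `|r| => // x; apply: contraNle => h.
by rewrite hr// (le_lt_trans (ler_norm r)).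
Qed.

Lemma CcI (w : T -> R) (r : R) : lc (w : T -> rspace R) -> (forall x, w x != 0 -> nm x <= r) -> Cc w.
Proof.
move=> lw hr; split => //; exists r => x h; apply/eqP; apply: contraTT h => /hr.
by rewrite -leNgt.
Qed.

Lemma PF_le_bound (L : (T -> R) -> R) (w u : T -> R) (e : R) : PF L -> Cc w -> Cc u ->
  (forall x, `|w x| <= e * u x) -> `|L w| <= e * L u.
Proof. by move=> hL hw hu h; rewrite -(PFZ hL)//; apply: (PFabs hL) => //; exact: CcZ. Qed.

End SupportForm.

Section AsymptoticUniqueness.
Variables (R : realType) (n : nat).
Local Notation G := (slT R n).
Local Notation gs := (slspace R n).
Variable J : (gs -> R) -> R.
Hypotheses (hJ : PF J) (Jr : rinv J).
Hypothesis Jnz : exists2 w, Cc w & J w != 0.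
Let Jl := J_left hJ Jr Jnz.
Variable L : R -> (gs -> R) -> R.
Hypotheses (hL : forall t, PF (L t))
  (Lbd : forall w, Cc w -> exists C : R, forall t, `|L t w| <= C)
  (Linv : forall h w (e : R), Cc w -> 0 < e -> exists T : R, forall t, T <= t ->
     `|L t (tr h w) - L t w| <= e).

(** Invariance holds eventually at each point of a finite net and extends to the ball by uniform
    continuity; [Lbd] makes the error uniform in t. *)
Lemma asym_uniform (psi : gs -> R) (r e : R) : Cc psi -> 0 < e ->
  exists T : R, forall t (g : gs), T <= t -> nm g <= r -> `|L t (tr g psi) - L t psi| <= e.
Proof.
move=> hp e0; have [r0 hr0] := uc_right hp.
have [B B0 hB] := @nmV_bound R n (r + 1).
pose u : gs -> R := cutoff (`|r0 + 1| * B).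
have Cu : Cc u by exact: Cc_cutoff.
have [C hC] := Lbd Cu.
have C0 : 0 < C + 1 by rewrite ltr_wpDl//; apply: le_trans (hC 0).
have e1 : 0 < e / 2 / (C + 1) by rewrite !divr_gt0.
have [d d0 hd] := hr0 _ e1.
have dB : 0 < Num.min 1 (d / B) by rewrite lt_min ltr01 divr_gt0.
have [I [a ha]] := @nm_net R gs r _ dB.
have e2 : 0 < e / 2 by rewrite divr_gt0.
have /choice[T hT] : forall i, exists T : R, forall t, T <= t -> `|L t (tr (a i) psi) - L t psi| <= e / 2.
  by move=> i; exact: Linv.
exists (\sum_i `|T i|) => t g Tt gr.
have [i] := ha g gr; rewrite lt_min => /andP[gi1 gi2].
have ai : nm (a i : gs) <= r + 1.
  by apply: le_trans (nm_lip (a i) g) _; rewrite dst_sym; apply: lerD => //; exact: ltW.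
have Ti : T i <= t.
  apply: le_trans Tt; rewrite (bigD1 i)//=; apply: le_trans (ler_norm _) _.
  by rewrite lerDl sumr_ge0.
have -> : L t (tr g psi) - L t psi = (L t (tr g psi) - L t (tr (a i) psi)) + (L t (tr (a i) psi) - L t psi).
  by rewrite addrA subrK.
rewrite [e]splitr; apply: le_trans (ler_normD _ _) _; apply: lerD; last exact: hT.
rewrite -(PFB (hL t)); [|exact: Cc_tr|exact: Cc_tr].
apply: (@le_trans _ _ (e / 2 / (C + 1) * L t u)); last first.
  rewrite -[leRHS](@divfK _ (C + 1)) ?gt_eqF//; apply: ler_wpM2l; first exact: ltW.
  by apply: le_trans (ler_norm _) _; apply: le_trans (hC t) _; rewrite lerDl.
apply: PF_le_bound => //; first by apply: CcB; exact: Cc_tr.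
move=> x; have ha1 : dst ((a i)^-1 * g : gs)%g 1%g < d.
  have := dstMl ((a i)^-1)%g g (a i); rewrite mulVg => /le_lt_trans; apply.
  have := hB _ ai; move: gi2; rewrite ltr_pdivlMr// => h1 h2.
  apply: le_lt_trans h1; rewrite mulrC; apply: ler_wpM2l => //; exact: dst_ge0.
have := hd _ (x * a i)%g ha1; rewrite mulgA mulgK => h.
rewrite /tr; apply: le_trans h _; apply: ler_wpM2l; first exact: ltW.
have [->|h] := eqVneq (cutoff r0 (x * a i : gs)%g) 0; first exact: cutoff_ge0.
rewrite /u [leRHS]cutoff1 ?cutoff_le1// -[x](mulgK (a i)); apply: le_trans (nmM _ _) _.
apply: ler_pM; rewrite ?nm_ge0//; last exact: hB.
apply: le_trans (ler_norm _); rewrite leNgt; apply: contra h => h.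
by rewrite cutoff0// ltW.
Qed.

(** Exchange of the two functionals, then left translation by x inside J. *)
Lemma asym_fubini (psi w : gs -> R) t : Cc psi -> Cc w ->
  [/\ Cc (fun g => psi g * L t (fun x => w (x^-1 * g)%g)), Cc (fun g => w g * L t (tr g psi)) &
  J (fun g => psi g * L t (fun x => w (x^-1 * g)%g)) = J (fun g => w g * L t (tr g psi))].
Proof.
move=> hp hw; have [rp rp0 hrp] := Cc_supp hp; have [rw rw0 hrw] := Cc_supp hw.
have [B B0 hB] := @nmV_bound R n rw.
pose K (x g : gs) := psi g * w (x^-1 * g)%g.
pose K' (x g : gs) := psi (x * g)%g * w g.
have mx (a b : R) : a <= Num.max a b by rewrite le_max lexx.
have mx' (a b : R) : b <= Num.max a b by rewrite le_max lexx orbT.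
have CK : Cc (fun z : prodspace gs gs => K z.1 z.2).
  apply: (@CcI _ _ _ (Num.max rp (rp * B))).
    apply: lcM; first by apply: (lc_comp (Cc_lc hp)); exact: lc_snd.
    by apply: (lc_comp (Cc_lc hw)); apply: lc_mulg; [exact/lc_invg/lc_fst|exact: lc_snd].
  move=> [x g] /=; rewrite /K mulf_eq0 => /norP[/hrp h1 /hrw h2]; rewrite ge_max; apply/andP; split.
    apply: le_trans (mx' _ _); have -> : x = (g * (x^-1 * g)^-1)%g by rewrite invgM invgK mulVKg.
    by apply: le_trans (nmM _ _) _; apply: ler_pM; rewrite ?nm_ge0//; exact: hB.
  exact: le_trans h1 (mx _ _).
have CK' : Cc (fun z : prodspace gs gs => K' z.1 z.2).
  apply: (@CcI _ _ _ (Num.max rw (rp * B))).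
    apply: lcM; last by apply: (lc_comp (Cc_lc hw)); exact: lc_snd.
    by apply: (lc_comp (Cc_lc hp)); apply: lc_mulg; [exact: lc_fst|exact: lc_snd].
  move=> [x g] /=; rewrite /K' mulf_eq0 => /norP[/hrp h1 /hrw h2]; rewrite ge_max; apply/andP; split.
    apply: le_trans (mx' _ _); have -> : x = (x * g * g^-1)%g by rewrite mulgK.
    by apply: le_trans (nmM _ _) _; apply: ler_pM; rewrite ?nm_ge0//; exact: hB.
  exact: le_trans h2 (mx _ _).
have E g : psi g * L t (fun x => w (x^-1 * g)%g) = L t (K ^~ g).
  rewrite -(PFZ (hL t))//; exact: (@Cc_inv _ _ (fun x => w (x * g)%g) (Cc_tr g hw)).
have E' g : w g * L t (tr g psi) = L t (K' ^~ g).
  by rewrite -(PFZ (hL t)); [congr (L t); apply/funext => x; rewrite mulrC|exact: Cc_tr].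
split.
- by under eq_fun do rewrite E; apply: (@Cc2_int_r _ gs gs (fun g x => K x g) (Cc2_swap CK)).
- by under eq_fun do rewrite E'; apply: (@Cc2_int_r _ gs gs (fun g x => K' x g) (Cc2_swap CK')).
under eq_fun do rewrite E; under [in RHS]eq_fun do rewrite E'.
rewrite -(PF_fubini CK (hL t) hJ) -(PF_fubini CK' (hL t) hJ); congr (L t); apply/funext => x.
rewrite -[LHS](Jl x); last exact: (Cc2_l CK x).
by congr J; apply/funext => g; rewrite /tl /K mulKg.
Qed.

(** In [asym_fubini] with psi = kap, one side is close to J(kap) L(w of the inverse) because kap
    concentrates at 1, the other to L(kap) J(w) because L is almost invariant under the g in the
    support of w. *)
Lemma asym_kernel (w : gs -> R) (e : R) : Cc w -> 0 < e ->
  exists2 d0 : R, 0 < d0 & forall d, 0 < d -> d <= d0 -> exists T : R, forall t, T <= t ->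
  `|J (kap d) * L t (fun x => w (x^-1)%g) - L t (kap d) * J w| <= e * J (kap d).
Proof.
move=> hw e0; have [r hr] := uc_right hw.
have Cw : Cc ((fun x => w (x^-1)%g) : gs -> R) by exact: Cc_inv.
have Cu : Cc ((fun x => cutoff r (x^-1 : gs)%g) : gs -> R) by apply: Cc_inv; exact: Cc_cutoff.
have [C hC] := Lbd Cu.
have C0 : 0 < C + 1 by rewrite ltr_wpDl//; apply: le_trans (hC 0).
have e2 : 0 < e / 2 by rewrite divr_gt0.
have [d0 d00 hd0] := hr _ (divr_gt0 e2 C0); exists d0 => // d dp dd0.
have Ck := Cc_kap n d.
have Jk : 0 < J (kap d).
  apply: (J_gt0 hJ Jr Jnz Ck) => [g|]; first exact: kap_ge0.
  by instantiate (1 := 1%g); rewrite /kap dst_xx subr0 lt_max dp orbT.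
have [rw rw0 hrw] := Cc_supp hw.
have Ca := Cc_abs hw.
have Ja : 0 < J (fun x => `|w x|) + 1 by rewrite ltr_wpDl//; apply: hJ.2.
have e3 : 0 < e / 2 * J (kap d) / (J (fun x => `|w x|) + 1) by rewrite divr_gt0// mulr_gt0.
have [T hT] := asym_uniform rw Ck e3.
exists T => t Tt; have [C1 C2 E] := asym_fubini t Ck hw.
have -> : J (kap d) * L t (fun x => w (x^-1)%g) - L t (kap d) * J w =
  (J (fun g => w g * L t (tr g (kap d))) - L t (kap d) * J w) -
  (J (fun g => kap d g * L t (fun x => w (x^-1 * g)%g)) - J (kap d) * L t (fun x => w (x^-1)%g)).
  by rewrite E; ring.
rewrite [e]splitr mulrDl; apply: le_trans (ler_normB _ _) _; apply: lerD.
  rewrite -(PFZ hJ)// -(PFB hJ)//; last exact: CcZ.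
  rewrite -[leRHS](@divfK _ (J (fun x => `|w x|) + 1)) ?gt_eqF//.
  apply: (@le_trans _ _ (e / 2 * J (kap d) / (J (fun x => `|w x|) + 1) * J (fun x => `|w x|))); last first.
    by apply: ler_wpM2l; [exact: ltW|rewrite lerDl].
  apply: PF_le_bound => //; first by apply: CcB => //; exact: CcZ.
  move=> g; rewrite [_ * w g]mulrC -mulrBr normrM mulrC.
  have [->|w0] := eqVneq (w g) 0; first by rewrite normr0 !mulr0.
  by rewrite ler_wpM2r// hT// hrw.
rewrite [J (kap d) * _]mulrC -(PFZ hJ (L t (fun x => w (x^-1)%g)))// -(PFB hJ)//; last exact: CcZ.
apply: PF_le_bound => //; first by apply: CcB => //; exact: CcZ.
move=> g; rewrite [_ * kap d g]mulrC -mulrBr normrM ger0_norm ?kap_ge0// mulrC.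
have [->|k0] := eqVneq (kap d g) 0; first by rewrite !mulr0.
rewrite ler_wpM2r ?kap_ge0//.
have Cg : Cc ((fun x => w (x^-1 * g)%g) : gs -> R).
  exact: (@Cc_inv _ _ (fun x => w (x * g)%g) (Cc_tr g hw)).
rewrite -(PFB (hL t))//.
apply: (@le_trans _ _ (e / 2 / (C + 1) * L t (fun x => cutoff r (x^-1 : gs)%g))); last first.
  rewrite -[leRHS](@divfK _ (C + 1)) ?gt_eqF//; apply: ler_wpM2l; first by rewrite ltW// divr_gt0.
  by apply: le_trans (ler_norm _) _; apply: le_trans (hC t) _; rewrite lerDl.
apply: PF_le_bound => //; first exact: CcB.
by move=> x; apply: hd0; exact: lt_le_trans (kap_dst k0) dd0.
Qed.

(** The factor L(kap) is eliminated between two kernel estimates; the width of the bump is fixed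
    before t grows. *)
Lemma asym_unique (w1 w2 : gs -> R) (e : R) : Cc w1 -> Cc w2 -> 0 < e -> exists T : R, forall t, T <= t ->
  `|L t (fun x => w1 (x^-1)%g) * J w2 - L t (fun x => w2 (x^-1)%g) * J w1| <= e.
Proof.
move=> h1 h2 e0; pose D := `|J w1| + `|J w2| + 1.
have D0 : 0 < D by rewrite ltr_wpDl// addr_ge0.
have [d1 d10 H1] := asym_kernel h1 (divr_gt0 e0 D0).
have [d2 d20 H2] := asym_kernel h2 (divr_gt0 e0 D0).
have d0 : 0 < Num.min d1 d2 by rewrite lt_min d10.
have [T1 {}H1] : exists T : R, _ := H1 _ d0 ltac:(by rewrite ge_min lexx).
have [T2 {}H2] : exists T : R, _ := H2 _ d0 ltac:(by rewrite ge_min lexx orbT).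
exists (Num.max T1 T2) => t; rewrite ge_max => /andP[t1 t2].
move: (H1 t t1) (H2 t t2) => {}H1 {}H2.
set k := Num.min d1 d2 in d0 H1 H2.
have Jk : 0 < J (kap k).
  apply: (J_gt0 hJ Jr Jnz (Cc_kap n k)) => [g|]; first exact: kap_ge0.
  by instantiate (1 := 1%g); rewrite /kap dst_xx subr0 lt_max d0 orbT.
move: (L t (fun x => w1 _)) (L t (fun x => w2 _)) (L t (kap k)) (J (kap k)) Jk H1 H2.
move=> a1 a2 lk jk jk0 H1 H2.
rewrite -(ler_pM2l jk0) -{1}(gtr0_norm jk0) -normrM.
have -> : jk * (a1 * J w2 - a2 * J w1) = (jk * a1 - lk * J w1) * J w2 - (jk * a2 - lk * J w2) * J w1 by ring.
apply: le_trans (ler_normB _ _) _; rewrite !normrM.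
apply: (@le_trans _ _ (e / D * jk * `|J w2| + e / D * jk * `|J w1|)).
  by apply: lerD; apply: ler_wpM2r.
rewrite -mulrDr mulrAC mulrC ler_pM2l// -mulrA -[leRHS]mulr1 ler_pM2l//.
by rewrite mulrC ler_pdivrMr// mul1r /D; lra.
Qed.

End AsymptoticUniqueness.

(** * Horospherical averages *)

Section Diagonal.
Variables (R : realType) (m k : nat) (hm : (0 < m)%N) (hk : (0 < k)%N).
Local Notation n := (m + k)%N.

Lemma dst_sl (g h : slspace R n) : dst g h = nrm (val g - val h). Proof. by []. Qed.

Definition dv (t : R) : 'rV[R]_n :=
  row_mx (const_mx (t `^ m%:R^-1)) (const_mx (t `^ (- k%:R^-1))).

Lemma dvl t i : dv t 0 (lshift k i) = t `^ m%:R^-1.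
Proof. by rewrite row_mxEl mxE. Qed.

Lemma dvr t i : dv t 0 (rshift m i) = t `^ (- k%:R^-1).
Proof. by rewrite row_mxEr mxE. Qed.

Lemma dv_gt0 t : 0 < t -> forall i, 0 < dv t 0 i.
Proof. by move=> t0 i; case: (split_ordP i) => j ->; rewrite ?dvl ?dvr powR_gt0. Qed.

Lemma powR_root (x : R) p : (0 < p)%N -> 0 <= x -> (x `^ p%:R^-1) ^+ p = x.
Proof.
by move=> p0 x0; rewrite -powR_mulrn ?powR_ge0// -powRrM mulVf ?pnatr_eq0 -?lt0n// powRr1.
Qed.

Lemma powR_rootN (x : R) p : (0 < p)%N -> 0 <= x -> (x `^ (- p%:R^-1)) ^+ p = x^-1.
Proof. by move=> p0 x0; rewrite powRN exprVn powR_root. Qed.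

Lemma dv_prod t : 0 < t -> \prod_l dv t 0 l = 1.
Proof.
move=> t0; rewrite big_split_ord /=.
under eq_bigr do rewrite dvl; under [X in _ * X]eq_bigr do rewrite dvr.
by rewrite !prodr_const !card_ord powR_root ?powR_rootN ?mulfV ?gt_eqF// ltW.
Qed.

Definition dLb : pred 'I_n := fun i => (i < m)%N.

Lemma dLbl i : dLb (lshift k i) = true. Proof. by rewrite /dLb/= ltn_ord. Qed.

Lemma dLbr i : dLb (rshift m i) = false. Proof. by rewrite /dLb/= ltnNge leq_addr. Qed.

Definition ds (t : R) : R := t `^ (- k%:R^-1) / t `^ m%:R^-1.

Lemma dv_s t : 0 < t -> forall i j, dLb i -> ~~ dLb j -> dv t 0 j / dv t 0 i = ds t.
Proof.
move=> t0 i j; case: (split_ordP i) => i' ->; rewrite ?dLbr// => _.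
by case: (split_ordP j) => j' ->; rewrite ?dLbl// dvl dvr.
Qed.

Lemma ds_le1 t : 1 <= t -> 0 <= ds t <= 1.
Proof.
move=> t1; have t0 := lt_le_trans ltr01 t1; rewrite /ds divr_ge0 ?powR_ge0//=.
rewrite ler_pdivrMr ?powR_gt0// mul1r powRN.
apply: (@le_trans _ _ 1); first by rewrite invf_le1 ?powR_gt0// -[leLHS](powRr0 t) ler_powR// invr_ge0 ler0n.
by rewrite -[leLHS](powRr0 t) ler_powR// invr_ge0 ler0n.
Qed.

Lemma ds_cvg (e : R) : 0 < e -> exists2 T : R, 0 < T & forall t, T <= t -> `|ds t| < e.
Proof.
move=> e0; pose p : R := k%:R^-1 + m%:R^-1.
have p0 : 0 < p by rewrite addr_gt0// invr_gt0 ltr0n.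
have d0 : 0 < 2 / e by rewrite divr_gt0.
exists ((2 / e) `^ p^-1); first by rewrite powR_gt0.
move=> t Tt; have t0 : 0 < t by apply: lt_le_trans Tt; rewrite powR_gt0.
have -> : ds t = (t `^ p)^-1.
  by rewrite /ds /p powRD ?gt_eqF ?implybT// powRN invfM.
rewrite gtr0_norm ?invr_gt0 ?powR_gt0//.
have : 2 / e <= t `^ p.
  have d1 := ltW d0; have -> : 2 / e = (2 / e) `^ p^-1 `^ p by rewrite -powRrM mulVf ?powRr1// gt_eqF.
  by apply: ge0_ler_powR => //; rewrite ?nnegrE ?powR_ge0//; exact: ltW.
move=> h; rewrite invf_plt ?posrE ?powR_gt0//; apply: lt_le_trans h.
by rewrite -[ltLHS]mul1r ltr_pM2r ?invr_gt0// ltr1n.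
Qed.

Definition Dg (t : R) : slT R n := Dt dv t.

Lemma val_Dg t : 0 < t -> val (Dg t) = diag_mx (dv t).
Proof. by move=> t0; rewrite val_dgmx// dv_prod. Qed.

Lemma val_DgV t : 0 < t -> val ((Dg t)^-1)%g = diag_mx (\row_i (dv t 0 i)^-1).
Proof.
move=> t0; rewrite sl_valV.
have E : diag_mx (\row_i (dv t 0 i)^-1) *m val (Dg t) = 1%:M.
  rewrite val_Dg//; move: (dv t) (fun i => lt0r_neq0 (dv_gt0 t0 i)) => w hw.
  apply/matrixP => i j; rewrite mul_diag_mx !mxE.
  by case: eqVneq => [->|]; rewrite ?mulr0 ?mulr1n ?mulVf.
by rewrite -[LHS]mul1mx -E -mulmxA mulmxV ?mulmx1// sl_unit.
Qed.

Definition ub (u : 'M[R]_(k, m)) : slT R n := insubd (1%g : slT R n) (block_mx 1%:M 0 u 1%:M).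

Lemma val_ub u : val (ub u) = block_mx 1%:M 0 u 1%:M.
Proof. by rewrite /ub val_insubd det_lblock !det1 mulr1 eqxx. Qed.

Lemma ubD a b : ub (a + b) = (ub a * ub b)%g.
Proof.
apply: val_inj; rewrite sl_valM !val_ub mulmx_block.
by rewrite !mul1mx !mulmx1 !mul0mx !mulmx0 !addr0 add0r.
Qed.

Lemma ub0 : ub 0 = 1%g.
Proof. by apply: val_inj; rewrite val_ub sl_val1 -scalar_mx_block. Qed.

Lemma ubN a : ub (- a) = ((ub a)^-1)%g.
Proof. by apply: (mulIg (ub a)); rewrite -ubD addNr ub0 mulVg. Qed.

Lemma lc_ub (T : pspace R) (f : T -> matspace R k m) : lc f -> lc (fun x => ub (f x) : slspace R n).
Proof.
move=> lf; apply: lc_slI; apply: (@lc_ext _ _ _ (fun x => block_mx 1%:M 0 (f x) 1%:M : matspace R n n)).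
  by move=> x; rewrite val_ub.
apply: lc_mx => i j; case: (split_ordP i) => i' ->; case: (split_ordP j) => j' ->.
- by apply: lc_ext (lc_cst _ (1%:M i' j' : rspace R)) => x; rewrite block_mxEul.
- by apply: lc_ext (lc_cst _ (0 : rspace R)) => x; rewrite block_mxEur mxE.
- by apply: lc_ext (lc_mxE i' j' lf) => x; rewrite block_mxEdl.
- by apply: lc_ext (lc_cst _ (1%:M i' j' : rspace R)) => x; rewrite block_mxEdr.
Qed.

Lemma nrm_ub u : nrm (val (ub u) - 1%:M) = nrm u.
Proof.
rewrite val_ub (@scalar_mx_block _ m k) opp_block_mx add_block_mx !subrr !subr0.
rewrite /nrm big_split_ord /= big1 ?add0r => [|i _].
  apply: eq_bigr => i _; rewrite big_split_ord /= [X in _ + X]big1 ?addr0 => [|j _].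
    by apply: eq_bigr => j _; rewrite block_mxEdl.
  by rewrite block_mxEdr mxE normr0.
by rewrite big1// => j _; case: (split_ordP j) => j' ->; rewrite ?block_mxEul ?block_mxEur mxE normr0.
Qed.

Lemma Dg_ub t u : 0 < t -> (ub u * Dg t)%g = (Dg t * ub ((ds t)^-1 *: u))%g.
Proof.
move=> t0; apply: val_inj; rewrite !sl_valM val_Dg// !val_ub.
apply/matrixP => i j; rewrite mul_mx_diag mul_diag_mx [LHS]mxE [RHS]mxE.
have /negbTE a0 : t `^ m%:R^-1 != 0 by rewrite gt_eqF// powR_gt0.
have /negbTE b0 : t `^ (- k%:R^-1) != 0 by rewrite gt_eqF// powR_gt0.
case: (split_ordP i) => i' ->; case: (split_ordP j) => j' ->.
- by rewrite !block_mxEul !dvl mulrC.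
- by rewrite !block_mxEur !mxE mul0r mulr0.
- by rewrite !block_mxEdl dvl dvr mxE /ds; field; rewrite ?a0 ?b0.
- by rewrite !block_mxEdr !dvr mulrC.
Qed.

(** Conjugation fixes the diagonal blocks and multiplies the upper right block by ds t <= 1; the
    lower left block, which it would expand, is zero. *)
Lemma Dg_conj t (b : slspace R n) : 1 <= t -> dlsubmx (val b) = 0 ->
  dst ((Dg t)^-1 * b * Dg t : slspace R n)%g 1%g <= dst b 1%g.
Proof.
move=> t1 b0; have t0 : 0 < t := lt_le_trans ltr01 t1.
rewrite !dst_sl !sl_valM sl_val1 val_DgV// val_Dg//; apply: ler_sum => i _; apply: ler_sum => j _.
rewrite [X in `|X| <= _]mxE mul_mx_diag [X in `|X + _| <= _]mxE mul_diag_mx [X in `|X * _ + _| <= _]mxE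
  [X in `|X * _ * _ + _| <= _]mxE [X in _ <= `|X|]mxE.
set e := (- 1%:M) i j; rewrite -mulrA mulrC -mulrA.
have ne0 l : dv t 0 l != 0 by rewrite gt_eqF ?dv_gt0.
have [ij|ij] := boolP (dLb i == dLb j).
  suff -> : dv t 0 j / dv t 0 i = 1 by rewrite mulr1.
  rewrite -[RHS](mulfV (ne0 i)); congr (_ / _).
  move: ij; rewrite /dLb; case: (split_ordP i) => i' ->; case: (split_ordP j) => j' -> /=;
    by rewrite ?dvl ?dvr// ?ltn_ord ltnNge leq_addr.
have -> : e = 0.
  by rewrite /e !mxE; case: (i =P j) ij => [->|]; rewrite ?eqxx// mulr0n oppr0.
rewrite !addr0 normrM; case Li : (dLb i) ij; case Lj : (dLb j) => // _.
  rewrite dv_s ?Li ?Lj//; have /andP[s0 s1] := ds_le1 t1.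
  by rewrite (ger0_norm s0) ler_piMr.
have -> : val b i j = 0; last by rewrite normr0 mul0r.
move: Li Lj; case: (split_ordP i) => i' ->; rewrite ?dLbl//.
case: (split_ordP j) => j' ->; rewrite ?dLbr//.
by move=> _ _; have /matrixP/(_ i' j') := b0; rewrite !mxE.
Qed.

(** Block elimination: y = c a^-1 with a the upper left and c the lower left block of g, where a is
    invertible near the identity. *)
Lemma block_lu (e : R) : 0 < e -> exists2 d : R, 0 < d & forall g : slspace R n, dst g 1%g < d ->
  exists y, dlsubmx (val (ub (- y) * g)%g) = 0 /\ dst (ub (- y) * g : slspace R n)%g 1%g < e.
Proof.
move=> e0.
pose N : R := nm (1%g : slspace R n) + 1.
have lu : lc (fun x : slspace R n => ulsubmx (val x) : matspace R m m).
  by apply: lc_mx => i j; apply: lc_ext (lc_mxE (lshift k i) (lshift k j) (lc_val (@lc_id _ _))) => x; rewrite !mxE.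
have [[A hA] _] := lc_adj lu N.
have [_ /(_ 2^-1 ltac:(by rewrite invr_gt0 ltr0n))[d1 d10 hd1]] := lc_det lu N.
(* Bounds the inverse of a: its determinant is at least 1/2 and its adjugate has norm at most A. *)
pose C : R := 2 * (`|A| + 1).
have C0 : 0 < C by rewrite mulr_gt0// ltr_wpDl.
pose d := Num.min 1 (Num.min d1 (e / (2 * (C + N + C)))).
have N0 : 0 <= nm (1%g : slspace R n) by exact: nm_ge0.
have D0 : 0 < 2 * (C + N + C) by rewrite mulr_gt0// addr_gt0// addr_gt0// /N ltr_wpDl.
exists d; first by rewrite !lt_min ltr01 d10 divr_gt0.
move=> g; rewrite !lt_min => /and3P[gd1 gd2 gd3].
have gN : nm g <= N by apply: le_trans (nm_lip g 1%g) _; rewrite /N lerD2l ltW.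
have n1N : nm (1%g : slspace R n) <= N by rewrite /N lerDl.
pose a := ulsubmx (val g); pose c := dlsubmx (val g).
have da : 2^-1 <= \det a.
  have := hd1 g 1%g gN n1N gd2; rewrite sl_val1 (@scalar_mx_block _ m k) block_mxKul det1 /dst/=.
  by rewrite -/a ltr_norml => /andP[]; lra.
have da0 : \det a != 0 by rewrite gt_eqF//; lra.
have ua : a \in unitmx by rewrite unitmxE unitfE.
pose y := c *m invmx a.
have nc : nrm c <= dst g 1%g.
  rewrite dst_sl sl_val1 /nrm [leRHS]big_split_ord /=.
  apply: (@le_trans _ _ (\sum_i \sum_j `|(val g - 1%:M) (rshift m i) j|)); last first.
    by rewrite lerDr; apply: sumr_ge0 => i _; exact: sumr_ge0.
  apply: ler_sum => i _; rewrite big_split_ord /=.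
  apply: (@le_trans _ _ (\sum_j `|(val g - 1%:M) (rshift m i) (lshift k j)|)); last first.
    by rewrite lerDl; apply: sumr_ge0.
  apply: ler_sum => j _; rewrite !mxE eq_rlshift mulr0n oppr0 addr0//.
have ny : nrm y <= C * dst g 1%g.
  rewrite /y.
  have -> : invmx a = (\det a)^-1 *: \adj a by rewrite /invmx ua.
  rewrite -scalemxAr nrmZ ger0_norm ?invr_ge0 ?(le_trans _ da)//.
  rewrite /C -mulrA; apply: ler_pM; rewrite ?invr_ge0 ?nrm_ge0 ?(le_trans _ da)//.
    by rewrite -[leRHS]invrK lef_pV2// posrE ?invr_gt0// (lt_le_trans _ da)// invr_gt0.
  apply: le_trans (nrmM _ _) _; rewrite mulrC; apply: ler_pM; rewrite ?nrm_ge0//.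
  by apply: le_trans (hA g gN) _; apply: le_trans (ler_norm A) _; rewrite lerDl.
exists y; split.
  rewrite sl_valM val_ub -[val g]submxK mulmx_block block_mxKdl -/a -/c.
  by rewrite mul1mx mulNmx /y mulmxKV// addNr.
suff : dst (ub (- y) * g : slspace R n)%g 1%g <= e / 2 by move=> /le_lt_trans; apply; lra.
have dd : (C + N + C) * dst g 1%g <= e / 2.
  by move: gd3; rewrite ltr_pdivlMr// => /ltW h; lra.
apply: le_trans dd; apply: le_trans (dst_tri (ub (- y) : slspace R n) _ _) _.
have d0' := dst_ge0 g (1%g : slspace R n).
have h1 : dst (ub (- y) : slspace R n) 1%g <= C * dst g 1%g by rewrite dst_sl sl_val1 nrm_ub nrmN.
have h2 : dst (ub (- y) * g : slspace R n)%g (ub (- y)) <= (N + C) * dst g 1%g.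
  rewrite -{2}[ub (- y)]mulg1; apply: le_trans (dstMl _ _ _) _; apply: ler_wpM2r => //.
  apply: le_trans (nm_lip (ub (- y) : slspace R n) 1%g) _.
  apply: lerD => //; apply: le_trans h1 _; rewrite -[leRHS]mulr1 ler_pM2l//; exact: ltW.
lra.
Qed.

End Diagonal.

(** * Integration over the torus of matrices modulo integral matrices *)

Section UnitPartition.
Variables (R : realType) (p q : nat).
Local Notation V := (matspace R p q).

Lemma shift_locfin (f : V -> R) : Cc f -> locfin setT (fun z (x : V) => f (x + zr R z)).
Proof.
move=> /Cc_supp[r r0 hr] r1; apply: sub_finite_set (@finite_zr R p q (r + r1)).
move=> z [_ [x xr /hr h]] /=; have -> : zr R z = (x + zr R z) - x by rewrite addrC addKr.
by apply: le_trans (nrmD _ _) _; rewrite nrmN; exact: lerD.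
Qed.

Lemma shift_lc (f : V -> R) z : Cc f -> lc (fun x : V => f (x + zr R z) : rspace R).
Proof. by move=> hf; apply: Cc_lc; exact: Cc_shift. Qed.

(** Its ball contains the unit cube, so the integral translates sum to at least 1. The quotient
    [chi] has translates summing to 1, and Iv(chi a) is the torus integral of a periodic a. *)
Definition chi0 : V -> R := cutoff (p * q)%:R.
Definition chiS (x : V) : R := \sum_(z \in [set: 'M[int]_(p, q)]) chi0 (x + zr R z).
Definition chi (x : V) : R := (chiS x)^-1 * chi0 x.

Lemma chiS_ge1 x : 1 <= chiS x.
Proof.
have C0 : Cc chi0 by exact: Cc_cutoff.
pose z : 'M[int]_(p, q) := \matrix_(i, j) - Num.floor (x i j).
have -> : 1 = chi0 (x + zr R z).
  rewrite /chi0 cutoff1// /nm/= -[leRHS]mulr1; apply: nrm_le => i j.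
  rewrite !mxE intrN ger0_norm ?subr_ge0 ?floor_le//.
  by have := floorD1_gt (x i j); rewrite intrD => /ltW; rewrite lerBlDl.
apply: (@fsum_ge_term _ _ setT (fun z => chi0 (x + zr R z))) => // [|y _].
  exact: (lfs_fsupp (shift_locfin C0)).
exact: cutoff_ge0.
Qed.

Lemma chiS_shift x z : chiS (x + zr R z) = chiS x.
Proof.
rewrite /chiS [RHS](reindex_fsbig (fun a => z + a) setT); last first.
  split=> [a _|a b _ _ /addrI//|a _]; first by [].
  by exists (a - z) => //; rewrite addrC subrK.
by apply: eq_fsbigr => a _; rewrite zrD addrA.
Qed.

Lemma Cc_chi : Cc chi.
Proof.
have C0 : Cc chi0 by exact: Cc_cutoff.
apply: CcM => //; apply: (@lcV _ _ 1) => // [|]; first exact: chiS_ge1.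
by apply: (lfs_lc (shift_locfin C0)) => z; exact: shift_lc.
Qed.

Lemma chi_ge0 x : 0 <= chi x.
Proof.
by apply: mulr_ge0; [rewrite invr_ge0 (le_trans ler01)// chiS_ge1|exact: cutoff_ge0].
Qed.

Lemma chi_sum x : \sum_(z \in [set: 'M[int]_(p, q)]) chi (x + zr R z) = 1.
Proof.
rewrite (eq_fsbigr (fun z => (chiS x)^-1 * chi0 (x + zr R z))); last first.
  by move=> z _; rewrite /chi chiS_shift.
by rewrite -mulr_fsumr mulVf// gt_eqF// (lt_le_trans ltr01)// chiS_ge1.
Qed.

Local Notation Iv := (@Iv R p q).

Lemma Iv_chi_sum (w : V -> R) : Cc w ->
  fsupp setT (fun z : 'M[int]_(p, q) => Iv (fun x => w x * chi (x + zr R z))) /\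
  \sum_(z \in [set: 'M[int]_(p, q)]) Iv (fun x => w x * chi (x + zr R z)) = Iv w.
Proof.
move=> hw; have [h E] := lfs_PF (shift_locfin Cc_chi) (fun z => shift_lc z Cc_chi) (@Iv_PF R p q) hw.
split=> //; rewrite -E; congr Iv; apply/funext => x.
by rewrite chi_sum mulr1.
Qed.

(** Translation invariance on the torus: the partition of unity built from the translated weight is
    inserted next to chi, and integral translations exchange the two weights. *)
Lemma Iv_chi_shift (a : V -> R) (y : V) : lc (a : V -> rspace R) ->
  (forall x z, a (x + zr R z) = a x) ->
  Iv (fun x => chi (x + y) * a x) = Iv (fun x => chi x * a x).
Proof.
move=> la ap.
have C1 : Cc (fun x : V => chi (x + y) * a x).
  by have := CcM la (Cc_shift y Cc_chi); congr Cc; apply/funext => x; rewrite mulrC.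
have C2 : Cc (fun x : V => chi x * a x).
  by have := CcM la Cc_chi; congr Cc; apply/funext => x; rewrite mulrC.
have Cs z : Cc (fun x : V => chi (x + zr R z)) by apply: Cc_shift; exact: Cc_chi.
rewrite -(Iv_chi_sum C1).2.
have [_ E] := lfs_PF (shift_locfin (Cc_shift y Cc_chi)) (fun z => shift_lc z (Cc_shift y Cc_chi)) (@Iv_PF R p q) C2.
have -> : (fun x => chi x * a x) = (fun x => chi x * a x * \sum_(z \in [set: 'M[int]_(p, q)]) chi (x + zr R z + y)).
  apply/funext => x; under eq_fsbigr do rewrite addrAC.
  by rewrite chi_sum mulr1.
rewrite E [RHS](reindex_fsbig (fun z => - z) setT); last first.
  by split=> // [a1 a2 _ _ /oppr_inj//|z _]; exists (- z) => //; rewrite opprK.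
apply: eq_fsbigr => z _; rewrite -(Iv_shift (- zr R z)).
  congr Iv; apply/funext => x.
  have -> : zr R (- z) = - zr R z by rewrite /zr map_mxN.
  rewrite subrK.
  have -> : a (x - zr R z) = a x by rewrite -{2}(subrK (zr R z) x) ap.
  by rewrite [RHS]mulrC [chi x * a x]mulrC mulrA.
have := CcM (Cc_lc (Cs z)) C1; congr Cc; apply/funext => x; exact: mulrC.
Qed.

Lemma Iv_chi_norm : exists2 C : R, 0 <= C & forall (f : V -> R) (e : R), lc (f : V -> rspace R) ->
  (forall x, `|f x| <= e) -> `|Iv (fun x => chi x * f x)| <= e * C.
Proof.
exists (Iv chi); first by apply: (@Iv_PF R p q).2; [exact: Cc_chi|exact: chi_ge0].
move=> f e lf fe; apply: PF_le_bound; [exact: Iv_PF| |exact: Cc_chi|].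
  by have := CcM lf Cc_chi; congr Cc; apply/funext => x; rewrite mulrC.
by move=> x; rewrite normrM (ger0_norm (chi_ge0 x)) mulrC ler_wpM2r// chi_ge0.
Qed.

End UnitPartition.

(** * Thickening of closed horospheres *)

Section Thickening.
Variables (R : realType) (m k : nat) (hm : (0 < m)%N) (hk : (0 < k)%N).
Local Notation n := (m + k)%N.
Local Notation gs := (slspace R n).
Local Notation V := (matspace R k m).
Local Notation Iv := (@Iv R k m).
Local Notation chi := (@chi R k m).

(** The modulus is uniform over all of G: [per_bnd] controls the periodisation of the difference
    through its sup norm and support radius alone. *)
Lemma per_uc (psi : gs -> R) (e : R) : Cc psi -> 0 < e -> exists2 d : R, 0 < d &
  forall g x : gs, dst g 1%g < d -> `|per psi (x * g)%g - per psi x| <= e.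
Proof.
move=> hp e0; have [r hr] := uc_right hp.
have [C C0 hC] := @per_bnd R n (r + 1).
have C1 : 0 < C + 1 by rewrite ltr_wpDl.
have [d d0 hd] := hr _ (divr_gt0 e0 C1); exists d => // g x gd.
have hg : Cc (tr g psi : gs -> R) by exact: Cc_tr.
have -> : per psi (x * g)%g - per psi x = per (fun y => tr g psi y - psi y) x.
  rewrite -[per psi (x * g)%g]/(tr g (per psi) x) -per_tr.
  have -> : (fun y => tr g psi y - psi y) = (fun y => tr g psi y + -1 * psi y).
    by apply/funext => y; rewrite mulN1r.
  by rewrite perD ?perZ ?mulN1r//; exact: CcZ.
apply: (@le_trans _ _ (e / (C + 1) * C)); last first.
  by rewrite mulrAC ler_pdivrMr// ler_pM2l// lerDl.
apply: hC; first exact: CcB.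
  move=> y yr; apply/eqP; rewrite -normr_le0; apply: le_trans (hd g y gd) _.
  by rewrite cutoff0 ?mulr0// ltW.
move=> y; apply: le_trans (hd g y gd) _.
by rewrite ler_piMr ?cutoff_le1// ltW// divr_gt0.
Qed.

Lemma Gam_ub (z : 'M[int]_(k, m)) : Gam (ub (zr R z)).
Proof.
exists (block_mx 1%:M 0 z 1%:M); rewrite val_ub map_block_mx !map_mx1 map_mx0//.
Qed.

Lemma lc_ubg (f : gs -> R) (g : gs) : lc (f : gs -> rspace R) ->
  lc (fun u : V => f (ub (- u) * g)%g : rspace R).
Proof.
move=> lf; apply: (@lc_comp _ _ _ _ f (fun u : V => (ub (- u) * g)%g : gs)) => //.
apply: lc_mulg; last exact: lc_cst.
apply: lc_ub; apply: (@lc_ext _ _ _ (fun u : V => -1 *: u)); first by move=> u; rewrite scaleN1r.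
by apply: lc_scalemx; [exact: lc_cst|exact: lc_id].
Qed.

Definition av (f : gs -> R) (g : gs) : R := Iv (fun u => chi u * f (ub (- u) * g)%g).

(** On a Gam-invariant f, left translation by ub y acts as a translation of the torus. *)
Lemma av_ub (f : gs -> R) (y : V) (g : gs) : lc (f : gs -> rspace R) ->
  (forall c g, Gam c -> f (c * g)%g = f g) -> av f (ub y * g)%g = av f g.
Proof.
move=> lf fi; pose a (u : V) := f (ub (- u) * g)%g.
have la : lc (a : V -> rspace R) by exact: lc_ubg.
have ap x z : a (x + zr R z) = a x.
  rewrite /a opprD addrC ubD -mulgA [ub (- zr R z)]ubN.
  by apply: fi; apply: GamV; exact: Gam_ub.
rewrite -[RHS](Iv_chi_shift y la ap) /av.
rewrite -[LHS](Iv_shift y).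
  congr Iv; apply/funext => u; rewrite /a mulgA -ubD; congr (_ * f (ub _ * _)%g).
  by rewrite opprD addrNK.
have lb := lc_ubg (ub y * g)%g lf.
by have := CcM lb (@Cc_chi R k m); congr Cc; apply/funext => x; rewrite mulrC.
Qed.

Variable J : (gs -> R) -> R.
Hypotheses (hJ : PF J) (Jr : rinv J).
Hypothesis Jnz : exists2 w, Cc w & J w != 0.
Let Jl := J_left hJ Jr Jnz.

(* The average of the bump [kap d] over the horosphere: pairing with it thickens the horosphere. *)
Definition kat (d : R) (g : gs) : R := Iv (fun u => chi u * kap d (ub u * g : gs)%g).

Lemma Cc_katK d : Cc (fun z : prodspace gs V => chi z.2 * kap d (ub z.2 * z.1 : gs)%g).
Proof.
have [r r0 hr] := Cc_supp (Cc_kap n d); have [r1 r10 hr1] := Cc_supp (@Cc_chi R k m).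
have lu : lc (fun u : V => (ub u)^-1%g : gs) by apply: lc_invg; apply: lc_ub; exact: lc_id.
have [[B hB] _] := lu r1.
apply: (@CcI _ _ _ (Num.max (`|B| * r) r1)).
  apply: lcM; first by apply: (lc_comp (Cc_lc (@Cc_chi R k m))); exact: lc_snd.
  apply: (lc_comp (Cc_lc (Cc_kap n d))); apply: lc_mulg; last exact: lc_fst.
  by apply: lc_ub; exact: lc_snd.
move=> [g u] /=; rewrite mulf_eq0 => /norP[/hr1 h1 /hr h2]; rewrite ge_max !le_max h1 orbT andbT.
apply/orP; left; rewrite -[g](mulKg (ub u)); apply: le_trans (nmM _ _) _.
apply: ler_pM; rewrite ?nm_ge0//; apply: le_trans (ler_norm _); exact: hB.
Qed.

Lemma Cc_kat d : Cc (kat d).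
Proof.
exact: (@Cc2_int_r _ gs V (fun g u => chi u * kap d (ub u * g : gs)%g) (Cc_katK d) _ (@Iv_PF R k m)).
Qed.

Lemma kat_ge0 d g : 0 <= kat d g.
Proof.
apply: (@Iv_PF R k m).2; last by move=> u; rewrite mulr_ge0 ?chi_ge0 ?kap_ge0.
exact: (@Cc2_l _ gs V (fun g u => chi u * kap d (ub u * g : gs)%g) (Cc_katK d) g).
Qed.

Lemma kat_unfold d (f : gs -> R) : lc (f : gs -> rspace R) ->
  Cc (fun g => kap d g * av f g) /\ J (fun g => kat d g * f g) = J (fun g => kap d g * av f g).
Proof.
move=> lf.
pose K (g : gs) (u : V) := chi u * kap d (ub u * g : gs)%g * f g.
pose K' (g : gs) (u : V) := kap d g * (chi u * f (ub (- u) * g)%g).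
have CK : Cc (fun z : prodspace gs V => K z.1 z.2).
  have := CcM (lc_comp lf (@lc_fst _ gs V)) (Cc_katK d).
  by congr Cc; apply/funext => z; rewrite mulrC.
have CK' : Cc (fun z : prodspace gs V => K' z.1 z.2).
  have [r r0 hr] := Cc_supp (Cc_kap n d); have [r1 r10 hr1] := Cc_supp (@Cc_chi R k m).
  apply: (@CcI _ _ _ (Num.max r r1)); last first.
    move=> [g u] /=; rewrite /K' mulf_eq0 => /norP[/hr h1]; rewrite mulf_eq0 => /norP[/hr1 h2 _].
    by rewrite ge_max !le_max h1 h2 orbT.
  apply: lcM; first by apply: (lc_comp (Cc_lc (Cc_kap n d))); exact: lc_fst.
  apply: lcM; first by apply: (lc_comp (Cc_lc (@Cc_chi R k m))); exact: lc_snd.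
  apply: (lc_comp lf); apply: lc_mulg; last exact: lc_fst.
  apply: lc_ub; apply: (@lc_ext _ _ _ (fun z : prodspace gs V => -1 *: z.2)).
    by move=> z; rewrite scaleN1r.
  by apply: lc_scalemx; [exact: lc_cst|exact: lc_snd].
have Cav g : Cc (fun u : V => chi u * f (ub (- u) * g)%g).
  by have := CcM (lc_ubg g lf) (@Cc_chi R k m); congr Cc; apply/funext => x; rewrite mulrC.
have E' g : kap d g * av f g = Iv (K' g) by rewrite /av -(PFZ (@Iv_PF R k m)).
have E g : kat d g * f g = Iv (K g).
  rewrite /kat mulrC -(PFZ (@Iv_PF R k m)); last exact: (@Cc2_l _ gs V (fun g u => chi u * kap d (ub u * g : gs)%g) (Cc_katK d) g).
  by congr Iv; apply/funext => u; rewrite /K mulrC.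
split; first by under eq_fun do rewrite E'; exact: (@Cc2_int_r _ gs V K' CK' _ (@Iv_PF R k m)).
under eq_fun do rewrite E; under [in RHS]eq_fun do rewrite E'.
rewrite (PF_fubini CK hJ (@Iv_PF R k m)) (PF_fubini CK' hJ (@Iv_PF R k m)); congr Iv; apply/funext => u.
rewrite -[LHS](Jl (ub (- u))); last exact: (Cc2_r CK u).
by congr J; apply/funext => g; rewrite /tl /K /K' mulgA -ubD subrr ub0 mul1g; ring.
Qed.

(** The sign of u suits functions of x^-1: for psi x = w (x^-1), the term of c is w (D_t^-1 ub u
    c^-1). *)
Definition eT (t : R) (psi : gs -> R) : R := Iv (fun u => chi u * per psi (ub (- u) * Dg m k t)%g).

(** A point g near 1 is ub y times a block upper triangular b near 1. The average ignores ub y, and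
    D_t^-1 b D_t stays near 1 for all t >= 1, so the error does not depend on t. *)
Lemma thickening (psi : gs -> R) (e : R) : Cc psi -> 0 < e -> exists2 d0 : R, 0 < d0 &
  forall d, 0 < d -> d <= d0 -> forall t, 1 <= t ->
  `|J (kap d) * eT t psi - ip J (kat d) (tr (Dg m k t) psi)| <= e * J (kap d).
Proof.
move=> hp e0; have [C C0 hC] := @Iv_chi_norm R k m.
have C1 : 0 < C + 1 by rewrite ltr_wpDl.
have [de de0 hde] := per_uc hp (divr_gt0 e0 C1).
have [d0 d00 hd0] := @block_lu R m k _ de0.
exists d0 => // d dp dd0 t t1.
have ht : Cc (tr (Dg m k t) psi : gs -> R) by exact: Cc_tr.
set f := per (tr (Dg m k t) psi).
have lf : lc (f : gs -> rspace R) by exact: per_lc.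
have fi c g : Gam c -> f (c * g)%g = f g by move=> Gc; exact: per_inv.
have [Ck Ek] := kat_unfold d lf.
have Cf g : Cc (fun u : V => chi u * f (ub (- u) * g)%g).
  by have := CcM (lc_ubg g lf) (@Cc_chi R k m); congr Cc; apply/funext => x; rewrite mulrC.
rewrite /ip -/f Ek.
have -> : eT t psi = av f 1%g.
  by congr Iv; apply/funext => u; rewrite /f per_tr /tr mulg1.
rewrite mulrC -(PFZ hJ (av f 1%g)); last exact: Cc_kap.
rewrite -(PFB hJ)//; last by apply: CcZ; exact: Cc_kap.
apply: PF_le_bound => //; [|exact: Cc_kap|].
  by apply: CcB => //; apply: CcZ; exact: Cc_kap.
move=> g; rewrite mulrC -mulrBr normrM mulrC (ger0_norm (kap_ge0 _ _)).
have [->|k0] := eqVneq (kap d g) 0; first by rewrite !mulr0.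
rewrite ler_wpM2r ?kap_ge0//.
have [y [b0 bd]] := hd0 g (lt_le_trans (kap_dst k0) dd0).
set b := (ub (- y) * g)%g in b0 bd.
have -> : g = (ub y * b)%g by rewrite /b ubN mulVKg.
rewrite av_ub// /av -(PFB (@Iv_PF R k m))//.
apply: (@le_trans _ _ (e / (C + 1) * C)); last first.
  by rewrite mulrAC ler_pdivrMr// ler_pM2l// lerDl.
have -> : (fun x => chi x * f (ub (- x) * 1)%g - chi x * f (ub (- x) * b)%g) =
  (fun x => chi x * (f (ub (- x) * 1)%g - f (ub (- x) * b)%g)).
  by apply/funext => x; rewrite mulrBr.
apply: hC; first by apply: lcB; exact: lc_ubg.
move=> u; rewrite distrC /f per_tr /tr mulg1.
have -> : (ub (- u) * b * Dg m k t = ub (- u) * Dg m k t * ((Dg m k t)^-1 * b * Dg m k t))%g.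
  by rewrite !mulgA mulgK.
by apply: hde; apply: le_lt_trans bd; exact: Dg_conj.
Qed.

(** Induction over products of elementary matrices, with psi generalised because the right factor of
    a product is absorbed into it. *)
Lemma mixing_all (chi psi : gs -> R) h : Cc chi -> Cc psi -> forall e : R, 0 < e ->
  exists T : R, forall t, T <= t ->
  `|ip J chi (tr (Dg m k t * h)%g psi) - ip J chi (tr (Dg m k t) psi)| <= e.
Proof.
move=> hc hp; move: psi hp; apply: (@sl_gen _ _ (fun h => forall psi, Cc psi -> _)) h.
- by move=> psi hp e e0; exists 0 => t _; rewrite mulg1 subrr normr0 ltW.
- move=> a b ha hb psi hp e e0; have e2 : 0 < e / 2 by rewrite divr_gt0.
  have [T1 h1] := ha (tr b psi) (Cc_tr b hp) _ e2.
  have [T2 h2] := hb psi hp _ e2.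
  exists (Num.max T1 T2) => t; rewrite ge_max => /andP[t1 t2].
  have := h1 t t1; have := h2 t t2; rewrite mulgA !trM.
  set x := ip _ _ _; set y := ip _ _ _; set z := ip _ _ _ => A B.
  have -> : z - y = (z - x) + (x - y) by rewrite addrA subrK.
  by rewrite [e]splitr; apply: le_trans (ler_normD _ _) _; apply: lerD.
- move=> i j x ij psi hp e e0.
  exact: (mixing_elt hJ Jr Jnz (dv_prod hm hk) (@dv_gt0 R m k) (@dv_s R m k)
    (ds_cvg hm hk) (dLbl k (Ordinal hm)) (negbT (dLbr m (Ordinal hk))) x ij hc hp e0).
Qed.

(** [asym_unique] for the pairing of [kat d] with R_{D_t} psi, which is asymptotically
    right-invariant by mixing. The width d comes first, so that thickening costs e/2 at every t. *)
Theorem eT_asym (w1 w2 : gs -> R) (e : R) : Cc w1 -> Cc w2 -> 0 < e -> exists T : R, forall t, T <= t ->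
  `|eT t (fun x => w1 (x^-1)%g) * J w2 - eT t (fun x => w2 (x^-1)%g) * J w1| <= e.
Proof.
move=> h1 h2 e0; pose D := `|J w1| + `|J w2| + 1.
have D0 : 0 < D by rewrite ltr_wpDl// addr_ge0.
have e1 : 0 < e / 2 / D by rewrite !divr_gt0.
have [d1 d10 H1] := thickening (Cc_inv h1) e1.
have [d2 d20 H2] := thickening (Cc_inv h2) e1.
pose d := Num.min d1 d2.
have d0 : 0 < d by rewrite lt_min d10.
have {}H1 := H1 d d0 ltac:(by rewrite ge_min lexx).
have {}H2 := H2 d d0 ltac:(by rewrite ge_min lexx orbT).
have Jk : 0 < J (kap d).
  apply: (J_gt0 hJ Jr Jnz (Cc_kap n d)) => [g|]; first exact: kap_ge0.
  by instantiate (1 := 1%g); rewrite /kap dst_xx subr0 lt_max d0 orbT.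
pose L t psi := ip J (kat d) (tr (Dg m k t) psi).
have hL t : PF (L t).
  split=> [c f g hf hg|f hf f0].
    rewrite /L -(ipZr hJ Jr Jnz c (Cc_tr (Dg m k t) hf) (Cc_kat d)).
    rewrite -(ipDr hJ Jr Jnz (CcZ c (Cc_tr (Dg m k t) hf)) (Cc_tr _ hg) (Cc_kat d)).
    by congr ip.
  apply: hJ.2; first by apply: Cc_ip; [exact: Cc_kat|exact: Cc_tr].
  move=> g; apply: mulr_ge0; first exact: kat_ge0.
  by apply: fsum_ge0 => c _; exact: f0.
have Lbd w : Cc w -> exists C : R, forall t, `|L t w| <= C.
  move=> hw; have [r hr] := hw.2; have [b b0 hb] := Cc_bd hw.
  have [C1 C10 hC1] := @per_bnd R n r.
  exists (b * C1 * J (kat d)) => t; rewrite /L /ip; apply: PF_le_bound => //.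
  - by apply: Cc_ip; [exact: Cc_kat|exact: Cc_tr].
  - exact: Cc_kat.
  move=> g; rewrite normrM (ger0_norm (kat_ge0 _ _)) mulrC ler_wpM2r ?kat_ge0//.
  by rewrite per_tr; exact: hC1.
have Linv h w (e' : R) : Cc w -> 0 < e' -> exists T : R, forall t, T <= t -> `|L t (tr h w) - L t w| <= e'.
  move=> hw e'0; have [T hT] := mixing_all h (Cc_kat d) hw e'0; exists T => t Tt.
  by rewrite /L -trM; exact: hT.
have e2 : 0 < e / 2 * J (kap d) by rewrite mulr_gt0// divr_gt0.
have [T hT] := asym_unique hJ Jr Jnz hL Lbd Linv h1 h2 e2.
exists (Num.max 1 T) => t; rewrite ge_max => /andP[t1 tT].
move: (hT t tT) (H1 t t1) (H2 t t1) => {}hT {}H1 {}H2; rewrite -/(L t (fun x => w1 (x^-1)%g)) in H1; rewrite -/(L t (fun x => w2 (x^-1)%g)) in H2.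
move: (L t (fun x => w1 _)) (L t (fun x => w2 _)) (eT t (fun x => w1 _)) (eT t (fun x => w2 _)) (J (kap d)) Jk H1 H2 hT => l1 l2 a1 a2 jk jk0 H1 H2 hT.
rewrite -(ler_pM2l jk0) -{1}(gtr0_norm jk0) -normrM.
have -> : jk * (a1 * J w2 - a2 * J w1) =
   (jk * a1 - l1) * J w2 - (jk * a2 - l2) * J w1 + (l1 * J w2 - l2 * J w1) by ring.
rewrite [in leRHS](splitr e) mulrDr [jk * (e / 2)]mulrC.
apply: le_trans (ler_normD _ _) _; apply: lerD => //.
apply: le_trans (ler_normB _ _) _; rewrite !normrM.
apply: (@le_trans _ _ (e / 2 / D * jk * `|J w2| + e / 2 / D * jk * `|J w1|)).
  by apply: lerD; apply: ler_wpM2r.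
rewrite -mulrDr mulrAC ler_pM2r// -[leRHS](divfK (lt0r_neq0 D0)).
by apply: ler_wpM2l; [exact: ltW|rewrite /D; lra].
Qed.

End Thickening.

(** * Unfolding *)

Section HOperator.
Variables (R : realType) (m k : nat).
Local Notation n := (m + k)%N.
Local Notation gs := (slspace R n).
Local Notation G := (slT R n).
Local Notation V := (matspace R k m).
Local Notation Iv := (@Iv R k m).
Local Notation chi := (@chi R k m).

Lemma nrm_block (A : 'M[R]_n) : nrm A =
  nrm (ulsubmx A) + nrm (ursubmx A) + nrm (dlsubmx A) + nrm (drsubmx A).
Proof.
rewrite /nrm big_split_ord /= -addrA; congr (_ + _).
  rewrite -big_split /=; apply: eq_bigr => i _; rewrite big_split_ord /=.
  by congr (_ + _); apply: eq_bigr => j _; rewrite !mxE.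
rewrite -big_split /=; apply: eq_bigr => i _; rewrite big_split_ord /=.
by congr (_ + _); apply: eq_bigr => j _; rewrite !mxE.
Qed.

(** Basis vectors are rows, so H is block lower triangular and acts on the left: its elements are
    the products ub y * h with h in [GamH]. *)
Definition GamH : set G := [set g | [/\ Gam g, ursubmx (val g) = 0 & dlsubmx (val g) = 0]].

Lemma bdiag_eq (g : G) : ursubmx (val g) = 0 -> dlsubmx (val g) = 0 ->
  val g = block_mx (ulsubmx (val g)) 0 0 (drsubmx (val g)).
Proof. by move=> h1 h2; rewrite -[LHS]submxK h1 h2. Qed.

Lemma GamH1 : GamH 1%g.
Proof.
split; first exact: Gam1.
  by rewrite sl_val1 (@scalar_mx_block _ m k) block_mxKur.
by rewrite sl_val1 (@scalar_mx_block _ m k) block_mxKdl.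
Qed.

Lemma GamHM a b : GamH a -> GamH b -> GamH (a * b)%g.
Proof.
move=> [Ga a1 a2] [Gb b1 b2]; split; first exact: GamM.
  by rewrite sl_valM (bdiag_eq a1 a2) (bdiag_eq b1 b2) mulmx_block block_mxKur !mulmx0 !mul0mx addr0.
by rewrite sl_valM (bdiag_eq a1 a2) (bdiag_eq b1 b2) mulmx_block block_mxKdl !mulmx0 !mul0mx addr0.
Qed.

Lemma bdiag_unit (g : G) : ursubmx (val g) = 0 -> ulsubmx (val g) \in unitmx /\ drsubmx (val g) \in unitmx.
Proof.
move=> h; have := sl_det g; rewrite -{1}[val g]submxK h det_lblock => d.
rewrite !unitmxE !unitfE; split; apply/eqP => z; move: d => /eqP;
  by rewrite z ?mul0r ?mulr0 eq_sym oner_eq0.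
Qed.

Lemma GamHV a : GamH a -> GamH (a^-1)%g.
Proof.
move=> [Ga a1 a2]; have [u1 u2] := bdiag_unit a1.
have : val (a^-1 * a)%g = block_mx 1%:M 0 0 1%:M by rewrite mulVg sl_val1 -scalar_mx_block.
rewrite sl_valM (bdiag_eq a1 a2) -[val (a^-1)%g]submxK mulmx_block !mulmx0 !addr0 !add0r.
move=> /eq_block_mx[_ e1 e2 _]; split; first exact: GamV.
  by rewrite -[LHS](mulmxK u2) e1 mul0mx.
by rewrite -[LHS](mulmxK u1) e2 mul0mx.
Qed.

Lemma GamH_ub h y : GamH h -> exists y', (h * ub y = ub y' * h)%g.
Proof.
move=> [Ga a1 a2]; have [u1 u2] := bdiag_unit a1.
exists (drsubmx (val h) *m y *m invmx (ulsubmx (val h))); apply: val_inj.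
rewrite !sl_valM !val_ub (bdiag_eq a1 a2) !mulmx_block !mulmx0 !mul0mx !mulmx1 !mul1mx !addr0 !add0r.
by rewrite block_mxKdr block_mxKul mulmxKV.
Qed.

Definition Hinv (F : G -> R) := (forall y g, F (ub y * g)%g = F g) /\
  (forall h g, GamH h -> F (h * g)%g = F g).

Definition Vop (w : gs -> R) (g : gs) : R := Iv (fun u => w (ub u * g)%g).

Lemma ub_bound (u : V) (g : gs) : nm u <= nm (ub u * g : gs)%g * nm (g^-1 : gs)%g.
Proof.
apply: le_trans (nmM _ _); rewrite mulgK /nm/= nrm_block val_ub block_mxKdl.
by rewrite addrAC lerDr !addr_ge0// nrm_ge0.
Qed.

Lemma Cc_Vop (w : gs -> R) g : Cc w -> Cc (fun u : V => w (ub u * g)%g).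
Proof.
move=> hw; have [r r0 hr] := Cc_supp hw; apply: (@CcI _ _ _ (r * nm (g^-1 : gs)%g)).
  apply: (lc_comp (Cc_lc hw)); apply: lc_mulg; last exact: lc_cst.
  by apply: lc_ub; exact: lc_id.
move=> u /hr h; apply: le_trans (ub_bound u g) _.
by apply: ler_wpM2r => //; exact: nm_ge0.
Qed.

Lemma Vop_ub w y g : Cc w -> Vop w (ub y * g)%g = Vop w g.
Proof.
move=> hw; rewrite -[RHS](Iv_shift y); last exact: Cc_Vop.
by congr Iv; apply/funext => u; rewrite ubD mulgA.
Qed.

Lemma Vop_ex w g : Cc w -> Vop w g != 0 -> exists u, w (ub u * g)%g != 0.
Proof.
move=> hw h; apply: contrapT => nu; move: h; rewrite /Vop (_ : (fun u => _) = (fun=> 0)).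
  by rewrite (PF0 (@Iv_PF R k m)) eqxx.
by apply/funext => u; apply/eqP; apply: contrapT => /negP h; apply: nu; exists u.
Qed.

Lemma Vop_lc w : Cc w -> lc (Vop w : gs -> rspace R).
Proof.
move=> hw; apply: lc_local => r.
have [r1 r10 hr1] := Cc_supp hw.
have [B B0 hB] := @nmV_bound R n (r + 1).
pose K (g : gs) (u : V) := cutoff r g * w (ub u * g)%g.
have CK : Cc (fun z : prodspace gs V => K z.1 z.2).
  apply: (@CcI _ _ _ (Num.max (r + 1) (r1 * B))).
    apply: lcM; first by apply: (lc_comp (Cc_lc (Cc_cutoff _ r))); exact: lc_fst.
    apply: (lc_comp (Cc_lc hw)); apply: lc_mulg; last exact: lc_fst.
    by apply: lc_ub; exact: lc_snd.
  move=> [g u] /=; rewrite /K mulf_eq0 => /norP[h1 /hr1 h2].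
  have gr : nm g <= r + 1 by rewrite leNgt; apply: contra h1 => h1; rewrite cutoff0// ltW.
  rewrite ge_max !le_max gr /=; apply/orP; right; apply: le_trans (ub_bound u g) _.
  by apply: ler_pM; rewrite ?nm_ge0//; exact: hB.
apply: Cc_lc; rewrite (_ : (fun x => _) = (fun x => Iv (K x))).
  exact: (Cc2_int_r CK (@Iv_PF R k m)).
by apply/funext => g; rewrite /Vop -(PFZ (@Iv_PF R k m))//; exact: Cc_Vop.
Qed.

Definition Hop (w : gs -> R) (g : gs) : R := \sum_(h \in GamH) Vop w (h * g)%g.

(** The diagonal blocks of ub u * h are those of h, so the norm of the product bounds that of h and
    discreteness of Gam applies. *)
Lemma Hop_locfin w : Cc w -> locfin GamH (fun h g => Vop w (h * g)%g : R).
Proof.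
move=> hw r; have [r1 r10 hr1] := Cc_supp hw.
have [B B0 hB] := @nmV_bound R n r.
apply: sub_finite_set (@finite_Gam R n (r1 * B)) => h [[Gh h1 h2] [g gr /(Vop_ex hw)[u /hr1 hu]]].
split => //; apply: (@le_trans _ _ (nm (ub u * h : gs)%g)).
  rewrite -[nm h]/(nrm (val h)) -[nm _]/(nrm (val (ub u * h)%g)) sl_valM val_ub (bdiag_eq h1 h2) mulmx_block !mul1mx !mulmx0 !mul0mx !addr0 !add0r.
  rewrite !nrm_block !block_mxKul !block_mxKur !block_mxKdl !block_mxKdr !nrm0 addr0.
  by rewrite lerD2r lerDl nrm_ge0.
rewrite -[(ub u * h)%g](mulgK g); apply: le_trans (nmM _ _) _.
by apply: ler_pM; rewrite ?nm_ge0//; [rewrite -mulgA|exact: hB].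
Qed.

Lemma Hop_lcF w : Cc w -> forall h, lc (fun g : gs => Vop w (h * g)%g : rspace R).
Proof.
by move=> hw h; apply: (lc_comp (Vop_lc hw)); apply: lc_mulg; [exact: lc_cst|exact: lc_id].
Qed.

Lemma Hop_lc w : Cc w -> lc (Hop w : gs -> rspace R).
Proof. by move=> hw; exact: lfs_lc (Hop_locfin hw) (Hop_lcF hw). Qed.

Lemma Hop_fsupp w g : Cc w -> fsupp GamH (fun h => Vop w (h * g)%g).
Proof. by move=> hw; exact: (lfs_fsupp (Hop_locfin hw)). Qed.

Lemma Hop_inv w : Cc w -> Hinv (Hop w).
Proof.
move=> hw; split=> [y g|h g Hh].
  apply: eq_fsbigr => h /set_mem Hh; have [y' E] := GamH_ub y Hh.
  by rewrite mulgA E -mulgA Vop_ub.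
rewrite /Hop [RHS](reindex_fsbig (fun a => a * h)%g GamH); last first.
  split=> [a Ga|a b _ _ /mulIg//|a Ga]; first exact: GamHM.
  by exists (a * h^-1)%g; [exact/GamHM/GamHV|rewrite mulgVK].
by apply: eq_fsbigr => a _; rewrite mulgA.
Qed.

Lemma Hop_ex w g : Cc w -> Hop w g != 0 -> exists u h, GamH h /\ w (ub u * (h * g))%g != 0.
Proof.
move=> hw; rewrite /Hop => h0; apply: contrapT => nx; move: h0.
rewrite fsbig1 ?eqxx// => h Hh; apply/eqP; apply: contrapT => /negP /(Vop_ex hw)[u hu].
by apply: nx; exists u, h.
Qed.

Lemma Hinv_uh F u h g : Hinv F -> GamH h -> F (ub u * (h * g))%g = F g.
Proof. by move=> [F1 F2] Hh; rewrite F1 F2. Qed.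

Lemma HopM (f w : gs -> R) g : Hinv f -> lc (f : gs -> rspace R) -> Cc w ->
  Hop (fun x => f x * w x) g = f g * Hop w g.
Proof.
move=> fi lf hw; rewrite /Hop mulr_fsumr; apply: eq_fsbigr => h /set_mem Hh.
rewrite /Vop -(PFZ (@Iv_PF R k m)); last exact: Cc_Vop.
by congr Iv; apply/funext => u; rewrite Hinv_uh.
Qed.

Lemma Hop_ge0 w g : Cc w -> (forall x, 0 <= w x) -> 0 <= Hop w g.
Proof.
by move=> hw w0; apply: fsum_ge0 => h _; apply: (@Iv_PF R k m).2 => //; exact: Cc_Vop.
Qed.

Lemma HopD u w g : Cc u -> Cc w -> Hop (fun x => u x + w x) g = Hop u g + Hop w g.
Proof.
move=> hu hw; rewrite /Hop -fsumD; [|exact: Hop_fsupp|exact: Hop_fsupp].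
apply: eq_fsbigr => h _; rewrite /Vop -(PFD (@Iv_PF R k m))//; exact: Cc_Vop.
Qed.

Lemma HopZ c w g : Cc w -> Hop (fun x => c * w x) g = c * Hop w g.
Proof.
by move=> hw; apply: (@HopM (fun=> c)) => //; exact: (lc_cst _ (c : rspace R)).
Qed.

Lemma Hop_le u w g : Cc u -> Cc w -> (forall x, u x <= w x) -> Hop u g <= Hop w g.
Proof.
move=> hu hw le; apply: fsum_le => [||h _]; [exact: Hop_fsupp|exact: Hop_fsupp|].
by apply: (PFle (@Iv_PF R k m)) => //; exact: Cc_Vop.
Qed.

Lemma Hop_tr a w g : Hop (tr a w) g = Hop w (g * a)%g.
Proof.
apply: eq_fsbigr => h _; congr Iv; apply/funext => u.
by rewrite /tr !mulgA.
Qed.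

(** By H-invariance every nonzero value is already taken on a ball containing the support of w. *)
Lemma Hop_bd w : Cc w -> exists2 b : R, 0 <= b & forall g, `|Hop w g| <= b.
Proof.
move=> hw; have [r r0 hr] := Cc_supp hw; have [[b hb] _] := Hop_lc hw r.
exists `|b| => // g; have [->|h0] := eqVneq (Hop w g) 0; first by rewrite normr0.
have [u [h [Hh /hr hu]]] := Hop_ex hw h0.
rewrite -(Hinv_uh u g (Hop_inv hw) Hh); apply: le_trans (ler_norm b).
exact: hb.
Qed.

(** The term h = 1 suffices: ub u * g stays within radius j for all u in a ball of volume at least
    1. *)
Lemma Hop_cutoff (r0 : R) : exists J, forall (j : R) (g : gs), nm g <= r0 -> J <= j -> 1 <= Hop (cutoff j) g.
Proof.
have lu : lc (fun u : V => ub u : gs) by apply: lc_ub; exact: lc_id.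
have [[r hr] _] := lu ((k * m)%:R + 1).
exists (r * r0) => j g gr0 rj; have Cj : Cc (cutoff j : gs -> R) by exact: Cc_cutoff.
apply: (@le_trans _ _ (Vop (cutoff j) (1 * g)%g)).
  apply: le_trans (Iv_cutoff_ge1 R k m) _; apply: (PFle (@Iv_PF R k m)); [exact: Cc_cutoff|exact: Cc_Vop|].
  move=> u; rewrite mul1g; have [h|h] := leP (nm u) ((k * m)%:R + 1).
    by rewrite [leRHS]cutoff1 ?cutoff_le1// (le_trans (nmM _ _))// (le_trans _ rj)// ler_pM ?nm_ge0// hr.
  by rewrite cutoff0 ?cutoff_ge0// ltW.
apply: (@fsum_ge_term _ _ GamH (fun h => Vop (cutoff j) (h * g)%g)); first exact: Hop_fsupp.
  by move=> h _; apply: (@Iv_PF R k m).2 => [|x]; [exact: Cc_Vop|exact: cutoff_ge0].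
exact: GamH1.
Qed.

Hypotheses (hm : (0 < m)%N) (hk : (0 < k)%N).

Lemma ds_gt0 t : 0 < t -> 0 < ds m k t :> R.
Proof. by move=> t0; rewrite /ds divr_gt0 ?powR_gt0. Qed.

(** The Jacobian of the dilation by ds t on k by m matrices; it accounts for the normalising power
    in [Dsum]. *)
Lemma ds_exp t : 0 < t -> ds m k t ^+ (k * m) = t^-1 ^+ n :> R.
Proof.
move=> t0; have t1 := ltW t0; have E : (t `^ m%:R^-1) ^+ (k * m) = t ^+ k by rewrite mulnC exprM powR_root.
by rewrite /ds exprMn [(_ `^ m%:R^-1)^-1 ^+ _]exprVn E exprM powR_rootN// -exprVn -exprD.
Qed.

Lemma Dg_GamH t h : 0 < t -> GamH h -> (Dg m k t * h = h * Dg m k t)%g.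
Proof.
move=> t0 [_ h1 h2]; apply: val_inj; rewrite !sl_valM val_Dg//.
apply/matrixP => i j; rewrite mul_mx_diag mul_diag_mx [LHS]mxE [RHS]mxE mulrC.
case: (split_ordP i) => i' ->; case: (split_ordP j) => j' ->; rewrite ?dvl ?dvr//.
  by have /matrixP/(_ i' j') := h1; rewrite !mxE => ->; rewrite !mul0r.
by have /matrixP/(_ i' j') := h2; rewrite !mxE => ->; rewrite !mul0r.
Qed.

Lemma DgV_ub (t : R) u : 0 < t -> ((Dg m k t)^-1 * ub u = ub ((ds m k t)^-1 *: u) * (Dg m k t)^-1)%g.
Proof.
move=> t0; apply: (mulgI (Dg m k t)); rewrite mulVKg; apply: (mulIg (Dg m k t)).
by rewrite Dg_ub// !mulgA mulgVK.
Qed.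

Lemma Vop_DgV t w g : 0 < t -> Cc w ->
  Iv (fun u => w ((Dg m k t)^-1 * (ub u * g))%g) = t^-1 ^+ n * Vop w ((Dg m k t)^-1 * g)%g.
Proof.
move=> t0 hw.
rewrite (_ : (fun u => _) = (fun u => w (ub ((ds m k t)^-1 *: u) * ((Dg m k t)^-1 * g))%g)); last first.
  by apply/funext => u; rewrite mulgA DgV_ub// mulgA.
rewrite (@Iv_dil _ _ _ (fun u => w (ub u * ((Dg m k t)^-1 * g))%g)) ?invr_gt0 ?ds_gt0//.
  by rewrite invrK ds_exp.
exact: Cc_Vop.
Qed.

Lemma Hop_tl t w g : 0 < t -> Cc w ->
  Hop (tl ((Dg m k t)^-1)%g w) g = t^-1 ^+ n * Hop w ((Dg m k t)^-1 * g)%g.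
Proof.
move=> t0 hw; rewrite /Hop mulr_fsumr; apply: eq_fsbigr => h /set_mem Hh.
rewrite [LHS](_ : _ = Iv (fun u => w ((Dg m k t)^-1 * (ub u * (h * g)))%g))// Vop_DgV//.
congr (_ * Vop w _); rewrite !mulgA; congr (_ * _)%g.
by apply: (mulgI (Dg m k t)); rewrite mulVKg; apply: (mulIg (Dg m k t)); rewrite !mulgA Dg_GamH// mulgVK.
Qed.

(** The rational points in abstract form: the fibre of [pr] over l is the coset of sct l under the
    integral points of H. *)
Variables (I : choiceType) (Q : set I) (pr : G -> I) (sct : I -> G).
Hypotheses (prQ : forall g, Gam g -> Q (pr g)) (sctG : forall l, Q l -> Gam (sct l))
  (prE : forall l g, Q l -> Gam g -> (pr g = l <-> exists z h, GamH h /\ g = (ub (zr R z) * (h * sct l))%g)).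

Definition Dsum (t : R) (F : G -> R) : R := t^-1 ^+ n * \sum_(l \in Q) F ((Dg m k t)^-1 * sct l)%g.

Lemma Gam_GamH h : GamH h -> Gam h. Proof. by case. Qed.

Lemma ub_inj : injective (@ub R m k).
Proof.
by move=> a b /(congr1 val); rewrite !val_ub => /eq_block_mx[].
Qed.

Lemma ubGamH_eq (u v : 'M[R]_(k, m)) a b : GamH a -> GamH b -> (ub u * a = ub v * b)%g -> u = v /\ a = b.
Proof.
move=> Ha Hb E.
have E1 : (ub (u - v) = b * a^-1)%g.
  rewrite addrC ubD ubN; apply: (mulIg a); rewrite -mulgA E mulgVK mulKg//.
have [_ _ h] : GamH (ub (u - v)) by rewrite E1; exact/GamHM/GamHV.
move: h; rewrite val_ub block_mxKdl => /eqP; rewrite subr_eq0 => /eqP uv; split => //.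
by move: E; rewrite uv => /mulgI.
Qed.

(** Gam is split into fibres over the rational points and each fibre according to its component in
    [GamH]. Summing over U_Z turns the torus integral into an integral over U, and summing over
    [GamH] completes it to [Hop w]. *)
Theorem eT_Dsum t (w : gs -> R) : 0 < t -> Cc w ->
  fsupp Q (fun l => Hop w ((Dg m k t)^-1 * sct l)%g) /\
  eT t (fun x => w (x^-1)%g) = Dsum t (Hop w).
Proof.
move=> t0 hw; have hwi := Cc_inv hw.
set D := Dg m k t.
pose T g := Iv (fun u => chi u * w (D^-1 * (ub u * g))%g).
have lF c : lc (fun u : V => tl c (fun x => w (x^-1)%g) (ub (- u) * D)%g : rspace R).
  apply: (@lc_ubg _ _ _ (tl c (fun x => w (x^-1)%g))); apply: Cc_lc; exact: Cc_tl.
have lf : locfin (@Gam R n) (fun c (u : V) => tl c (fun x => w (x^-1)%g) (ub (- u) * D)%g).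
  move=> r; have lu : lc (fun u : V => (ub (- u) * D)%g : gs).
    apply: lc_mulg; last exact: lc_cst.
    apply: lc_ub; apply: (@lc_ext _ _ _ (fun u : V => -1 *: u)); first by move=> u; rewrite scaleN1r.
    by apply: lc_scalemx; [exact: lc_cst|exact: lc_id].
  have [[r' hr'] _] := lu r.
  apply: sub_finite_set (per_locfin hwi r') => c [Gc [u ur h]]; split => //.
  by exists (ub (- u) * D)%g => //; exact: hr'.
have [fs E] := lfs_PF lf lF (@Iv_PF R k m) (@Cc_chi R k m).
have TE c : T (c^-1)%g = Iv (fun u => chi u * tl c (fun x => w (x^-1)%g) (ub (- u) * D)%g).
  by congr Iv; apply/funext => u; rewrite /tl !invgM -ubN opprK mulgA.
have GamVK : set_bij (@Gam R n) (@Gam R n) (fun a => a^-1)%g.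
  split=> [a|a b _ _ /invg_inj//|a Ga]; first exact: GamV.
  by exists (a^-1)%g; [exact: GamV|rewrite invgK].
have E1 : eT t (fun x => w (x^-1)%g) = \sum_(c \in @Gam R n) T c.
  rewrite /eT /per E [RHS](reindex_fsbig (fun a => a^-1)%g (@Gam R n))//.
  by apply: eq_fsbigr => c _; rewrite TE.
have fsT : fsupp (@Gam R n) T.
  have := finite_image (fun a : G => a^-1)%g fs; apply: sub_finite_set => c [Gc Tc].
  exists (c^-1)%g; last by rewrite invgK.
  by split; [exact: GamV|rewrite -TE invgK].
have in1 l h : Q l -> GamH h ->
  \sum_(c \in @Gam R n `&` [set c | pr c = l] `&` [set c | exists z, c = (ub (zr R z) * (h * sct l))%g]) T c =
  t^-1 ^+ n * Vop w (h * (D^-1 * sct l))%g.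
  move=> Ql Hh; rewrite (reindex_fsbig (fun z : 'M[int]_(k, m) => ub (zr R z) * (h * sct l))%g setT); last first.
    split=> [z _ /=|a b _ _ /mulIg/ub_inj|c [_ [z ->]]]; last by exists z.
      have Gz : Gam (ub (zr R z) * (h * sct l))%g.
        by apply: GamM; [exact: Gam_ub|apply: GamM; [exact: Gam_GamH|exact: sctG]].
      by split; [split => //; apply/prE => //; exists z, h|exists z].
    by move=> /matrixP E2; apply/matrixP => i j; have := E2 i j; rewrite !mxE => /eqP; rewrite eqr_int => /eqP.
  pose w' (u : V) := w (D^-1 * (ub u * (h * sct l)))%g.
  have Cw' : Cc w'.
    have := Cc_Vop (h * sct l)%g (Cc_tl (D^-1)%g hw); exact.
  have -> : t^-1 ^+ n * Vop w (h * (D^-1 * sct l))%g = Iv w'.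
    rewrite /w' Vop_DgV//; congr (_ * Vop w _); rewrite !mulgA; congr (_ * _)%g.
    by apply: (mulgI D); rewrite mulVKg; apply: (mulIg D); rewrite !mulgA Dg_GamH// mulgVK.
  (* The integral translates of chi sum to 1, so the sum over z unfolds the torus to all of U. *)
  rewrite -(Iv_chi_sum Cw').2 [RHS](reindex_fsbig (fun z => - z) setT); last first.
    by split=> // [a1 a2 _ _ /oppr_inj//|z _]; exists (- z) => //; rewrite opprK.
  apply: eq_fsbigr => z _; rewrite /T -[LHS](Iv_shift (- zr R z)).
    congr Iv; apply/funext => u.
    have -> : zr R (- z) = - zr R z by rewrite /zr map_mxN.
    by rewrite mulrC; congr (w (_ * _)%g * _); rewrite mulgA -ubD subrK.
  have h1 := Cc_Vop (ub (zr R z) * (h * sct l))%g (Cc_tl (D^-1)%g hw).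
  by have := CcM (Cc_lc (@Cc_chi R k m)) h1; congr Cc.
have in2 l : Q l -> fsupp (@Gam R n `&` [set c | pr c = l]) T /\
  \sum_(c \in @Gam R n `&` [set c | pr c = l]) T c = t^-1 ^+ n * Hop w (D^-1 * sct l)%g.
  move=> Ql; have fs1 : fsupp (@Gam R n `&` [set c | pr c = l]) T.
    by apply: sub_finite_set fsT => c [[]].
  split=> //.
  (* [et] reads off the component in [GamH], which [ubGamH_eq] shows to be unique. *)
  have /choice[et het] : forall c : G, exists h : G, (Gam c /\ pr c = l) -> GamH h /\ exists z, c = (ub (zr R z) * (h * sct l))%g.
    move=> c; have [[Gc pc]|nc] := pselect (Gam c /\ pr c = l); last by exists 1%g => /nc.
    by have [z [h [Hh E2]]] := (prE Ql Gc).1 pc; exists h => _; split => //; exists z.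
  rewrite (@fsum_fiber _ _ _ _ GamH et)//; last first.
    by move=> c [Gc pc]; have [] := het c (conj Gc pc).
  rewrite /Hop mulr_fsumr; apply: eq_fsbigr => h /set_mem Hh; rewrite -in1//.
  congr (\sum_(c \in _) _); apply/seteqP; split=> c [[Gc pc] hc]; split => //=.
    by have [_ [z ->]] := het c (conj Gc pc); exists z; rewrite hc.
  have [He [z E2]] := het c (conj Gc pc); move: hc => [z' hc].
  have := etrans (esym E2) hc; rewrite !mulgA => /mulIg E3.
  by have [] := ubGamH_eq He Hh E3.
have E2 : eT t (fun x => w (x^-1)%g) = \sum_(l \in Q) t^-1 ^+ n * Hop w (D^-1 * sct l)%g.
  rewrite E1 (@fsum_fiber _ _ _ _ Q pr)//.
  by apply: eq_fsbigr => l /set_mem Ql; rewrite (in2 l Ql).2.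
split; last by rewrite E2 /Dsum mulr_fsumr.
have fin : finite_set [set c | Gam c /\ T c != 0] := fsT.
apply: sub_finite_set (finite_image pr fin) => l [Ql hl].
apply: contrapT => nl; move: hl; apply/negP; rewrite negbK.
have : t^-1 ^+ n * Hop w (D^-1 * sct l)%g = 0.
  rewrite -(in2 l Ql).2 fsbig1// => c [Gc pc]; apply/eqP; apply: contrapT => /negP Tc.
  by apply: nl; exists c.
by move=> /eqP; rewrite mulf_eq0 expf_eq0 invr_eq0 (gt_eqF t0) andbF.
Qed.

End HOperator.

(** * Lattices and their bases *)

Section Gram.
Variable R : realType.

Lemma dotv_gt0 N (u : 'rV[R]_N) : u != 0 -> 0 < (u *m u^T) 0 0.
Proof.
move=> u0; rewrite mxE lt_neqAle eq_sym; apply/andP; split; last first.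
  by apply: sumr_ge0 => i _; rewrite mxE -expr2 sqr_ge0.
rewrite psumr_eq0 => [|i _]; last by rewrite mxE -expr2 sqr_ge0.
apply: contra u0 => /allP h; apply/eqP/rowP => i; apply/eqP; rewrite mxE.
by have := h i (mem_index_enum i); rewrite mxE mulf_eq0 orbb.
Qed.

(** Induction on the number of rows: the lower rows are orthonormalised, then the top row minus its
    projection onto them is normalised. *)
Lemma gram_schmidt p N (A : 'M[R]_(p, N)) : row_free A ->
  exists T : 'M[R]_p, (T *m A) *m (T *m A)^T = 1%:M.
Proof.
elim: p A => [|p IH] A fA; first by exists 0; apply/matrixP => -[].
move: A fA; change (forall A : 'M[R]_(1 + p, N), row_free A ->
  exists T : 'M[R]_(1 + p), T *m A *m (T *m A)^T = 1%:M) => A.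
rewrite -[A]vsubmxK; move: (usubmx A) (dsubmx A) => a A' fA.
have fA' : row_free A'.
  apply: inj_row_free => v vA.
  have : row_mx (0 : 'rV[R]_1) v *m col_mx a A' = 0 by rewrite mul_row_col mul0mx add0r vA.
  by move/eqP; rewrite mulmx_free_eq0// => /eqP; rewrite -[X in _ = X]row_mx0 => /eq_row_mx[].
have [T' hT'] := IH A' fA'.
have [Q EQ] : exists Q, T' *m A' = Q by exists (T' *m A').
rewrite EQ in hT'.
pose a' := a - a *m Q^T *m Q.
have a'0 : a' != 0.
  apply/eqP => z; have : row_mx (1%:M : 'M[R]_1) (- (a *m Q^T *m T')) *m col_mx a A' = 0.
    by rewrite mul_row_col mul1mx mulNmx -[_ *m T' *m A']mulmxA EQ; exact: z.
  move/eqP; rewrite mulmx_free_eq0// => /eqP; rewrite -[X in _ = X]row_mx0 => /eq_row_mx[/matrixP/(_ 0 0) + _].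
  by rewrite !mxE eqxx => /eqP; rewrite oner_eq0.
have d0 := dotv_gt0 a'0; set d := (a' *m a'^T) 0 0 in d0.
have a'Q : a' *m Q^T = 0 by rewrite mulmxBl -[_ *m Q *m Q^T]mulmxA hT' mulmx1 subrr.
pose c := (Num.sqrt d)^-1.
exists (block_mx c%:M (- (c *: (a *m Q^T *m T'))) 0 T' : 'M[R]_(1 + p)).
have -> : (block_mx c%:M (- (c *: (a *m Q^T *m T'))) 0 T' : 'M[R]_(1 + p)) *m col_mx a A' = col_mx (c *: a') Q.
  rewrite mul_block_col mul0mx add0r EQ; congr col_mx.
  by rewrite mul_scalar_mx mulNmx -scalemxAl -[_ *m T' *m A']mulmxA EQ -scalerBr.
rewrite tr_col_mx mul_col_row linearZ /= -scalemxAl -scalemxAr scalerA hT'.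
have -> : a' *m a'^T = d%:M by rewrite [LHS]mx11_scalar.
rewrite scale_scalar_mx -expr2 exprVn sqr_sqrtr ?ltW// mulVf ?gt_eqF//.
have Qa' : Q *m a'^T = 0 by rewrite -[LHS]trmxK trmx_mul trmxK a'Q linear0.
rewrite -scalemxAl -scalemxAr a'Q Qa' !scaler0.
by rewrite -scalar_mx_block.
Qed.

Lemma gram_gt0 p N (A : 'M[R]_(p, N)) : row_free A -> 0 < \det (A *m A^T).
Proof.
move=> /gram_schmidt[T hT].
have : \det T ^+ 2 * \det (A *m A^T) = 1.
  by rewrite -(det1 R p) -hT trmx_mul !mulmxA -[T *m A *m A^T]mulmxA !det_mulmx det_tr; ring.
move=> E; have : 0 < \det T ^+ 2 * \det (A *m A^T) by rewrite E.
have [z|nz] := eqVneq (\det T) 0; first by rewrite z expr0n mul0r ltxx.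
by rewrite pmulr_rgt0// exprn_even_gt0.
Qed.

Lemma gram_unit p N (A : 'M[R]_(p, N)) : row_free A -> A *m A^T \in unitmx.
Proof. by move=> /gram_gt0 h; rewrite unitmxE unitfE gt_eqF. Qed.

Lemma row_free_gram p N (A : 'M[R]_(p, N)) : \det (A *m A^T) != 0 -> row_free A.
Proof.
move=> h; apply/row_freeP; exists (A^T *m invmx (A *m A^T)).
by rewrite mulmxA mulmxV// unitmxE unitfE.
Qed.

Lemma zspan_row p N (A : 'M[R]_(p, N)) i : zspan A (row i A).
Proof. by exists (delta_mx 0 i); rewrite map_delta_mx -rowE. Qed.

Lemma zspan_mulP p q N (A : 'M[R]_(p, N)) (B : 'M[R]_(q, N)) :
  (forall i, zspan A (row i B)) -> exists U : 'M[int]_(q, p), B = map_mx intr U *m A.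
Proof.
move=> /choice[z hz]; exists (\matrix_(i, j) z i 0 j); apply/row_matrixP => i.
by rewrite hz row_mul; congr (_ *m A); apply/rowP => j; rewrite !mxE.
Qed.

Lemma zspan_mul p q N (A : 'M[R]_(p, N)) (U : 'M[int]_(q, p)) : zspan (map_mx intr U *m A) `<=` zspan A.
Proof. by move=> v [z ->]; exists (z *m U); rewrite map_mxM mulmxA. Qed.

Lemma zr_inj p q : injective (@zr R p q).
Proof.
move=> a b /matrixP h; apply/matrixP => i j; have := h i j; rewrite !mxE => /eqP.
by rewrite eqr_int => /eqP.
Qed.

Lemma zspan_eqP p N (A B : 'M[R]_(p, N)) : row_free A -> zspan A = zspan B ->
  exists U U' : 'M[int]_p, [/\ B = map_mx intr U *m A, A = map_mx intr U' *m B, U *m U' = 1%:M & U' *m U = 1%:M].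
Proof.
move=> fA E.
have [U hU] : exists U : 'M[int]_p, B = map_mx intr U *m A.
  by apply: zspan_mulP => i; rewrite E; exact: zspan_row.
have [U' hU'] : exists U : 'M[int]_p, A = map_mx intr U *m B.
  by apply: zspan_mulP => i; rewrite -E; exact: zspan_row.
have h : U' *m U = 1%:M.
  apply: zr_inj; rewrite /zr map_mxM map_mx1; apply: (row_free_inj fA) => /=.
  by rewrite mul1mx -mulmxA -hU -hU'.
by exists U, U'; split => //; exact: mulmx1C.
Qed.

Lemma zspan_unimod p N (A : 'M[R]_(p, N)) (U U' : 'M[int]_p) : U' *m U = 1%:M ->
  zspan (map_mx intr U *m A) = zspan A.
Proof.
move=> h; apply/seteqP; split; first exact: zspan_mul.
by rewrite -{1}[A]mul1mx -(map_mx1 intr) -h map_mxM -mulmxA; exact: zspan_mul.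
Qed.

Lemma det_unimod p (U U' : 'M[int]_p) : U *m U' = 1%:M -> (\det (map_mx intr U : 'M[R]_p)) ^+ 2 = 1.
Proof.
move=> /(congr1 determinant); rewrite det_mulmx det1 det_map_mx => h.
have : \det U = 1 \/ \det U = -1.
  move: (\det U) (\det U') h => x y h.
  move: h => /(congr1 absz); rewrite abszM => /eqP; rewrite muln_eq1 => /andP[/eqP h _]; lia.
by case=> ->; rewrite ?intrN ?sqrrN expr1n.
Qed.

(** The basis picked by [xget] differs from A by a unimodular matrix, whose squared determinant is
    1. *)
Lemma covol_zspan p N (A : 'M[R]_(p, N)) : row_free A -> covol p (zspan A) = Num.sqrt (\det (A *m A^T)).
Proof.
move=> fA; rewrite /covol; set S := [set B | _].
have [fB E] : S (xget 0 S) by apply: xgetPex; exists A.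
have [U [U' [-> _ h _]]] := zspan_eqP fA E.
rewrite trmx_mul !mulmxA -[_ *m A *m A^T]mulmxA !det_mulmx det_tr mulrAC -expr2 (det_unimod h) mul1r//.
Qed.

Lemma realspan_zspan p N (A : 'M[R]_(p, N)) v : realspan (zspan A) v <-> exists c : 'rV[R]_p, v = c *m A.
Proof.
split=> [[q [c [w [hw ->]]]]|[c ->]].
  have /choice[z hz] := hw; exists (\sum_i c i *: map_mx intr (z i)).
  by rewrite mulmx_suml; apply: eq_bigr => i _; rewrite -scalemxAl hz.
exists p, (fun i => c 0 i), (fun i => row i A); split; first by move=> i; exact: zspan_row.
by rewrite mulmx_sum_row.
Qed.

Lemma dual_zspan p N (A : 'M[R]_(p, N)) : row_free A ->
  dual (zspan A) = zspan (invmx (A *m A^T) *m A).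
Proof.
move=> fA; have uA := gram_unit fA; apply/seteqP; split=> y.
  move=> [/realspan_zspan[c ->] h].
  have /choice[z hz] : forall i, exists q : int, dotv (c *m A) (row i A) = q%:~R.
    by move=> i; apply: h; exact: zspan_row.
  exists (\row_i z i).
  have E : c *m (A *m A^T) = map_mx (fun x : int => x%:~R) (\row_i z i).
    apply/rowP => i; rewrite mulmxA [RHS]mxE [(\row_i z i) _ _]mxE -hz /dotv [LHS]mxE [RHS]mxE.
    by apply: eq_bigr => j _; congr (_ * _); rewrite !mxE.
  by rewrite [RHS]mulmxA -E -[_ *m invmx _]mulmxA mulmxV// mulmx1.
move=> [z ->]; split.
  by apply/realspan_zspan; exists (map_mx intr z *m invmx (A *m A^T)); rewrite mulmxA.
move=> x [z' ->]; exists ((z *m z'^T) 0 0); rewrite /dotv trmx_mul.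
have -> : map_mx (fun x : int => x%:~R) z *m (invmx (A *m A^T) *m A) *m
  (A^T *m (map_mx (fun x : int => x%:~R) z')^T) = map_mx intr (z *m z'^T) :> 'M[R]_1.
  rewrite !mulmxA -[_ *m A *m A^T]mulmxA -[_ *m invmx _ *m _]mulmxA mulVmx// mulmx1.
  by rewrite map_mxM map_trmx.
by rewrite mxE.
Qed.

(** For independent rows, the orthogonal projection onto the complement of the row space, acting on
    row vectors from the right. *)
Definition projm p N (A : 'M[R]_(p, N)) : 'M[R]_N := 1%:M - A^T *m invmx (A *m A^T) *m A.

Lemma projm_tr p N (A : 'M[R]_(p, N)) : (projm A)^T = projm A.
Proof.
by rewrite /projm linearB /= trmx1 !trmx_mul trmxK trmx_inv trmx_mul trmxK mulmxA.
Qed.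

Lemma mul_projm p N (A : 'M[R]_(p, N)) : row_free A -> A *m projm A = 0.
Proof. by move=> /gram_unit uA; rewrite mulmxBr mulmx1 !mulmxA mulmxV// mul1mx subrr. Qed.

Lemma projm_mul p N (A : 'M[R]_(p, N)) : row_free A -> projm A *m A^T = 0.
Proof. by move=> fA; rewrite -[LHS]trmxK trmx_mul trmxK projm_tr mul_projm// linear0. Qed.

Lemma projm_unit p N (A : 'M[R]_(p, N)) (U : 'M[R]_p) : U \in unitmx -> row_free A -> projm (U *m A) = projm A.
Proof.
move=> uU fA; have uA := gram_unit fA; rewrite /projm; congr (_ - _).
rewrite trmx_mul !mulmxA -[U *m A *m A^T]mulmxA.
have uUT : U^T \in unitmx by rewrite unitmx_tr.
have -> : invmx (U *m (A *m A^T) *m U^T) = invmx U^T *m invmx (A *m A^T) *m invmx U.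
  apply: (@row_free_inj _ _ _ _ (U *m (A *m A^T) *m U^T)).
    by rewrite row_free_unit !unitmx_mul uU uA.
  rewrite mulVmx ?unitmx_mul ?uU ?uA//.
  by rewrite !mulmxA mulmxKV// -[_ *m A *m A^T]mulmxA mulmxKV// mulVmx.
by rewrite !mulmxA mulmxK// mulmxKV.
Qed.

Lemma projperp_zspan p q N (A : 'M[R]_(p, N)) (B : 'M[R]_(q, N)) : row_free A ->
  projperp (zspan A) (zspan (col_mx A B)) = zspan (B *m projm A).
Proof.
move=> fA; have uA := gram_unit fA; apply/seteqP; split=> w.
  move=> [x [[z ->] [/realspan_zspan[c hc] h]]].
  exists (rsubmx z).
  have wA : w *m projm A = w.
    suff E : w *m A^T = 0 by rewrite mulmxBr mulmx1 !mulmxA E !mul0mx subr0.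
    apply/rowP => i; rewrite [RHS]mxE -(h (row i A)); last first.
      by apply/realspan_zspan; exists (delta_mx 0 i); rewrite -rowE.
    by rewrite /dotv !mxE; apply: eq_bigr => j _; rewrite !mxE.
  move: hc => /(congr1 (fun x => x *m projm A)); rewrite mulmxBl wA -[c *m A *m _]mulmxA mul_projm// mulmx0.
  rewrite -[z]hsubmxK map_row_mx mul_row_col mulmxDl -[_ *m A *m _]mulmxA mul_projm// mulmx0 add0r.
  by move=> /eqP; rewrite subr_eq0 => /eqP <-; rewrite row_mxKr mulmxA.
move=> [z ->]; exists (map_mx intr z *m B); split.
  by exists (row_mx 0 z); rewrite map_row_mx map_mx0 mul_row_col mul0mx add0r.
split.
  apply/realspan_zspan; exists (map_mx intr z *m B *m A^T *m invmx (A *m A^T)).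
  by rewrite /projm !mulmxBr mulmx1 !mulmxA opprB addrC subrK.
move=> u /realspan_zspan[c ->]; rewrite /dotv trmx_mul !mulmxA.
by rewrite -[_ *m projm A *m _]mulmxA projm_mul// mulmx0 mul0mx mxE.
Qed.

Lemma scaleset_zspan p N c (A : 'M[R]_(p, N)) : scaleset c (zspan A) = zspan (c *: A).
Proof.
apply/seteqP; split=> v.
  by move=> [_ [z ->] <-]; exists z; rewrite scalemxAr.
by move=> [z ->]; exists (map_mx intr z *m A); [exists z|rewrite scalemxAr].
Qed.

(** The Kronecker product, as the matrix of Z -> A^T Z B on vectorised matrices; its Gram
    determinant then becomes that of a composition of linear maps. *)
Definition tmx p q N (A : 'M[R]_(p, N)) (B : 'M[R]_(q, N)) : 'M[R]_(p * q, N * N) :=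
  lin_mx (mulmxr B \o mulmx A^T).

Lemma mul_tmx p q N (A : 'M[R]_(p, N)) (B : 'M[R]_(q, N)) (Z : 'M[R]_(p, q)) :
  mxvec Z *m tmx A B = mxvec (A^T *m Z *m B).
Proof. by rewrite mul_vec_lin. Qed.

Lemma row_tmx p q N (A : 'M[R]_(p, N)) (B : 'M[R]_(q, N)) i j :
  row (mxvec_index i j) (tmx A B) = tens (row i A) (row j B).
Proof.
rewrite rowE -mxvec_delta mul_tmx /tens !rowE trmx_mul trmx_delta; congr mxvec.
by rewrite !mulmxA -[A^T *m delta_mx i 0 *m _]mulmxA mul_delta_mx.
Qed.

Lemma mxvec_map p q (Z : 'M[int]_(p, q)) : map_mx intr (mxvec Z) = mxvec (map_mx intr Z) :> 'rV[R]_(p * q).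
Proof. by rewrite map_mxvec. Qed.

Lemma tensorL_zspan p q N (A : 'M[R]_(p, N)) (B : 'M[R]_(q, N)) :
  tensorL (zspan A) (zspan B) = zspan (tmx A B).
Proof.
apply/seteqP; split=> v.
  move=> [l [a [b [hab ->]]]].
  have /choice[x hx] : forall i, exists z : 'rV[int]_p, a i = map_mx intr z *m A by move=> i; have [] := hab i.
  have /choice[y hy] : forall i, exists z : 'rV[int]_q, b i = map_mx intr z *m B by move=> i; have [] := hab i.
  exists (mxvec (\sum_i (x i)^T *m y i)).
  rewrite [X in X *m _]mxvec_map mul_tmx raddf_sum mulmx_sumr mulmx_suml raddf_sum /=.
  apply: eq_bigr => i _; rewrite /tens hx hy trmx_mul map_mxM map_trmx !mulmxA//.
move=> [z ->]; rewrite -[z]vec_mxK; move: (vec_mx z) => Z.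
rewrite [X in X *m _]mxvec_map mul_tmx.
exists p, (fun i => row i A), (fun i => map_mx intr (row i Z) *m B); split.
  by move=> i; split; [exact: zspan_row|exists (row i Z)].
rewrite [in LHS](_ : map_mx intr Z = \sum_i delta_mx i 0 *m map_mx intr (row i Z) :> 'M[R]_(p, q)); last first.
  apply/matrixP => a b; rewrite summxE (bigD1 a)//= big1 ?addr0 => [|i ia]; rewrite !mxE big_ord1 !mxE.
    by rewrite !eqxx mul1r.
  by rewrite eq_sym (negbTE ia) mul0r.
rewrite mulmx_sumr mulmx_suml raddf_sum /=; apply: eq_bigr => i _.
by rewrite /tens [row i A]rowE trmx_mul trmx_delta !mulmxA.
Qed.

Lemma lin_mx_comp a b c d e f (F : {linear 'M[R]_(a, b) -> 'M[R]_(c, d)})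
  (F' : {linear 'M[R]_(c, d) -> 'M[R]_(e, f)}) (H : {linear 'M[R]_(a, b) -> 'M[R]_(e, f)}) :
  (forall X, H X = F' (F X)) -> lin_mx F *m lin_mx F' = lin_mx H.
Proof.
move=> E; apply/row_matrixP => i; rewrite !rowE mulmxA -[delta_mx 0 i]vec_mxK.
by rewrite !mul_vec_lin E.
Qed.

(* A multiplicative function is 1 on elementary matrices, since conjugation by a diagonal
   matrix turns E_ij(x) into its square. *)
Lemma mult_det1 p (f : 'M[R]_p -> R) (P : 'M[R]_p) : f 1%:M = 1 ->
  (forall A B, f (A *m B) = f A * f B) -> \det P = 1 -> f P = 1.
Proof.
move=> f1 fM dP; apply: (@sl_gen_mx R p (fun P => f P = 1)) => //.
split=> // [A B fA fB|i j x ij]; first by rewrite fM fA fB mulr1.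
set E := 1%:M + x *: delta_mx i j.
pose D : 'M[R]_p := 1%:M + 1 *: delta_mx i i.
pose D' : 'M[R]_p := 1%:M + (- 2^-1) *: delta_mx i i.
have ji : j != i by rewrite eq_sym.
have dii : delta_mx i i *m delta_mx i i = delta_mx i i :> 'M[R]_p by rewrite mul_delta_mx.
have dij : delta_mx i i *m delta_mx i j = delta_mx i j :> 'M[R]_p by rewrite mul_delta_mx.
have dji : delta_mx i j *m delta_mx i i = 0 :> 'M[R]_p by rewrite mul_delta_mx_0.
have djj : delta_mx i j *m delta_mx i j = 0 :> 'M[R]_p by rewrite mul_delta_mx_0.
have h1 : D *m D' = 1%:M.
  rewrite /D /D' scale1r mulmxDl mul1mx mulmxDr mulmx1 -scalemxAr dii.
  by apply/matrixP => a b; rewrite !mxE; lra.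
have h2 : D *m E *m D' = E *m E.
  rewrite /D /E /D' scale1r !mulmxDl !mul1mx !mulmxDr !mulmx1 -!scalemxAr -!scalemxAl ?mulmxDl.
  rewrite -?scalemxAl ?mul1mx ?dii ?dij ?dji ?djj ?scaler0.
  by apply/matrixP => a b; rewrite !mxE; lra.
have h3 : E *m (1%:M - x *: delta_mx i j) = 1%:M.
  by rewrite /E mulmxDl mul1mx mulmxBr mulmx1 -scalemxAr -scalemxAl djj !scaler0 subr0 subrK.
have e0 : f E != 0 by apply/eqP => z; move: (fM E (1%:M - x *: delta_mx i j)); rewrite h3 f1 z mul0r => /eqP; rewrite oner_eq0.
have fD : f D * f D' = 1 by rewrite -fM h1.
have := congr1 f h2; rewrite !fM mulrAC fD mul1r -{1}[f E]mulr1 => /(mulfI e0) <-//.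
Qed.

Lemma lin_mx_id r s (F : {linear 'M[R]_(r, s) -> 'M[R]_(r, s)}) : (forall X, F X = X) -> lin_mx F = 1%:M.
Proof.
by move=> E; apply/row_matrixP => i; rewrite !rowE -[delta_mx 0 i]vec_mxK mul_vec_lin E mulmx1.
Qed.

Lemma det_lin_mulmx p q (P : 'M[R]_p) : \det P = 1 ->
  \det (lin_mx (mulmx P : 'M[R]_(p, q) -> 'M[R]_(p, q))) = 1.
Proof.
apply: (@mult_det1 p (fun P => \det (lin_mx (mulmx P : 'M[R]_(p, q) -> 'M[R]_(p, q))))).
  rewrite -[RHS](det1 R (p * q)); congr determinant.
  exact: (@lin_mx_id p q (mulmx 1%:M) (fun X => mul1mx X)).
move=> A B.
have E := @lin_mx_comp p q p q p q (mulmx B) (mulmx A) (mulmx (A *m B)) (fun X => esym (mulmxA A B X)).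
apply: etrans (congr1 determinant (esym E)) _; rewrite det_mulmx; exact: mulrC.
Qed.

Lemma det_lin_mulmxr p q (P : 'M[R]_q) : \det P = 1 ->
  \det (lin_mx (mulmxr P : 'M[R]_(p, q) -> 'M[R]_(p, q))) = 1.
Proof.
apply: (@mult_det1 q (fun P => \det (lin_mx (mulmxr P : 'M[R]_(p, q) -> 'M[R]_(p, q))))).
  rewrite -[RHS](det1 R (p * q)); congr determinant.
  exact: (@lin_mx_id p q (mulmxr 1%:M) (fun X => mulmx1 X)).
move=> A B.
have E := @lin_mx_comp p q p q p q (mulmxr A) (mulmxr B) (mulmxr (A *m B)) (fun X => mulmxA X A B).
by apply: etrans (congr1 determinant (esym E)) _; rewrite det_mulmx.
Qed.

(** The Gram matrix of a tensor basis is multiplication by A A^T on one side and by B B^T on the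
    other, each of determinant 1. *)
Lemma det_tmx p q N (A : 'M[R]_(p, N)) (B : 'M[R]_(q, N)) :
  \det (A *m A^T) = 1 -> \det (B *m B^T) = 1 -> \det (tmx A B *m (tmx A B)^T) = 1.
Proof.
move=> dA dB.
have tE : (tmx A B)^T = lin_mx (mulmxr B^T \o mulmx A).
  apply/matrixP => i j; case/mxvec_indexP: i => a b; case/mxvec_indexP: j => c d; rewrite mxE.
  have h1 := row_tmx A B c d.
  transitivity (row (mxvec_index c d) (tmx A B) 0 (mxvec_index a b)); first by rewrite [RHS]mxE.
  transitivity (A c a * B d b); first by rewrite h1 /tens mxvecE !mxE big_ord1 !mxE.
  transitivity (row (mxvec_index a b) (lin_mx (mulmxr B^T \o mulmx A)) 0 (mxvec_index c d)); last by rewrite [LHS]mxE.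
  rewrite rowE -mxvec_delta mul_vec_lin mxvecE /= -[delta_mx a b](mul_delta_mx (0 : 'I_1)) !mulmxA -colE.
  by rewrite -[col a A *m _ *m _]mulmxA -rowE !mxE big_ord1 !mxE.
have -> : tmx A B *m (tmx A B)^T = lin_mx (mulmx (A *m A^T)) *m lin_mx (mulmxr (B *m B^T)).
  rewrite tE (@lin_mx_comp _ _ _ _ _ _ _ _ (mulmxr (B *m B^T) \o mulmx (A *m A^T))); last first.
    by move=> X; rewrite /= !mulmxA.
  by rewrite (@lin_mx_comp _ _ _ _ _ _ _ _ (mulmxr (B *m B^T) \o mulmx (A *m A^T))).
by rewrite det_mulmx det_lin_mulmx// det_lin_mulmxr// mulr1.
Qed.

End Gram.

(** * Lattice data attached to an element of G *)

Section PointGeometry.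
Variables (R : realType) (m k : nat).
Local Notation n := (m + k)%N.
Local Notation gs := (slspace R n).
Local Notation G := (slT R n).

Lemma gramZ p N (a : R) (A : 'M[R]_(p, N)) : (a *: A) *m (a *: A)^T = (a * a) *: (A *m A^T).
Proof. by rewrite linearZ /= -scalemxAl -scalemxAr scalerA. Qed.

Lemma detZgram p N (a : R) (A : 'M[R]_(p, N)) : \det ((a *: A) *m (a *: A)^T) = (a ^+ p) ^+ 2 * \det (A *m A^T).
Proof. by rewrite gramZ detZ exprMn expr2. Qed.

Lemma det_gramM p N (T : 'M[R]_p) (A : 'M[R]_(p, N)) :
  \det ((T *m A) *m (T *m A)^T) = \det T ^+ 2 * \det (A *m A^T).
Proof. by rewrite trmx_mul mulmxA -[T *m A *m _]mulmxA det_mulmx [\det (T *m _)]det_mulmx det_tr; ring. Qed.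

Lemma dual_basisZ p N (a : R) (A : 'M[R]_(p, N)) : a != 0 -> row_free A ->
  invmx ((a *: A) *m (a *: A)^T) *m (a *: A) = a^-1 *: (invmx (A *m A^T) *m A).
Proof.
move=> a0 fA; have uA := gram_unit fA; rewrite gramZ invmxZ; last first.
  by rewrite unitmxE detZ unitrM unitrX ?unitfE ?mulf_neq0//= -unitfE -unitmxE.
by rewrite -scalemxAl -scalemxAr scalerA; congr (_ *: _); field.
Qed.

Lemma row_freeZ p N (a : R) (A : 'M[R]_(p, N)) : a != 0 -> row_free A -> row_free (a *: A).
Proof. by move=> a0 fA; rewrite /row_free mxrank_scale_nz. Qed.

Definition Ag (g : G) : 'M[R]_(m, n) := usubmx (val g).
Definition Bg (g : G) : 'M[R]_(k, n) := dsubmx (val g) *m projm (Ag g).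

Lemma val_col (g : G) : val g = col_mx (Ag g) (dsubmx (val g)).
Proof. by rewrite vsubmxK. Qed.

Lemma Ag_free g : row_free (Ag g).
Proof.
apply: inj_row_free => v vA.
have : row_mx v (0 : 'rV[R]_k) *m val g = 0 by rewrite val_col mul_row_col vA mul0mx addr0.
move/eqP; rewrite mulmx_free_eq0 ?row_free_unit ?sl_unit// => /eqP.
by rewrite -[X in _ = X]row_mx0 => /eq_row_mx[].
Qed.

(** The squared covolume of Lambda, a polynomial in the entries of g; continuity estimates use it in
    place of the covolume. *)
Definition cov2 (g : G) : R := \det (Ag g *m (Ag g)^T).

Lemma cov2_gt0 g : 0 < cov2 g. Proof. exact/gram_gt0/Ag_free. Qed.

Definition cov (g : G) : R := Num.sqrt (cov2 g).

Lemma cov_gt0 g : 0 < cov g. Proof. by rewrite sqrtr_gt0 cov2_gt0. Qed.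

Lemma cov_sqr g : cov g ^+ 2 = cov2 g. Proof. by rewrite sqr_sqrtr// ltW// cov2_gt0. Qed.

Lemma AgBg g : Ag g *m (Bg g)^T = 0.
Proof. by rewrite trmx_mul projm_tr mulmxA mul_projm ?mul0mx// Ag_free. Qed.

(* Schur complement: the Gram matrix of g is block diagonal in the basis (Ag g, Bg g). *)
Lemma schur g : cov2 g * \det (Bg g *m (Bg g)^T) = 1.
Proof.
set X := dsubmx (val g) *m (Ag g)^T *m invmx (Ag g *m (Ag g)^T).
have E : block_mx 1%:M 0 (- X) 1%:M *m val g = col_mx (Ag g) (Bg g).
  rewrite [in LHS]val_col mul_block_col !mul1mx mul0mx addr0; congr col_mx.
  by rewrite /Bg /projm mulmxBr mulmx1 mulNmx addrC !mulmxA.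
have dE : \det (col_mx (Ag g) (Bg g)) = 1.
  by rewrite -E det_mulmx det_lblock !det1 !mul1r sl_det.
have := congr1 (fun M => \det (M *m M^T)) (erefl (col_mx (Ag g) (Bg g))).
rewrite {1}det_mulmx det_tr dE mulr1 tr_col_mx mul_col_row AgBg.
have -> : Bg g *m (Ag g)^T = 0 by rewrite -[LHS]trmxK trmx_mul trmxK AgBg linear0.
by rewrite det_ublock => <-.
Qed.

Lemma Bg_free g : row_free (Bg g).
Proof.
apply: row_free_gram; apply/eqP => z; have := schur g; rewrite z mulr0 => /eqP.
by rewrite eq_sym oner_eq0.
Qed.

Lemma ptE (g : G) : pt (val g) = (zspan (Ag g), zspan (Bg g)).
Proof.
rewrite /pt -/(Ag g); congr pair; rewrite [X in projperp _ (zspan X)]val_col.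
by rewrite projperp_zspan// Ag_free.
Qed.

Lemma covol_pt (g : G) : covol m (pt (val g)).1 = cov g.
Proof. by rewrite ptE covol_zspan// Ag_free. Qed.

Lemma Ag_ub y g : Ag (ub y * g)%g = Ag g.
Proof.
rewrite /Ag sl_valM val_ub [in LHS]val_col mul_block_col col_mxKu mul1mx mul0mx addr0//.
Qed.

Lemma Bg_ub y g : Bg (ub y * g)%g = Bg g.
Proof.
rewrite /Bg Ag_ub sl_valM val_ub [in LHS]val_col mul_block_col col_mxKd mul1mx mulmxDl -mulmxA.
by rewrite mul_projm ?mulmx0 ?add0r// Ag_free.
Qed.

Lemma pt_ub y (g : G) : pt (val (ub y * g)%g) = pt (val g).
Proof. by rewrite !ptE Ag_ub Bg_ub. Qed.

Lemma bdiag_mul (h g : G) : ursubmx (val h) = 0 -> dlsubmx (val h) = 0 ->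
  Ag (h * g)%g = ulsubmx (val h) *m Ag g /\ Bg (h * g)%g = drsubmx (val h) *m Bg g.
Proof.
move=> h1 h2; have [u1 u2] := bdiag_unit h1.
have E : val (h * g)%g = col_mx (ulsubmx (val h) *m Ag g) (drsubmx (val h) *m dsubmx (val g)).
  by rewrite sl_valM {1}(bdiag_eq h1 h2) {1}[val g]val_col mul_block_col !mul0mx add0r addr0.
have EA : Ag (h * g)%g = ulsubmx (val h) *m Ag g by rewrite /Ag E col_mxKu.
split=> //; rewrite /Bg EA projm_unit ?Ag_free// E col_mxKd mulmxA//.
Qed.

Lemma GamH_int (h : G) : GamH h -> exists U U' : 'M[int]_m, exists W W' : 'M[int]_k,
  [/\ ulsubmx (val h) = map_mx intr U, drsubmx (val h) = map_mx intr W, U' *m U = 1%:M & W' *m W = 1%:M].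
Proof.
move=> Hh; have [[z hz] h1 h2] := Hh; have [[z' hz'] h1' h2'] := GamHV Hh.
exists (ulsubmx z), (ulsubmx z'), (drsubmx z), (drsubmx z').
have E0 : val (h^-1 * h)%g = block_mx 1%:M 0 0 1%:M by rewrite mulVg sl_val1 -scalar_mx_block.
rewrite sl_valM (bdiag_eq h1 h2) (bdiag_eq h1' h2') mulmx_block !mulmx0 !mul0mx !addr0 !add0r in E0.
move: E0 => /eq_block_mx[e1 _ _ e2].
have E1 : ulsubmx (val h) = map_mx intr (ulsubmx z) by rewrite hz map_ulsubmx.
have E2 : drsubmx (val h) = map_mx intr (drsubmx z) by rewrite hz map_drsubmx.
have E3 : ulsubmx (val (h^-1)%g) = map_mx intr (ulsubmx z') by rewrite hz' map_ulsubmx.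
have E4 : drsubmx (val (h^-1)%g) = map_mx intr (drsubmx z') by rewrite hz' map_drsubmx.
split => //; apply: (@zr_inj R); rewrite /zr map_mxM map_mx1 -?E1 -?E2 -?E3 -?E4//.
Qed.

Lemma pt_GamH (h g : G) : GamH h -> pt (val (h * g)%g) = pt (val g).
Proof.
move=> Hh; have [_ h1 h2] := Hh; have [EA EB] := bdiag_mul g h1 h2.
have [U [U' [W [W' [eU eW hU hW]]]]] := GamH_int Hh.
by rewrite !ptE EA EB eU eW (zspan_unimod _ hU) (zspan_unimod _ hW).
Qed.

(** P is H\G as a set. Changes of basis of Lambda and of its factor lattice give the block diagonal
    part; the remaining discrepancy D of the last k rows projects to 0, so it lies in the span of
    Lambda and gives the unipotent part. *)
Lemma pt_eq (g g' : G) : pt (val g) = pt (val g') ->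
  exists y h, GamH h /\ g' = (ub y * (h * g))%g.
Proof.
rewrite !ptE => -[eA eB].
have [U [U' [hA hA' UU' U'U]]] := zspan_eqP (Ag_free g) eA.
have [W [W' [hB hB' WW' W'W]]] := zspan_eqP (Bg_free g) eB.
have uU : map_mx intr U \in @unitmx R m.
  by have /(congr1 (map_mx (intr : int -> R))) := UU'; rewrite map_mxM map_mx1 => /mulmx1_unit[].
have eP : projm (Ag g') = projm (Ag g) by rewrite hA projm_unit// Ag_free.
set B := dsubmx (val g) in hB *; set B' := dsubmx (val g') in hB *.
pose D := B' - map_mx intr W *m B.
have DP : D *m projm (Ag g) = 0.
  by rewrite mulmxBl -mulmxA -/(Bg g) -hB /Bg -/B' eP subrr.
pose X := D *m (Ag g)^T *m invmx (Ag g *m (Ag g)^T).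
have DX : D = X *m Ag g.
  by move: DP; rewrite /projm mulmxBr mulmx1 !mulmxA => /eqP; rewrite subr_eq0 => /eqP.
pose hM : 'M[R]_n := block_mx (map_mx intr U) 0 0 (map_mx intr W).
have gE : val g' = block_mx 1%:M 0 (X *m invmx (map_mx intr U)) 1%:M *m hM *m val g.
  rewrite [val g']val_col [val g]val_col /hM mulmx_block !mul1mx !mul0mx !mulmx0 !addr0 !add0r.
  rewrite mulmxKV// mul_block_col mul0mx addr0 -hA -DX; congr col_mx.
  by rewrite /D subrK.
have dh : \det hM = 1.
  have := congr1 determinant gE; rewrite !det_mulmx !sl_det det_lblock !det1 !mulr1 mul1r//.
pose h : G := insubd (1%g : G) hM.
have vh : val h = hM by rewrite /h val_insubd dh eqxx.
exists (X *m invmx (map_mx intr U)), h; split.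
  split; rewrite ?vh ?block_mxKur ?block_mxKdl//.
  by exists (block_mx U 0 0 W); rewrite vh /hM map_block_mx !map_mx0.
by apply: val_inj; rewrite !sl_valM val_ub vh mulmxA gE.
Qed.

Lemma cov2_inv : Hinv (fun g => cov2 g).
Proof.
split=> [y g|h g Hh]; first by rewrite /cov2 Ag_ub.
have [_ h1 h2] := Hh; have [EA _] := bdiag_mul g h1 h2.
have [U [U' [W [W' [eU _ hU _]]]]] := GamH_int Hh.
rewrite /cov2 EA trmx_mul !mulmxA -[_ *m Ag g *m _]mulmxA !det_mulmx det_tr mulrAC -expr2 eU.
by rewrite (det_unimod _ (mulmx1C hU)) mul1r.
Qed.

Lemma lc_Ag : lc (fun g : gs => Ag g : matspace R m n).
Proof.
apply: lc_mx => i j.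
by apply: lc_ext (lc_mxE (lshift k i) j (lc_val (@lc_id _ _))) => x; rewrite !mxE.
Qed.

Lemma lc_gram : lc (fun g : gs => Ag g *m (Ag g)^T : matspace R m m).
Proof. by apply: lc_mulmx; [exact: lc_Ag|apply: lc_trmx; exact: lc_Ag]. Qed.

Lemma lc_cov2 : lc (fun g : gs => cov2 g : rspace R).
Proof. by apply: lc_det; exact: lc_gram. Qed.

(** After orthonormalising the rows of Ag x, the factor det T^2 cancels and it remains to bound the
    Gram determinant of Q g, where Q has orthonormal rows. *)
Lemma cov2_bound (r : R) : exists2 C : R, 0 < C & forall x g : G, nm g <= r -> cov2 (x * g)%g <= C * cov2 x.
Proof.
have ld : lc (fun X : matspace R m n => \det (X *m X^T) : rspace R).
  by apply: lc_det; apply: lc_mulmx; [exact: lc_id|apply: lc_trmx; exact: lc_id].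
have [[C hC] _] := ld ((m * n)%:R * `|r|).
exists (`|C| + 1); first by rewrite ltr_wpDl.
move=> x g gr; have [T hT] := gram_schmidt (Ag_free x).
set Q := T *m Ag x in hT.
have dT : \det T ^+ 2 * cov2 x = 1.
  by rewrite -(det1 R m) -hT /Q det_gramM.
have T0 : 0 < \det T ^+ 2.
  by rewrite -(pmulr_lgt0 _ (cov2_gt0 x)) dT.
have EA : Ag (x * g)%g = Ag x *m val g by rewrite /Ag sl_valM mul_usub_mx.
have E : \det T ^+ 2 * cov2 (x * g)%g = \det (Q *m val g *m (Q *m val g)^T).
  by rewrite /cov2 EA -det_gramM /Q mulmxA.
clearbody Q.
have Q1 i j : `|Q i j| <= 1.
  have : (Q *m Q^T) i i = 1 by rewrite hT !mxE eqxx.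
  rewrite mxE (bigD1 j)//= mxE -expr2 => h.
  have : Q i j ^+ 2 <= 1.
    by rewrite -h lerDl; apply: sumr_ge0 => l _; rewrite mxE -expr2 sqr_ge0.
  by move=> h2; rewrite -sqrtr_sqr -[leRHS]sqrtr1 ler_wsqrtr.
have nQ : nm (Q *m val g : matspace R m n) <= (m * n)%:R * `|r|.
  apply: le_trans (nrmM _ _) _; apply: ler_pM; rewrite ?nrm_ge0//.
    by rewrite -[leRHS]mulr1; exact: nrm_le.
  exact: le_trans gr (ler_norm r).
have := hC _ nQ; rewrite /nm/= -E => h.
rewrite -(ler_pM2l T0) mulrCA dT mulr1; apply: le_trans (ler_norm _) _; apply: le_trans h _.
by apply: le_trans (ler_norm C) _; rewrite lerDl.
Qed.

Hypotheses (hm : (0 < m)%N) (hk : (0 < k)%N).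

Lemma DgV_split t (g : G) : 0 < t ->
  Ag ((Dg m k t)^-1 * g)%g = (t `^ m%:R^-1)^-1 *: Ag g /\
  Bg ((Dg m k t)^-1 * g)%g = (t `^ (- k%:R^-1))^-1 *: Bg g.
Proof.
move=> t0; have V := val_DgV hm hk t0.
have E : val ((Dg m k t)^-1)%g = block_mx ((t `^ m%:R^-1)^-1%:M) 0 0 ((t `^ (- k%:R^-1))^-1%:M).
  rewrite V; apply/matrixP => i j; rewrite [LHS]mxE [X in X *+ _]mxE.
  case: (split_ordP i) => i' ->; case: (split_ordP j) => j' ->; rewrite ?dvl ?dvr.
  - by rewrite block_mxEul !mxE (inj_eq (@lshift_inj _ _)).
  - by rewrite block_mxEur !mxE eq_lrshift mulr0n.
  - by rewrite block_mxEdl !mxE eq_rlshift mulr0n.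
  - by rewrite block_mxEdr !mxE (inj_eq (@rshift_inj _ _)).
have h1 : ursubmx (val ((Dg m k t)^-1)%g) = 0 by rewrite E block_mxKur.
have h2 : dlsubmx (val ((Dg m k t)^-1)%g) = 0 by rewrite E block_mxKdl.
by have [-> ->] := bdiag_mul g h1 h2; rewrite E block_mxKul block_mxKdr !mul_scalar_mx.
Qed.

Lemma cov2_Dg t (g : G) : 0 < t -> cov2 ((Dg m k t)^-1 * g)%g = t ^- 2 * cov2 g.
Proof.
move=> t0; rewrite /cov2 (DgV_split g t0).1 linearZ /= -scalemxAl -scalemxAr scalerA detZ.
by congr (_ * _); rewrite exprMn exprVn powR_root ?ltW// -invfM -expr2.
Qed.

Lemma cov_Dg t (g : G) : 0 < t -> cov ((Dg m k t)^-1 * g)%g = t^-1 * cov g.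
Proof.
move=> t0; rewrite /cov cov2_Dg// sqrtrM ?invr_ge0 ?sqr_ge0//.
by rewrite -exprVn sqrtr_sqr ger0_norm// invr_ge0 ltW.
Qed.

Lemma tmxZ p q N a b (A : 'M[R]_(p, N)) (B : 'M[R]_(q, N)) : tmx (a *: A) (b *: B) = (a * b) *: tmx A B.
Proof.
apply/row_matrixP => i; case/mxvec_indexP: i => i j; rewrite linearZ /= !row_tmx /tens.
have rZ N1 p1 c (C : 'M[R]_(p1, N1)) l : row l (c *: C) = c *: row l C by rewrite linearZ.
by rewrite !rZ [(_ *: _)^T]linearZ /= -scalemxAl -scalemxAr scalerA [LHS]linearZ.
Qed.

Definition Xg (g : G) := invmx (Ag g *m (Ag g)^T) *m Ag g.

(** The tangent basis rescaled to covolume 1: the dual lattice and the factor lattice both have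
    covolume 1/cov, and the two roots of cov normalise them separately. *)
Definition Mg (g : G) : 'M[R]_(m * k, n * n) :=
  (cov g `^ m%:R^-1 * cov g `^ k%:R^-1) *: tmx (Xg g) (Bg g).

Lemma det_Xg g : \det (Xg g *m (Xg g)^T) = (cov2 g)^-1.
Proof.
have uA := gram_unit (Ag_free g).
rewrite /Xg trmx_mul trmx_inv trmx_mul trmxK mulmxA -[_ *m Ag g *m (Ag g)^T]mulmxA mulVmx// mul1mx.
by rewrite det_inv.
Qed.

Lemma Mg_tmx g : Mg g = tmx (cov g `^ m%:R^-1 *: Xg g) (cov g `^ k%:R^-1 *: Bg g).
Proof. by rewrite tmxZ. Qed.

Lemma det_Mg g : \det (Mg g *m (Mg g)^T) = 1.
Proof.
have c0 := cov_gt0 g; have c1 := ltW c0; rewrite Mg_tmx; apply: det_tmx; rewrite detZgram powR_root// cov_sqr.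
  by rewrite det_Xg mulfV// gt_eqF// cov2_gt0.
exact: schur.
Qed.

Lemma Mg_UY g : UY (Mg g).
Proof.
have c0 := cov_gt0 g; have c1 := ltW c0.
have pm : cov g `^ m%:R^-1 != 0 by rewrite gt_eqF// powR_gt0.
have pk : cov g `^ k%:R^-1 != 0 by rewrite gt_eqF// powR_gt0.
split; last exact: det_Mg.
exists (cov g `^ m%:R^-1 *: Xg g), (cov g `^ k%:R^-1 *: Bg g); split.
- apply: row_free_gram; rewrite detZgram powR_root// cov_sqr det_Xg mulfV ?oner_eq0// gt_eqF// cov2_gt0//.
- apply: row_free_gram; rewrite detZgram powR_root// cov_sqr schur oner_eq0//.
- by rewrite linearZ /= -scalemxAl -scalemxAr /Xg -mulmxA AgBg mulmx0 !scaler0.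
by move=> i j; rewrite Mg_tmx row_tmx.
Qed.

Lemma Phi_pt (g : G) : Phi (Pnorm (pt (val g))) = zspan (Mg g).
Proof.
have c0 := cov_gt0 g; have c1 := ltW c0.
have pm : cov g `^ (- m%:R^-1) != 0 by rewrite gt_eqF// powR_gt0.
rewrite Mg_tmx -tensorL_zspan /Phi; congr tensorL; rewrite /Pnorm covol_pt ptE [LHS]/= scaleset_zspan//.
rewrite dual_zspan; last exact: row_freeZ (Ag_free g).
by rewrite dual_basisZ ?Ag_free// powRN invrK.
Qed.

Lemma Mg_Dg t (g : G) : 0 < t -> Mg ((Dg m k t)^-1 * g)%g = Mg g.
Proof.
move=> t0; have c0 := cov_gt0 g; have [EA EB] := DgV_split g t0.
rewrite /Mg /Xg EA EB cov_Dg//.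
set a := t `^ m%:R^-1; set b := t `^ (- k%:R^-1).
have a0 : a != 0 by rewrite gt_eqF// powR_gt0.
have b0 : b != 0 by rewrite gt_eqF// powR_gt0.
rewrite dual_basisZ ?Ag_free ?invr_eq0// invrK.
rewrite tmxZ scalerA; congr (_ *: _).
rewrite !powRM ?invr_ge0 ?ltW//.
have -> : t^-1 `^ m%:R^-1 = a^-1 by rewrite /a -[t^-1]powR_inv1 ?ltW// -powRrM mulN1r powRN.
have -> : t^-1 `^ k%:R^-1 = b by rewrite /b -[t^-1]powR_inv1 ?ltW// -powRrM mulN1r.
by field; rewrite a0 b0.
Qed.

Lemma Gam_Zlat (g : G) : Gam g -> zspan (val g) = @Zlat R n.
Proof.
move=> Gg; have [z hz] := Gg; have [z' hz'] := GamV Gg.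
rewrite /Zlat -[val g]mulmx1 hz; apply: (@zspan_unimod _ _ _ _ _ z').
by apply: (@zr_inj R); rewrite /zr map_mxM map_mx1 -hz -hz' -sl_valM mulVg.
Qed.

Lemma uT_Mg (g : G) : Gam g -> @uT R m k (zspan (Ag g)) = zspan (Mg g).
Proof.
move=> Gg; have c0 := cov_gt0 g.
have eT' : tangent (zspan (Ag g)) = zspan (tmx (Xg g) (Bg g)).
  rewrite /tangent /factor_lattice -(Gam_Zlat Gg).
  have /(congr1 snd) := ptE g; rewrite /pt /= => ->.
  by rewrite dual_zspan ?tensorL_zspan// Ag_free.
set la := cov g `^ m%:R^-1 * cov g `^ k%:R^-1.
have la0 : 0 < la by rewrite mulr_gt0// powR_gt0.
have E := det_Mg g; rewrite /Mg -/la detZgram in E.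
have lN : 0 < (la ^+ (m * k)) ^+ 2 by rewrite !exprn_gt0.
have dE : \det (tmx (Xg g) (Bg g) *m (tmx (Xg g) (Bg g))^T) = ((la ^+ (m * k))^-1) ^+ 2.
  by apply: (mulfI (lt0r_neq0 lN)); rewrite E exprVn mulfV ?gt_eqF.
rewrite /uT /unimod eT' covol_zspan; last by apply: row_free_gram; rewrite dE expf_neq0// invr_eq0 expf_neq0 ?gt_eqF.
rewrite dE sqrtr_sqr ger0_norm ?invr_ge0 ?exprn_ge0 ?ltW// scaleset_zspan /Mg -/la; congr (zspan (_ *: _)).
rewrite -powR_mulrn ?ltW// -powRN -powRrM mulrNN mulfV ?powRr1 ?ltW// pnatr_eq0 muln_eq0.
by rewrite negb_or -!lt0n hm hk.
Qed.

End PointGeometry.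

(** * Rational points *)

Section GrassmannianCosets.
Variables (R : realType) (m k : nat) (hk : (0 < k)%N).
Local Notation n := (m + k)%N.
Local Notation G := (slT R n).
Local Notation GrQ := (@GrQ R m n).

Lemma GrQ_Ag (g : G) : Gam g -> GrQ (zspan (Ag g)).
Proof.
move=> Gg; have [z hz] := Gg; split; [|split].
- have -> : Ag g = map_mx intr (usubmx z) *m 1%:M by rewrite mulmx1 /Ag hz map_usubmx.
  exact: zspan_mul.
- by exists (Ag g); split => //; exact: Ag_free.
apply/seteqP; split=> v.
  move=> [/realspan_zspan[c ->]]; rewrite -(Gam_Zlat Gg) => -[x hx].
  have E : row_mx c (0 : 'rV[R]_k) *m val g = map_mx intr x *m val g.
    by rewrite -hx [in LHS]val_col mul_row_col mul0mx addr0.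
  have {}E := row_free_inj (etrans (row_free_unit _) (sl_unit g)) E.
  exists (lsubmx x); congr (_ *m _).
  have := congr1 lsubmx E; rewrite row_mxKl => ->.
  by rewrite -map_lsubmx.
move=> Lv; split.
  have [c ->] := Lv; by apply/realspan_zspan; exists (map_mx intr c).
have [c ->] := Lv; rewrite -(Gam_Zlat Gg); exists (row_mx c 0).
by rewrite map_row_mx map_mx0 [X in _ = _ *m X]val_col mul_row_col mul0mx addr0.
Qed.

Lemma Zlat_int p (A : 'M[R]_(p, n)) : (forall i, @Zlat R n (row i A)) -> exists Z : 'M[int]_(p, n), A = map_mx intr Z.
Proof. by move=> /zspan_mulP[Z ->]; exists Z; rewrite mulmx1. Qed.

(** Smith normal form writes an integral basis as M W1, with W1 the first m rows of a unimodular
    matrix and M invertible over R; primitivity then makes W1 itself a basis. *)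
Lemma GrQ_ex L : GrQ L -> exists2 g : G, Gam g & L = zspan (Ag g).
Proof.
move=> [LZ [[A [fA EL]] prim]].
have [Z hZ] : exists Z : 'M[int]_(m, n), A = map_mx intr Z.
  by apply: Zlat_int => i; apply: LZ; rewrite EL; exact: zspan_row.
have [Lm uL [W uW [d _ EZ]]] := int_Smith_normal_form Z.
set D := \matrix_(i, j) _ in EZ.
have D0 : rsubmx D = 0.
  apply/matrixP => i j; rewrite !mxE /=.
  by have -> : (i == m + j :> nat) = false by apply/eqP; have := ltn_ord i; lia.
have EZ' : Z = Lm *m lsubmx D *m usubmx W.
  by rewrite EZ -[D]hsubmxK -[W in LHS]vsubmxK D0 -mulmxA mul_row_col mul0mx addr0 row_mxKl mulmxA.
pose M : 'M[R]_m := map_mx intr (Lm *m lsubmx D).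
pose W1 : 'M[R]_(m, n) := map_mx intr (usubmx W).
have EA : A = M *m W1 by rewrite hZ EZ' map_mxM.
have uM : M \in unitmx.
  rewrite -row_free_unit; apply: inj_row_free => v vM.
  by apply/eqP; rewrite -(mulmx_free_eq0 _ fA) EA mulmxA vM mul0mx.
have EL1 : L = zspan W1.
  apply/seteqP; split; first by rewrite EL EA; exact: zspan_mul.
  move=> v [z ->]; rewrite -prim; split.
    rewrite EL; apply/realspan_zspan; exists (map_mx intr z *m invmx M).
    by rewrite EA mulmxA mulmxKV.
  by exists (z *m usubmx W); rewrite mulmx1 map_mxM.
have dW : \det W = 1 \/ \det W = -1.
  move: uW; rewrite unitmxE => /unitrP[x [h _]]; move: (\det W) h => y.
  move=> /(congr1 absz); rewrite abszM => /eqP; rewrite muln_eq1 => /andP[_ /eqP h]; lia.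
(* Corrects the sign of the determinant in one of the last k rows, which leaves the span of the
   first m unchanged. *)
pose E : 'M[int]_k := diag_mx (\row_j (if j == Ordinal hk then \det W else 1)).
have dE : \det E = \det W.
  rewrite /E det_diag (bigD1 (Ordinal hk))//= mxE eqxx big1 ?mulr1// => j jn.
  by rewrite mxE (negbTE jn).
pose N : 'M[int]_n := block_mx 1%:M 0 0 E *m W.
have dN : \det (map_mx intr N : 'M[R]_n) = 1.
  rewrite det_map_mx /N det_mulmx det_lblock det1 mul1r dE.
  by case: dW => ->.
pose g : G := insubd (1%g : G) (map_mx intr N).
have vg : val g = map_mx intr N by rewrite /g val_insubd dN eqxx.
exists g; first by exists N.
rewrite EL1; congr zspan; rewrite /Ag vg -map_usubmx; congr map_mx.
by rewrite /N -{2}[W]vsubmxK mul_block_col col_mxKu mul1mx mul0mx addr0.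
Qed.

(* An integral matrix of determinant 1 whose first m rows span L. *)
Definition sct (L : set 'rV[R]_n) : G := xget 1%g [set g : G | Gam g /\ L = zspan (Ag g)].

Lemma sctP L : GrQ L -> Gam (sct L) /\ L = zspan (Ag (sct L)).
Proof.
move=> /GrQ_ex[g Gg Eg].
by apply: (@xgetPex _ 1%g [set g : G | Gam g /\ L = zspan (Ag g)]); exists g.
Qed.

Lemma Gam_ub_int (y : 'M[R]_(k, m)) : Gam (ub y) -> exists z, y = zr R z.
Proof.
by move=> [z hz]; exists (dlsubmx z); rewrite /zr map_dlsubmx -hz val_ub block_mxKdl.
Qed.

(** Integral matrices with the same first span define the same point of P, since both span Z^n. They
    differ by an element of H, whose unipotent part is integral because everything else is. *)
Lemma GrQ_fiber L g : GrQ L -> Gam g ->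
  (zspan (Ag g) = L <-> exists z h, GamH h /\ g = (ub (zr R z) * (h * sct L))%g).
Proof.
move=> QL Gg; have [Gs Es] := sctP QL; split=> [E|[z [h [Hh ->]]]].
  have Ept : pt (val (sct L)) = pt (val g).
    by rewrite /pt -/(Ag g) -/(Ag (sct L)) -Es E (Gam_Zlat Gs) (Gam_Zlat Gg).
  have [y [h [Hh Eg]]] := pt_eq Ept.
  have [z Ez] : exists z, y = zr R z.
    apply: Gam_ub_int; have -> : ub y = (g * (h * sct L)^-1)%g by rewrite Eg mulgK.
    apply: GamM => //; apply: GamV; apply: GamM => //; exact: Gam_GamH.
  by exists z, h; rewrite -Ez.
have := pt_ub (zr R z) (h * sct L)%g; rewrite (pt_GamH (sct L) Hh) => /(congr1 fst).
by rewrite !ptE /= -Es.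
Qed.

End GrassmannianCosets.

(** * A lower bound for the number of coprime pairs *)

Section CoprimePairs.
Local Open Scope set_scope.
Variable R : realType.

(** The term 1/4 followed by the telescoping bound 1/g^2 <= 1/(g-1) - 1/g. *)
Lemma inv_sqr_sum M : \sum_(2 <= g < M.+2) ((g%:R : R) ^- 2) <= 3 / 4.
Proof.
case: M => [|M]; first by rewrite big_geq//; lra.
suff : \sum_(2 <= g < M.+3) ((g%:R : R) ^- 2) <= 3 / 4 - M.+2%:R^-1.
  by move=> /le_trans; apply; rewrite gerBl invr_ge0.
elim: M => [|M IH]; first by rewrite big_nat1; lra.
rewrite big_nat_recr//=; apply: le_trans (lerD IH (lexx _)) _.
have a0 : 0 < M.+2%:R :> R by rewrite ltr0n.
have -> : M.+3%:R = M.+2%:R + 1 :> R by rewrite -natr1.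
move: (M.+2%:R) a0 => a a0.
have b0 : 0 < a + 1 by rewrite addr_gt0.
have E : 3 / 4 - (a + 1)^-1 - (3 / 4 - a^-1 + (a + 1) ^- 2) = (a * (a + 1) ^+ 2)^-1.
  by field; rewrite !gt_eqF.
by rewrite -subr_ge0 E invr_ge0 mulr_ge0 ?sqr_ge0// ltW.
Qed.

(** At most (M/g)^2 pairs have gcd g, so the pairs with gcd at least 2 fill no more than three
    quarters of the square. *)
Lemma coprime_pairs M : (M ^ 2 <= 4 * #|[set x : 'I_M * 'I_M | coprime x.1.+1 x.2.+1]|)%N.
Proof.
case: M => [//|M0]; set M := M0.+1.
set P := [set x | _].
pose gc (x : 'I_M * 'I_M) : 'I_M.+1 := inord (gcdn x.1.+1 x.2.+1).
have gcE x : gc x = gcdn x.1.+1 x.2.+1 :> nat.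
  rewrite /gc inordK// ltnS; apply: leq_trans (ltn_ord x.1).
  by apply: dvdn_leq => //; exact: dvdn_gcdl.
have tot : (M ^ 2 = \sum_(g < M.+1) #|[set x | gc x == g]|)%N.
  have -> : (M ^ 2 = #|{: 'I_M * 'I_M}|)%N by rewrite card_prod card_ord expnS expn1.
  rewrite -sum1_card (partition_big gc predT)//=; apply: eq_bigr => g _.
  by rewrite -sum1_card; apply: eq_bigl => x; rewrite inE.
have bnd (g : 'I_M.+1) : (#|[set x | gc x == g]| <= (M %/ g) ^ 2)%N.
  case: (posnP g) => [g0|g0].
    rewrite (_ : [set x | _] = finset.set0) ?cards0//; apply/finset.setP => x; rewrite !inE.
    by apply/negbTE/eqP => /(congr1 val) /=; rewrite gcE g0 => h; have := gcdn_gt0 x.1.+1 x.2.+1; rewrite h.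
  pose D := (M %/ g)%N.
  pose f (x : 'I_M * 'I_M) : 'I_D.+1 * 'I_D.+1 := (inord (x.1.+1 %/ g), inord (x.2.+1 %/ g)).
  have fD (y : 'I_M) : (y.+1 %/ g < D.+1)%N by rewrite ltnS leq_div2r.
  have dv x : gc x == g -> (g %| x.1.+1)%N /\ (g %| x.2.+1)%N.
    by move=> /eqP/(congr1 val) /=; rewrite gcE => <-; rewrite dvdn_gcdl dvdn_gcdr.
  have finj : {in [set x | gc x == g] &, injective f}.
    move=> x y; rewrite !inE => /dv[x1 x2] /dv[y1 y2] [] /(congr1 val) + /(congr1 val).
    rewrite /= !inordK// => e1 e2.
    have h1 : x.1.+1 = y.1.+1 by rewrite -(divnK x1) -(divnK y1) e1.
    have h2 : x.2.+1 = y.2.+1 by rewrite -(divnK x2) -(divnK y2) e2.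
    by case: x y h1 h2 {x1 x2 y1 y2 e1 e2} => [x1 x2] [y1 y2] /= [h1] [h2]; congr pair; apply: val_inj.
  rewrite -(card_in_imset finj).
  have sub : f @: [set x | gc x == g] \subset finset.setX [set~ ord0] [set~ ord0].
    apply/fintype.subsetP => _ /imsetP[x +  ->]; rewrite inE => /dv[x1 x2].
    rewrite finset.in_setX !finset.in_setC1; apply/andP; split.
      by rewrite -val_eqE [val _]/= inordK ?fD// -lt0n divn_gt0// dvdn_leq.
    by rewrite -val_eqE [val _]/= inordK ?fD// -lt0n divn_gt0// dvdn_leq.
  apply: leq_trans (subset_leq_card sub) _; rewrite cardsX !cardsC1 card_ord /=.
  by rewrite expnS expn1.
have P1 : (#|[set x | gc x == inord 1]| <= #|P|)%N.
  apply: subset_leq_card; apply/fintype.subsetP => x; rewrite !inE => /eqP/(congr1 val) /=.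
  by rewrite gcE inordK// /coprime => ->.
rewrite -(ler_nat R) tot natrM.
have E : (\sum_(g < M.+1) #|[set x | gc x == g]| <= #|P| + \sum_(2 <= g < M.+1) (M %/ g) ^ 2)%N.
  rewrite (eq_bigr (fun g : 'I_M.+1 => #|[set x | gc x == inord g]|)); last first.
    by move=> g _; apply: eq_card => x; rewrite !inE inord_val.
  rewrite -(big_mkord xpredT (fun g => #|[set x | gc x == inord g]|)) big_ltn// big_ltn//.
  have -> : #|[set x | gc x == inord 0]| = 0%N.
    by apply/eqP; rewrite -leqn0; have := bnd (inord 0); rewrite inordK// divn0.
  rewrite add0n; apply: leq_add; first exact: P1.
  rewrite big_seq [X in (_ <= X)%N]big_seq; apply: leq_sum => g; rewrite mem_index_iota => /andP[_ gM].
  by have := bnd (inord g); rewrite inordK.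
have S : (\sum_(2 <= g < M.+1) (M %/ g) ^ 2)%N%:R <= 3 / 4 * M%:R ^+ 2 :> R.
  apply: (@le_trans _ _ (\sum_(2 <= g < M.+1) M%:R ^+ 2 * (g%:R : R) ^- 2)); last first.
    by rewrite -mulr_sumr mulrC ler_wpM2r ?sqr_ge0//; exact: inv_sqr_sum.
  rewrite natr_sum big_seq [leRHS]big_seq; apply: ler_sum => g; rewrite mem_index_iota => /andP[g2 _].
  have g0 : 0 < g%:R :> R by rewrite ltr0n; lia.
  rewrite natrX -expr_div_n lerXn2r ?nnegrE// ?divr_ge0// ler_pdivlMr// -natrM ler_nat.
  exact: leq_trunc_div.
have := E; rewrite -(ler_nat R) natrD -tot natrX => E'.
lra.
Qed.

End CoprimePairs.

(** * An explicit family of primitive lattices *)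

Section LowerBound.
Variables (R : realType) (m' k' : nat).
Local Notation m := (m' + 1)%N.
Local Notation k := (1 + k')%N.
Local Notation n := (m + k)%N.

(** Bases [T | S] in Hermite form: T has last column (r, d) and S last row a. The integer parts in S
    keep T^-1 S bounded, so that the covolume is of order d = det T. *)
Definition Tz (d : nat) (r : 'cV[int]_m') : 'M[int]_m := block_mx 1%:M r 0 (d%:Z)%:M.
Definition Sz (d : nat) (r : 'cV[int]_m') (a : 'rV[int]_k) : 'M[int]_(m, k) :=
  col_mx (\matrix_(i, j) (divz (r i 0 * a 0 j) d%:Z)) a.
Definition Lz d r a : 'M[int]_(m, n) := row_mx (Tz d r) (Sz d r a).
Definition Lr d r a : 'M[R]_(m, n) := map_mx intr (Lz d r a).

Lemma det_Tz d r : \det (map_mx intr (Tz d r) : 'M[R]_m) = d%:R.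
Proof. by rewrite det_map_mx /Tz det_ublock det1 mul1r det_scalar expr1. Qed.

Lemma Lr_free d r a : (0 < d)%N -> row_free (Lr d r a).
Proof.
move=> d0; apply: inj_row_free => v; rewrite /Lr /Lz map_row_mx mul_mx_row -[X in _ = X]row_mx0.
move=> /eq_row_mx[vT _]; apply/eqP; rewrite -(mulmx_free_eq0 v (B := map_mx intr (Tz d r))) ?vT//.
by rewrite row_free_unit unitmxE unitfE det_Tz pnatr_eq0 -lt0n.
Qed.

(** If a real combination of the rows is integral, so are its first coefficients and the products of
    the last one with d and with a1; Bezout makes the last one integral too. *)
Lemma Lr_GrQ d r (a : 'rV[int]_k) (a1 : nat) : (0 < d)%N -> a 0 (lshift k' 0) = a1 -> coprime d a1 ->
  @GrQ R m n (zspan (Lr d r a)).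
Proof.
move=> d0 ea cop; split; [|split].
- have -> : Lr d r a = map_mx intr (Lz d r a) *m 1%:M by rewrite mulmx1.
  exact: zspan_mul.
- by exists (Lr d r a); split => //; exact: Lr_free.
apply/seteqP; split=> v.
  move=> [/realspan_zspan[c ->] [x]]; rewrite mulmx1 => hx0.
  have hx : c *m Lr d r a = map_mx intr x := hx0.
  suff [z hz] : exists z, c = map_mx intr z by exists z; rewrite hz.
  move: hx; rewrite /Lr /Lz map_row_mx mul_mx_row -[x]hsubmxK map_row_mx => /eq_row_mx[h1 h2].
  move: h1 h2; rewrite -[c]hsubmxK; move: (lsubmx c) (rsubmx c) (lsubmx x) (rsubmx x) => c1 c2 x1 x2 h1 h2.
  move: h1; rewrite /Tz map_block_mx map_mx1 map_mx0 map_scalar_mx mul_row_block mulmx1 mulmx0 addr0.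
  rewrite -[x1]hsubmxK map_row_mx => /eq_row_mx[h1 h3].
  move: h2; rewrite /Sz map_col_mx mul_row_col => h2.
  rewrite h1 -map_mxM in h2; rewrite h1 -map_mxM in h3.
  have cd : exists q : int, c2 0 0 * d%:R = q%:~R.
    have E : c2 *m (d%:Z%:~R)%:M = map_mx intr (rsubmx x1 - lsubmx x1 *m r).
      by rewrite map_mxB -h3 addrC addKr.
    exists ((rsubmx x1 - lsubmx x1 *m r) 0 0).
    transitivity ((c2 *m (d%:Z%:~R)%:M) 0 0); first by rewrite mul_mx_scalar mxE mulrC.
    by rewrite E mxE.
  have ca : exists q : int, c2 0 0 * a1%:R = q%:~R.
    set B := \matrix_(i, j) _ in h2.
    have E : c2 *m map_mx intr a = map_mx intr (x2 - lsubmx x1 *m B).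
      by rewrite map_mxB -h2 addrC addKr.
    exists ((x2 - lsubmx x1 *m B) 0 (lshift k' 0)).
    transitivity ((c2 *m map_mx intr a) 0 (lshift k' 0)); first by rewrite mxE big_ord1 mxE ea.
    by rewrite E mxE.
  have [q1 hq1] := cd; have [q2 hq2] := ca.
  have [[u w] huw] : exists uw : int * int, uw.1 * d%:Z + uw.2 * a1%:Z = 1.
    have [u [w h]] := Bezoutz d%:Z a1%:Z; exists (u, w); rewrite /= h.
    by move: cop; rewrite /gcdz /= => /eqP ->.
  exists (row_mx (lsubmx x1) (u * q1 + w * q2)%:M); rewrite map_row_mx h1; congr row_mx.
  rewrite [LHS]mx11_scalar map_scalar_mx; congr scalar_mx.
  have := congr1 (fun x : int => x%:~R : R) huw; rewrite /= intrD !intrM -!pmulrn => h.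
  rewrite /= intrD !intrM -hq1 -hq2.
  transitivity (c2 0 0 * (u%:~R * d%:R + w%:~R * a1%:R)); first by rewrite h mulr1.
  by ring.
move=> Lv; have [z ->] := Lv; split.
  by apply/realspan_zspan; exists (map_mx intr z).
by exists (z *m Lz d r a); rewrite mulmx1 /Lr map_mxM.
Qed.

(** Uniqueness of the Hermite form: the change of basis must be unipotent with a single nontrivial
    column, and that column vanishes because r is reduced modulo d. *)
Lemma Lr_inj d1 (r1 : 'cV[int]_m') a1 d2 (r2 : 'cV[int]_m') a2 : (0 < d1)%N -> (0 < d2)%N ->
  (forall i, 0 <= r1 i 0 < d1%:Z) -> (forall i, 0 <= r2 i 0 < d2%:Z) ->
  zspan (Lr d1 r1 a1) = zspan (Lr d2 r2 a2) -> [/\ d1 = d2, r1 = r2 & a1 = a2].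
Proof.
move=> d10 d20 hr1 hr2 /(zspan_eqP (Lr_free r1 a1 d10))[U [U' [E _ UU' _]]].
have {}E : Lz d2 r2 a2 = U *m Lz d1 r1 a1.
  by apply: (@zr_inj R); rewrite /zr map_mxM.
move: E; rewrite /Lz mul_mx_row => /eq_row_mx[].
rewrite -[U]submxK in UU' *; rewrite -[U']submxK in UU'.
move: (ulsubmx U) (ursubmx U) (dlsubmx U) (drsubmx U) (ulsubmx U') (ursubmx U') (dlsubmx U') (drsubmx U') UU'.
move=> u1 u2 u3 u4 v1 v2 v3 v4 UU'.
rewrite /Tz /Sz !mulmx_block !mulmx1 !mulmx0 !addr0 => /eq_block_mx[e1 e2 e3 e4].
move: UU'; rewrite mulmx_block (@scalar_mx_block _ m' 1) -e1 -e3 !mul0mx !add0r => /eq_block_mx[_ _ _ uv].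
rewrite mul_block_col => /eq_col_mx[_]; rewrite mul0mx add0r => ea.
move: e2 e4; rewrite -e1 -e3 mul1mx mul0mx add0r => e2 e4.
have u41 : u4 0 0 = 1.
  have /matrixP/(_ 0 0) := e4; rewrite mul_mx_scalar !mxE mulr1n => h1.
  have /matrixP/(_ 0 0) := uv; rewrite !mxE big_ord1 mulr1n => h2.
  move: (u4 0 0) (v4 0 0) h1 h2 => x y h1 h2.
  have : x = 1 \/ x = -1.
    move: h2 => /(congr1 absz); rewrite abszM => /eqP; rewrite muln_eq1 => /andP[/eqP h _]; lia.
  case=> // x1; exfalso; move: h1; rewrite x1; lia.
have u4E : u4 = 1%:M by rewrite [LHS]mx11_scalar u41.
have de : d1 = d2.
  have /matrixP/(_ 0 0) := e4; rewrite u4E mul1mx !mxE !mulr1n => -[] ->//.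
split=> //; last by rewrite ea u4E mul1mx.
apply/colP => i; have /matrixP/(_ i 0) := e2; rewrite mul_mx_scalar !mxE.
have := hr1 i; have := hr2 i; rewrite -de; move: (r1 i 0) (r2 i 0) (u2 i 0) => x y z hy hx e.
have : z = 0 by nia.
by move=> z0; move: e; rewrite z0 mulr0 addr0.
Qed.

(** The basis is T times a matrix with entries bounded by 8, whose Gram determinant is therefore
    bounded, and det T = d <= 8 N. *)
Lemma Lr_covol : exists2 C : R, 0 < C & forall (N d : nat) (r : 'cV[int]_m') (a : 'rV[int]_k), (0 < N)%N -> (N < d)%N -> (d <= 8 * N)%N ->
  (forall i, 0 <= r i 0 < d%:Z) -> (forall j, 0 <= a 0 j <= (8 * N)%N%:Z) ->
  covol m (zspan (Lr d r a)) <= C * N%:R.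
Proof.
have ld : lc (fun X : matspace R m n => \det (X *m X^T) : rspace R).
  by apply: lc_det; apply: lc_mulmx; [exact: lc_id|apply: lc_trmx; exact: lc_id].
have [[C hC] _] := ld ((m * n)%:R * 8).
exists (8 * Num.sqrt (`|C| + 1)).
  by rewrite mulr_gt0// sqrtr_gt0 ltr_wpDl.
move=> N d r a N0 Nd d8 hr ha.
have d0 : (0 < d)%N by exact: leq_ltn_trans Nd.
have dR : 0 < d%:R :> R by rewrite ltr0n.
pose T : 'M[R]_m := map_mx intr (Tz d r).
have uT' : T \in unitmx by rewrite unitmxE unitfE det_Tz pnatr_eq0 -lt0n.
pose Th : 'M[R]_(m, k) := col_mx (\matrix_(i, j) ((divz (r i 0 * a 0 j) d%:Z)%:~R - (r i 0)%:~R * (a 0 j)%:~R / d%:R))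
   (\row_j ((a 0 j)%:~R / d%:R)).
have E : Lr d r a = T *m row_mx 1%:M Th.
  rewrite /Lr /Lz map_row_mx mul_mx_row mulmx1; congr row_mx.
  rewrite /T /Tz /Sz /Th map_block_mx map_col_mx mul_block_col map_mx1 map_mx0 mul1mx mul0mx add0r map_scalar_mx.
  congr col_mx; apply/matrixP => i j.
    rewrite !mxE big_ord1 !mxE; field; rewrite gt_eqF//.
  by rewrite mul_scalar_mx !mxE ord1 /= -pmulrn; field; rewrite gt_eqF.
have nT i j : `|row_mx 1%:M Th i j| <= 8.
  case: (split_ordP j) => j' ->.
    rewrite row_mxEl mxE; case: (i == j'); rewrite ?mulr1n ?mulr0n ?normr1 ?normr0//; lra.
  rewrite row_mxEr /Th; case: (split_ordP i) => i' ->.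
    rewrite col_mxEu mxE -intrM; set x : int := r i' 0 * a 0 j'.
    have x0 : 0 <= x by rewrite mulr_ge0//; [case/andP: (hr i')|case/andP: (ha j')].
    have dZ : d%:Z != 0 by rewrite eqz_nat -lt0n.
    have ex : x%:~R = (x %/ d)%Z%:~R * d%:R + (x %% d)%Z%:~R :> R.
      by rewrite {1}(divz_eq x d) intrD intrM.
    have -> : (x %/ d)%Z%:~R - x%:~R / d%:R = - ((x %% d)%Z%:~R / d%:R) :> R.
      by rewrite ex; field; rewrite gt_eqF.
    rewrite normrN ger0_norm ?divr_ge0 ?ler0z ?modz_ge0// ler_pdivrMr//.
    apply: (@le_trans _ _ d%:R); last by rewrite ler_peMl// ler1n.
    by rewrite -[d%:R]/((d%:Z)%:~R) ler_int ltW// ltz_mod.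
  rewrite col_mxEd mxE; have /andP[a0 a8] := ha j'.
  rewrite ger0_norm ?divr_ge0 ?ler0z// ler_pdivrMr//.
  apply: (@le_trans _ _ (8 * N)%N%:R); first by rewrite -[_%:R]/(((8 * N)%N%:Z)%:~R) ler_int.
  by rewrite natrM ler_pM2l// ler_nat ltnW.
have := hC _ (nrm_le nT); rewrite /nm/= => h.
rewrite covol_zspan ?Lr_free// E det_gramM det_Tz sqrtrM ?sqr_ge0// sqrtr_sqr ger0_norm//.
rewrite mulrAC; apply: ler_pM; rewrite ?sqrtr_ge0//.
  by rewrite -natrM ler_nat.
by apply: ler_wsqrtr; apply: le_trans (ler_norm _) _; apply: le_trans h _; apply: le_trans (ler_norm C) _; rewrite lerDl.
Qed.

Lemma GrQ_many : exists2 C : R, 0 < C & forall N : nat, (0 < N)%N -> exists s : seq (set 'rV[R]_n),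
  [/\ uniq s, (forall L, L \in s -> @GrQ R m n L /\ covol m L <= C * N%:R) & (N ^ n <= size s)%N].
Proof.
have [C C0 hC] := Lr_covol; exists C => // N N0.
(* There are at least 16 N^2 coprime pairs in this range and at most 8 N^2 of them have d <= N; the
   other parameters contribute N^(m' + k'). *)
pose M := (8 * N)%N.
pose par : finType := (('I_M * 'I_M) * ({ffun 'I_m' -> 'I_N} * {ffun 'I_k' -> 'I_N}))%type.
pose dd (x : par) : nat := x.1.1.+1.
pose rr (x : par) : 'cV[int]_m' := \col_i (x.2.1 i : nat)%:Z.
pose aa (x : par) : 'rV[int]_k := row_mx (const_mx (x.1.2.+1)%:Z) (\row_j (x.2.2 j : nat)%:Z).
pose good := [pred y : 'I_M * 'I_M | coprime y.1.+1 y.2.+1 && (N <= y.1)%N].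
pose S := enum [pred x : par | good x.1].
pose f x := zspan (Lr (dd x) (rr x) (aa x)).
have hr x : good x.1 -> forall i, 0 <= rr x i 0 < (dd x)%:Z.
  move=> /andP[_ gx] i; rewrite mxE /= ltz_nat; apply: leq_trans (ltn_ord _) _.
  exact: leq_trans gx (leqnSn _).
have aaE x : aa x 0 (lshift k' 0) = (x.1.2.+1)%:Z by rewrite row_mxEl mxE.
exists (map f S); split.
- rewrite map_inj_in_uniq ?enum_uniq// => x y; rewrite !mem_enum !inE => gx gy Exy.
  have [e1 e2 e3] := Lr_inj (ltn0Sn _) (ltn0Sn _) (hr x gx) (hr y gy) Exy.
  move: e1 e2 e3; rewrite /dd /rr /aa; case: x y {gx gy Exy} => [[x1 x2] [x3 x4]] [[y1 y2] [y3 y4]] /= [e1] e2 /eq_row_mx[e3 e4].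
  congr (_, _, (_, _)); first exact: val_inj.
  - by apply: val_inj; move/matrixP/(_ 0 0): e3; rewrite !mxE => -[].
  - by apply/ffunP => i; apply: val_inj; move/matrixP/(_ i 0): e2; rewrite !mxE => -[].
  - by apply/ffunP => i; apply: val_inj; move/matrixP/(_ 0 i): e4; rewrite !mxE => -[].
- move=> L /mapP[x]; rewrite mem_enum inE => gx ->; have /andP[cx nx] := gx; split.
    exact: (@Lr_GrQ _ _ _ (x.1.2.+1)).
  apply: hC => //; [exact: ltn_ord|exact: hr|].
  move=> j; rewrite /aa; case: (split_ordP j) => j' ->.
    by rewrite row_mxEl mxE lez_nat ltn_ord.
  rewrite row_mxEr mxE lez_nat /=; apply: leq_trans (ltnW (ltn_ord _)) _.
  by rewrite leq_pmull.
rewrite size_map -cardE.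
have -> : #|[pred x : par | good x.1]| = (#|good| * N ^ (m' + k'))%N.
  rewrite (eq_card (B := predX good predT)) ?cardX => [|x]; last by rewrite !inE andbT.
  by congr (_ * _)%N; rewrite cardT -cardE card_prod !card_ffun !card_ord expnD.
have cg : (N ^ 2 <= #|good|)%N.
  have := coprime_pairs R M; set Q := #|_| => hQ.
  have : (Q <= #|good| + N * M)%N.
    pose low := [pred y : 'I_M * 'I_M | (y.1 < N)%N].
    have lowc : (#|low| <= N * M)%N.
      pose i := [pred y : 'I_M | (y < N)%N].
      rewrite (eq_card (B := predX i predT)) ?cardX => [|x]; last by rewrite !inE andbT.
      rewrite cardT -cardE card_ord leq_mul2r; apply/orP; right.
      have ii : {in i &, injective (fun y : 'I_M => inord y : 'I_N.-1.+1)}.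
        move=> x y; rewrite !inE => hx hy /(congr1 val) /=.
        by rewrite !inordK ?prednK// => h; exact: val_inj.
      change (#|i| <= N)%N; rewrite -(card_in_image ii); apply: leq_trans (max_card _) _.
      by rewrite card_ord prednK.
    apply: (@leq_trans #|[predU good & low]|); last first.
      by apply: leq_trans (leq_add (leqnn _) lowc); rewrite -cardUI leq_addr.
    apply: subset_leq_card; apply/fintype.subsetP => x; rewrite !inE => ->.
    by rewrite /= leqNgt; case: (x.1 < N)%N.
  by rewrite /M in hQ *; nia.
apply: leq_trans (leq_mul cg (leqnn _)); rewrite -expnD leq_eqVlt; apply/orP; left; apply/eqP; congr (_ ^ _)%N; lia.
Qed.

End LowerBound.

(** * The invariant measure *)

Section MatrixTopology.
Variables (R : realType) (p q : nat).

Lemma nrm_nbhs (A : 'M[R]_(p, q)) (e : R) : 0 < e -> nbhs A [set B : 'M[R]_(p, q) | nrm (B - A) < e].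
Proof.
move=> e0; apply/nbhs_ballP; pose c : R := (p * q)%:R + 1.
have c0 : 0 < c by rewrite ltr_wpDl.
exists (e / c); first by rewrite /= divr_gt0.
move=> B [_ hB] /=; apply: (@le_lt_trans _ _ ((p * q)%:R * (e / c))).
  apply: nrm_le => i j; rewrite !mxE -opprB normrN; apply: ltW.
  by have := hB i j; rewrite /ball /= /ball_.
by rewrite mulrA ltr_pdivrMr// mulrC ltr_pM2l// ltrDl.
Qed.

Lemma nbhs_nrm (A : 'M[R]_(p, q)) (S : set 'M[R]_(p, q)) : nbhs A S ->
  exists2 e : R, 0 < e & forall B, nrm (B - A) < e -> S B.
Proof.
move=> /nbhs_ballP[e /= e0 h]; exists e => // B hB; apply: h; split => // i j.
rewrite /ball /= /ball_; apply: le_lt_trans hB; rewrite -normrN opprB.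
by have := nrm_entry (B - A) i j; rewrite !mxE.
Qed.

Lemma open_nrm (A : 'M[R]_(p, q)) (e : R) : open [set B : 'M[R]_(p, q) | nrm (B - A) < e].
Proof.
rewrite openE => B /= hB; apply: filterS (@nrm_nbhs B (e - nrm (B - A)) _); last by rewrite subr_gt0.
move=> C /= hC; have -> : C - A = (C - B) + (B - A) by rewrite addrA subrK.
by apply: le_lt_trans (nrmD _ _) _; rewrite -ltrBrDr.
Qed.

End MatrixTopology.

(** * From the measure on P to a Haar functional on G *)

Section QuotientMeasure.
Variables (R : realType) (m k : nat).
Local Notation n := (m + k)%N.
Local Notation gs := (slspace R n).
Local Notation G := (slT R n).
Local Notation T := (Pmeas R m k).
Local Notation Pset := (@Pset R m k).

(* A representative in G of a point of P; [dn] descends functions to P. *)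
Definition rep (p : T) : G := xget 1%g [set g : G | pt (val g) = p].
Definition dn (F : G -> R) (p : T) : R := F (rep p).

Lemma SL_val (A : 'M[R]_n) : SL A -> exists g : G, val g = A.
Proof. by move=> /= hA; exists (insubd (1%g : G) A); rewrite val_insubd hA eqxx. Qed.

Lemma PsetP p : Pset p <-> exists g : G, pt (val g) = p.
Proof.
split=> [[A /SL_val[g <-] <-]|[g <-]]; first by exists g.
by exists (val g) => //; exact: sl_det.
Qed.

Lemma Pset_pt (g : G) : Pset (pt (val g)). Proof. by apply/PsetP; exists g. Qed.

Lemma rep_pt p : Pset p -> pt (val (rep p)) = p.
Proof. by move=> /PsetP hp; exact: (@xgetPex _ 1%g [set g : G | pt (val g) = p]). Qed.

Lemma Hinv_pt F (g g' : G) : Hinv F -> pt (val g) = pt (val g') -> F g = F g'.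
Proof. by move=> hF /pt_eq[y [h [Hh ->]]]; rewrite Hinv_uh. Qed.

Lemma dnE F (g : G) : Hinv F -> dn F (pt (val g)) = F g.
Proof. by move=> hF; apply: Hinv_pt => //; rewrite rep_pt//; exact: Pset_pt. Qed.

(** [P_open] wants an open set of matrices while F lives on SL_n: the witness is the union of the
    matrix balls whose trace on SL_n satisfies F > a. *)
Lemma P_open_lc F (a : R) : Hinv F -> lc (F : gs -> rspace R) -> P_open [set p | Pset p /\ a < dn F p].
Proof.
move=> hF lF; split; first by move=> p [].
exists [set A | exists g : G, exists2 d : R, (forall g' : G, dst g' (g : gs) < d -> a < F g') & nrm (A - val g) < d].
split.
  rewrite openE => A [g [d hd Ad]]; apply: (@filterS _ _ _ [set B | nrm (B - val g) < d]) => [B Bd|]; first by exists g, d.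
  by apply: open_nbhs_nbhs; split => //; exact: open_nrm.
apply/seteqP; split=> A /=.
  move=> [/SL_val[g <-] [_]]; rewrite dnE// => ag; split; last exact: sl_det.
  have e0 : 0 < F g - a by rewrite subr_gt0.
  have [_ /(_ _ e0)[d d0 hd]] := lF (nm (g : gs) + 1).
  exists g, (Num.min 1 d); last by rewrite subrr nrm0 lt_min ltr01.
  move=> g'; rewrite lt_min => /andP[g1 g2].
  have := hd g' g _ _ g2; rewrite /dst/= ltr_distl => /(_ _ _)/andP[]//.
  - by apply: le_trans (nm_lip g' g) _; rewrite lerD2l ltW.
  - by rewrite lerDl.
  by rewrite opprB addrCA subrr addr0.
move=> [[g [d hd Ad]] /SL_val[g' eg]]; rewrite -eg in Ad *; split; first exact: sl_det.
by split; [exact: Pset_pt|rewrite dnE//; exact: hd].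
Qed.

Lemma P_open_meas (A : set T) : P_open A -> measurable A.
Proof. by move=> hA; exact: sub_sigma_algebra. Qed.

Lemma meas_gt F (a : R) : Hinv F -> lc (F : gs -> rspace R) ->
  measurable ([set p | Pset p /\ a < dn F p] : set T).
Proof. by move=> hF lF; apply: P_open_meas; exact: P_open_lc. Qed.

Lemma Hinv_cst (c : R) : Hinv (fun _ : G => c). Proof. by []. Qed.

Lemma meas_Pset : measurable (Pset : set T).
Proof.
have := meas_gt 0 (Hinv_cst 1) (lc_cst gs (1 : rspace R)).
by congr measurable; apply/seteqP; split=> [p []//|p hp]; split => //; exact: ltr01.
Qed.

Lemma meas_le F (a : R) : Hinv F -> lc (F : gs -> rspace R) ->
  measurable ([set p | Pset p /\ dn F p <= a] : set T).
Proof.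
move=> hF lF; have := measurableD meas_Pset (meas_gt a hF lF); congr measurable.
apply/seteqP; split=> p /=; first by move=> [hp h]; split => //; rewrite leNgt; apply/negP => h'; apply: h.
by move=> [hp h]; split => // -[_]; rewrite ltNge h.
Qed.

Lemma HinvN (F : G -> R) : Hinv F -> Hinv (fun g => - F g).
Proof. by move=> [h1 h2]; split=> *; rewrite ?h1 ?h2. Qed.

Lemma meas_ge F (a : R) : Hinv F -> lc (F : gs -> rspace R) ->
  measurable ([set p | Pset p /\ a <= dn F p] : set T).
Proof.
move=> hF lF; have := meas_le (- a) (HinvN hF) (lcN lF); congr measurable.
by apply/seteqP; split=> p [hp h]; split => //; move: h; rewrite /dn lerN2.
Qed.

Lemma mfun_dn F : Hinv F -> lc (F : gs -> rspace R) -> measurable_fun (Pset : set T) (dn F).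
Proof.
move=> hF lF mD; apply: (measurability _ (RGenOInfty.measurableE R)) => //.
move=> /= _ [_ [x ->] <-]; have := meas_gt x hF lF; congr measurable.
by apply/seteqP; split=> p [hp h]; split => //; move: h; rewrite /= in_itv /= andbT.
Qed.

Lemma pt_mulr (g g' a : G) : pt (val g) = pt (val g') -> pt (val (g * a)%g) = pt (val (g' * a)%g).
Proof.
by move=> /pt_eq[y [h [Hh ->]]]; rewrite -!mulgA [RHS]pt_ub (pt_GamH _ Hh).
Qed.

Variable mu : {measure set T -> \bar R}.
Hypotheses (mu_inv : P_invariant mu) (mu_fin : (mu (@Pball R m k) < +oo)%E).

(** Invariance is given for images of sets; as a statement on preimages it can be integrated. *)
Lemma mu_act (a : G) (A : set T) : measurable A -> A `<=` Pset ->
  mu [set p | Pset p /\ A (pt (val (rep p * a)%g))] = mu A.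
Proof.
move=> mA sA; rewrite -(mu_inv (sl_det (a^-1)%g) mA sA); congr (mu _).
apply/seteqP; split=> p.
  move=> [hp Ap]; exists (val (rep p * a)%g); first by split => //; exact: sl_det.
  by rewrite -sl_valM mulgK rep_pt.
move=> [B [/SL_val[g <-] Ag] <-]; rewrite -sl_valM; split; first exact: Pset_pt.
have := rep_pt (Pset_pt (g * a^-1)%g) => /(pt_mulr a); rewrite mulgVK => ->//.
Qed.

Lemma PballE : @Pball R m k = [set p | Pset p /\ dn (@cov2 R m k) p <= 1].
Proof.
have e p : Pset p -> (covol m p.1 <= 1) = (dn (@cov2 R m k) p <= 1).
  move=> hp; have := covol_pt (rep p); rewrite rep_pt// => ->.
  by rewrite /dn -cov_sqr expr_le1// ltW// cov_gt0.
by apply/seteqP; split=> p [hp h]; split => //; rewrite ?e -?e in h *.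
Qed.

Lemma meas_Pball : measurable (@Pball R m k : set T).
Proof. by rewrite PballE; apply: meas_le; [exact: cov2_inv|exact: lc_cov2]. Qed.

Lemma Hinv_trg F (a : G) : Hinv F -> Hinv (fun g => F (g * a)%g).
Proof. by move=> [h1 h2]; split=> [y g|h g Hh]; rewrite -mulgA ?(h2 _ _ Hh)// h1. Qed.

Lemma lc_trg (F : G -> R) (a : G) : lc (F : gs -> rspace R) -> lc ((fun g => F (g * a)%g) : gs -> rspace R).
Proof. by move=> lF; apply: (lc_comp lF); apply: lc_mulg; [exact: lc_id|exact: lc_cst]. Qed.

Lemma mu_trans (a : G) : mu [set p | Pset p /\ dn (fun g => cov2 (g * a)%g) p <= 1] = mu (@Pball R m k).
Proof.
rewrite -(mu_act a meas_Pball) ?PballE => [|p []//]; congr (mu _).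
apply/seteqP; split=> p [hp h]; split => //.
  by split; [exact: Pset_pt|rewrite (dnE _ (@cov2_inv R m k))].
by move: h => [_]; rewrite (dnE _ (@cov2_inv R m k)).
Qed.

Lemma finite_big (s : seq (set T)) : (forall A, A \in s -> [/\ measurable A, A `<=` Pset & (mu A < +oo)%E]) ->
  exists K : set T, [/\ measurable K, K `<=` Pset, (mu K < +oo)%E & forall A, A \in s -> A `<=` K].
Proof.
elim: s => [|A s IH] h; first by exists set0; split => //; rewrite measure0.
have [|K [mK sK fK hK]] := IH; first by move=> B Bs; apply: h; rewrite in_cons Bs orbT.
have [mA sA fA] := h A (mem_head _ _).
exists (A `|` K); split.
- exact: measurableU.
- by move=> p [/sA|/sK].
- by apply: le_lt_trans (measureU2 _ mA mK) _; exact: lte_add_pinfty.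
by move=> B; rewrite in_cons => /predU1P[->|/hK BK] p hp; [left|right; exact: BK].
Qed.

Hypotheses (hm : (0 < m)%N) (hk : (0 < k)%N).

Lemma cov2_1 : cov2 (1%g : G) = 1.
Proof.
rewrite /cov2 /Ag sl_val1 (@scalar_mx_block _ m k) /block_mx col_mxKu tr_row_mx mul_row_col.
by rewrite trmx1 mul1mx trmx0 mulmx0 addr0 det1.
Qed.

(** The point [h0] has covolume 1/2, so a neighbourhood of it lies in the unit ball. A bounded set
    is covered by finitely many right translates of the ball, all of the same finite measure. *)
Lemma finite_cover (r : R) : exists K : set T,
  [/\ measurable K, K `<=` Pset, (mu K < +oo)%E & forall g : G, nm (g : gs) <= r -> K (pt (val g))].
Proof.
pose h0 : G := ((Dg m k 2)^-1)%g.
have c0 : cov2 h0 < 1.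
  by rewrite -[h0]mulg1 cov2_Dg// cov2_1 mulr1 invf_lt1 ?exprn_gt0// exprn_egt1// ltr1n.
have [d d0 hd] : exists2 d : R, 0 < d & forall c : gs, dst c 1%g < d -> cov2 (c * h0)%g <= 1.
  have lF : lc ((fun c => cov2 (c * h0)%g) : gs -> rspace R) by apply: lc_trg; exact: lc_cov2.
  have e0 : 0 < 1 - cov2 h0 by rewrite subr_gt0.
  have [_ /(_ _ e0)[d d0 hd]] := lF (nm (1%g : gs) + 1).
  exists (Num.min 1 d); first by rewrite lt_min ltr01.
  move=> c; rewrite lt_min => /andP[c1 c2].
  have := hd c 1%g _ _ c2; rewrite /dst/= mul1g ltr_distl => /(_ _ _)/andP[]//.
  - by apply: le_trans (nm_lip c 1%g) _; rewrite lerD2l ltW.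
  - by rewrite lerDl.
  by move=> _; rewrite addrC subrK => /ltW.
have [B B0 hB] := @nmV_bound R n (r + 1).
have dB : 0 < Num.min 1 (d / B) by rewrite lt_min ltr01 divr_gt0.
have [I [a ha]] := @nm_net R gs r _ dB.
pose E i : set T := [set p | Pset p /\ dn (fun g => cov2 (g * ((a i)^-1 * h0))%g) p <= 1].
have [|K [mK sK fK hK]] := @finite_big [seq E i | i <- enum I].
  move=> A /mapP[i _ ->]; split.
  - by apply: meas_le; [apply: Hinv_trg; exact: cov2_inv|apply: lc_trg; exact: lc_cov2].
  - by move=> p [].
  - by rewrite mu_trans.
exists K; split => // g gr; have [i] := ha g gr; rewrite lt_min => /andP[gi1 gi2].
apply: (hK (E i)); first by apply/mapP; exists i => //; rewrite mem_enum.
split; first exact: Pset_pt.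
rewrite dnE; last by apply: Hinv_trg; exact: cov2_inv.
rewrite mulgA; apply: hd.
have ai : nm (a i : gs) <= r + 1.
  by apply: le_trans (nm_lip (a i) g) _; rewrite dst_sym; apply: lerD => //; exact: ltW.
have := dstMr ((a i)^-1)%g g (a i); rewrite mulgV => /le_lt_trans; apply.
move: gi2; rewrite ltr_pdivlMr//; apply: le_lt_trans; apply: ler_wpM2l; [exact: dst_ge0|exact: hB].
Qed.

Definition intg (F : G -> R) := mu.-integrable (Pset : set T) (EFin \o dn F).
Definition Ieg (F : G -> R) : R := (\int[mu]_(p in Pset) dn F p)%R.

Lemma intg_bd F (b : R) (K : set T) : Hinv F -> lc (F : gs -> rspace R) -> measurable K -> (mu K < +oo)%E ->
  (forall g, `|F g| <= b) -> (forall g, F g != 0 -> K (pt (val g))) -> intg F.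
Proof.
move=> hF lF mK fK Fb FK.
have mf : measurable_fun (Pset : set T) (EFin \o dn F) by apply/measurable_EFinP; exact: mfun_dn.
have b0 : 0 <= b by apply: le_trans (Fb 1%g).
apply/integrableP; split => //.
apply: (@le_lt_trans _ _ (\int[mu]_(p in Pset) (b * \1_K p)%:E)%E).
  apply: ge0_le_integral => //; first exact: meas_Pset.
  - exact: measurableT_comp.
  - by apply/measurable_EFinP; apply: measurable_funM => //; apply: measurable_indic.
  move=> p hp; rewrite /= lee_fin indicE.
  have [/set_mem Kp|nK] := boolP (p \in K); first by rewrite mulr1; exact: Fb.
  rewrite mulr0; have [->|Fp] := eqVneq (dn F p) 0; first by rewrite normr0.
  by exfalso; move/negP: nK; apply; apply/mem_set; rewrite -(rep_pt hp); exact: FK.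
rewrite (eq_integral (fun p => (b%:E * (\1_K p)%:E)%E)); last by move=> p _; rewrite EFinM.
rewrite ge0_integralZl_EFin//; last 2 first.
- exact: meas_Pset.
- by apply/measurable_EFinP; apply: measurable_indic.
apply: lte_mul_pinfty => //; rewrite (@integral_indic _ _ _ mu Pset meas_Pset K mK).
by apply: le_lt_trans fK; apply: (le_measure mu (mem_set (measurableI _ _ mK meas_Pset)) (mem_set mK)).
Qed.

Lemma intg_Hop w : Cc w -> intg (Hop w).
Proof.
move=> hw; have [r r0 hr] := Cc_supp hw; have [K [mK sK fK hK]] := finite_cover r.
have [b b0 hb] := Hop_bd hw.
apply: (@intg_bd _ b K) => //; [exact: Hop_inv|exact: Hop_lc|].
move=> g /(Hop_ex hw)[u [h [Hh /hr hu]]].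
by rewrite -(pt_GamH g Hh) -(pt_ub u); exact: hK.
Qed.

Lemma IegD F F' : intg F -> intg F' -> Ieg (fun g => F g + F' g) = Ieg F + Ieg F'.
Proof. by move=> h h'; rewrite /Ieg -RintegralD//; exact: meas_Pset. Qed.

Lemma IegZ c F : intg F -> Ieg (fun g => c * F g) = c * Ieg F.
Proof. by move=> h; rewrite /Ieg -RintegralZl//; exact: meas_Pset. Qed.

Lemma Ieg_ge0 F : (forall g, 0 <= F g) -> 0 <= Ieg F.
Proof. by move=> h; apply: Rintegral_ge0 => p _; exact: h. Qed.

(** Integration over H followed by integration over H\G: the Haar functional recovered from mu. *)
Definition Jmu (w : gs -> R) : R := Ieg (Hop w).

Lemma Jmu_PF : PF Jmu.
Proof.
split=> [c f g hf hg|f hf f0]; last by apply: Ieg_ge0 => g; exact: Hop_ge0.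
rewrite /Jmu -IegZ ?intg_Hop// -IegD ?intg_Hop//; last first.
  have -> : (fun g => c * Hop f g) = Hop (fun x => c * f x) by apply/funext => x; rewrite HopZ.
  by apply: intg_Hop; exact: CcZ.
congr Ieg; apply/funext => x; rewrite HopD ?HopZ//; exact: CcZ.
Qed.

Definition mvp (a : G) (p : T) : T := if pselect (Pset p) then pt (val (rep p * a)%g) : T else p.

Lemma mvp_meas a : measurable_fun [set: T] (mvp a).
Proof.
apply: (@measurability _ _ T T setT (mvp a) (@P_open R m k) (erefl _)) => _ [A oA <-]; rewrite setTI.
have sA := oA.1; have -> : mvp a @^-1` A = [set p | Pset p /\ A (pt (val (rep p * a)%g))].
  by apply/seteqP; split=> p; rewrite /preimage /mkset /mvp; case: pselect => hp; [split|move/sA|case|case].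
apply: P_open_meas; split; first by move=> p [].
have [_ [U [oU EU]]] := oA.
exists [set B : 'M[R]_n | U (B *m val a)]; split.
  rewrite openE => B /= UB; have [e e0 he] := nbhs_nrm (open_nbhs_nbhs (conj oU UB)).
  have N0 : 0 < nrm (val a) + 1 by rewrite ltr_wpDl// nrm_ge0.
  apply: filterS (nrm_nbhs B (divr_gt0 e0 N0)) => C /=; rewrite ltr_pdivlMr// => hC; apply: he.
  rewrite -mulmxBl; apply: le_lt_trans (nrmM _ _) _; apply: le_lt_trans hC.
  by apply: ler_wpM2l; rewrite ?nrm_ge0// lerDl.
apply/seteqP; split=> B /=.
  move=> [/SL_val[g <-] [_]].
  rewrite (pt_mulr a (rep_pt (Pset_pt g))) => Ag; split; last exact: sl_det.
  have : [set g | SL g /\ A (pt g)] (val (g * a)%g) by split => //; exact: sl_det.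
  by rewrite EU => -[].
move=> [UB /SL_val[g eg]]; rewrite -eg in UB *; split; first exact: sl_det.
split; first exact: Pset_pt.
rewrite (pt_mulr a (rep_pt (Pset_pt g))).
have : (U `&` @SL R m k) (val (g * a)%g) by split => //; exact: sl_det.
by rewrite -EU => -[].
Qed.

Lemma Ieg_tr F (a : G) : Hinv F -> lc (F : gs -> rspace R) -> (forall g, 0 <= F g) ->
  Ieg (fun g => F (g * a)%g) = Ieg F.
Proof.
move=> hF lF F0; rewrite /Ieg /Rintegral; congr fine.
have mF : measurable_fun (Pset : set T) (EFin \o dn F) by apply/measurable_EFinP; exact: mfun_dn.
transitivity (\int[pushforward mu (mvp a)]_(p in Pset) (dn F p)%:E)%E; last first.
  apply: eq_measure_integral => [|mv A mA sA]; first exact: mvp_meas.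
  rewrite /pushforward -[RHS](mu_act a mA sA); congr (mu _).
  by apply/seteqP; split=> p; rewrite /preimage /mkset /mvp; case: pselect => hp; [split|move/sA|case|case].
have h0 : {in (Pset : set T), forall y, (0 <= (EFin \o dn F) y)%E} by move=> y _; rewrite lee_fin; exact: F0.
rewrite (ge0_integral_pushforward (mvp_meas a) mu meas_Pset mF h0).
have -> : mvp a @^-1` Pset = Pset.
  by apply/seteqP; split=> p; rewrite /preimage /mkset /mvp; case: pselect => hp // _; exact: Pset_pt.
apply: eq_integral => p /set_mem hp; rewrite /= /mvp; case: pselect => // hp'; congr EFin.
by rewrite dnE// /dn.
Qed.

Lemma Jmu_rinv : rinv Jmu.
Proof.
have pos a w : Cc w -> (forall g, 0 <= w g) -> Jmu (tr a w) = Jmu w.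
  move=> hw w0; rewrite /Jmu -[RHS](@Ieg_tr _ a); [|exact: Hop_inv|exact: Hop_lc|by move=> g; exact: Hop_ge0].
  by congr Ieg; apply/funext => g; rewrite Hop_tr.
move=> a w hw; have ha := Cc_abs hw.
(* Reduction to the nonnegative functions |w| + w and |w|, for which the change of variables is
   known. *)
pose w1 x := `|w x| + w x.
have h1 : Cc w1 by exact: CcD.
have w10 x : 0 <= w1 x by rewrite /w1 -lerBlDr sub0r -normrN ler_norm.
have E : w = (fun x => w1 x - `|w x|) by apply/funext => x; rewrite /w1 addrAC subrr add0r.
have E' : tr a w = (fun x => tr a w1 x - tr a (fun x => `|w x|) x).
  by apply/funext => x; rewrite /tr {1}E.
rewrite E' [in RHS]E !(PFB Jmu_PF)//; try exact: Cc_tr.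
by rewrite !pos.
Qed.

(** These sets exhaust the ball {cov2 <= C} and play the part of its compact subsets: an H-average
    of bounded support is at least 1 on each. *)
Definition Sj (C : R) (j : nat) : set T := [set p | [/\ Pset p, dn (@cov2 R m k) p <= C & 1 <= dn (Hop (cutoff j%:R)) p]].
Definition Bc (C : R) : set T := [set p | Pset p /\ dn (@cov2 R m k) p <= C].

Lemma meas_Bc C : measurable (Bc C).
Proof. by apply: meas_le; [exact: cov2_inv|exact: lc_cov2]. Qed.

Lemma Cc_cut j : Cc (cutoff j : gs -> R). Proof. exact: Cc_cutoff. Qed.

Lemma meas_Sj C j : measurable (Sj C j).
Proof.
have := measurableI _ _ (meas_Bc C) (meas_ge 1 (Hop_inv (Cc_cut j%:R)) (Hop_lc (Cc_cut j%:R))).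
congr measurable; apply/seteqP; split=> p /=; first by move=> [[h1 h2] [h3 h4]].
by move=> [h1 h2 h3].
Qed.

Lemma cutoff_mono (i j : R) (x : gs) : i <= j -> cutoff i x <= cutoff j x.
Proof.
by move=> ij; rewrite /cutoff; apply: le_max2 => //; apply: le_min2 => //; lra.
Qed.

Lemma Hop_cutoff_mono (i j : R) (g : gs) : i <= j -> Hop (cutoff i) g <= Hop (cutoff j) g.
Proof. by move=> ij; apply: Hop_le; [exact: Cc_cut|exact: Cc_cut|move=> x; exact: cutoff_mono]. Qed.

Lemma Sj_mono C : {homo Sj C : i j / (i <= j)%N >-> (i <= j)%O}.
Proof.
move=> i j ij; rewrite subsetEset => p [h1 h2 h3]; split => //; apply: le_trans h3 _.
by apply: Hop_cutoff_mono; rewrite ler_nat.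
Qed.

Lemma Sj_union C : \bigcup_j Sj C j = Bc C.
Proof.
apply/seteqP; split=> p; first by move=> [j _ []].
move=> [hp h]; have [J hJ] := @Hop_cutoff R m k (nm (rep p : gs)).
exists (Num.bound `|J|) => //; split => //; apply: hJ => //.
exact: ltW (le_lt_trans (ler_norm J) (archi_boundP (normr_ge0 J))).
Qed.

Hypothesis (mu_pos : (0 < mu (@Pball R m k))%E).

(** The ball has positive measure and is exhausted by the [Sj], so one of them has positive measure,
    and there [Hop] of a cutoff is at least 1. *)
Lemma Jmu_nz : exists2 w, Cc w & Jmu w != 0.
Proof.
have [j hj] : exists j, (0 < mu (Sj 1 j))%E.
  apply: contrapT => h; move: mu_pos.
  have := @nondecreasing_cvg_mu _ _ _ mu (Sj 1) (meas_Sj 1) _ (Sj_mono 1).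
  rewrite Sj_union => /(_ (meas_Bc 1)) c.
  have z : mu \o Sj 1 = cst 0%E.
    apply/funext => i /=; apply/eqP; rewrite eq_le measure_ge0 andbT leNgt; apply/negP => hi.
    by apply: h; exists i.
  rewrite z in c; have := cvg_lim (@ereal_hausdorff R) c; rewrite lim_cst//.
  by rewrite PballE -/(Bc 1) => <-; rewrite ltxx.
have hC := Cc_cut j%:R; exists (cutoff j%:R) => //; rewrite gt_eqF//.
have ig := intg_Hop hC.
have fin : (mu (Sj 1 j) < +oo)%E.
  apply: le_lt_trans mu_fin; apply: (le_measure mu (mem_set (meas_Sj 1 j)) (mem_set meas_Pball)).
  by rewrite PballE => p [].
rewrite /Jmu /Ieg /Rintegral; apply: (@lt_le_trans _ _ (fine (mu (Sj 1 j)))).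
  by apply: fine_gt0; rewrite hj.
apply: fine_le; first by rewrite ge0_fin_numE.
  exact: (integrable_fin_num meas_Pset ig).
apply: (@le_trans _ _ (\int[mu]_(p in Pset) (\1_(Sj 1 j) p)%:E)%E).
  rewrite integral_indic; [|exact: meas_Pset|exact: meas_Sj].
  by rewrite setIidl// => p [].
apply: ge0_le_integral => //.
- exact: meas_Pset.
- by apply/measurable_EFinP; apply: measurable_indic; exact: meas_Sj.
- by apply/measurable_EFinP; apply: mfun_dn; [exact: Hop_inv|exact: Hop_lc].
move=> p hp; rewrite lee_fin indicE; have [/set_mem[_ _ h]|_] := boolP (_ \in _) => //.
by apply: Hop_ge0 => // x; exact: cutoff_ge0.
Qed.

End QuotientMeasure.

(** * Cutoffs on H\G and the volume of balls *)

Section Exhaustion.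
Variables (R : realType) (m k : nat).
Local Notation n := (m + k)%N.
Local Notation gs := (slspace R n).
Local Notation G := (slT R n).
Local Notation T := (Pmeas R m k).
Local Notation Pset := (@Pset R m k).
Implicit Types F f : G -> R.

Lemma Hinv_comp (u : R -> R) F : Hinv F -> Hinv (fun g : G => u (F g)).
Proof. by move=> [h1 h2]; split=> *; rewrite ?h1 ?h2. Qed.

Lemma Hinv_comp2 (u : R -> R -> R) F f : Hinv F -> Hinv f -> Hinv (fun g : G => u (F g) (f g)).
Proof. by move=> [h1 h2] [h3 h4]; split=> *; rewrite ?h1 ?h3 ?h2 ?h4. Qed.

Definition nice F := Hinv F /\ lc (F : gs -> rspace R).

Lemma nice_cst (c : R) : nice (fun _ => c). Proof. by split => //; exact: lc_cst. Qed.
Lemma niceD F f : nice F -> nice f -> nice (fun g => F g + f g).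
Proof. by move=> [h1 h2] [h3 h4]; split; [exact: Hinv_comp2|exact: lcD]. Qed.
Lemma niceM F f : nice F -> nice f -> nice (fun g => F g * f g).
Proof. by move=> [h1 h2] [h3 h4]; split; [exact: Hinv_comp2|exact: lcM]. Qed.
Lemma niceB F f : nice F -> nice f -> nice (fun g => F g - f g).
Proof. by move=> [h1 h2] [h3 h4]; split; [exact: (Hinv_comp2 (fun x y => x - y))|exact: lcB]. Qed.
Lemma nice_min F f : nice F -> nice f -> nice (fun g => Num.min (F g) (f g)).
Proof. by move=> [h1 h2] [h3 h4]; split; [exact: Hinv_comp2|exact: lc_min]. Qed.
Lemma nice_max F f : nice F -> nice f -> nice (fun g => Num.max (F g) (f g)).
Proof. by move=> [h1 h2] [h3 h4]; split; [exact: Hinv_comp2|exact: lc_max]. Qed.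
Lemma nice_cov2 : nice (@cov2 R m k). Proof. by split; [exact: cov2_inv|exact: lc_cov2]. Qed.
Lemma nice_Hop w : Cc w -> nice (Hop w). Proof. by split; [exact: Hop_inv|exact: Hop_lc]. Qed.

Definition bmp (C D x : R) : R := Num.max 0 (Num.min 1 ((D - x) / (D - C))).

Lemma bmp_ge0 C D x : 0 <= bmp C D x. Proof. by rewrite le_max lexx. Qed.
Lemma bmp_le1 C D x : bmp C D x <= 1. Proof. by rewrite ge_max ler01 ge_min lexx. Qed.
Lemma bmp1 C D x : C < D -> x <= C -> bmp C D x = 1.
Proof.
move=> CD xC; have h : 1 <= (D - x) / (D - C) by rewrite ler_pdivlMr ?subr_gt0// mul1r lerD2l lerN2.
by rewrite /bmp (min_idPl h) (max_idPr ler01).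
Qed.
Lemma bmp0 C D x : C < D -> D <= x -> bmp C D x = 0.
Proof.
move=> CD Dx; have h : (D - x) / (D - C) <= 0 by rewrite ler_pdivrMr ?subr_gt0// mul0r subr_le0.
by rewrite /bmp; apply/max_idPl; rewrite ge_min h orbT.
Qed.
Lemma bmp_neq0 C D x : C < D -> bmp C D x != 0 -> x <= D.
Proof. by move=> CD; apply: contraNT; rewrite -ltNge => /ltW /(bmp0 CD) ->. Qed.

Definition bc C D (g : G) : R := bmp C D (cov2 g).

Lemma nice_bc C D : nice (bc C D).
Proof.
rewrite /bc /bmp; apply: nice_max; first exact: nice_cst.
apply: nice_min; first exact: nice_cst.
apply: niceM; last exact: nice_cst.
by apply: niceB; [exact: nice_cst|exact: nice_cov2].
Qed.

Definition phi (j : R) (g : G) : R := Num.min 1 (Hop (cutoff j) g).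

Lemma Hop_cut_ge0 (j : R) (g : G) : 0 <= Hop (cutoff j) g.
Proof. by apply: Hop_ge0; [exact: Cc_cutoff|move=> x; exact: cutoff_ge0]. Qed.

Lemma phi_ge0 j g : 0 <= phi j g. Proof. by rewrite le_min ler01 Hop_cut_ge0. Qed.
Lemma phi_le1 j g : phi j g <= 1. Proof. by rewrite ge_min lexx. Qed.
Lemma phi1 j g : 1 <= Hop (cutoff j) g -> phi j g = 1. Proof. by move=> h; apply/min_idPl. Qed.
Lemma nice_phi j : nice (phi j).
Proof. by apply: nice_min; [exact: nice_cst|apply: nice_Hop; exact: Cc_cutoff]. Qed.

(** A nonzero value of phi i puts some H-translate of x in a ball, and right translation by a
    bounded g keeps it in a larger one. *)
Lemma phi_dom (r i : R) : exists J : R, forall (j : R) (x g : G), J <= j -> nm (g : gs) <= r ->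
  phi i x != 0 -> phi j (x * g)%g = 1.
Proof.
have [J hJ] := @Hop_cutoff R m k ((i + 1) * r).
exists J => j x g Jj gr px; apply: phi1.
have : Hop (cutoff i) x != 0 by apply: contraNneq px => h; rewrite /phi h; apply/eqP/min_idPr/ler01.
move=> /(Hop_ex (@Cc_cutoff R gs i))[u [h [Hh hc]]].
have hn : nm (ub u * (h * x) : gs)%g <= i + 1.
  by move: hc; apply: contraNT; rewrite -ltNge => /ltW /cutoff0 ->.
rewrite -(Hinv_uh u (x * g)%g (Hop_inv (@Cc_cutoff R gs j)) Hh).
apply: hJ => //; rewrite !mulgA; apply: le_trans (nmM _ _) _; rewrite -[(ub u * h * x)%g]mulgA.
by apply: ler_pM => //; exact: nm_ge0.
Qed.

Lemma phi_ex (g : G) : exists J : R, forall j : R, J <= j -> phi j g = 1.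
Proof.
by have [J hJ] := @Hop_cutoff R m k (nm (g : gs)); exists J => j Jj; apply: phi1; exact: hJ.
Qed.

(** A section of [Hop] over F phi j: the average of the cutoff divided by the maximum of 1 and
    itself is phi j. *)
Definition qf (j : R) F (x : gs) : R := F x * (Num.max 1 (Hop (cutoff j) x))^-1 * cutoff j x.

Lemma qf_Cc j F : nice F -> Cc (qf j F).
Proof.
move=> [hF lF]; apply: CcM; last exact: Cc_cutoff.
apply: lcM => //; apply: (@lcV _ _ 1) => // [x|]; first by rewrite le_max lexx.
by apply: lc_max; [exact: lc_cst|apply: Hop_lc; exact: Cc_cutoff].
Qed.

Lemma qf_ge0 j F x : (forall g, 0 <= F g) -> 0 <= qf j F x.
Proof.
move=> F0; rewrite /qf mulr_ge0 ?cutoff_ge0// mulr_ge0// invr_ge0 le_max ler01//.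
Qed.

Lemma Hop_qf j F : nice F -> Hop (qf j F) = (fun g => F g * phi j g).
Proof.
move=> [hF lF]; apply/funext => g; rewrite /qf HopM; last exact: Cc_cutoff.
- rewrite -mulrA; congr (_ * _); rewrite /phi.
  have [h|h] := leP 1 (Hop (cutoff j) g); first by rewrite mulVf// gt_eqF// (lt_le_trans ltr01 h).
  by rewrite invr1 mul1r.
- apply: Hinv_comp2 => //; apply: (Hinv_comp (fun x => (Num.max 1 x)^-1)).
  by apply: Hop_inv; exact: Cc_cutoff.
apply: lcM => //; apply: (@lcV _ _ 1) => // [x|]; first by rewrite le_max lexx.
by apply: lc_max; [exact: lc_cst|apply: Hop_lc; exact: Cc_cutoff].
Qed.

Definition Kc F := exists2 w : gs -> R, Cc w & F = Hop w.

Lemma Kc_phi j F : nice F -> Kc (fun g => F g * phi j g).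
Proof. by move=> hF; exists (qf j F); [exact: qf_Cc|rewrite Hop_qf]. Qed.

Lemma Kc_nice F : Kc F -> nice F. Proof. by move=> [w hw ->]; exact: nice_Hop. Qed.

Variable mu : {measure set T -> \bar R}.
Hypotheses (mu_inv : P_invariant mu) (mu_fin : (mu (@Pball R m k) < +oo)%E)
  (mu_pos : (0 < mu (@Pball R m k))%E).
Hypotheses (hm : (0 < m)%N) (hk : (0 < k)%N).
Let hJ := Jmu_PF mu_inv mu_fin hm hk.
Let Jr := Jmu_rinv mu_inv mu_fin hm hk.
Let Jnz := Jmu_nz mu_inv mu_fin hm hk mu_pos.
Let Jl := J_left hJ Jr Jnz.
Local Notation Ieg := (Ieg mu).
Local Notation intg := (intg mu).

Lemma Kc_intg F : Kc F -> intg F.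
Proof. by move=> [w hw ->]; exact: intg_Hop. Qed.

Lemma Ieg_scale F (t : R) : 0 < t -> Kc F ->
  Kc (fun g => F ((Dg m k t)^-1 * g)%g) /\ Ieg (fun g => F ((Dg m k t)^-1 * g)%g) = t ^+ n * Ieg F.
Proof.
move=> t0 [w hw ->].
have tn : t ^+ n != 0 by rewrite expf_neq0// gt_eqF.
have E : (fun g => Hop w ((Dg m k t)^-1 * g)%g) = Hop (fun x => t ^+ n * tl ((Dg m k t)^-1)%g w x).
  apply/funext => g; rewrite HopZ; last exact: Cc_tl.
  by rewrite Hop_tl// exprVn mulrA divff// mul1r.
have hc : Cc (fun x => t ^+ n * tl ((Dg m k t)^-1)%g w x) by apply: CcZ; exact: Cc_tl.
split; first by exists (fun x => t ^+ n * tl ((Dg m k t)^-1)%g w x).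
rewrite E -/(Jmu mu _) (PFZ hJ); last exact: Cc_tl.
by rewrite Jl.
Qed.

Lemma IegE F : intg F -> (Ieg F)%:E = (\int[mu]_(p in Pset) (dn F p)%:E)%E.
Proof. by move=> iF; exact: (fineK (integrable_fin_num (@meas_Pset R m k) iF)). Qed.

Lemma mu_le_Ieg F (A : set T) : measurable A -> A `<=` Pset -> nice F -> intg F ->
  (forall g, 0 <= F g) -> (forall p, A p -> 1 <= dn F p) -> (mu A <= (Ieg F)%:E)%E.
Proof.
move=> mA sA [hF lF] iF F0 F1; rewrite (IegE iF).
apply: (@le_trans _ _ (\int[mu]_(p in Pset) (\1_A p)%:E)%E).
  by rewrite integral_indic ?setIidl//; exact: meas_Pset.
apply: ge0_le_integral => //.
- exact: meas_Pset.
- by apply/measurable_EFinP; exact: measurable_indic.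
- by apply/measurable_EFinP; exact: mfun_dn.
move=> p hp; rewrite lee_fin indicE; have [/set_mem/F1//|_] := boolP (_ \in _).
exact: F0.
Qed.

Lemma Ieg_le_mu F (A : set T) : measurable A -> A `<=` Pset -> nice F -> intg F ->
  (forall g, 0 <= F g <= 1) -> (forall p, Pset p -> dn F p != 0 -> A p) -> ((Ieg F)%:E <= mu A)%E.
Proof.
move=> mA sA [hF lF] iF F01 F1; rewrite (IegE iF).
apply: (@le_trans _ _ (\int[mu]_(p in Pset) (\1_A p)%:E)%E); last first.
  by rewrite integral_indic ?setIidl//; exact: meas_Pset.
apply: ge0_le_integral => //.
- exact: meas_Pset.
- by move=> p _; rewrite lee_fin; have /andP[] := F01 (rep p).
- by apply/measurable_EFinP; exact: mfun_dn.
- by apply/measurable_EFinP; exact: measurable_indic.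
move=> p hp; rewrite lee_fin indicE; have [h|/negP h] := boolP (_ \in _).
  by have /andP[] := F01 (rep p).
by have [->//|/(F1 p hp)/mem_set] := eqVneq (dn F p) 0.
Qed.

Lemma mu_Sj_scale (C D t : R) (j : nat) : C < D -> 0 < t ->
  (mu (Sj C j) <= ((t ^+ n)^-1)%:E * mu (Bc (t ^+ 2 * D)))%E.
Proof.
move=> CD t0; pose F g := bc C D g * phi j%:R g.
have KF : Kc F by apply: Kc_phi; exact: nice_bc.
have [KG EG] := Ieg_scale t0 KF.
have F01 g : 0 <= F g <= 1.
  by rewrite mulr_ge0 ?bmp_ge0 ?phi_ge0//= mulr_ile1 ?bmp_ge0 ?phi_ge0 ?bmp_le1 ?phi_le1.
apply: (@le_trans _ _ (Ieg F)%:E).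
  apply: mu_le_Ieg; rewrite ?Kc_intg//; [exact: meas_Sj|by move=> p []|exact: Kc_nice|by move=> g; have /andP[] := F01 g|].
  by move=> p [_ h1 h2]; rewrite /dn /F /bc bmp1// phi1// mulr1.
have tn : 0 < t ^+ n by rewrite exprn_gt0.
have -> : Ieg F = (t ^+ n)^-1 * Ieg (fun g => F ((Dg m k t)^-1 * g)%g).
  by rewrite EG mulKf// gt_eqF.
rewrite EFinM lee_pmul2l ?lte_fin ?invr_gt0//.
apply: Ieg_le_mu; rewrite ?Kc_intg//; [exact: meas_Bc|by move=> p []|exact: Kc_nice|].
move=> p hp; rewrite /dn /F mulf_eq0 negb_or => /andP[/(bmp_neq0 CD)+ _].
rewrite cov2_Dg// => h; split => //; rewrite /dn; move: h.
by rewrite mulrC ler_pdivrMr ?exprn_gt0// mulrC.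
Qed.

(** The loss from C to D comes from squeezing a continuous bump between two balls; [Vol_sqr_le]
    removes it by letting D tend to C. *)
Lemma mu_Bc_scale (C D t : R) : C < D -> 0 < t ->
  (mu (Bc C) <= ((t ^+ n)^-1)%:E * mu (Bc (t ^+ 2 * D)))%E.
Proof.
move=> CD t0; have := @nondecreasing_cvg_mu _ _ _ mu (Sj C) (meas_Sj C) _ (@Sj_mono R m k C).
rewrite Sj_union => /(_ (meas_Bc C)) c.
rewrite -(cvg_lim (@ereal_hausdorff R) c); apply: lime_le; first by apply/cvg_ex; exists (mu (Bc C)).
by near=> j; exact: mu_Sj_scale.
Unshelve. all: by end_near. Qed.

Lemma Bc1 : Bc 1 = @Pball R m k. Proof. by rewrite PballE. Qed.

Lemma mu_Bc_fin (C : R) : (mu (Bc C) < +oo)%E.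
Proof.
pose D : R := `|C| + 1; have D0 : 0 < D by rewrite ltr_wpDl.
have CD : C < D by rewrite (le_lt_trans (ler_norm C))// ltrDl.
have s0 : 0 < Num.sqrt (D^-1) by rewrite sqrtr_gt0 invr_gt0.
apply: le_lt_trans (mu_Bc_scale CD s0) _.
rewrite sqr_sqrtr ?invr_ge0 1?ltW// mulVf ?gt_eqF// Bc1; apply: lte_mul_pinfty => //; rewrite lee_fin invr_ge0 exprn_ge0// ltW.
Qed.

Definition Vol (C : R) : R := fine (mu (Bc C)).

Lemma VolE C : mu (Bc C) = (Vol C)%:E.
Proof. by rewrite fineK// ge0_fin_numE// mu_Bc_fin. Qed.

Lemma Vol_ge0 C : 0 <= Vol C. Proof. by rewrite fine_ge0. Qed.
Lemma Vol1_gt0 : 0 < Vol 1. Proof. by rewrite fine_gt0// Bc1 mu_pos mu_fin. Qed.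

Lemma Vol_scale_le (C D t : R) : C < D -> 0 < t -> Vol C <= (t ^+ n)^-1 * Vol (t ^+ 2 * D).
Proof. by move=> CD t0; rewrite -lee_fin EFinM -!VolE; exact: mu_Bc_scale. Qed.

Lemma le_root (x y : R) : 0 <= y -> (forall r, 1 < r -> x <= r ^+ n * y) -> x <= y.
Proof.
move=> y0 h; rewrite leNgt; apply/negP => yx.
have [y00|yn0] := eqVneq y 0.
  by have := h 2 (ltr1n _ _); rewrite y00 mulr0 leNgt -{1}y00 yx.
have yp : 0 < y by rewrite lt_neqAle eq_sym yn0.
pose z := (x + y) / 2 / y.
have z1 : 1 < z by rewrite /z ltr_pdivlMr// mul1r ltr_pdivlMr// mulr2n mulrDr mulr1 ltrD2r.
have zx : z * y < x by rewrite /z divfK// ltr_pdivrMr// mulr2n mulrDr mulr1 ltrD2l.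
have n0 : (0 < n)%N by rewrite addn_gt0 hm.
have : 1 `^ n%:R^-1 < z `^ n%:R^-1.
  by rewrite gt0_ltr_powR ?invr_gt0 ?ltr0n// nnegrE// ltW// (lt_trans ltr01).
rewrite powR1 => /h.
by rewrite powR_root// ?(le_trans ler01 (ltW z1))// leNgt zx.
Qed.

Lemma Vol_sqr_le (a b : R) : 0 < a -> 0 < b -> Vol (a ^+ 2) <= (a / b) ^+ n * Vol (b ^+ 2).
Proof.
move=> a0 b0; apply: le_root; first by rewrite mulr_ge0 ?Vol_ge0// exprn_ge0// divr_ge0// ltW.
move=> r r1; have r0 := lt_trans ltr01 r1.
have CD : a ^+ 2 < (a * r) ^+ 2 by rewrite exprMn ltr_pMr ?exprn_gt0// exprn_egt1.
have t0 : 0 < b / (a * r) by rewrite divr_gt0// mulr_gt0.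
have ar : a * r != 0 by rewrite mulf_neq0 ?gt_eqF.
have := Vol_scale_le CD t0; rewrite -exprMn divfK// => /le_trans; apply.
by rewrite mulrA -exprMn -exprVn invf_div [r * _]mulrC mulrAC.
Qed.

(** The scaling inequality is used for a dilation and for its inverse. The volume is thus continuous
    in the radius, and thin annuli are small. *)
Lemma Vol_sqr (a : R) : 0 < a -> Vol (a ^+ 2) = a ^+ n * Vol 1.
Proof.
move=> a0; apply/eqP; rewrite eq_le; have := Vol_sqr_le a0 ltr01; rewrite expr1n divr1 => ->/=.
have := Vol_sqr_le ltr01 a0; rewrite expr1n div1r exprVn -ler_pdivlMl ?invrK//.
exact: exprn_gt0.
Qed.

Lemma Bc_mono (C D : R) : C <= D -> Bc C `<=` @Bc R m k D.
Proof. by move=> CD p [hp h]; split => //; exact: le_trans CD. Qed.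

Lemma mu_annulus (C D : R) : C <= D -> mu (Bc D `\` Bc C) = (Vol D - Vol C)%:E.
Proof.
move=> CD; rewrite measureD ?setIidr//; try exact: meas_Bc; try exact: Bc_mono.
  by rewrite EFinB -!VolE.
exact: mu_Bc_fin.
Qed.

Lemma mu_tail (C e : R) : 0 < e -> exists j0 : nat, forall j, (j0 <= j)%N -> (mu (Bc C `\` Sj C j) <= e%:E)%E.
Proof.
move=> e0; have := @nondecreasing_cvg_mu _ _ _ mu (Sj C) (meas_Sj C) _ (@Sj_mono R m k C).
rewrite Sj_union => /(_ (meas_Bc C)) c.
have SB j : @Sj R m k C j `<=` Bc C by move=> p [].
have fS (j : nat) : (mu (Sj C j) < +oo)%E.
  by apply: le_lt_trans (mu_Bc_fin C); apply: (le_measure mu (mem_set (meas_Sj C j)) (mem_set (meas_Bc C))).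
have fSE (j : nat) : mu (Sj C j) = (fine (mu (Sj C j)))%:E by rewrite fineK// ge0_fin_numE.
have c' : fine (mu (Sj C j)) @[j --> \oo] --> Vol C.
  by apply: fine_cvg; rewrite -VolE.
move/cvgrPdist_le: c' => /(_ e e0)[j0 _ hj0]; exists j0 => j jj.
rewrite measureD ?setIidr//; [|exact: meas_Bc|exact: meas_Sj|exact: mu_Bc_fin].
apply: (@le_trans _ _ (Vol C - fine (mu (Sj C j)))%:E); first by rewrite EFinB -VolE -fSE.
rewrite lee_fin; apply: le_trans (ler_norm _) _.
exact: hj0.
Qed.

End Exhaustion.

(** * Orbit sums *)

Section LatticeSums.
Variables (R : realType) (m k : nat).
Local Notation n := (m + k)%N.
Local Notation gs := (slspace R n).
Local Notation G := (slT R n).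
Local Notation T := (Pmeas R m k).
Local Notation Pset := (@Pset R m k).
Local Notation GrQ := (@GrQ R m n).
Implicit Types F f : G -> R.
Hypotheses (hm : (0 < m)%N) (hk : (0 < k)%N).

Definition xt (t : R) (L : set 'rV[R]_n) : G := ((Dg m k t)^-1 * sct L)%g.
Definition DS (t : R) F : R := Dsum GrQ (@sct R m k) t F.

Lemma DS_eT (t : R) (w : gs -> R) : 0 < t -> Cc w ->
  fsupp GrQ (fun L => Hop w (xt t L)) /\ eT t (fun x => w (x^-1)%g) = DS t (Hop w).
Proof.
move=> t0 hw; apply: (@eT_Dsum R m k hm hk _ GrQ (fun g => zspan (Ag g)) (@sct R m k)) => //.
- by move=> g; exact: GrQ_Ag.
- by move=> L /sctP[].
- by move=> L g; exact: GrQ_fiber.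
Qed.

Lemma Kc_fsupp F (t : R) : 0 < t -> Kc F -> fsupp GrQ (fun L => F (xt t L)).
Proof. by move=> t0 [w hw ->]; have [] := DS_eT t0 hw. Qed.

Lemma tn_gt0 (t : R) : 0 < t -> 0 < t^-1 ^+ n. Proof. by move=> t0; rewrite exprn_gt0// invr_gt0. Qed.

Lemma DS_le F f (t : R) : 0 < t -> fsupp GrQ (fun L => F (xt t L)) -> fsupp GrQ (fun L => f (xt t L)) ->
  (forall L, GrQ L -> F (xt t L) <= f (xt t L)) -> DS t F <= DS t f.
Proof. by move=> t0 h1 h2 h; apply: ler_wpM2l; [exact/ltW/tn_gt0|exact: fsum_le]. Qed.

Lemma DS_ge0 F (t : R) : 0 < t -> (forall g, 0 <= F g) -> 0 <= DS t F.
Proof. by move=> t0 h; apply: mulr_ge0; [exact/ltW/tn_gt0|apply: fsum_ge0 => L _; exact: h]. Qed.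

Lemma DSD F f (t : R) : fsupp GrQ (fun L => F (xt t L)) -> fsupp GrQ (fun L => f (xt t L)) ->
  DS t (fun g => F g + f g) = DS t F + DS t f.
Proof. by move=> h1 h2; rewrite /DS /Dsum fsumD// mulrDr. Qed.

Lemma DSZ F (c t : R) : fsupp GrQ (fun L => F (xt t L)) -> DS t (fun g => c * F g) = c * DS t F.
Proof.
move=> h; rewrite /DS /Dsum mulrCA; congr (_ * _).
rewrite (fsum_supp h) mulr_sumr (@fsumE _ _ _ [set L | GrQ L /\ F (xt t L) != 0])// => [L []//|L hL].
by rewrite mulf_eq0 negb_or => /andP[].
Qed.

Lemma DS_abs F f (t : R) : 0 < t -> fsupp GrQ (fun L => F (xt t L)) -> fsupp GrQ (fun L => f (xt t L)) ->
  (forall L, GrQ L -> `|F (xt t L)| <= f (xt t L)) -> `|DS t F| <= DS t f.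
Proof.
move=> t0 h1 h2 h; rewrite /DS /Dsum normrM ger0_norm; last exact/ltW/tn_gt0.
by apply: ler_wpM2l; [exact/ltW/tn_gt0|exact: fsum_abs].
Qed.

Lemma eT_PF (t : R) : PF (eT t : (gs -> R) -> R).
Proof.
have hc w : Cc w -> Cc (fun u => chi u * per w (ub (- u) * Dg m k t)%g).
  move=> hw; under [X in Cc X]funext => u do rewrite mulrC.
  by apply: CcM; [exact: (lc_ubg _ (per_lc hw))|exact: Cc_chi].
split=> [c f g hf hg|f hf f0].
  rewrite /eT -((@Iv_PF R k m).1 c _ _ (hc f hf) (hc g hg)); congr Iv; apply/funext => u.
  rewrite perD ?perZ//; last exact: CcZ.
  by rewrite mulrDr mulrCA.
apply: (@Iv_PF R k m).2 => [|u]; first exact: hc.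
by apply: mulr_ge0; [exact: chi_ge0|apply: fsum_ge0 => c _; exact: f0].
Qed.

(** Right translation moves the periodisation without changing its sup norm, hence uniformity in g
    as well as in t. *)
Lemma eT_tr_bd (psi : gs -> R) : Cc psi -> exists2 C : R, 0 <= C & forall t g, `|eT t (tr g psi)| <= C.
Proof.
move=> hp; have [C C0 hC] := @Iv_chi_norm R k m.
have [r hr] := hp.2; have [b b0 hb] := Cc_bd hp.
have [C1 C10 hC1] := @per_bnd R n r.
exists (b * C1 * C) => [|t g]; first by rewrite !mulr_ge0.
apply: hC; first by apply: (lc_ubg _ (per_lc _)); exact: Cc_tr.
by move=> u; rewrite per_tr; exact: hC1.
Qed.

Lemma DS_bd F : Kc F -> exists2 C : R, 0 <= C & forall t, 0 < t -> `|DS t F| <= C.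
Proof.
move=> [w hw ->]; have [C C0 hC] := eT_tr_bd (Cc_inv hw); exists C => // t t0.
have [_ <-] := DS_eT t0 hw; have := hC t 1%g; congr (`|eT t _| <= _).
by apply/funext => x; rewrite /tr mulg1.
Qed.

Variable mu : {measure set T -> \bar R}.
Hypotheses (mu_inv : P_invariant mu) (mu_fin : (mu (@Pball R m k) < +oo)%E)
  (mu_pos : (0 < mu (@Pball R m k))%E).
Let hJ := Jmu_PF mu_inv mu_fin hm hk.
Let Jr := Jmu_rinv mu_inv mu_fin hm hk.
Let Jnz := Jmu_nz mu_inv mu_fin hm hk mu_pos.
Local Notation Ieg := (Ieg mu).
Local Notation intg := (intg mu).
Local Notation Vol := (Vol mu).

Lemma DS_asym F f (e : R) : Kc F -> Kc f -> 0 < e -> exists2 T0 : R, 1 <= T0 & forall t, T0 <= t ->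
  `|DS t F * Ieg f - DS t f * Ieg F| <= e.
Proof.
move=> [w hw ->] [v hv ->] e0; have [T0 hT] := eT_asym hm hk hJ Jr Jnz hw hv e0.
exists (Num.max 1 T0) => [|t]; first by rewrite le_max lexx.
rewrite ge_max => /andP[t1 tT]; have t0 := lt_le_trans ltr01 t1.
by have := hT t tT; rewrite (DS_eT t0 hw).2 (DS_eT t0 hv).2.
Qed.

Lemma Jkap_gt0 : 0 < Jmu mu (kap 1).
Proof.
apply: (@J_gt0 _ _ _ hJ Jr Jnz _ 1%g (Cc_kap n 1)) => [g|]; first exact: kap_ge0.
by rewrite /kap dst_xx subr0 lt_max ltr01 orbT.
Qed.

(* The weight kap averages DS over a neighbourhood of the identity; unfolding against [mu] bounds the average. *)
Lemma DS_dom : exists2 K : R, 0 <= K & forall (w v : gs -> R) t, 0 < t -> Cc w -> Cc v ->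
  (forall x, 0 <= v x) ->
  (forall x g : G, nm (g : gs) <= nm (1%g : gs) + 1 -> Hop w x <= Hop v (x * g)%g) ->
  DS t (Hop w) <= K * Jmu mu v.
Proof.
have [C C0 hC] := eT_tr_bd (Cc_kap n (1 : R)); have J0 := Jkap_gt0.
exists (C / Jmu mu (kap 1)) => [|w v t t0 hw hv v0 le]; first by rewrite divr_ge0// ltW.
rewrite mulrAC ler_pdivlMr// mulrC.
have [h1 h2 E] := asym_fubini hJ Jr Jnz (fun _ => eT_PF t) t (Cc_kap n (1 : R)) hv.
rewrite mulrC -(PFZ hJ _ (Cc_kap n 1)) -(PFZ hJ _ hv).
apply: (@le_trans _ _ (Jmu mu (fun g => kap 1 g * eT t (fun x => v (x^-1 * g)%g)))).
  apply: (PFle hJ (CcZ (DS t (Hop w)) (Cc_kap n 1)) h1).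
  move=> g; rewrite mulrC; have [->|kg] := eqVneq (kap 1 g) 0; first by rewrite !mul0r.
  apply: ler_wpM2l; first exact: kap_ge0.
  have gn : nm g <= nm (1%g : gs) + 1.
    apply: le_trans (nm_lip g 1%g) _; rewrite lerD2l; apply: ltW; exact: kap_dst.
  have [fs ->] := DS_eT t0 (Cc_tr g hv).
  by apply: (DS_le t0 (DS_eT t0 hw).1 fs) => L _; rewrite Hop_tr; exact: le.
rewrite E; apply: (PFle hJ h2 (CcZ C hv)).
by move=> g; rewrite mulrC; apply: (ler_wpM2r (v0 g)); exact: le_trans (ler_norm _) (hC t g).
Qed.

End LatticeSums.

Lemma fsum_ge_fset (R : realType) (I : choiceType) (A : set I) (f : I -> R) (B : {fset I}) :
  fsupp A f -> (forall x, A x -> 0 <= f x) -> [set` B] `<=` A ->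
  \sum_(x <- B) f x <= \sum_(x \in A) f x.
Proof.
move=> hf f0 BA.
have -> : \sum_(x <- B) f x = \sum_(x \in A) f x * (x \in B)%:R.
  rewrite (@fsumE _ _ A [set` B])//; last by move=> x _; case: (boolP (x \in B)); rewrite ?mulr0 ?eqxx.
  rewrite set_fsetK [RHS]big_seq [LHS]big_seq; apply: eq_bigr => x xB.
  by rewrite xB mulr1.
apply: fsum_le => //; first by apply: fsupp_le hf => x _ ->; rewrite mul0r.
by move=> x Ax; case: (x \in B); rewrite ?mulr1 ?mulr0 ?f0.
Qed.

(** * No escape of mass *)

Section Tightness.
Variables (R : realType) (m k : nat).
Local Notation n := (m + k)%N.
Local Notation gs := (slspace R n).
Local Notation G := (slT R n).
Local Notation T := (Pmeas R m k).
Local Notation Pset := (@Pset R m k).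
Local Notation GrQ := (@GrQ R m n).
Implicit Types F f : G -> R.
Hypotheses (hm : (0 < m)%N) (hk : (0 < k)%N).
Variable mu : {measure set T -> \bar R}.
Hypotheses (mu_inv : P_invariant mu) (mu_fin : (mu (@Pball R m k) < +oo)%E)
  (mu_pos : (0 < mu (@Pball R m k))%E).
Local Notation Ieg := (Ieg mu).
Local Notation intg := (intg mu).
Local Notation Vol := (Vol mu).
Local Notation r0 := (nm (1%g : gs) + 1).

(** If f is dominated by the translates of f' near the identity, [DS_dom] bounds the orbit sum of f
    by the measure of a set carrying f'. The constants K and C1 depend on neither the cutoff i nor
    t, so the bound reaches into the cusp. *)
Lemma DS_mass (C : R) : 0 < C -> exists2 K : R, 0 <= K & exists C1 : R, forall f f' (A : set T),
  nice f -> nice f' -> (forall g, 0 <= f g <= 1) -> (forall g, 0 <= f' g <= 1) ->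
  (forall x g : G, nm (g : gs) <= r0 -> f x <= f' (x * g)%g) ->
  measurable A -> A `<=` Pset -> (forall p, Bc C1 p -> dn f' p != 0 -> A p) ->
  forall i t, 0 < t -> ((DS t (fun g => bc C (2 * C) g * f g * phi i g))%:E <= K%:E * mu A)%E.
Proof.
move=> C0; have [K K0 hK] := DS_dom hm hk mu_inv mu_fin mu_pos.
have [c c0 hc] := @cov2_bound R m k r0.
pose C1 := c * (2 * C); have C10 : 0 < C1 by rewrite !mulr_gt0.
have CC : C < 2 * C by rewrite ltr_pMl// ltr1n.
have CC1 : C1 < 2 * C1 by rewrite ltr_pMl// ltr1n.
exists K => //; exists (2 * C1) => f f' A nf nf' f01 f01' ff' mA sA hA i t t0.
have [J2 h2] := @phi_dom R m k r0 i.
have n1 : nice (fun g => bc C (2 * C) g * f g) by apply: niceM => //; exact: nice_bc.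
have n2 : nice (fun g => bc C1 (2 * C1) g * f' g) by apply: niceM => //; exact: nice_bc.
have c01 c1 c2 (g : G) (u : G -> R) : 0 <= u g <= 1 -> 0 <= bc c1 c2 g * u g <= 1.
  by move=> /andP[u0 u1]; rewrite mulr_ge0 ?bmp_ge0//= mulr_ile1 ?bmp_ge0 ?bmp_le1.
have := hK _ _ t t0 (qf_Cc i n1) (qf_Cc J2 n2).
rewrite !Hop_qf// => hh; have {hh} := hh _ _.
rewrite /Jmu Hop_qf//; set F' := fun g => bc C1 (2 * C1) g * f' g * phi J2 g => hh.
apply: (@le_trans _ _ (K * Ieg F')%:E).
  rewrite lee_fin; apply: hh.
    by move=> x; apply: qf_ge0 => g; have /andP[] := c01 C1 (2 * C1) g f' (f01' g).
  move=> x g gr; rewrite /F'.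
  have F'0 : 0 <= bc C1 (2 * C1) (x * g)%g * f' (x * g)%g * phi J2 (x * g)%g.
    by rewrite mulr_ge0 ?phi_ge0//; have /andP[] := c01 C1 (2 * C1) (x * g)%g f' (f01' _).
  have [->|p0] := eqVneq (phi i x) 0; first by rewrite mulr0.
  have [->|b0] := eqVneq (bc C (2 * C) x) 0; first by rewrite !mul0r.
  rewrite h2// mulr1 [X in _ <= X * _]bmp1//; last first.
    apply: le_trans (hc x g gr) _; apply: ler_wpM2l; first exact: ltW.
    exact: bmp_neq0 b0.
  rewrite mul1r; apply: le_trans (ff' x g gr).
  have /andP[f0 f1] := f01 x; rewrite -[leRHS]mulr1; apply: ler_pM; rewrite ?phi_ge0 ?phi_le1//.
    by rewrite mulr_ge0 ?bmp_ge0.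
  by rewrite ler_piMl ?bmp_le1.
have KF : Kc F' by exact: Kc_phi.
rewrite EFinM; apply: lee_pmul; rewrite ?lee_fin//.
  by apply: Ieg_ge0 => g; rewrite mulr_ge0 ?phi_ge0//; have /andP[] := c01 C1 (2 * C1) g f' (f01' g).
apply: Ieg_le_mu => //; [exact: Kc_nice|exact: Kc_intg| |].
  move=> g; have /andP[h0 h1] := c01 C1 (2 * C1) g f' (f01' g).
  by rewrite mulr_ge0 ?phi_ge0//= mulr_ile1 ?phi_ge0 ?phi_le1.
move=> p hp; rewrite /dn /F' !mulf_eq0 !negb_or => /andP[/andP[b0 f0] _].
by apply: hA => //; split => //; exact: bmp_neq0 b0.
Qed.

Lemma phi_all (s : seq G) : exists J : R, forall j g, J <= j -> g \in s -> phi j g = 1.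
Proof.
elim: s => [|g s [J hJ]]; first by exists 0.
have [J' hJ'] := @phi_ex R m k g; exists (Num.max J J') => j h.
rewrite ge_max => /andP[h1 h2]; rewrite in_cons => /predU1P[->|hs]; [exact: hJ'|exact: hJ].
Qed.

(** The mass bound does not depend on the cutoff, so it limits the size of every finite set of
    points in the ball. *)
Lemma ball_finite (C t : R) : 0 < t -> finite_set [set L | GrQ L /\ cov2 (xt t L : G) <= C].
Proof.
move=> t0; pose D := Num.max 1 C; have D0 : 0 < D by rewrite lt_max ltr01.
have DD : D < 2 * D by rewrite ltr_pMl// ltr1n.
have [K K0 [C1 hK]] := DS_mass D0.
have {}hK (i : R) : DS t (fun g : G => bc D (2 * D) g * 1 * phi i g) <= K * Vol C1.
  have E : (K * Vol C1)%:E = (K%:E * mu (Bc C1))%E.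
    by rewrite [LHS]EFinM -(VolE mu_inv mu_fin mu_pos hm hk).
  rewrite -lee_fin E.
  by apply: (hK (fun=> 1) (fun=> 1)) => //; [exact: nice_cst|exact: nice_cst|move=> _; rewrite ler01 lexx|
    move=> _; rewrite ler01 lexx|exact: meas_Bc|move=> p []].
apply: contrapT => inf.
have V0 : 0 <= t ^+ n * (K * Vol C1) by rewrite !mulr_ge0 ?Vol_ge0// exprn_ge0// ltW.
have [B BA NB] := infinite_set_fset (Num.bound (t ^+ n * (K * Vol C1))) inf.
have [J hJ] := phi_all [seq (xt t L : G) | L <- B].
pose F (g : G) := bc D (2 * D) g * 1 * phi J g.
have KF : Kc F by apply: Kc_phi; apply: niceM; [exact: nice_bc|exact: nice_cst].
have F0 g : 0 <= F g by rewrite mulr_ge0 ?phi_ge0// mulr1 bmp_ge0.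
have := @fsum_ge_fset R _ GrQ (fun L => F (xt t L)) B (Kc_fsupp hm hk t0 KF) (fun L _ => F0 _).
have hB : [set` B] `<=` GrQ by move=> L /BA[].
move=> /(_ hB); rewrite (eq_big_seq (fun _ => 1)); last first.
  move=> L LB; rewrite /F hJ//; last exact: map_f.
  have [_ hL] := BA L LB; rewrite /bc bmp1// ?mulr1// (le_trans hL)// le_max lexx orbT//.
rewrite big_const_seq count_predT iter_addr_0 => h1.
have := archi_boundP V0; rewrite ltNge => /negP; apply.
apply: (@le_trans _ _ (size B)%:R); first by rewrite ler_nat.
apply: le_trans h1 _; rewrite -ler_pdivrMl ?exprn_gt0// -exprVn; exact: hK.
Qed.

Definition ib (C : R) (g : G) : R := (cov2 g <= C)%R%:R.

Lemma ib_ge0 C g : 0 <= ib C g. Proof. exact: ler0n. Qed.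

Lemma ib_fsupp (C t : R) F : 0 < t -> fsupp GrQ (fun L => ib C (xt t L) * F (xt t L)).
Proof.
move=> t0; apply: sub_finite_set (ball_finite C t0) => L [hL]; rewrite mulf_eq0 negb_or => /andP[+ _].
by rewrite /ib; case: leP => //; rewrite eqxx.
Qed.

(** [phi_dom] dominates 1 - phi j by the translates of 1 - phi j1, which within the ball is carried
    by the complement of [Sj C1 j1], small by [mu_tail]; [DS_mass] concludes. *)
Lemma DS_tail (C e : R) : 0 < C -> 0 < e -> exists J : R, forall j t, J <= j -> 0 < t ->
  DS t (fun g : G => ib C g * (1 - phi j g)) <= e.
Proof.
move=> C0 e0; have [K K0 [C1 hK]] := DS_mass C0.
have K1 : 0 < K + 1 by rewrite ltr_wpDl.
have [j1 hj1] := mu_tail mu_inv mu_fin mu_pos hm hk C1 (divr_gt0 e0 K1).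
have [r' r'0 hr'] := @nmV_bound R n r0.
have [J hJ] := @phi_dom R m k r' j1%:R.
exists J => j t Jj t0.
have CC : C < 2 * C by rewrite ltr_pMl// ltr1n.
have nphi i : nice (fun g : G => 1 - phi i g) by apply: niceB; [exact: nice_cst|exact: nice_phi].
have p01 i (g : G) : 0 <= 1 - phi i g <= 1 by rewrite subr_ge0 phi_le1 gerBl phi_ge0.
(* For fixed t the ball contains finitely many points, so a cutoff equal to 1 at all of them can be
   inserted; I may depend on t. *)
have [I hI] := phi_all [seq (xt t L : G) | L <- fset_set [set L | GrQ L /\ cov2 (xt t L : G) <= C]].
pose F (g : G) := bc C (2 * C) g * (1 - phi j g) * phi I g.
have KF : Kc F by apply: Kc_phi; apply: niceM => //; exact: nice_bc.
apply: (@le_trans _ _ (DS t F)).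
  apply: (DS_le t0 (@ib_fsupp C t (fun g => 1 - phi j g) t0) (Kc_fsupp hm hk t0 KF)) => L hL.
  have F0 : 0 <= F (xt t L).
    by rewrite mulr_ge0 ?phi_ge0// mulr_ge0 ?bmp_ge0//; have /andP[] := p01 j (xt t L).
  rewrite /ib; case: (leP (cov2 (xt t L)) C) => h; last by rewrite mul0r.
  rewrite mul1r /F (hI I (xt t L) (lexx I)); last first.
    by apply: map_f; rewrite in_fset_set; [apply/mem_set; split|exact: ball_finite].
  by rewrite mulr1 /bc bmp1// mul1r.
rewrite -lee_fin.
have mA : measurable (Bc C1 `\` @Sj R m k C1 j1) by apply: measurableD; [exact: meas_Bc|exact: meas_Sj].
apply: le_trans (hK (fun g => 1 - phi j g) (fun g => 1 - phi j1%:R g) _ _ _ _ _ _ mA _ _ I t t0) _ => //.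
- move=> x g gr; have [->|p0] := eqVneq (phi j1%:R (x * g)%g) 0; first by rewrite subr0 gerBl phi_ge0.
  have := hJ j (x * g)%g (g^-1)%g Jj (hr' g gr) p0; rewrite mulgK => ->.
  by rewrite subrr subr_ge0 phi_le1.
- by move=> p [[]].
- move=> p hp; rewrite /dn => h; split => // -[_ _ h1]; move/eqP: h; apply.
  by rewrite phi1// subrr.
apply: (@le_trans _ _ (K%:E * (e / (K + 1))%:E)%E).
  by apply: lee_wpmul2l; [rewrite lee_fin|exact: hj1].
rewrite -EFinM lee_fin mulrA ler_pdivrMr// mulrC; apply: ler_wpM2l; first exact: ltW.
by rewrite lerDl.
Qed.

End Tightness.

Lemma fsuppD (R : realType) (I : choiceType) (A : set I) (f g : I -> R) : fsupp A f -> fsupp A g ->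
  fsupp A (fun x => f x + g x).
Proof.
move=> hf hg; apply: (@sub_finite_set _ _ ([set x | A x /\ f x != 0] `|` [set x | A x /\ g x != 0])).
  move=> x [Ax hx]; have [z|z] := eqVneq (f x) 0; last by left.
  by right; split => //; move: hx; rewrite z add0r.
by rewrite finite_setU.
Qed.

(** * Asymptotics of orbit sums over balls *)

Section BallAsymptotics.
Variables (R : realType) (m k : nat).
Local Notation n := (m + k)%N.
Local Notation gs := (slspace R n).
Local Notation G := (slT R n).
Local Notation T := (Pmeas R m k).
Local Notation Pset := (@Pset R m k).
Local Notation GrQ := (@GrQ R m n).
Implicit Types F f : G -> R.
Hypotheses (hm : (0 < m)%N) (hk : (0 < k)%N).
Variable mu : {measure set T -> \bar R}.
Hypotheses (mu_inv : P_invariant mu) (mu_fin : (mu (@Pball R m k) < +oo)%E)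
  (mu_pos : (0 < mu (@Pball R m k))%E).
Local Notation Ieg := (Ieg mu).
Local Notation intg := (intg mu).
Local Notation Vol := (Vol mu).
Let bfin C : (mu (Bc C) < +oo)%E := mu_Bc_fin mu_inv mu_fin mu_pos hm hk C.

(* The unknown constant a_t, normalised by one fixed test function. *)
Definition At (t : R) : R := DS t (Hop (kap 1 : gs -> R)) / Jmu mu (kap 1).

Lemma Kc_kap : Kc (Hop (kap 1 : gs -> R)).
Proof. by exists (kap 1 : gs -> R) => //; exact: Cc_kap. Qed.

Lemma At_bd : exists2 A : R, 0 <= A & forall t, 0 < t -> 0 <= At t <= A.
Proof.
have J0 := Jkap_gt0 hm hk mu_inv mu_fin mu_pos.
have [C C0 hC] := DS_bd hm hk Kc_kap.
exists (C / Jmu mu (kap 1)) => [|t t0]; first by rewrite divr_ge0// ltW.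
have h0 : 0 <= DS t (Hop (kap 1 : gs -> R)).
  by apply: DS_ge0 => // g; apply: Hop_ge0 => [|x]; [exact: Cc_kap|exact: kap_ge0].
rewrite /At divr_ge0 ?(ltW J0)//= ler_pdivrMr// divfK ?gt_eqF//.
exact: le_trans (ler_norm _) (hC t t0).
Qed.

Lemma Kc_asym F (e : R) : Kc F -> 0 < e -> exists2 T0 : R, 1 <= T0 & forall t, T0 <= t ->
  `|DS t F - At t * Ieg F| <= e.
Proof.
move=> KF e0; have J0 := Jkap_gt0 hm hk mu_inv mu_fin mu_pos.
have [T0 T1 hT] := DS_asym hm hk mu_inv mu_fin mu_pos KF Kc_kap (mulr_gt0 e0 J0).
exists T0 => // t /hT; rewrite /At -/(Jmu mu _); set J := Jmu _ _ in J0 *; set a := DS t _; set b := DS t _ => h.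
have -> : a - b / J * Ieg F = (a * J - b * Ieg F) / J by field; rewrite gt_eqF.
by rewrite normrM normfV (gtr0_norm J0) ler_pdivrMr.
Qed.

Definition IB (C : R) F : R := (\int[mu]_(p in Bc C) dn F p)%R.

Lemma bd_intg (C M : R) (h : T -> R) : measurable_fun (Bc C) h -> (forall p, `|h p| <= M) ->
  mu.-integrable (Bc C) (EFin \o h).
Proof.
move=> mh hM; apply: measurable_bounded_integrable => //; first exact: meas_Bc.
exists M; split; first exact: num_real.
by move=> x Mx p _; exact: le_trans (hM p) (ltW Mx).
Qed.

Lemma Bc_Pset C : @Bc R m k C `<=` Pset. Proof. by move=> p []. Qed.

Lemma mfun_Bc C F : nice F -> measurable_fun (@Bc R m k C) (dn F).
Proof.
by move=> [hF lF]; apply: (measurable_funS (@meas_Pset R m k) (@Bc_Pset C)); exact: mfun_dn.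
Qed.

Lemma IB_intg C M F : nice F -> (forall g, `|F g| <= M) -> mu.-integrable (Bc C) (EFin \o dn F).
Proof. by move=> nF FM; apply: (@bd_intg C M); [exact: mfun_Bc|move=> p; exact: FM]. Qed.

Lemma Rint_indic C (A : set T) (M : R) : measurable A -> A `<=` Bc C -> 0 <= M ->
  (\int[mu]_(p in Bc C) (M * \1_A p))%R = M * fine (mu A).
Proof.
move=> mA sA M0; rewrite /Rintegral.
rewrite (eq_integral (fun p => (M%:E * (\1_A p)%:E)%E)); last by move=> p _; rewrite EFinM.
rewrite ge0_integralZl_EFin//; last 2 first.
- exact: meas_Bc.
- by apply/measurable_EFinP; apply: measurable_indic.
rewrite (@integral_indic _ _ _ mu _ (meas_Bc C) A mA) setIidl// fineM//.
rewrite ge0_fin_numE//; apply: le_lt_trans (bfin C).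
exact: (le_measure mu (mem_set mA) (mem_set (meas_Bc C))).
Qed.

Lemma IB_diff C F f (A : set T) (M N : R) : nice F -> nice f -> (forall g, `|F g| <= M) -> (forall g, `|f g| <= M) ->
  (forall g, `|F g - f g| <= N) -> measurable A -> A `<=` Bc C ->
  (forall p, Bc C p -> ~ A p -> dn F p = dn f p) -> `|IB C F - IB C f| <= N * fine (mu A).
Proof.
move=> nF nf FM fM FN mA sA h; have N0 : 0 <= N by apply: le_trans (FN 1%g).
have iF := IB_intg C nF FM; have if' := IB_intg C nf fM.
have i1 : mu.-integrable (Bc C) (EFin \o (fun p => dn F p - dn f p)).
  by apply: (@bd_intg C N); [apply: measurable_funB; exact: mfun_Bc|move=> p; exact: FN].
rewrite /IB -(RintegralB (meas_Bc C) iF if').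
apply: le_trans (le_normr_Rintegral (meas_Bc C) i1) _.
rewrite -(Rint_indic mA sA N0); apply: le_Rintegral.
- exact: meas_Bc.
- apply: (@bd_intg C N); last by move=> p; rewrite normr_id; exact: FN.
  by apply: measurableT_comp => //; apply: measurable_funB; exact: mfun_Bc.
- apply: (@bd_intg C N).
    by apply: measurable_funM => //; apply: measurable_indic.
  by move=> p; rewrite indicE normrM (ger0_norm N0); case: (_ \in _); rewrite ?normr1 ?normr0 ?mulr1 ?mulr0.
move=> p hp; rewrite indicE; have [_|/negP nA] := boolP (p \in A); first by rewrite mulr1; exact: FN.
by rewrite mulr0 h// ?subrr ?normr0// => Ap; apply: nA; apply/mem_set.
Qed.

Lemma IB_Ieg C F : (forall g, C < cov2 g -> F g = 0) -> IB C F = Ieg F.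
Proof.
move=> h; rewrite /IB /Ieg [LHS]Rintegral_mkcond [RHS]Rintegral_mkcond; congr Rintegral.
apply/funext => p; rewrite /patch; case: ifPn => [/set_mem[hp _]|/negP hB].
  by rewrite (mem_set hp).
case: ifPn => // /set_mem hp; rewrite /dn h// ltNge; apply/negP => hc; apply: hB; apply/mem_set.
by split.
Qed.

Lemma root_gap (e : R) : 0 < e -> exists2 q : R, 1 < q & q ^+ n - (q^-1) ^+ n <= e.
Proof.
move=> e0; have n0 : (0 < n)%N by rewrite addn_gt0 hm.
pose d := e / 2; have d0 : 0 < d by rewrite divr_gt0.
have d1 : 1 < 1 + d by rewrite ltrDl.
exists ((1 + d) `^ n%:R^-1).
  have : 1 `^ n%:R^-1 < (1 + d) `^ n%:R^-1.
    by rewrite gt0_ltr_powR ?invr_gt0 ?ltr0n// nnegrE// addr_ge0// ltW.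
  by rewrite powR1.
rewrite exprVn powR_root//; last by rewrite addr_ge0// ltW.
have : (1 + d)^-1 >= 1 - d.
  rewrite -div1r ler_pdivlMr ?(lt_trans ltr01)//; have := sqr_ge0 d; rewrite expr2; lra.
by rewrite /d; lra.
Qed.

(** Bookkeeping for [ball_asym]: d, f1, x are the orbit sums of F on the ball, of its compactly
    supported approximation and of the annulus; ib0, i1, y are the matching integrals. *)
Lemma asm_bound (d f1 i1 ib0 x y a A M1 e : R) : `|d - f1| <= M1 * (e + x) -> `|x - a * y| <= e ->
  0 <= y <= e -> `|f1 - a * i1| <= e -> `|i1 - ib0| <= M1 * (2 * e) -> 0 <= a <= A -> 0 <= M1 ->
  `|d - a * ib0| <= e * (M1 * (2 + 3 * A) + 1).
Proof.
move=> h1 h2 /andP[y0 ye] h3 h4 /andP[a0 aA] M0.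
have e0 : 0 <= e by exact: le_trans y0 ye.
have hx : x <= e + A * e.
  have : x - a * y <= e by exact: le_trans (ler_norm _) h2.
  rewrite lerBlDr => /le_trans; apply; rewrite lerD2l; exact: ler_pM.
have -> : d - a * ib0 = (d - f1) + (f1 - a * i1) + a * (i1 - ib0) by ring.
apply: le_trans (ler_normD _ _) _; rewrite normrM (ger0_norm a0).
have h5 : a * `|i1 - ib0| <= A * (M1 * (2 * e)) by exact: ler_pM.
have h6 : `|d - f1| <= M1 * (2 * e + A * e).
  by apply: le_trans h1 _; apply: ler_wpM2l => //; lra.
have := lerD (le_trans (ler_normD (d - f1) (f1 - a * i1)) (lerD h6 h3)) h5.
by move=> /le_trans; apply; rewrite le_eqVlt; apply/orP; left; apply/eqP; ring.
Qed.

(** The radius a is squeezed between a/q and a q so that the shell has measure at most h. F is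
    replaced by F1 in [Kc], and the error is dominated by the tail 1 - phi and by an annular
    function [an] to which [Kc_asym] applies again. *)
Theorem ball_asym F (a e M : R) : 0 < a -> 0 < e -> nice F -> (forall g, `|F g| <= M) ->
  exists2 T0 : R, 1 <= T0 & forall t, T0 <= t ->
  `|DS t (fun g => ib (a ^+ 2) g * F g) - At t * IB (a ^+ 2) F| <= e.
Proof.
move=> a0 e0 nF FM; have M0 : 0 <= M by apply: le_trans (FM 1%g).
have [A A0 hA] := At_bd.
pose D := M * (2 + 3 * A) + 1; have D0 : 0 < D by rewrite ltr_wpDl// mulr_ge0// addr_ge0// mulr_ge0.
pose h := e / D; have h0 : 0 < h by rewrite divr_gt0.
have V1 := Vol1_gt0 mu_fin mu_pos.
have S0 : 0 < a ^+ n * Vol 1 by rewrite mulr_gt0// exprn_gt0.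
have [q q1 hq] := root_gap (divr_gt0 h0 S0).
have q0 := lt_trans ltr01 q1.
set C := a ^+ 2; pose Ci := (a / q) ^+ 2; pose Co := (a * q) ^+ 2.
have CiC : Ci < C.
  by rewrite /Ci exprMn gtr_pMr ?exprn_gt0// exprVn invf_lt1 ?exprn_gt0// exprn_egt1.
have CCo : C < Co by rewrite /Co exprMn ltr_pMr ?exprn_gt0// exprn_egt1.
have VC : Vol Co - Vol Ci <= h.
  rewrite /Co /Ci !(Vol_sqr mu_inv mu_fin mu_pos hm hk) ?mulr_gt0 ?invr_gt0//.
  rewrite -mulrBl !exprMn -mulrBr mulrAC -ler_pdivlMl// mulrC; exact: hq.
have VV : Vol C <= Vol Co.
  rewrite -lee_fin -!(VolE mu_inv mu_fin mu_pos hm hk).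
  exact: (le_measure mu (mem_set (meas_Bc C)) (mem_set (meas_Bc Co)) (Bc_mono (ltW CCo))).
have C0 : 0 < C by rewrite exprn_gt0.
have [j0 hj0] := mu_tail mu_inv mu_fin mu_pos hm hk C h0.
have [J hJ] := DS_tail hm hk mu_inv mu_fin mu_pos C0 h0.
pose j := maxn j0 (Num.bound `|J|).
have Jj : J <= j%:R.
  apply: le_trans (ltW (le_lt_trans (ler_norm J) (archi_boundP (normr_ge0 J)))) _.
  by rewrite ler_nat leq_maxr.
have {hj0}tl1 := hj0 j (leq_maxl _ _).
have {hJ}tl2 t := hJ j%:R t Jj.
pose b := @bc R m k Ci C; pose ph := @phi R m k j%:R.
pose an (g : G) := bc C Co g - b g.
have nb : nice b by exact: nice_bc.
have nph : nice ph by exact: nice_phi.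
have nan : nice an by apply: niceB => //; exact: nice_bc.
pose F1 (g : G) := F g * b g * ph g.
have KF1 : Kc F1 by apply: Kc_phi; exact: niceM.
have Kan : Kc (fun g => an g * ph g) by exact: Kc_phi.
have b01 g : 0 <= b g <= 1 by rewrite bmp_ge0 bmp_le1.
have p01 g : 0 <= ph g <= 1 by rewrite phi_ge0 phi_le1.
have an01 g : 0 <= an g <= 1.
  rewrite /an; have /andP[b0 b1] := b01 g; apply/andP; split; last first.
    by rewrite lerBlDr (le_trans (bmp_le1 _ _ _))// lerDl.
  have [cg|cg] := leP (cov2 g) C; first by rewrite /bc bmp1// subr_ge0.
  by rewrite /b /bc [X in _ - X]bmp0 ?(ltW cg)// subr0 bmp_ge0.
have [T1 T11 hT1] := Kc_asym KF1 h0.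
have [T2 T21 hT2] := Kc_asym Kan h0.
exists (Num.max T1 T2) => [|t]; first by rewrite le_max T11.
rewrite ge_max => /andP[/[dup] tT1 /hT1 {}hT1 /hT2 {}hT2].
have t0 : 0 < t by apply: lt_le_trans ltr01 (le_trans T11 tT1).
have -> : e = h * (M * (2 + 3 * A) + 1) by rewrite /h divfK// gt_eqF.
apply: (@asm_bound _ (DS t F1) (Ieg F1) _ (DS t (fun g => an g * ph g)) (Ieg (fun g => an g * ph g))) => //; last first.
- exact: hA.
- rewrite -(@IB_Ieg C F1); last by move=> g cg; rewrite /F1 /b /bc bmp0 ?(ltW cg)// mulr0 mul0r.
  rewrite distrC.
  have mA : measurable ((Bc C `\` @Sj R m k C j) `|` (Bc C `\` Bc Ci)).
    by apply: measurableU; apply: measurableD; [exact: meas_Bc|exact: meas_Sj|exact: meas_Bc|exact: meas_Bc].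
  have F1F g : F1 g = F g * (b g * ph g) by rewrite mulrA.
  have bp01 g : 0 <= b g * ph g <= 1.
    have /andP[b0 b1] := b01 g; have /andP[p0 p1] := p01 g.
    by rewrite mulr_ge0//= mulr_ile1.
  apply: le_trans (@IB_diff C F F1 _ M M nF (Kc_nice KF1) FM _ _ mA _ _) _.
  + move=> g; have /andP[c0 c1] := bp01 g.
    rewrite F1F normrM (ger0_norm c0); apply: le_trans (FM g); by rewrite ler_piMr.
  + move=> g; have /andP[c0 c1] := bp01 g.
    have -> : F g - F1 g = F g * (1 - b g * ph g) by rewrite F1F mulrBr mulr1.
    have s0 : 0 <= 1 - b g * ph g by rewrite subr_ge0.
    rewrite normrM (ger0_norm s0); apply: le_trans (FM g).
    by rewrite ler_piMr// gerBl.
  + by move=> p [[]|[]].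
  + move=> p hp /not_orP[n1 n2]; rewrite /dn F1F.
    have hS : Sj C j p by apply: contrapT => hS; apply: n1.
    have [_ hc] : Bc Ci p by apply: contrapT => hB; apply: n2.
    have [_ _ h1] := hS.
    by rewrite /b /bc bmp1// /ph phi1// !mulr1.
  apply: ler_wpM2l => //; rewrite -lee_fin fineK; last first.
    rewrite ge0_fin_numE//; apply: le_lt_trans (bfin C).
    apply: (le_measure mu (mem_set mA) (mem_set (meas_Bc C))); by move=> p [[]|[]].
  have m1 : measurable (Bc C `\` @Sj R m k C j) by apply: measurableD; [exact: meas_Bc|exact: meas_Sj].
  have m2 : measurable (Bc C `\` @Bc R m k Ci) by apply: measurableD; exact: meas_Bc.
  apply: le_trans (measureU2 mu m1 m2) _.
  have -> : (2 * h)%:E = (h%:E + h%:E)%E by rewrite -EFinD; congr EFin; ring.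
  have ann : (mu (Bc C `\` Bc Ci) <= h%:E)%E.
    rewrite (mu_annulus mu_inv mu_fin mu_pos hm hk (ltW CiC)) lee_fin.
    by apply: le_trans VC; rewrite lerD2r.
  exact: (leeD tl1 ann).
- apply/andP; split.
    by apply: Ieg_ge0 => g; have /andP[? _] := an01 g; have /andP[? _] := p01 g; rewrite mulr_ge0.
  rewrite -lee_fin; apply: (@le_trans _ _ (mu (Bc Co `\` Bc Ci))); last first.
    by rewrite (mu_annulus mu_inv mu_fin mu_pos hm hk (ltW (lt_trans CiC CCo))) lee_fin.
  apply: Ieg_le_mu.
  + by apply: measurableD; exact: meas_Bc.
  + by move=> p [[]].
  + exact: Kc_nice.
  + exact: Kc_intg.
  + move=> g; have /andP[? ?] := an01 g; have /andP[? ?] := p01 g.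
    by rewrite mulr_ge0//= mulr_ile1.
  move=> p hp; rewrite /dn mulf_eq0 negb_or => /andP[/eqP an0 _]; split.
    split => //; rewrite leNgt; apply/negP => hc; apply: an0.
    by rewrite /an /b /bc !bmp0 ?subrr// ?(ltW hc)// (ltW (lt_trans CCo hc)).
  move=> [_ hc]; apply: an0; rewrite /an /b /bc !bmp1 ?subrr//.
  exact: le_trans hc (ltW CiC).
have fib (f : G -> R) : fsupp GrQ (fun L => ib C (xt t L : G) * f (xt t L)).
  exact: (ib_fsupp hm hk mu_inv mu_fin mu_pos C f t0).
have fF1 : fsupp GrQ (fun L => F1 (xt t L)) by exact: (Kc_fsupp hm hk t0 KF1).
have fF1N : fsupp GrQ (fun L => -1 * F1 (xt t L)) by apply: fsupp_le fF1 => L _ ->; rewrite mulr0.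
have E : DS t (fun g => ib C g * F g) - DS t F1 = DS t (fun g => ib C g * F g + (- 1) * F1 g).
  by rewrite (DSD (fib F) fF1N) (DSZ _ fF1) mulN1r.
have f1 : fsupp GrQ (fun L => ib C (xt t L : G) * (1 - ph (xt t L))).
  exact: (fib (fun g => 1 - ph g)).
have f2 : fsupp GrQ (fun L => an (xt t L) * ph (xt t L)) by exact: (Kc_fsupp hm hk t0 Kan).
have f3 : fsupp GrQ (fun L => ib C (xt t L) * (1 - ph (xt t L)) + an (xt t L) * ph (xt t L)).
  exact: (fsuppD f1 f2).
rewrite E; apply: (@le_trans _ _ (DS t (fun g => M * (ib C g * (1 - ph g) + an g * ph g)))).
  apply: (DS_abs t0).
  + exact: (fsuppD (fib F) fF1N).
  + by apply: fsupp_le f3 => L _ ->; rewrite mulr0.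
  move=> L hL; set g := xt t L; rewrite mulN1r /F1 /ib /an.
  have /andP[p0 p1] := p01 g; have /andP[b0 b1] := b01 g.
  case: (leP (cov2 g) C) => cg.
    have -> : (1%N%:R : R) = 1 by [].
    rewrite /bc [X in X - b g]bmp1// mul1r.
    have -> : F g - F g * b g * ph g = F g * (1 * (1 - ph g) + (1 - b g) * ph g) by ring.
    have s0 : 0 <= 1 * (1 - ph g) + (1 - b g) * ph g.
      by rewrite mul1r addr_ge0 ?subr_ge0// mulr_ge0// subr_ge0.
    by rewrite normrM (ger0_norm s0) ler_wpM2r.
  have -> : b g = 0 by rewrite /b /bc bmp0// ltW.
  by rewrite !(mul0r, mulr0) subrr normr0 add0r subr0 !mulr_ge0 ?bmp_ge0.
by rewrite (DSZ _ f3) (DSD f1 f2); apply: (ler_wpM2l M0); apply: (lerD (tl2 t t0)).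
Qed.

End BallAsymptotics.

(** * Continuity of the tangent lattice *)

Section PointwiseContinuity.
Variable R : realType.

(** Continuity at one point, as the topology of UG delivers it; [heine_cantor] upgrades it to
    [lc]. *)
Definition ptc (T1 T2 : pspace R) (f : T1 -> T2) (x : T1) := forall e : R, 0 < e ->
  exists2 d : R, 0 < d & forall y, dst y x < d -> dst (f y) (f x) < e.

Lemma lc_ptc (T1 T2 : pspace R) (f : T1 -> T2) x : lc f -> ptc f x.
Proof.
move=> lf e e0; have [_ /(_ e e0)[d d0 hd]] := lf (nm x + 1).
exists (Num.min 1 d) => [|y]; first by rewrite lt_min ltr01.
rewrite lt_min => /andP[y1 yd]; apply: hd => //; last by rewrite lerDl.
by apply: le_trans (nm_lip y x) _; rewrite lerD2l ltW.
Qed.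

Lemma ptc_comp (T1 : pspace R) (f : T1 -> R) (u : R -> R) (x : T1) :
  ptc (f : T1 -> rspace R) x -> {for f x, continuous u} -> ptc (fun y => u (f y) : rspace R) x.
Proof.
move=> hf hu e e0; move/cvgrPdist_lt: hu => /(_ e e0) /nbhs_ballP[d /= d0 hd].
have [d' d'0 hd'] := hf d d0; exists d' => // y /hd' h; rewrite /dst/= distrC; apply: hd.
by rewrite /ball /= distrC.
Qed.

Lemma ptc_scale (T1 : pspace R) p q (u : T1 -> R) (f : T1 -> matspace R p q) (x : T1) :
  ptc (u : T1 -> rspace R) x -> ptc f x -> ptc (fun y => u y *: f y : matspace R p q) x.
Proof.
move=> hu hf e e0; pose b := nrm (f x) + 1; pose c : R := `|u x| + 1.
have b0 : 0 < b by rewrite ltr_wpDl// nrm_ge0.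
have c0 : 0 < c by rewrite ltr_wpDl.
have e1 : 0 < e / 2 / b by rewrite !divr_gt0.
have [d1 d10 h1] := hu _ e1.
have m0 : 0 < Num.min 1 (e / 2 / c) by rewrite lt_min ltr01 !divr_gt0.
have [d2 d20 h2] := hf _ m0.
exists (Num.min d1 d2) => [|y]; first by rewrite lt_min d10.
rewrite lt_min => /andP[/h1 {}h1 /h2]; rewrite lt_min => /andP[h3 h4].
rewrite /dst/= in h1 h3 h4 *.
have -> : u y *: f y - u x *: f x = (u y - u x) *: f y + u x *: (f y - f x).
  by rewrite scalerBl scalerBr addrA subrK.
apply: le_lt_trans (nrmD _ _) _; rewrite !nrmZ.
have fb : nrm (f y) <= b.
  by rewrite -[f y](subrK (f x)) (le_trans (nrmD _ _))// addrC lerD2l ltW.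
have k1 : `|u y - u x| * nrm (f y) < e / 2.
  apply: (@le_lt_trans _ _ (`|u y - u x| * b)); first exact: ler_wpM2l.
  by rewrite -ltr_pdivlMr.
have k2 : `|u x| * nrm (f y - f x) <= e / 2.
  apply: (@le_trans _ _ (c * (e / 2 / c))); last by rewrite mulrC divfK// gt_eqF.
  apply: ler_pM => //; rewrite ?nrm_ge0//; last exact: ltW.
  by rewrite lerDl.
by have := ltr_leD k1 k2; rewrite -splitr.
Qed.

End PointwiseContinuity.

(** * Uniform continuity on balls of SL_n(R) *)

Section HeineCantor.
Variables (R : realType) (n : nat).
Local Notation gs := (slspace R n).

Lemma nrm_vec_mx (v : 'rV[R]_(n * n)) : nrm (vec_mx v : 'M[R]_n) <= (n * n)%:R * nrm v.
Proof. by apply: nrm_le => i j; rewrite mxE; exact: nrm_entry. Qed.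

(** Compactness of a box of matrices: a matrix of determinant 1 gets its neighbourhood from
    continuity, and any other matrix has a neighbourhood free of group elements. *)
Lemma heine_cantor (F : gs -> R) : (forall g, ptc (F : gs -> rspace R) g) -> lc (F : gs -> rspace R).
Proof.
move=> hF; apply: lcI => r e e0.
pose K := [set v : 'rV[R]_(n * n) | forall i, `[- r, r]%classic (v ord0 i)].
have cK : compact K := @rV_compact _ (n * n) (fun=> `[- r, r]%classic) (fun=> @segment_compact R (- r) r).
pose P (d : R) (v : 'rV[R]_(n * n)) := forall g h : gs, val g = vec_mx v -> dst g h < d -> `|F g - F h| < e.
have nb (v : 'rV[R]_(n * n)) (d : R) : 0 < d -> nbhs v [set v' | nrm (vec_mx v' - vec_mx v : 'M[R]_n) < d].
  move=> d0; have c0 : 0 < (n * n)%:R + 1 :> R by rewrite ltr_wpDl.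
  apply: filterS (nrm_nbhs v (divr_gt0 d0 c0)) => v' /=; rewrite ltr_pdivlMr// => hv.
  rewrite -linearB; apply: le_lt_trans (nrm_vec_mx _) _; apply: le_lt_trans hv.
  by rewrite mulrC ler_wpM2l ?nrm_ge0// lerDl.
have hP v : K v -> \forall v' \near v & d \near 0^'+, P d v'.
  move=> _; have [dv|dv] := eqVneq (\det (vec_mx v : 'M[R]_n)) 1.
    have [g0 eg0] : exists g0 : slT R n, val g0 = vec_mx v.
      by exists (insubd (1%g : slT R n) (vec_mx v)); rewrite val_insubd dv eqxx.
    have e2 : 0 < e / 2 by rewrite divr_gt0.
    have [d d0 hd] := hF g0 _ e2; have d2 : 0 < d / 2 by rewrite divr_gt0.
    exists ([set v' | nrm (vec_mx v' - vec_mx v : 'M[R]_n) < d / 2], [set d' | 0 < d' < d / 2]).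
      split; first exact: nb.
      by near=> x; apply/andP; split; near: x; [exact: nbhs_right_gt|exact: nbhs_right_lt].
    move=> [v' d'] /= [hv' /andP[_ hd']] g h eg gh.
    have g1 : dst g g0 < d / 2 by rewrite /dst/= eg eg0.
    have h1 : dst h g0 < d.
      by apply: le_lt_trans (dst_tri g h g0) _; rewrite [ltRHS]splitr ltrD// dst_sym (lt_trans gh).
    have g2 : dst g g0 < d by apply: lt_trans g1 _; rewrite ltr_pdivrMr// ltr_pMr// ltr1n.
    have := ltrD (hd g g2) (hd h h1); rewrite -splitr; apply: le_lt_trans; rewrite /dst/=.
    by rewrite [X in _ <= _ + X]distrC; exact: ler_distD.
  have l : lc ((fun A => \det A) : matspace R n n -> rspace R) by apply: lc_det; exact: lc_id.
  have d0 : 0 < `|\det (vec_mx v : 'M[R]_n) - 1| by rewrite normr_gt0 subr_eq0.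
  have [d dp hd] := lc_ptc (vec_mx v) l d0.
  exists ([set v' | nrm (vec_mx v' - vec_mx v : 'M[R]_n) < d], setT).
    by split; [exact: nb|exact: filterT].
  move=> [v' d'] /= [hv' _] g h eg _; have := hd _ hv'; rewrite /dst/= -eg sl_det distrC ltxx//.
have H : \forall d \near 0^'+, K `<=` P d by apply: ((compact_near_coveringP K).1 cK R 0^'+ P _ hP).
have [d [d0 hd]] := filter_ex (filterI (nbhs_right_gt 0) H).
exists d => // x y xr yr xy; apply: (hd (mxvec (val x)) _ x y) => //; last by rewrite mxvecK.
move=> i; have [a b] := mxvec_indexP i; rewrite mxvecE /= in_itv /=.
by rewrite -ler_norml (le_trans (nrm_entry _ a b)).
Unshelve. all: by end_near. Qed.

End HeineCantor.

(** * Continuity of the normalised tangent basis *)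

Section LatticeContinuity.
Variables (R : realType) (m k : nat).
Local Notation n := (m + k)%N.
Local Notation gs := (slspace R n).
Local Notation G := (slT R n).

Lemma tmxE p q N (A : 'M[R]_(p, N)) (B : 'M[R]_(q, N)) i j a b :
  tmx A B (mxvec_index i j) (mxvec_index a b) = A i a * B j b.
Proof.
have /rowP/(_ (mxvec_index a b)) := row_tmx A B i j; rewrite mxE => ->.
by rewrite /tens mxvecE mxE big_ord1 !mxE.
Qed.

Lemma lc_tmx (T : pspace R) p q N (A : T -> matspace R p N) (B : T -> matspace R q N) :
  lc A -> lc B -> lc (fun x => tmx (A x) (B x) : matspace R (p * q) (N * N)).
Proof.
move=> lA lB; apply: lc_mx => i j; have [i1 i2] := mxvec_indexP i; have [j1 j2] := mxvec_indexP j.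
apply: (@lc_ext _ _ _ (fun x => A x i1 j1 * B x i2 j2)) => [x|]; first by rewrite tmxE.
by apply: lcM; exact: lc_mxE.
Qed.

Let gr (g : G) := Ag g *m (Ag g)^T.
Let X0 (g : G) : 'M[R]_(m, n) := \adj (gr g) *m Ag g.
Let B0 (g : G) : 'M[R]_(k, n) := dsubmx (val g) *m (cov2 g *: 1%:M - (Ag g)^T *m \adj (gr g) *m Ag g).

Lemma invmx_gr (g : G) : invmx (gr g) = (cov2 g)^-1 *: \adj (gr g).
Proof. by rewrite /invmx (gram_unit (Ag_free g)). Qed.

Let XgE (g : G) : Xg g = (cov2 g)^-1 *: X0 g.
Proof. by rewrite /Xg -/(gr g) invmx_gr -scalemxAl. Qed.

Let BgE (g : G) : Bg g = (cov2 g)^-1 *: B0 g.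
Proof.
rewrite /Bg /projm -/(gr g) invmx_gr /B0 [RHS]scalemxAr; congr mulmx.
by rewrite scalerBr scalerA mulVf ?gt_eqF ?cov2_gt0// scale1r -scalemxAr -scalemxAl.
Qed.

(** With adjugates in place of inverses, [Mg] is this scalar at cov2 times a matrix that is
    polynomial in g; the two inverses of x come from the dual basis and from the projection. *)
Let ps (x : R) : R := expR (m%:R^-1 * ln (Num.sqrt x)) * expR (k%:R^-1 * ln (Num.sqrt x)) * (x^-1 * x^-1).

Lemma Mg_scalar (g : G) : Mg g = ps (cov2 g) *: tmx (X0 g) (B0 g).
Proof.
rewrite /Mg XgE BgE tmxZ scalerA /powR !gt_eqF ?cov_gt0//.
Qed.

Lemma ps_cont x : 0 < x -> {for x, continuous ps}.
Proof.
move=> x0; have s0 : 0 < Num.sqrt x by rewrite sqrtr_gt0.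
have cl (a : R) : {for x, continuous (fun x => expR (a * ln (Num.sqrt x)))}.
  apply: (@continuous_comp _ _ _ (fun x => a * ln (Num.sqrt x)) expR); last exact: continuous_expR.
  apply: (@cvgM _ _ _ _ (fun=> a) (fun x => ln (Num.sqrt x))); first exact: cvg_cst.
  by apply: (@continuous_comp _ _ _ Num.sqrt (@ln R)); [exact: sqrt_continuous|exact: continuous_ln].
have ci : {for x, continuous (fun x : R => x^-1)} by apply: cvgV; [rewrite gt_eqF|exact: cvg_id].
by apply: cvgM; [exact: cvgM (cl _) (cl _)|exact: cvgM].
Qed.

Lemma Mg_ptc (g : G) : ptc (fun g : gs => Mg g : matspace R (m * k) (n * n)) g.
Proof.
have lv : lc (fun g : gs => val g : matspace R n n) by apply: lc_val; exact: lc_id.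
have ld : lc (fun g : gs => dsubmx (val g) : matspace R k n).
  by apply: lc_mx => i j; apply: (@lc_ext _ _ _ (fun g : gs => val g (rshift m i) j)) => [x|]; [rewrite mxE|exact: lc_mxE].
have lA := @lc_Ag R m k.
have la : lc (fun g : gs => \adj (gr g) : matspace R m m) by apply: lc_adj; exact: lc_gram.
have lX : lc (fun g : gs => X0 g : matspace R m n) by exact: lc_mulmx.
have l1 : lc (fun g : gs => cov2 g *: 1%:M : matspace R n n).
  by apply: lc_scalemx; [exact: lc_cov2|exact: lc_cst].
have l2 : lc (fun g : gs => (-1) *: ((Ag g)^T *m \adj (gr g) *m Ag g) : matspace R n n).
  apply: lc_scalemx; first exact: lc_cst.
  by apply: lc_mulmx => //; apply: lc_mulmx => //; exact: lc_trmx.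
have lB : lc (fun g : gs => B0 g : matspace R k n).
  apply: lc_mulmx => //; apply: lc_ext (lc_addmx l1 l2) => x.
  by rewrite scaleN1r.
have h : ptc (fun g : gs => ps (cov2 g) *: tmx (X0 g) (B0 g) : matspace R (m * k) (n * n)) g.
  apply: ptc_scale; last by apply: lc_ptc; exact: lc_tmx.
  apply: (ptc_comp (lc_ptc g (@lc_cov2 R m k))).
  by apply: ps_cont; exact: cov2_gt0.
move=> e e0; have [d d0 hd] := h e e0; exists d; first exact: d0.
by move=> y yd; have := hd y yd; rewrite -!Mg_scalar.
Qed.

Definition Ff (f : set 'rV[R]_(n * n) -> R) (g : G) : R := f (zspan (Mg g)).

Lemma zMg_pt (g g' : G) : pt (val g) = pt (val g') -> zspan (Mg g) = zspan (Mg g').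
Proof. by move=> E; rewrite -!Phi_pt E. Qed.

Hypotheses (hm : (0 < m)%N) (hk : (0 < k)%N).

Lemma zMg_ub y (g : G) : zspan (Mg (ub y * g)%g) = zspan (Mg g).
Proof. by apply: zMg_pt; exact: pt_ub. Qed.

Lemma zMg_GamH h (g : G) : GamH h -> zspan (Mg (h * g)%g) = zspan (Mg g).
Proof. by move=> hh; apply: zMg_pt; exact: pt_GamH. Qed.

Lemma nice_Ff f : UG_bcont f -> nice (Ff f).
Proof.
move=> [_ cf]; split.
  split=> [y g|h g Hh]; rewrite /Ff; first by rewrite zMg_ub.
  by rewrite (zMg_GamH g Hh).
apply: heine_cantor => g e e0.
have := (subspace_continuousP (@UY R m k) _).1 cf (Mg g) (Mg_UY hm hk g).
move=> /cvgrPdist_lt/(_ e e0)/nbhs_nrm[d d0 hd].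
have [d' d'0 hd'] := Mg_ptc g d0; exists d' => // h /hd' hh.
rewrite [dst _ _]distrC; exact: (hd (Mg h) hh (Mg_UY hm hk h)).
Qed.

Lemma Mg_UG (g : G) : UG (zspan (Mg g)).
Proof. by exists (Mg g) => //; exact: Mg_UY. Qed.

Lemma closed_Mg (E : set (set 'rV[R]_(n * n))) (g : G) : UG_closed E ->
  (forall e : R, 0 < e -> exists2 h : G, E (zspan (Mg h)) & dst (h : gs) g < e) -> E (zspan (Mg g)).
Proof.
move=> [_ [C [cC EC]]] hE.
suff : (C `&` @UY R m k) (Mg g) by rewrite -EC => -[].
split; last exact: Mg_UY.
apply: cC => U /nbhs_nrm[d d0 hd]; have [d' d'0 hd'] := Mg_ptc g d0.
have [h Eh hg] := hE d' d'0; exists (Mg h); split; last by apply: hd; exact: hd'.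
suff : (C `&` @UY R m k) (Mg h) by case.
by rewrite -EC; split => //; exact: Mg_UY.
Qed.

(** * Distance to a closed set of lattices *)

Section Distance.
Variable E : set (set 'rV[R]_(n * n)).
Hypothesis cE : UG_closed E.

(** How far g must be moved on the right to enter E, truncated at 1. Right translations commute with
    H, so the infimum is H-invariant; the element 1 keeps the set nonempty. *)
Definition rS (g : G) : set R := [set x | x = 1 \/ exists2 h : G, E (zspan (Mg (g * h)%g)) & x = dst (h : gs) 1%g].
Definition rho (g : G) : R := inf (rS g).

Lemma rS_lb g : lbound (rS g) 0.
Proof. by move=> x [->|[h _ ->]]; rewrite ?ler01 ?dst_ge0. Qed.

Lemma rS_has_inf g : has_inf (rS g).
Proof. by split; [exists 1; left|exists 0; exact: rS_lb]. Qed.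

Lemma rho_ge0 g : 0 <= rho g.
Proof. by apply: lb_le_inf; [exists 1; left|exact: rS_lb]. Qed.

Lemma rho_le g x : rS g x -> rho g <= x.
Proof. by move=> hx; apply: ge_inf => //; exists 0; exact: rS_lb. Qed.

Lemma rho_E g : E (zspan (Mg g)) -> rho g = 0.
Proof.
move=> Eg; apply/eqP; rewrite eq_le rho_ge0 andbT; apply: rho_le; right; exists 1%g; rewrite ?mulg1//.
by rewrite dst_xx.
Qed.

Lemma rho_gt0 g : ~ E (zspan (Mg g)) -> 0 < rho g.
Proof.
move=> nE; rewrite lt_neqAle rho_ge0 andbT; apply/negP => /eqP r0; apply: nE.
apply: closed_Mg => // e e0; pose c := nm (g : gs) + 1.
have c0 : 0 < c by rewrite ltr_wpDl// nm_ge0.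
have d0 : 0 < Num.min 1 (e / c) by rewrite lt_min ltr01 divr_gt0.
have [x hx] := inf_adherent d0 (rS_has_inf g); rewrite -/(rho g) -r0 add0r lt_min => /andP[x1 xe].
case: hx => [x1'|[h Eh xh]]; first by move: x1; rewrite x1' ltxx.
exists (g * h)%g => //; have := dstMl g h 1%g; rewrite mulg1 => /le_lt_trans; apply.
move: xe; rewrite xh ltr_pdivlMr// mulrC; apply: le_lt_trans.
by apply: ler_wpM2r; [exact: dst_ge0|rewrite lerDl].
Qed.

Lemma rho_lip (g g' : G) : rho g' <= rho g + dst (g'^-1 * g : gs)%g 1%g * (nm (1%g : gs) + 1).
Proof.
rewrite -lerBlDr; apply: lb_le_inf; first by exists 1; left.
move=> x hx; rewrite lerBlDr; have [x1|x1] := leP 1 x.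
  apply: le_trans (rho_le (or_introl erefl)) _; apply: le_trans x1 _; rewrite lerDl.
  by rewrite mulr_ge0 ?dst_ge0// addr_ge0// nm_ge0.
case: hx => [xE|[h Eh xh]]; first by rewrite xE ltxx in x1.
apply: le_trans (@rho_le g' (dst (g'^-1 * g * h : gs)%g 1%g) _) _.
  by right; exists (g'^-1 * g * h)%g; [rewrite !mulgA mulgV mul1g; exact: Eh|].
apply: le_trans (dst_tri h _ _) _; rewrite -xh addrC lerD2l.
have := dstMr h (g'^-1 * g)%g 1%g; rewrite mul1g => /le_trans; apply.
apply: ler_wpM2l; first exact: dst_ge0.
by apply: le_trans (nm_lip h 1%g) _; rewrite lerD2l -xh ltW.
Qed.

Lemma rho_ext (g g' : G) : (forall h, zspan (Mg (g * h)%g) = zspan (Mg (g' * h)%g)) -> rho g = rho g'.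
Proof.
move=> eg; rewrite /rho; congr inf; apply/seteqP; split=> x [->|[a Ea ->]]; try by left.
  by right; exists a; [rewrite -eg; exact: Ea|].
by right; exists a; [rewrite eg; exact: Ea|].
Qed.

Lemma nice_rho : nice rho.
Proof.
split.
  split=> [y g|h g Hh]; apply: rho_ext => a; first by rewrite -mulgA zMg_ub.
  by rewrite -mulgA (zMg_GamH _ Hh).
apply: lcI => r e e0; have [B Bp hB] := @nmV_bound R n r.
pose c := nm (1%g : gs) + 1; have c0 : 0 < c by rewrite ltr_wpDl// nm_ge0.
have Bc : 0 < B * c by rewrite mulr_gt0.
have le1 (x y : gs) : nm y <= r -> rho y - rho x <= dst x y * (B * c).
  move=> yr; rewrite lerBlDl; apply: le_trans (rho_lip x y) _; rewrite lerD2l mulrA.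
  apply: ler_wpM2r; first exact: ltW.
  have := dstMl (y^-1)%g x y; rewrite mulVg => /le_trans; apply.
  by rewrite mulrC; apply: ler_wpM2l; [exact: dst_ge0|exact: hB].
exists (e / (B * c)); first by rewrite divr_gt0.
move=> x y xr yr; rewrite ltr_pdivlMr// => h; rewrite /dst/=; apply: le_lt_trans h.
rewrite ler_norml; apply/andP; split; first by rewrite lerNl opprB; exact: (le1 x y yr).
rewrite dst_sym; exact: (le1 y x xr).
Qed.

(** Continuous functions decreasing in l to the indicator of the closed set E. *)
Definition Fl (l : nat) (g : G) : R := Num.max 0 (1 - l%:R * rho g).

Lemma nice_Fl l : nice (Fl l).
Proof.
apply: nice_max; first exact: nice_cst.
by apply: niceB; [exact: nice_cst|apply: niceM; [exact: nice_cst|exact: nice_rho]].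
Qed.

Lemma Fl_ge0 l g : 0 <= Fl l g. Proof. by rewrite le_max lexx. Qed.

Lemma Fl_le1 l g : Fl l g <= 1.
Proof. by rewrite ge_max ler01 gerBl mulr_ge0 ?rho_ge0. Qed.

Lemma Fl_E l g : E (zspan (Mg g)) -> Fl l g = 1.
Proof. by move=> /rho_E h; rewrite /Fl h mulr0 subr0 (max_idPr ler01). Qed.

Lemma Fl_neq0 l g : Fl l g != 0 -> l%:R * rho g <= 1.
Proof.
apply: contraNT; rewrite -ltNge => h; apply/eqP/max_idPl; rewrite subr_le0 ltW//.
Qed.

End Distance.
End LatticeContinuity.

Lemma GrQ_many_gen (R : realType) (m k : nat) : (0 < m)%N -> (0 < k)%N ->
  exists2 C : R, 0 < C & forall N : nat, (0 < N)%N -> exists s : seq (set 'rV[R]_(m + k)),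
  [/\ uniq s, (forall L, L \in s -> @GrQ R m (m + k) L /\ covol m L <= C * N%:R) & (N ^ (m + k) <= size s)%N].
Proof.
case: m k => [//|m'] [//|k'] _ _.
have := GrQ_many R m' k'; rewrite addn1 add1n; exact.
Qed.

Lemma frac_cancel (R : fieldType) (c x y : R) : c != 0 -> c * x / (c * y) = x / y.
Proof. by move=> c0; rewrite invfM mulrACA divff// mul1r. Qed.

(** * Counting rational points *)

Section Counting.
Variables (R : realType) (m k : nat).
Local Notation n := (m + k)%N.
Local Notation gs := (slspace R n).
Local Notation G := (slT R n).
Local Notation T := (Pmeas R m k).
Local Notation Pset := (@Pset R m k).
Local Notation GrQ := (@GrQ R m n).
Implicit Types F f : G -> R.
Hypotheses (hm : (0 < m)%N) (hk : (0 < k)%N).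

Lemma n_gt0 : (0 < n)%N. Proof. by rewrite addn_gt0 hm. Qed.

Lemma covol_sct L : GrQ L -> covol m L = cov (sct L : G).
Proof. by move=> hL; have [_ E] := @sctP R m k hk L hL; rewrite {1}E covol_zspan// Ag_free. Qed.

Lemma height_le L (t c : R) : 0 < t -> 0 <= c -> GrQ L ->
  (height m L <= (c * t) ^+ n) = (cov2 (xt t L : G) <= c ^+ 2).
Proof.
move=> t0 c0 hL; rewrite /height covol_sct// -cov_sqr /xt cov_Dg//.
have g0 : 0 < cov (sct L : G) by exact: cov_gt0.
rewrite ler_pXn2r ?n_gt0 ?nnegrE ?mulr_ge0 ?(ltW t0) ?(ltW g0)//.
by rewrite ler_pXn2r// ?nnegrE ?mulr_ge0 ?invr_ge0 ?(ltW t0) ?(ltW g0)// ler_pdivrMl// mulrC.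
Qed.

Lemma height_gt0 L : GrQ L -> 0 < height m L.
Proof. by move=> hL; rewrite /height covol_sct// exprn_gt0// cov_gt0. Qed.

Lemma uT_xt L (t : R) : 0 < t -> GrQ L -> @uT R m k L = zspan (Mg (xt t L : G)).
Proof.
move=> t0 hL; have [Gs E] := @sctP R m k hk L hL.
by rewrite {1}E (uT_Mg hm hk Gs) /xt (Mg_Dg hm hk _ t0).
Qed.

Variable mu : {measure set T -> \bar R}.
Hypotheses (mu_inv : P_invariant mu) (mu_fin : (mu (@Pball R m k) < +oo)%E)
  (mu_pos : (0 < mu (@Pball R m k))%E).
Local Notation Vol := (Vol mu).
Local Notation IB := (IB mu).
Let bfin C : (mu (Bc C) < +oo)%E := mu_Bc_fin mu_inv mu_fin mu_pos hm hk C.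

Lemma sum_DS (S : set (set 'rV[R]_n)) (h : set 'rV[R]_n -> R) F (c t : R) : 0 < t ->
  (forall L, S L <-> GrQ L /\ cov2 (xt t L : G) <= c) -> (forall L, S L -> h L = F (xt t L)) ->
  \sum_(L \in S) h L = t ^+ n * DS t (fun g => ib c g * F g).
Proof.
move=> t0 hS hF; rewrite /DS /Dsum mulrA -exprMn divff ?gt_eqF// expr1n mul1r.
have SE : S = [set L | GrQ L /\ cov2 (xt t L : G) <= c] by apply/seteqP; split=> L /hS.
have fS : finite_set S by rewrite SE; exact: (ball_finite hm hk mu_inv mu_fin mu_pos).
rewrite (@fsumE _ _ S S)// (@fsumE _ _ GrQ S)//.
- rewrite [LHS]big_seq [RHS]big_seq; apply: eq_bigr => L; rewrite in_fset_set// => /set_mem SL.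
  have [_ cL] := (hS L).1 SL.
  by rewrite (hF L SL) /ib cL mul1r.
- by move=> L /hS[].
move=> L hL; rewrite /ib; case: (leP (cov2 _) c) => cL; first by move=> _; apply/hS.
by rewrite mul0r eqxx.
Qed.

(** With N the integer part of t/C, hence N >= t/(2C) when t >= C, [GrQ_many_gen] supplies N^n
    points of height at most t^n. *)
Lemma DS_ball_ge : exists2 c : R, 0 < c & exists2 T0 : R, 1 <= T0 & forall t, T0 <= t ->
  c <= DS t (fun g : G => ib 1 g * 1).
Proof.
have [C C0 hC] := @GrQ_many_gen R m k hm hk.
exists ((2 * C)^-1 ^+ n); first by rewrite exprn_gt0// invr_gt0 mulr_gt0.
exists (Num.max 1 C) => [|t]; first by rewrite le_max lexx.
rewrite ge_max => /andP[t1 tC]; have t0 := lt_le_trans ltr01 t1.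
have tC0 : 0 <= t / C by rewrite divr_ge0 ?ltW.
pose N := Num.truncn (t / C).
have /andP[N1 N2] : N%:R <= t / C < N.+1%:R by exact: truncn_itv.
have N0 : (0 < N)%N by rewrite -ltnS -(ltr_nat R); apply: le_lt_trans N2; rewrite ler_pdivlMr ?mul1r.
have [s [us hs Ns]] := hC N N0.
pose B : {fset set 'rV[R]_n} := [fset L in s]%fset.
have BG : [set` B] `<=` GrQ by move=> L /=; rewrite in_fset => /hs[].
have f1 : fsupp GrQ (fun L => ib 1 (xt t L : G) * 1).
  exact: (ib_fsupp hm hk mu_inv mu_fin mu_pos 1 (fun=> 1) t0).
have := @fsum_ge_fset R _ GrQ _ B f1 _ BG.
rewrite (eq_big_seq (fun _ => 1)); last first.
  move=> L; rewrite in_fset => /hs[hL cL]; rewrite /ib.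
  have := height_le t0 ler01 hL; rewrite expr1n mul1r => <-.
  suff -> : height m L <= t ^+ n by rewrite mulr1.
  rewrite /height ler_pXn2r ?n_gt0 ?nnegrE ?(ltW t0)//; last by rewrite covol_sct// ltW// cov_gt0.
  by apply: le_trans cL _; rewrite mulrC -ler_pdivlMr.
rewrite big_const_seq count_predT iter_addr_0 => /(_ _) h1.
have {}h1 : (size s)%:R <= \sum_(L \in GrQ) ib 1 (xt t L : G) * 1.
  have -> : size s = #|` B| by rewrite card_fseq undup_id.
  by apply: h1 => L _; rewrite mulr1 ib_ge0.
rewrite /DS /Dsum; apply: (@le_trans _ _ (t^-1 ^+ n * N%:R ^+ n)); last first.
  apply: ler_wpM2l; first exact/ltW/tn_gt0.
  by apply: le_trans h1; rewrite -natrX ler_nat.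
rewrite -exprMn; apply: lerXn2r; rewrite ?nnegrE.
- by rewrite invr_ge0 mulr_ge0 ?ltW.
- by rewrite mulr_ge0 ?invr_ge0// ltW.
rewrite ler_pdivlMl// ler_pdivrMr ?mulr_gt0//.
have : t < C * N.+1%:R by rewrite mulrC -ltr_pdivrMr.
move=> /ltW/le_trans; apply; rewrite mulrC mulrCA mulrA; apply: ler_wpM2r; first exact: ltW.
by rewrite -natrM ler_nat mulnC muln2 -addnn -addn1 leq_add2l.
Qed.

Lemma IB_cst (C : R) : IB C (fun=> 1) = Vol C.
Proof.
rewrite /IB /Rintegral /Vol; congr fine.
have -> : (fun p : T => (dn (fun=> 1) p)%:E) = cst 1%:E by [].
by rewrite integral_cst ?mul1e//; exact: meas_Bc.
Qed.

(** The unknown factor a cancels: the numerator of x/y - X/V is (x - aX) V - X (y - aV). *)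
Lemma ratio_bound (x y a X V c h : R) : `|x - a * X| <= h -> `|y - a * V| <= h -> 0 < c -> c <= y -> 0 < V ->
  `|x / y - X / V| <= h * (V + `|X|) / (c * V).
Proof.
move=> h1 h2 c0 cy V0; have y0 := lt_le_trans c0 cy.
have -> : x / y - X / V = ((x - a * X) * V - X * (y - a * V)) / (y * V).
  by field; rewrite !gt_eqF.
rewrite normrM normfV (gtr0_norm (mulr_gt0 y0 V0)).
have hh : 0 <= h by exact: le_trans (normr_ge0 _) h1.
apply: ler_pM => //; first by rewrite invr_ge0 mulr_ge0 ?ltW.
  apply: le_trans (ler_normB _ _) _; rewrite !normrM (gtr0_norm V0) mulrDr.
  by apply: lerD; [apply: ler_wpM2r => //; exact: ltW|rewrite [leLHS]mulrC; apply: ler_wpM2r].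
by rewrite lef_pV2 ?posrE ?mulr_gt0//; apply: ler_wpM2r => //; exact: ltW.
Qed.

Lemma DS_ratio F (M a e : R) : 0 < a -> 0 < e -> nice F -> (forall g, `|F g| <= M) ->
  exists2 T0 : R, 1 <= T0 & forall t, T0 <= t -> 0 < DS t (fun g : G => ib 1 g * 1) /\
  `|DS t (fun g => ib (a ^+ 2) g * F g) / DS t (fun g : G => ib 1 g * 1) - IB (a ^+ 2) F / Vol 1| <= e.
Proof.
move=> a0 e0 nF FM; have V0 := Vol1_gt0 mu_fin mu_pos.
have [c c0 [T0 T01 hT0]] := DS_ball_ge.
set X := IB (a ^+ 2) F; pose h := e * (c * Vol 1) / (Vol 1 + `|X|).
have W0 : 0 < Vol 1 + `|X| by rewrite ltr_pwDl.
have h0 : 0 < h by rewrite divr_gt0// !mulr_gt0.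
have [T1 T11 hT1] := ball_asym hm hk mu_inv mu_fin mu_pos a0 h0 nF FM.
have n1 : forall g : G, `|(1 : R)| <= 1 by move=> _; rewrite normr1.
have [T2 T21 hT2] := ball_asym hm hk mu_inv mu_fin mu_pos ltr01 h0 (nice_cst m k 1) n1.
exists (Num.max T0 (Num.max T1 T2)) => [|t]; first by rewrite le_max T01.
rewrite !ge_max => /and3P[/hT0 h1 /hT1 h2 /hT2]; rewrite expr1n IB_cst => h3.
split; first exact: lt_le_trans c0 h1.
apply: le_trans (ratio_bound h2 h3 c0 h1 V0) _.
by rewrite /h divfK ?gt_eqF// mulfK// gt_eqF// mulr_gt0.
Qed.

Lemma rootB (T0 B : R) : 1 <= T0 -> T0 ^+ n < B ->
  [/\ T0 <= B `^ n%:R^-1, 0 < B `^ n%:R^-1 & (B `^ n%:R^-1) ^+ n = B].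
Proof.
move=> T1 TB; have T00 : 0 < T0 by exact: lt_le_trans T1.
have B0 : 0 < B by apply: lt_trans TB; rewrite exprn_gt0.
have E : (B `^ n%:R^-1) ^+ n = B by rewrite powR_root ?n_gt0// ltW.
have p0 : 0 < B `^ n%:R^-1 by exact: powR_gt0.
split => //; rewrite -(ler_pXn2r n_gt0) ?nnegrE ?(ltW T00) ?(ltW p0)// E ltW//.
Qed.

Lemma Ncount_DS (t : R) : 0 < t -> @Ncount R m k (t ^+ n) = t ^+ n * DS t (fun g : G => ib 1 g * 1).
Proof.
move=> t0; apply: (sum_DS t0) => [L|//].
have e : GrQ L -> (height m L <= t ^+ n) = (cov2 (xt t L : G) <= 1).
  by move=> hL; have := height_le t0 ler01 hL; rewrite mul1r expr1n.
by split=> -[hL h]; split => //; move: h; rewrite e.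
Qed.

Lemma nu_int_IB (f : set 'rV[R]_(n * n) -> R) : nu_int mu f = IB 1 (Ff f) / Vol 1.
Proof.
rewrite /nu_int -Bc1 /IB /Rintegral; congr (fine _ / _).
apply: eq_integral => p /set_mem[hp _]; congr EFin.
by rewrite /dn /Ff -Phi_pt rep_pt.
Qed.

Lemma Ff_bd (f : set 'rV[R]_(n * n) -> R) : UG_bcont f -> exists M : R, forall g : G, `|Ff f g| <= M.
Proof. by move=> [[C hC] _]; exists C => g; apply: hC; exact: (Mg_UG hm hk). Qed.

Theorem nuB_int_cvg (f : set 'rV[R]_(n * n) -> R) (M : R) : nice (Ff f : G -> R) -> (forall g : G, `|Ff f g| <= M) ->
  @nuB_int R m k f B @[B --> +oo] --> nu_int mu f.
Proof.
move=> nf hM; apply/cvgrPdist_le => /= e e0.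
have [T0 T01 hT0] := DS_ratio ltr01 e0 nf hM.
exists (T0 ^+ n); split; first exact: num_real.
move=> B /(rootB T01)[]; set t := B `^ _ => tT t0 <-.
have [y0] := hT0 t tT; rewrite expr1n distrC nu_int_IB; congr (`|_ - _| <= _).
rewrite /nuB_int (Ncount_DS t0).
have -> : \sum_(L \in @GrB R m k (t ^+ n)) f (@uT R m k L) = t ^+ n * DS t (fun g => ib 1 g * Ff f g).
  apply: (sum_DS t0) => [L|L [hL _]]; last by rewrite (uT_xt t0 hL).
  have e1 : GrQ L -> (height m L <= t ^+ n) = (cov2 (xt t L : G) <= 1).
    by move=> hL; have := height_le t0 ler01 hL; rewrite mul1r expr1n.
  by split=> -[hL h]; split => //; move: h; rewrite e1.
by apply/esym; apply: frac_cancel; rewrite expf_neq0// gt_eqF.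
Qed.

Lemma Ncount_gt0 : exists2 T0 : R, 1 <= T0 & forall B, T0 < B -> 0 < @Ncount R m k B.
Proof.
have [c c0 [T0 T01 hT0]] := DS_ball_ge.
exists (T0 ^+ n) => [|B]; first by rewrite exprn_ege1.
move=> /(rootB T01)[]; set t := B `^ _ => tT t0 <-.
rewrite (Ncount_DS t0) mulr_gt0 ?exprn_gt0//; exact: lt_le_trans c0 (hT0 t tT).
Qed.

(** Both counts are orbit sums at the same t, over balls of radius c^(1/n) and 1, so the limit is
    the quotient of their volumes. *)
Lemma Ncount_scale (c : R) : 0 < c -> (@Ncount R m k (c * B) / @Ncount R m k B) @[B --> +oo] --> c.
Proof.
move=> c0; apply/cvgrPdist_le => /= e e0.
pose s := c `^ n%:R^-1; have s0 : 0 < s by exact: powR_gt0.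
have sn : s ^+ n = c by rewrite /s powR_root ?n_gt0// ltW.
have n1 : forall g : G, `|(1 : R)| <= 1 by move=> _; rewrite normr1.
have [T0 T01 hT0] := DS_ratio s0 e0 (nice_cst m k 1) n1.
exists (T0 ^+ n); split; first exact: num_real.
move=> B /(rootB T01)[]; set t := B `^ _ => tT t0 <-.
have [y0] := hT0 t tT; rewrite IB_cst (Vol_sqr mu_inv mu_fin mu_pos hm hk s0) sn.
rewrite mulfK ?gt_eqF ?(Vol1_gt0 mu_fin mu_pos)// distrC; congr (`|_ - _| <= _).
rewrite (Ncount_DS t0) -{1}sn -exprMn.
have -> : @Ncount R m k ((s * t) ^+ n) = t ^+ n * DS t (fun g : G => ib (s ^+ 2) g * 1).
  apply: (sum_DS t0) => [L|//].
  by split=> -[hL h]; split => //; move: h; rewrite (height_le t0 (ltW s0) hL).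
by apply/esym; apply: frac_cancel; rewrite expf_neq0// gt_eqF.
Qed.

End Counting.

(** * Closed and Borel sets *)

Section LatticeTopology.
Variables (R : realType) (m k : nat).
Local Notation n := (m + k)%N.
Local Notation UG := (@UG R m k).
Local Notation UY := (@UY R m k).
Local Notation LS := (set (set 'rV[R]_(n * n))).

Lemma UG_zspan M : UY M -> UG (zspan M). Proof. by move=> hM; exists M. Qed.

Lemma UG_closedC (A : LS) : @UG_open R m k A -> @UG_closed R m k (UG `\` A).
Proof.
move=> [_ [U [oU EU]]]; split; first by move=> x [].
exists (~` U); split; first exact: open_closedC.
apply/seteqP; split=> M /= [h1 hM]; split => //.
  by move=> UM; apply: h1.2; have : (U `&` UY) M by []; rewrite -EU => -[].
split; first exact: UG_zspan.
by move=> AM; apply: h1; have : (@zspan R (m * k) (n * n) @^-1` A `&` UY) M by []; rewrite EU => -[].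
Qed.

Lemma UG_openC (A : LS) : @UG_closed R m k A -> @UG_open R m k (UG `\` A).
Proof.
move=> [_ [U [oU EU]]]; split; first by move=> x [].
exists (~` U); split; first exact: closed_openC.
apply/seteqP; split=> M /= [h1 hM]; split => //.
  by move=> UM; apply: h1.2; have : (U `&` UY) M by []; rewrite -EU => -[].
split; first exact: UG_zspan.
by move=> AM; apply: h1; have : (@zspan R (m * k) (n * n) @^-1` A `&` UY) M by []; rewrite EU => -[].
Qed.

Lemma UG_closedT : @UG_closed R m k UG.
Proof.
split => //; exists setT; split; first exact: closedT.
by apply/seteqP; split=> M /= [_ hM]; split => //; exact: UG_zspan.
Qed.

Lemma sub_closure (A : LS) : A `<=` UG_closure A.
Proof. by move=> x Ax C cC sAC; exact: sAC. Qed.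

Lemma closure_UG (A : LS) : A `<=` UG -> UG_closure A `<=` UG.
Proof. by move=> AU x; apply; [exact: UG_closedT|exact: AU]. Qed.

(** Closedness is witnessed by closed sets of matrices; the closure is witnessed by the intersection
    of all witnesses of closed sets containing A. *)
Lemma UG_closed_closure (A : LS) : A `<=` UG -> @UG_closed R m k (UG_closure A).
Proof.
move=> AU; split; first exact: closure_UG.
pose D := [set C : set 'M[R]_(m * k, n * n) | closed C /\ exists E : LS,
  [/\ UG_closed E, A `<=` E & (@zspan R (m * k) (n * n)) @^-1` E `&` UY = C `&` UY]].
exists (\bigcap_(C in D) C); split; first by apply: closed_bigI => C [].
apply/seteqP; split=> M /= [hM hY]; split => //.
  move=> C [cC [E [cE AE EE]]].
  have : ((@zspan R (m * k) (n * n)) @^-1` E `&` UY) M by split => //; exact: hM.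
  by rewrite EE => -[].
move=> E cE AE; have [_ [C [cC EC]]] := cE.
have hC : C M by apply: hM; split => //; exists E.
by have : (C `&` UY) M by []; rewrite -EC => -[].
Qed.

Lemma boundaryE (A : LS) : A `<=` UG -> UG_boundary A = UG_closure A `&` UG_closure (UG `\` A).
Proof.
move=> AU; apply/seteqP; split=> x [hx hI]; split => //.
  move=> C cC UC; apply: contrapT => nC; apply: hI; exists (UG `\` C); split; first exact: UG_openC.
  have xU : UG x by exact: closure_UG hx.
  split=> [y [hy nCy]|]; last by split.
  by apply: contrapT => nA; apply: nCy; apply: UC.
move=> [U [oU [UA Ux]]].
have [] : (UG `\` U) x by apply: hI; [exact: UG_closedC|move=> y [hy nA]; split => // /UA].
by [].
Qed.

End LatticeTopology.

(** * Closed sets and continuity sets *)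

Section ClosedSets.
Variables (R : realType) (m k : nat).
Local Notation n := (m + k)%N.
Local Notation gs := (slspace R n).
Local Notation G := (slT R n).
Local Notation T := (Pmeas R m k).
Local Notation Pset := (@Pset R m k).
Local Notation GrQ := (@GrQ R m n).
Local Notation UG := (@UG R m k).
Local Notation LS := (set (set 'rV[R]_(n * n))).
Hypotheses (hm : (0 < m)%N) (hk : (0 < k)%N).
Variable mu : {measure set T -> \bar R}.
Hypotheses (mu_inv : P_invariant mu) (mu_fin : (mu (@Pball R m k) < +oo)%E)
  (mu_pos : (0 < mu (@Pball R m k))%E).
Local Notation Vol := (Vol mu).
Local Notation IB := (IB mu).
Local Notation nu := (nu mu).
Local Notation nuB := (@nuB R m k).
Let bfin C : (mu (Bc C) < +oo)%E := mu_Bc_fin mu_inv mu_fin mu_pos hm hk C.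
Implicit Types E : LS.

Definition PE E : set T := [set p | @Pball R m k p /\ E (Phi (Pnorm p))].

Lemma Phi_rep p : Pset p -> Phi (Pnorm p) = zspan (Mg (rep p)).
Proof. by move=> hp; rewrite -Phi_pt rep_pt. Qed.

Lemma PE_Bc E p : PE E p <-> Bc 1 p /\ E (zspan (Mg (rep p))).
Proof.
rewrite Bc1; split=> -[hp hE]; split => //.
  by rewrite -Phi_rep//; case: hp.
by rewrite Phi_rep//; case: hp.
Qed.

Section Approximation.
Variable E : LS.
Hypothesis cE : UG_closed E.

(** Measurable sets that carry [Fl E l] within the unit ball and decrease to [PE E]. *)
Definition Dl (l : nat) : set T := Bc 1 `&` [set p | Pset p /\ dn (fun g => l%:R * rho E g) p <= 1].

Lemma meas_Dl l : measurable (Dl l).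
Proof.
have [h1 h2] : nice (fun g : G => l%:R * rho E g) by apply: niceM; [exact: nice_cst|exact: nice_rho].
by apply: measurableI; [exact: meas_Bc|exact: meas_le].
Qed.

Lemma Dl_cap : \bigcap_l Dl l = PE E.
Proof.
apply/seteqP; split=> p.
  move=> h; apply/PE_Bc; have [hB _] := h 0%N I; split => //.
  apply: contrapT => nE; have r0 := rho_gt0 hm hk cE nE.
  have [_ [_]] := h (Num.bound (rho E (rep p))^-1) I; rewrite /dn leNgt => /negP; apply.
  rewrite -ltr_pdivrMr// div1r; apply: archi_boundP; rewrite invr_ge0 ltW//.
move=> /PE_Bc[hB hE] l _; split => //; split; first by case: hB.
by rewrite /dn rho_E// mulr0 ler01.
Qed.

Lemma meas_PE_closed : measurable (PE E).
Proof. by rewrite -Dl_cap; apply: bigcap_measurableType => l _; exact: meas_Dl. Qed.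

Lemma Dl_mono : {homo Dl : i j / (i <= j)%N >-> (j <= i)%O}.
Proof.
move=> i j ij; rewrite subsetEset => p [hB [hp h]]; split => //; split => //; apply: le_trans h.
by rewrite /dn ler_wpM2r ?rho_ge0// ler_nat.
Qed.

Lemma fin_sub (A : set T) : measurable A -> A `<=` Bc 1 -> (mu A < +oo)%E.
Proof.
move=> mA sA; apply: le_lt_trans (bfin 1).
exact: (le_measure mu (mem_set mA) (mem_set (meas_Bc 1)) sA).
Qed.

Lemma PE_sub A : PE A `<=` Bc 1. Proof. by move=> p /PE_Bc[]. Qed.

Lemma Dl_tail (e : R) : 0 < e -> exists l, fine (mu (Dl l)) <= fine (mu (PE E)) + e.
Proof.
move=> e0; have f0 l : (mu (Dl l) < +oo)%E by apply: fin_sub; [exact: meas_Dl|exact: subIsetl].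
have mI : measurable (\bigcap_l Dl l) by rewrite Dl_cap; exact: meas_PE_closed.
have c := nonincreasing_cvg_mu (f0 0%N) meas_Dl mI Dl_mono.
have fP : (mu (PE E) < +oo)%E by apply: fin_sub; [exact: meas_PE_closed|exact: PE_sub].
have c' : fine (mu (Dl l)) @[l --> \oo] --> fine (mu (PE E)).
  by apply: fine_cvg; rewrite fineK ?ge0_fin_numE// -Dl_cap.
move/cvgrPdist_le: c' => /(_ e e0)[l _ hl]; exists l.
have := hl l (leqnn l); rewrite /= distrC => /(le_trans (ler_norm _)); rewrite lerBlDl//.
Qed.

Lemma IB_Fl l : IB 1 (Fl E l) <= fine (mu (Dl l)).
Proof.
rewrite -[leRHS]mul1r.
have sD : Dl l `<=` Bc 1 by exact: subIsetl.
rewrite -(Rint_indic hm hk mu_inv mu_fin mu_pos (meas_Dl l) sD ler01); apply: le_Rintegral.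
- exact: meas_Bc.
- apply: (IB_intg hm hk mu_inv mu_fin mu_pos 1 (nice_Fl E l) (M := 1)) => g.
  by rewrite ger0_norm ?Fl_ge0//; exact: Fl_le1.
- apply: (bd_intg hm hk mu_inv mu_fin mu_pos (M := 1)).
    by apply: measurable_funM => //; apply: measurable_indic; exact: meas_Dl.
  by move=> p; rewrite indicE mul1r; case: (_ \in _); rewrite ?normr1 ?normr0.
move=> p hp; rewrite mul1r indicE; have [_|/negP nD] := boolP (p \in Dl l); first exact: Fl_le1.
have [->|h] := eqVneq (dn (Fl E l) p) 0; first exact: lexx.
exfalso; apply: nD; apply/mem_set; split => //; split; first by case: hp.
exact: Fl_neq0.
Qed.

End Approximation.

Lemma Vol_gt0 : 0 < Vol 1. Proof. exact: Vol1_gt0. Qed.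

Lemma nuE E : nu E = fine (mu (PE E)) / Vol 1.
Proof. by rewrite /nu /Vol Bc1. Qed.

Definition iE E (g : G) : R := (`[< E (zspan (Mg g)) >])%:R.

Lemma nuB_DS E (t : R) : 0 < t ->
  nuB E (t ^+ n) = DS t (fun g => ib 1 g * iE E g) / DS t (fun g : G => ib 1 g * 1).
Proof.
move=> t0; rewrite /nuB (Ncount_DS hm hk mu_inv mu_fin mu_pos t0).
have e1 L : GrQ L -> (height m L <= t ^+ n) = (cov2 (xt t L : G) <= 1).
  by move=> hL; have := height_le hm hk t0 ler01 hL; rewrite mul1r expr1n.
have GE : @GrB R m k (t ^+ n) = [set L | GrQ L /\ cov2 (xt t L : G) <= 1].
  by apply/seteqP; split=> L [hL h]; split => //; move: h; rewrite e1.
have fG : finite_set (@GrB R m k (t ^+ n)).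
  by rewrite GE; exact: (ball_finite hm hk mu_inv mu_fin mu_pos).
have -> : \sum_(L \in @GrB R m k (t ^+ n) `&` [set L | E (@uT R m k L)]) (1 : R) =
          \sum_(L \in @GrB R m k (t ^+ n)) ((`[< E (@uT R m k L) >])%:R : R).
  have fI : finite_set (@GrB R m k (t ^+ n) `&` [set L | E (@uT R m k L)]).
    by apply: sub_finite_set fG => L [].
  rewrite (fsumE fI (@subset_refl _ _)) => [|//].
  rewrite (fsumE fI (@subIsetl _ _ _)) => [|L GL].
    rewrite [LHS]big_seq [RHS]big_seq; apply: eq_bigr => L; rewrite in_fset_set// => /set_mem[_ EL].
    by rewrite asboolT.
  by case: asboolP => [EL _|_]; [split|rewrite eqxx].
rewrite (@sum_DS R m k hm hk mu mu_inv mu_fin mu_pos _ _ (iE E) 1 t t0).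
- by apply: frac_cancel; rewrite expf_neq0// gt_eqF.
- by move=> L; rewrite GE.
by move=> L [hL _]; rewrite /iE (uT_xt hm hk t0 hL).
Qed.

(** The indicator of E is at most [Fl E l]; half of e pays for its integral exceeding nu E, the
    other half for the convergence of its averages. *)
Theorem nuB_closed E : UG_closed E -> forall e : R, 0 < e -> \forall B \near +oo, nuB E B <= nu E + e.
Proof.
move=> cE e e0; have V0 := Vol_gt0.
have e2 : 0 < e / 2 by rewrite divr_gt0.
have [l hl] := Dl_tail cE (mulr_gt0 e2 V0).
have F1 : forall g : G, `|Fl E l g| <= 1 by move=> g; rewrite ger0_norm ?Fl_ge0//; exact: Fl_le1.
have [T0 T01 hT0] := DS_ratio hm hk mu_inv mu_fin mu_pos ltr01 e2 (nice_Fl E l) F1.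
exists (T0 ^+ n); split; first exact: num_real.
move=> B /(rootB hm T01)[]; set t := B `^ _ => tT t0 <-.
have [y0] := hT0 t tT; rewrite expr1n => /(le_trans (ler_norm _)); rewrite lerBlDr => h.
rewrite (nuB_DS E t0); apply: (@le_trans _ _ (DS t (fun g => ib 1 g * Fl E l g) / DS t (fun g : G => ib 1 g * 1))).
  apply: ler_wpM2r; first by rewrite invr_ge0 ltW.
  apply: (DS_le t0).
  - exact: (ib_fsupp hm hk mu_inv mu_fin mu_pos 1 (iE E) t0).
  - exact: (ib_fsupp hm hk mu_inv mu_fin mu_pos 1 (Fl E l) t0).
  move=> L _; apply: ler_wpM2l; first exact: ib_ge0.
  by rewrite /iE; case: asboolP => [/Fl_E ->|_]; rewrite ?lexx ?Fl_ge0.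
apply: le_trans h _; rewrite nuE addrC [leRHS](_ : _ = fine (mu (PE E)) / Vol 1 + e / 2 + e / 2); last first.
  by rewrite -addrA -splitr.
rewrite lerD2r ler_pdivrMr// mulrDl divfK ?gt_eqF//.
exact: le_trans (IB_Fl E l) hl.
Qed.

(** Sets with measurable preimage in the ball form a sigma-algebra, which contains the open sets as
    complements of closed ones. *)
Lemma borel_meas E : @UG_borel R m k E -> E `<=` UG /\ measurable (PE E).
Proof.
apply: (@smallest_sub _ _ _ [set E | E `<=` UG /\ measurable (PE E)]); last first.
  move=> U oU; split; first by case: oU.
  have := measurableD (@meas_Bc R m k 1) (meas_PE_closed (UG_closedC oU)); congr measurable.
  apply/seteqP; split=> p.
    move=> [hB h]; apply/PE_Bc; split => //; apply: contrapT => nU; apply: h; apply/PE_Bc.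
    by split => //; split => //; exact: (Mg_UG hm hk).
  by move=> /PE_Bc[hB hU]; split => // /PE_Bc[_ []].
split.
- split; first exact: sub0set.
  by rewrite (_ : PE set0 = set0)//; apply/seteqP; split=> p // /PE_Bc[].
- move=> A [AU mA]; split; first by move=> x [].
  have := measurableD (@meas_Bc R m k 1) mA; congr measurable.
  apply/seteqP; split=> p.
    move=> [hB h]; apply/PE_Bc; split => //; split; first exact: (Mg_UG hm hk).
    by move=> hA; apply: h; apply/PE_Bc.
  by move=> /PE_Bc[hB [_ hU]]; split => // /PE_Bc[].
move=> A hA; split; first by move=> x [i _ /(hA i).1].
rewrite (_ : PE _ = \bigcup_i PE (A i)); first by apply: bigcup_measurable => i _; have [] := hA i.
apply/seteqP; split=> p; first by move=> /PE_Bc[hB [i _ hi]]; exists i => //; apply/PE_Bc.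
by move=> [i _ /PE_Bc[hB hi]]; apply/PE_Bc; split => //; exists i.
Qed.

Lemma nuB_le E E' (t : R) : 0 < t -> 0 < DS t (fun g : G => ib 1 g * 1) -> E `<=` E' ->
  nuB E (t ^+ n) <= nuB E' (t ^+ n).
Proof.
move=> t0 y0 EE; rewrite (nuB_DS E t0) (nuB_DS E' t0); apply: ler_wpM2r; first by rewrite invr_ge0 ltW.
apply: (DS_le t0).
- exact: (ib_fsupp hm hk mu_inv mu_fin mu_pos 1 (iE E) t0).
- exact: (ib_fsupp hm hk mu_inv mu_fin mu_pos 1 (iE E') t0).
move=> L _; apply: ler_wpM2l; first exact: ib_ge0.
rewrite /iE; case: asboolP => [/EE h|_]; last exact: ler0n.
by rewrite asboolT.
Qed.

Lemma nuB_compl E (t : R) : 0 < t -> 0 < DS t (fun g : G => ib 1 g * 1) ->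
  nuB E (t ^+ n) + nuB (UG `\` E) (t ^+ n) = 1.
Proof.
move=> t0 y0; rewrite (nuB_DS E t0) (nuB_DS _ t0) -mulrDl -[RHS](divff (lt0r_neq0 y0)); congr (_ / _).
rewrite -(DSD (ib_fsupp hm hk mu_inv mu_fin mu_pos 1 (iE E) t0) (ib_fsupp hm hk mu_inv mu_fin mu_pos 1 (iE (UG `\` E)) t0)).
congr (DS t _); apply/funext => g; rewrite -mulrDr; congr (_ * _); rewrite /iE.
case: asboolP => hE; first by rewrite asboolF ?addr0// => -[_].
by rewrite asboolT ?add0r//; split => //; exact: (Mg_UG hm hk).
Qed.

Theorem nuB_cvg E : @UG_borel R m k E -> nu (UG_boundary E) = 0 -> nuB E B @[B --> +oo] --> nu E.
Proof.
move=> bE; have [EU mE] := borel_meas bE; rewrite nuE => bd0; have V0 := Vol_gt0.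
set cl := UG_closure E; set cc := UG_closure (UG `\` E).
have c1 : UG_closed cl by exact: UG_closed_closure.
have c2 : UG_closed cc by apply: UG_closed_closure => x [].
have m1 := meas_PE_closed c1; have m2 := meas_PE_closed c2.
have bdE : PE (UG_boundary E) = PE cl `&` PE cc.
  rewrite boundaryE//; apply/seteqP; split=> p; first by move=> /PE_Bc[hB [h1 h2]]; split; apply/PE_Bc.
  by move=> [/PE_Bc[hB h1] /PE_Bc[_ h2]]; apply/PE_Bc; split.
have mB : measurable (PE (UG_boundary E)) by rewrite bdE; exact: measurableI.
have fin A : measurable (PE A) -> mu (PE A) = (fine (mu (PE A)))%:E.
  by move=> mA; rewrite fineK// ge0_fin_numE//; apply: fin_sub => //; exact: PE_sub.
have b0 : fine (mu (PE (UG_boundary E))) = 0.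
  by move/eqP: bd0; rewrite mulf_eq0 invr_eq0 (gt_eqF V0) orbF => /eqP.
have z : mu (PE (UG_boundary E)) = 0%E by rewrite fin// b0.
(* The closure adds only boundary points to E, a null set. *)
have w1 : fine (mu (PE cl)) <= fine (mu (PE E)).
  rewrite -lee_fin -!fin//.
  have : (mu (PE cl) <= mu (PE E `|` PE (UG_boundary E)))%E.
    apply: (le_measure mu (mem_set m1) (mem_set (measurableU _ _ mE mB))) => p /PE_Bc[hB hp].
    have [hE|nE] := pselect (E (zspan (Mg (rep p)))); first by left; apply/PE_Bc.
    right; apply/PE_Bc; split => //; split => // -[U [_ [UE hU]]]; exact: nE (UE _ hU).
  move=> /le_trans; apply; apply: le_trans (measureU2 mu mE mB) _.
  have -> : (mu (PE E) + mu (PE (UG_boundary E)))%E = mu (PE E) by rewrite z adde0.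
  exact: lexx.
(* Off the null boundary, E is disjoint from the closure of its complement. *)
have w2 : fine (mu (PE E)) + fine (mu (PE cc)) <= Vol 1.
  have mD : measurable (PE E `\` PE (UG_boundary E)) by exact: measurableD.
  have E1 : mu (PE E) = mu (PE E `\` PE (UG_boundary E)).
    apply/eqP; rewrite eq_le; apply/andP; split; last first.
      exact: (le_measure mu (mem_set mD) (mem_set mE) (@subDsetl _ _ _)).
    have : (mu (PE E) <= mu ((PE E `\` PE (UG_boundary E)) `|` PE (UG_boundary E)))%E.
      apply: (le_measure mu (mem_set mE) (mem_set (measurableU _ _ mD mB))) => p hp.
      by have [h|h] := pselect (PE (UG_boundary E) p); [right|left].
    move=> /le_trans; apply; apply: le_trans (measureU2 mu mD mB) _.
    have -> : (mu (PE E `\` PE (UG_boundary E)) + mu (PE (UG_boundary E)))%E = mu (PE E `\` PE (UG_boundary E)).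
      by rewrite z adde0.
    exact: lexx.
  rewrite -lee_fin EFinD -!fin// -(VolE mu_inv mu_fin mu_pos hm hk) E1.
  have dis : (PE E `\` PE (UG_boundary E)) `&` PE cc = set0.
    apply/seteqP; split=> p // [[/PE_Bc[hB hE] nb] /PE_Bc[_ hc]]; apply: nb.
    by rewrite bdE; split; apply/PE_Bc; split => //; exact: sub_closure.
  have := measureU mu mD m2 dis => <-.
  apply: (le_measure mu (mem_set (measurableU _ _ mD m2)) (mem_set (meas_Bc 1))).
  by move=> p [[/PE_sub]|/PE_sub].
apply/cvgrPdist_le => /= e e0.
have [c c0 [T0 T01 hT0]] := DS_ball_ge hm hk mu_inv mu_fin mu_pos.
near=> B.
have h1 : nuB cl B <= nu cl + e by near: B; exact: nuB_closed.
have h2 : nuB cc B <= nu cc + e by near: B; exact: nuB_closed.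
have : T0 ^+ n < B by near: B; apply: nbhs_pinfty_gt; exact: num_real.
move=> /(rootB hm T01)[]; move: h1 h2; set t := B `^ _ => h1 h2 tT t0 Bt.
have y0 := lt_le_trans c0 (hT0 t tT); rewrite -Bt in h1 h2 *.
rewrite !nuE in h1 h2 *; rewrite ler_distlC; apply/andP; split.
  have h3 := nuB_compl E t0 y0.
  have h4 : nuB (UG `\` E) (t ^+ n) <= nuB cc (t ^+ n) by apply: nuB_le => //; exact: sub_closure.
  have h5 : fine (mu (PE E)) / Vol 1 + fine (mu (PE cc)) / Vol 1 <= 1 by rewrite -mulrDl ler_pdivrMr// mul1r.
  rewrite lerBlDr; move: h2 h3 h4 h5.
  move: (fine _ / _) (fine _ / _) (nuB _ _) (nuB _ _) (nuB _ _) => a1 a2 a3 a4 a5; lra.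
apply: le_trans (nuB_le t0 y0 (@sub_closure R m k E)) _; apply: le_trans h1 _.
by rewrite lerD2r ler_wpM2r// invr_ge0 ltW.
Unshelve. all: by end_near. Qed.

End ClosedSets.

(** * Weighted counts *)

Section HatFunctions.
Variable R : realType.

Definition clamp (x : R) : R := Num.max 0 (Num.min 1 x).

Lemma clamp_ge0 x : 0 <= clamp x. Proof. by rewrite le_max lexx. Qed.
Lemma clamp_le1 x : clamp x <= 1. Proof. by rewrite ge_max ler01 ge_min lexx. Qed.
Lemma clamp1 x : 1 <= x -> clamp x = 1.
Proof. by move=> h; rewrite /clamp (min_idPl h) (max_idPr ler01). Qed.
Lemma clamp0 x : x <= 0 -> clamp x = 0.
Proof. by move=> h; apply/max_idPl; rewrite ge_min h orbT. Qed.
Lemma clamp_mono x y : x <= y -> clamp x <= clamp y.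
Proof. by move=> h; apply: le_max2 => //; exact: le_min2. Qed.

(** The tent function at i, written as a difference so that the sum over i telescopes. *)
Definition hat (i : nat) (x : R) : R := clamp (x - i%:R + 1) - clamp (x - i%:R).

Lemma hat_ge0 i x : 0 <= hat i x.
Proof. by rewrite subr_ge0 clamp_mono// lerDl. Qed.

Lemma hat_le1 i x : hat i x <= 1.
Proof. by rewrite lerBlDr (le_trans (clamp_le1 _))// lerDl clamp_ge0. Qed.

Lemma hat_supp i x : hat i x != 0 -> i%:R - 1 <= x <= i%:R + 1.
Proof.
move=> h; apply/andP; split; rewrite leNgt; apply: contraNN h => h; apply/eqP.
  by rewrite /hat !clamp0 ?subrr//; lra.
by rewrite /hat !clamp1 ?subrr//; lra.
Qed.

Lemma hat_sum (K : nat) x : 0 <= x <= K%:R -> \sum_(i < K.+1) hat i x = 1.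
Proof.
move=> /andP[x0 xK].
have E : forall j, \sum_(i < j) hat i x = clamp (x + 1) - clamp (x - j%:R + 1).
  elim=> [|j IH]; first by rewrite big_ord0 subr0 subrr.
  rewrite big_ord_recr /= IH /hat -natr1 opprD addrA subrK.
  by rewrite addrA subrK.
rewrite E clamp1 ?lerDr// clamp0 ?subr0// -natr1; lra.
Qed.

End HatFunctions.

Lemma cvg_sumr (R : realType) (S : Type) (F : set_system S) {FF : Filter F} (I : Type) (s : seq I)
  (f : I -> S -> R) (l : I -> R) : (forall i, f i x @[x --> F] --> l i) ->
  (\sum_(i <- s) f i x) @[x --> F] --> \sum_(i <- s) l i.
Proof.
move=> h; elim: s => [|i s IH].
  by rewrite big_nil; under eq_fun do rewrite big_nil; exact: cvg_cst.
by rewrite big_cons; under eq_fun do rewrite big_cons; exact: cvgD.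
Qed.

(** * Counts with a height bound depending on the shape *)

Section WeightedCount.
Variables (R : realType) (m k : nat).
Local Notation n := (m + k)%N.
Local Notation G := (slT R n).
Local Notation T := (Pmeas R m k).
Local Notation GrQ := (@GrQ R m n).
Local Notation GrB := (@GrB R m k).
Local Notation Ncount := (@Ncount R m k).
Local Notation uT := (@uT R m k).
Local Notation LF := (set 'rV[R]_(n * n) -> R).
Hypotheses (hm : (0 < m)%N) (hk : (0 < k)%N).
Variable mu : {measure set T -> \bar R}.
Hypotheses (mu_inv : P_invariant mu) (mu_fin : (mu (@Pball R m k) < +oo)%E)
  (mu_pos : (0 < mu (@Pball R m k))%E).
Local Notation Vol := (Vol mu).
Local Notation IB := (IB mu).
Implicit Types F f : G -> R.

Definition bnice F := nice F /\ exists M : R, forall g, `|F g| <= M.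

Lemma bnice_intg C F : bnice F -> mu.-integrable (Bc C) (EFin \o dn F).
Proof. by move=> [nF [M hM]]; exact: (IB_intg hm hk mu_inv mu_fin mu_pos C nF hM). Qed.

Lemma bnice_cst (c : R) : bnice (fun=> c).
Proof. by split; [exact: nice_cst|exists `|c|]. Qed.

Lemma bniceD F f : bnice F -> bnice f -> bnice (fun g => F g + f g).
Proof.
move=> [nF [M hM]] [nf [N hN]]; split; first exact: niceD.
by exists (M + N) => g; apply: le_trans (ler_normD _ _) _; exact: lerD.
Qed.

Lemma bniceZ (c : R) F : bnice F -> bnice (fun g => c * F g).
Proof.
move=> [nF [M hM]]; split; first by apply: niceM => //; exact: nice_cst.
by exists (`|c| * M) => g; rewrite normrM ler_wpM2l.
Qed.

Lemma IBD C F f : bnice F -> bnice f -> IB C (fun g => F g + f g) = IB C F + IB C f.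
Proof.
by move=> hF hf; rewrite /IB -(RintegralD (meas_Bc C) (bnice_intg C hF) (bnice_intg C hf)).
Qed.

Lemma IBZ C (c : R) F : bnice F -> IB C (fun g => c * F g) = c * IB C F.
Proof. by move=> hF; rewrite /IB -(RintegralZl c (meas_Bc C) (bnice_intg C hF)). Qed.

Lemma IB_le C F f : bnice F -> bnice f -> (forall g, F g <= f g) -> IB C F <= IB C f.
Proof.
move=> hF hf le; apply: (le_Rintegral (meas_Bc C) (bnice_intg C hF) (bnice_intg C hf)) => p _; exact: le.
Qed.

Lemma IB_sum C (K : nat) (a : nat -> R) (F : nat -> G -> R) : (forall i, bnice (F i)) ->
  bnice (fun g => \sum_(i < K) a i * F i g) /\
  IB C (fun g => \sum_(i < K) a i * F i g) = \sum_(i < K) a i * IB C (F i).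
Proof.
move=> hF; elim: K => [|K [IH1 IH2]].
  have E : (fun g : G => \sum_(i < 0) a i * F i g) = (fun=> 0) by apply/funext => g; rewrite big_ord0.
  rewrite E big_ord0; split; first exact: bnice_cst.
  rewrite -[RHS](mul0r (IB C (fun=> 1))) -IBZ; last exact: bnice_cst.
  by congr (IB C _); apply/funext => g; rewrite mul0r.
have E : (fun g : G => \sum_(i < K.+1) a i * F i g) = (fun g => \sum_(i < K) a i * F i g + a K * F K g).
  by apply/funext => g; rewrite big_ord_recr.
rewrite E; split; first by apply: bniceD => //; exact: bniceZ.
by rewrite IBD ?IBZ ?IH2 ?big_ord_recr//; exact: bniceZ.
Qed.

Lemma near_scale (c : R) (P : set R) : 0 < c -> (\forall B \near +oo, P B) -> \forall B \near +oo, P (c * B).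
Proof.
move=> c0 [M [_ h]]; exists (M / c); split; first exact: num_real.
by move=> B hB; apply: h; rewrite mulrC -ltr_pdivrMr.
Qed.

(** The sum up to c B is the average at c B times N(c B)/N(B). For c = 0 it is empty, as heights are
    positive. *)
Lemma sum_cvg (u : LF) (c : R) : bnice (Ff u : G -> R) -> 0 <= c ->
  ((\sum_(L \in GrB (c * B)) u (uT L)) / Ncount B) @[B --> +oo] --> c * nu_int mu u.
Proof.
move=> [nu' [M hM]]; rewrite le_eqVlt => /predU1P[<-|c0].
  rewrite mul0r; under eq_fun => B.
    have E : GrB (0 * B) = set0.
      by apply/seteqP; split=> L // [hL]; rewrite mul0r leNgt (height_gt0 hk hL).
    rewrite E fsbig_set0 mul0r; over.
  exact: cvg_cst.
have [T0 T01 hT0] := Ncount_gt0 hm hk mu_inv mu_fin mu_pos.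
have h1 : @nuB_int R m k u (c * B) @[B --> +oo] --> nu_int mu u.
  have := nuB_int_cvg hm hk mu_inv mu_fin mu_pos nu' hM => h P /h; exact: near_scale.
have h2 : (Ncount (c * B) / Ncount B * @nuB_int R m k u (c * B)) @[B --> +oo] --> c * nu_int mu u.
  exact: (cvgM (Ncount_scale hm hk mu_inv mu_fin mu_pos c0) h1).
apply: cvg_trans h2; apply: near_eq_cvg; near=> B.
have N0 : Ncount (c * B) != 0.
  rewrite gt_eqF//; near: B; apply: (@near_scale c [set x | 0 < Ncount x]) => //.
  by exists T0; split; [exact: num_real|move=> B /hT0].
rewrite /= /nuB_int [LHS]mulrC mulrA divfK//.
Unshelve. all: by end_near. Qed.

Lemma sum_seqE (S X : set (set 'rV[R]_n)) (h : set 'rV[R]_n -> R) : finite_set X -> S `<=` X ->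
  \sum_(L \in S) h L = \sum_(L <- fset_set X) (`[< S L >])%:R * h L.
Proof.
move=> fX SX; have fS : finite_set S by exact: sub_finite_set SX fX.
have -> : \sum_(L \in S) h L = \sum_(L \in X) (`[< S L >])%:R * h L.
  rewrite (fsumE fS (@subset_refl _ _)) => [|//].
  rewrite (fsumE fS SX) => [|L XL].
    rewrite [LHS]big_seq [RHS]big_seq; apply: eq_bigr => L; rewrite in_fset_set// => /set_mem SL.
    by rewrite asboolT// mul1r.
  by case: asboolP => //; rewrite mul0r eqxx.
by rewrite (fsumE fX (@subset_refl _ _)).
Qed.

Lemma GrB_finite (B : R) : finite_set (GrB B).
Proof.
pose t : R := (Num.max 1 B).
have t1 : 1 <= t by rewrite le_max lexx.
have t0 : 0 < t := lt_le_trans ltr01 t1.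
apply: sub_finite_set (ball_finite hm hk mu_inv mu_fin mu_pos 1 t0) => L [hL h]; split => //.
have := height_le hm hk t0 ler01 hL; rewrite mul1r expr1n => <-.
apply: le_trans h _; apply: (@le_trans _ _ t); first by rewrite le_max lexx orbT.
by rewrite -[leLHS]expr1; apply: ler_weXn2l => //; exact: n_gt0.
Qed.

Section Weight.
Variable f : LF.
Variables (K : nat) (d : R).
Hypotheses (d0 : 0 < d) (bf : bnice (Ff f : G -> R)).
Hypothesis fK : forall g : G, 0 <= Ff f g <= K%:R * d.

(** A partition of unity by the levels of f: where u i is nonzero, f lies between (i - 1) d and (i +
    1) d. *)
Let u (i : nat) : LF := fun L => hat i (f L / d).

Lemma bu i : bnice (Ff (u i) : G -> R).
Proof.
have [nf _] := bf; split; last first.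
  by exists 1 => g; rewrite ger0_norm; [exact: hat_le1|exact: hat_ge0].
have ncl (F : G -> R) : nice F -> nice (fun g => clamp (F g)).
  by move=> nF; apply: nice_max; [exact: nice_cst|apply: nice_min => //; exact: nice_cst].
have nfd : nice (fun g : G => Ff f g / d - i%:R).
  by apply: niceB; [apply: niceM => //|]; exact: nice_cst.
exact: (niceB (ncl _ (niceD nfd (nice_cst m k 1))) (ncl _ nfd)).
Qed.

(** The weighted count with the height bound f B replaced by the constant a i B on the i-th
    level. *)
Let wt (a : nat -> R) (B : R) := \sum_(i < K.+1) (\sum_(L \in GrB (a i * B)) u i (uT L)) / Ncount B.

Lemma wt_cvg a : (forall i, 0 <= a i) -> wt a B @[B --> +oo] --> IB 1 (fun g : G => \sum_(i < K.+1) a i * Ff (u i) g) / Vol 1.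
Proof.
move=> a0; have [_ ->] := IB_sum 1 K.+1 a bu; rewrite mulr_suml.
have -> : \sum_(i < K.+1) a i * IB 1 (Ff (u i)) / Vol 1 = \sum_(i < K.+1) a i * nu_int mu (u i).
  by apply: eq_bigr => i _; rewrite nu_int_IB mulrA.
rewrite /wt; apply: cvg_sumr => i; exact: (sum_cvg (bu i) (a0 i)).
Qed.

Lemma y_of (L : set 'rV[R]_n) : GrQ L -> 0 <= f (uT L) <= K%:R * d.
Proof. by move=> hL; rewrite (uT_xt hm hk ltr01 hL); exact: fK. Qed.

Lemma usum (L : set 'rV[R]_n) : GrQ L -> \sum_(i < K.+1) u i (uT L) = 1.
Proof.
move=> /y_of/andP[y0 yK]; apply: hat_sum; rewrite divr_ge0 ?(ltW d0)//=.
by rewrite ler_pdivrMr.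
Qed.

Lemma upos i L : 0 <= u i L. Proof. exact: hat_ge0. Qed.

Lemma usupp i L : u i L != 0 -> (i%:R - 1) * d <= f L <= (i%:R + 1) * d.
Proof. by move=> /hat_supp; rewrite ler_pdivlMr// ler_pdivrMr. Qed.

Lemma wtE a B : 0 < B -> (forall i, (i <= K)%N -> a i <= K.+1%:R * d) ->
  (forall i, 0 <= a i) ->
  wt a B = (\sum_(L <- fset_set (GrB (K.+1%:R * d * B))) \sum_(i < K.+1) (`[< GrB (a i * B) L >])%:R * u i (uT L)) / Ncount B.
Proof.
move=> B0 aK a0; rewrite /wt -mulr_suml; congr (_ / _); rewrite exchange_big /=; apply: eq_bigr => i _.
apply: sum_seqE; first exact: GrB_finite.
move=> L [hL h]; split => //; apply: le_trans h _; apply: ler_wpM2r; first exact: ltW.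
by apply: aK; rewrite -ltnS.
Qed.

Lemma NfE B : 0 < B -> @Nf R m k f B = \sum_(L <- fset_set (GrB (K.+1%:R * d * B))) (`[< height m L <= f (uT L) * B >])%:R.
Proof.
move=> B0; rewrite /Nf (@sum_seqE _ (GrB (K.+1%:R * d * B))); last 2 first.
- exact: GrB_finite.
- move=> L [hL h]; split => //; apply: le_trans h _; apply: ler_wpM2r; first exact: ltW.
  have /andP[_ /le_trans] := y_of hL; apply; apply: ler_wpM2r; first exact: ltW.
  by rewrite ler_nat.
rewrite [LHS]big_seq [RHS]big_seq; apply: eq_bigr => L; rewrite in_fset_set ?mulr1; last exact: GrB_finite.
move=> /set_mem[hL _]; congr (_%:R); congr nat_of_bool; apply: asbool_equiv_eq.
by split=> [[]|].
Qed.

Let up i : R := (i%:R + 1) * d.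
(** The natural predecessor makes the bound 0 at i = 0, where (i - 1) d would be negative. *)
Let lo i : R := (i.-1)%:R * d.

Lemma up0 i : 0 <= up i. Proof. by rewrite /up mulr_ge0 ?addr_ge0// ltW. Qed.
Lemma lo0 i : 0 <= lo i. Proof. by rewrite /lo mulr_ge0// ltW. Qed.

Lemma upK i : (i <= K)%N -> up i <= K.+1%:R * d.
Proof. by move=> iK; rewrite /up natr1 ler_wpM2r ?(ltW d0)// ler_nat. Qed.

Lemma loK i : (i <= K)%N -> lo i <= K.+1%:R * d.
Proof.
by move=> iK; rewrite /lo ler_wpM2r ?(ltW d0)// ler_nat; apply: leq_trans (leq_pred i) (leq_trans iK _).
Qed.

Lemma wt_up B : 0 < B -> 0 < Ncount B -> @Nf R m k f B / Ncount B <= wt up B.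
Proof.
move=> B0 N0; rewrite (wtE B0 upK up0) (NfE B0); apply: ler_wpM2r; first by rewrite invr_ge0 ltW.
rewrite !big_seq; apply: ler_sum => L; rewrite in_fset_set; last exact: GrB_finite.
move=> /set_mem[hL _]; case: asboolP => h; last by apply: sumr_ge0 => i _; apply: mulr_ge0; [exact: ler0n|exact: upos].
rewrite -{1}(usum hL); apply: ler_sum => i _.
have [->|ui] := eqVneq (u i (uT L)) 0; first by rewrite mulr0.
have /andP[_ ub'] := usupp ui.
have hG : GrB (up i * B) L.
  by split; [exact: hL|apply: le_trans h _; apply: (ler_wpM2r (ltW B0)); exact: ub'].
by rewrite (asboolT hG) mul1r lexx.
Qed.

Lemma wt_lo B : 0 < B -> 0 < Ncount B -> wt lo B <= @Nf R m k f B / Ncount B.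
Proof.
move=> B0 N0; rewrite (wtE B0 loK lo0) (NfE B0); apply: ler_wpM2r; first by rewrite invr_ge0 ltW.
rewrite !big_seq; apply: ler_sum => L; rewrite in_fset_set; last exact: GrB_finite.
move=> /set_mem[hL _]; case: (asboolP (height m L <= _)) => h.
  apply: (@le_trans _ _ (\sum_(i < K.+1) u i (uT L))); last by rewrite (usum hL) lexx.
  apply: ler_sum => i _; apply: ler_piMl; first exact: upos.
  by rewrite lern1; case: asboolP.
rewrite big1// => i _; case: asboolP => [[_ hi]|_]; last by rewrite mul0r.
have [->|ui] := eqVneq (u i (uT L)) 0; first by rewrite mulr0.
exfalso; have /andP[lb _] := usupp ui.
(* At i = 0 the height bound is 0, below every height. *)
have H0 := height_gt0 hk hL; case: (posnP i) => [i0|ip].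
  by move: hi; rewrite /lo i0 mul0r mul0r leNgt H0.
apply: h; apply: le_trans hi _; apply: ler_wpM2r; first exact: ltW.
by move: lb; rewrite /lo -(subn1 i) natrB.
Qed.

Lemma sum_up g : \sum_(i < K.+1) up i * Ff (u i) g <= Ff f g + 2 * d.
Proof.
have /andP[y0 yK] := fK g.
have us : \sum_(i < K.+1) Ff (u i) g = 1.
  by apply: hat_sum; rewrite divr_ge0 ?(ltW d0)//= ler_pdivrMr.
have -> : Ff f g + 2 * d = \sum_(i < K.+1) (Ff f g + 2 * d) * Ff (u i) g by rewrite -mulr_sumr us mulr1.
apply: ler_sum => i _.
have [->|ui] := eqVneq (Ff (u i) g) 0; first by rewrite !mulr0.
apply: ler_wpM2r; first exact: hat_ge0.
have /andP[lb _] := usupp ui; move: lb; rewrite /up -/(Ff f g) => lb.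
have -> : (i%:R + 1) * d = (i%:R - 1) * d + 2 * d by ring.
by rewrite lerD2r.
Qed.

Lemma sum_lo g : Ff f g - 2 * d <= \sum_(i < K.+1) lo i * Ff (u i) g.
Proof.
have /andP[y0 yK] := fK g.
have us : \sum_(i < K.+1) Ff (u i) g = 1.
  by apply: hat_sum; rewrite divr_ge0 ?(ltW d0)//= ler_pdivrMr.
have -> : Ff f g - 2 * d = \sum_(i < K.+1) (Ff f g - 2 * d) * Ff (u i) g by rewrite -mulr_sumr us mulr1.
apply: ler_sum => i _.
have [->|ui] := eqVneq (Ff (u i) g) 0; first by rewrite !mulr0.
apply: ler_wpM2r; first exact: hat_ge0.
have /andP[_ ub'] := usupp ui; move: ub'; rewrite -/(Ff f g) => ub'.
apply: (@le_trans _ _ ((i%:R - 1) * d)).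
  by rewrite lerBlDr (le_trans ub')// le_eqVlt; apply/orP; left; apply/eqP; ring.
rewrite /lo ler_wpM2r ?(ltW d0)//; case: (posnP i) => [->|ip]; first by rewrite sub0r lerN10.
by rewrite -(subn1 i) natrB.
Qed.

(** The count is trapped between [wt lo] and [wt up], whose limits are within 2 d of the integral of
    f because each threshold is within 2 d of f on its level. *)
Lemma weighted_bound (e : R) : 0 < e -> \forall B \near +oo,
  `|nu_int mu f - @Nf R m k f B / Ncount B| <= 2 * d + e.
Proof.
move=> e0; have V0 := Vol_gt0 mu_fin mu_pos.
have [T0 T01 hT0] := Ncount_gt0 hm hk mu_inv mu_fin mu_pos.
have cst c : IB 1 (fun=> c) = c * Vol 1.
  rewrite -(IB_cst mu 1) -IBZ; last exact: bnice_cst.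
  by congr (IB 1 _); apply/funext => g; rewrite mulr1.
have Lu : IB 1 (fun g : G => \sum_(i < K.+1) up i * Ff (u i) g) / Vol 1 <= nu_int mu f + 2 * d.
  rewrite nu_int_IB ler_pdivrMr// mulrDl divfK ?gt_eqF// -cst -IBD; [|exact: bf|exact: bnice_cst].
  by apply: IB_le; [exact: (IB_sum 1 K.+1 up bu).1|apply: bniceD => //; exact: bnice_cst|exact: sum_up].
have Ll : nu_int mu f - 2 * d <= IB 1 (fun g : G => \sum_(i < K.+1) lo i * Ff (u i) g) / Vol 1.
  rewrite nu_int_IB ler_pdivlMr// mulrDl divfK ?gt_eqF// -cst -IBD; [|exact: bf|exact: bnice_cst].
  by apply: IB_le; [apply: bniceD => //; exact: bnice_cst|exact: (IB_sum 1 K.+1 lo bu).1|exact: sum_lo].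
have /cvgrPdist_le /(_ e e0) c1 := wt_cvg up0.
have /cvgrPdist_le /(_ e e0) c2 := wt_cvg lo0.
near=> B.
have TB : T0 < B by near: B; apply: nbhs_pinfty_gt; exact: num_real.
have B0 : 0 < B by apply: lt_trans TB; exact: lt_le_trans ltr01 T01.
have N0 := hT0 B TB.
have h1 := wt_up B0 N0; have h2 := wt_lo B0 N0.
have h3 : `|IB 1 (fun g : G => \sum_(i < K.+1) up i * Ff (u i) g) / Vol 1 - wt up B| <= e by near: B; exact: c1.
have h4 : `|IB 1 (fun g : G => \sum_(i < K.+1) lo i * Ff (u i) g) / Vol 1 - wt lo B| <= e by near: B; exact: c2.
move: h1 h2 h3 h4 Lu Ll; move: (wt up B) (wt lo B) (IB _ _ / _) (IB _ _ / _) (Nf _ _ / _) (nu_int mu f).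
move=> a1 a2 a3 a4 a5 a6; rewrite !ler_distl => h1 h2 /andP[h3 h4] /andP[h5 h6] h7 h8.
by apply/andP; split; lra.
Unshelve. all: by end_near. Qed.

End Weight.

Theorem Nf_cvg (f : LF) : UG_bcont f -> (forall L, @UG R m k L -> 0 <= f L) ->
  (@Nf R m k f B / Ncount B) @[B --> +oo] --> nu_int mu f.
Proof.
move=> bf f0; have [M hM] := Ff_bd hm hk bf; apply/cvgrPdist_le => /= e e0.
pose d := e / 4; have d0 : 0 < d by rewrite divr_gt0.
have M0 : 0 <= M by apply: le_trans (hM 1%g).
pose K := Num.bound (M / d).
have KM : M <= K%:R * d by rewrite -ler_pdivrMr// ltW// archi_boundP// divr_ge0// ltW.
have fK (g : G) : 0 <= Ff f g <= K%:R * d.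
  apply/andP; split; first by apply: f0; exact: (Mg_UG hm hk).
  exact: le_trans (le_trans (ler_norm _) (hM g)) KM.
have bn : bnice (Ff f : G -> R) by split; [exact: nice_Ff|exists M].
have e2 : 0 < e / 2 by rewrite divr_gt0.
apply: filterS (weighted_bound d0 bn fK e2) => B /le_trans; apply.
by rewrite /d; lra.
Qed.

End WeightedCount.

Theorem theorem5p4 (R : realType) (m k : nat) (hm : (0 < m)%N) (hk : (0 < k)%N)
  (mu : {measure set (Pmeas R m k) -> \bar R})
  (mu_inv : P_invariant mu)
  (mu_pos : (0 < mu (@Pball R m k))%E) (mu_fin : (mu (@Pball R m k) < +oo)%E) :
  (* (i) *)
  (forall f, UG_bcont f ->
     nuB_int f B @[B --> +oo] --> nu_int mu f) /\
  (* (ii) *)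
  (forall E, @UG_borel R m k E -> nu mu (UG_boundary E) = 0 ->
     nuB E B @[B --> +oo] --> nu mu E) /\
  (* (iii) limsup_{B -> oo} nu_B(E) <= nu(E) *)
  (forall E, UG_closed E -> forall eps : R, 0 < eps ->
     \forall B \near +oo, nuB E B <= nu mu E + eps) /\
  (* (iv) *)
  (forall f, UG_bcont f -> (forall L, @UG R m k L -> 0 <= f L) ->
     (Nf f B / @Ncount R m k B) @[B --> +oo] --> nu_int mu f).
Proof.
split; last split; last split.
- move=> f bf; have [M hM] := Ff_bd hm hk bf.
  exact: (nuB_int_cvg hm hk mu_inv mu_fin mu_pos (nice_Ff hm hk bf) hM).
- by move=> E bE hE; exact: (nuB_cvg hm hk mu_inv mu_fin mu_pos bE hE).
- by move=> E cE e e0; exact: (nuB_closed hm hk mu_inv mu_fin mu_pos cE e0).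
by move=> f bf f0; exact: (Nf_cvg hm hk mu_inv mu_fin mu_pos bf f0).
Qed.
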